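(* Let $\mathbb D$ be either the category $Gp$ of groups or the category $\mathbb K\text{-}Lie$ of Lie algebras over a field $\mathbb K$. Then for every object $Y$ of $\mathbb D$, every internal abelian group $A$ in $\mathbb D/Y$ and every integer $n\ge 0$, the group homomorphism $j^n_A:H^n_{M(\mathbb D/Y)}(A)\to H^n_{\mathbb D/Y}(A)$ induced by the inclusion $M(\mathbb D/Y)\rightarrowtail \mathbb D/Y$ is an isomorphism.
   Context: $R[f]$, with projections $p_0,p_1$ and diagonal $s_0$, denotes the kernel pair of a map $f$. A Mal'cev category is a finitely complete category in which every reflexive relation is an equivalence relation; $Gp$, $\mathbb K\text{-}Lie$ and all their slices are such (and exact). **Commutative objects.** In a Mal'cev category $\mathbb E$ an object $X$ is commutative when it has a (necessarily unique) internal Mal'cev operation $p:X\times X\times X\to X$, $p(x,y,y)=x$, $p(x,x,y)=y$. $M\mathbb E$ is the full subcategory of commutative objects. In $\mathbb D/Y$ the terminal object is $1_Y$ and products are fibre products over $Y$ (for groups, $X\to Y$ is commutative in $Gp/Y$ iff its kernel is abelian). $M(\mathbb D/Y)$ contains all internal abelian groups of $\mathbb D/Y$ and is closed under finite limits and subobjects in $\mathbb D/Y$. **$n$-groupoids in a category $\mathbb E$.** $()_0: Grd\,\mathbb E\to\mathbb E$ sends an internal groupoid $\underline X_1$ (objects $X_0$, arrows $X_1$, domain $d_0$, codomain $d_1$, identities $s_0$) to $X_0$; it is a left exact fibration. Inductively for $n\ge2$ an $n$-groupoid is an internal groupoid inside a fibre of $()_{n-2}:(n-1)\text{-}Grd\,\mathbb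 E\to (n-2)\text{-}Grd\,\mathbb E$ (with $0\text{-}Grd\,\mathbb E=\mathbb E$), and $()_{n-1}: n\text{-}Grd\,\mathbb E\to(n-1)\text{-}Grd\,\mathbb E$ sends it to its object of objects. An $n$-groupoid $\underline X_n$ has an underlying diagram of reflexive graphs $X_n\rightrightarrows X_{n-1}\rightrightarrows\cdots\rightrightarrows X_0$ and underlying $k$-groupoids $\underline X_k$. Put $X_0^{\bumpeq}=X_0\times X_0$ and let $X_k^{\bumpeq}$ be the kernel pair of $(d_0,d_1):X_k\to X_{k-1}^{\bumpeq}$ (parallel $k$-cells). The map $(d_0,d_1):X_n\to X_{n-1}^{\bumpeq}$ is the core of $\underline X_n$. When $\mathbb E$ is regular, $\underline X_n$ is aspherical when all cores $X_k\to X_{k-1}^{\bumpeq}$, $1\le k\le n$, and the map $X_0\to1$ are regular epimorphisms ($X_0\to 1$ regular epic: $X_0$ has global support). **Directions and cohomology** ($\mathbb E=\mathbb D/Y$ or $\mathbb E=M(\mathbb D/Y)$). An aspherical $n$-groupoid $\underline X_n$ ($n\ge1$) has direction an internal abelian group $A$ given by a regular epimorphism $\nu:X_n^{\bumpeq}\to A$ such that $(p_i,\nu):X_n^{\bumpeq}\to X_n\times A$ is an isomorphism for $i=0,1$ and the square formed by $s_0:X_n\to X_n^{\bumpeq}$, $\nu$, $X_n\to 1$ and $0:1\to A$ is a pushout. A commutative object $X$ with global support has direction $A$, the quotient of $X\times X$ by the equivalence relation identifying $(x,y)$ with $(z,p(z,x,y))$. $n$-functors (resp. maps) induce homomorphisms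 between directions. $H^0_{\mathbb E}(A)=Hom_{\mathbb E}(1,A)$; $H^1_{\mathbb E}(A)$ is the set of connected components of the category of commutative objects with global support and direction (identified with) $A$; for $n\geq1$, $H^{n+1}_{\mathbb E}(A)$ is the set of connected components of the category of aspherical $n$-groupoids with direction (identified with) $A$; morphisms are those inducing $1_A$ on directions. The abelian group structure is the analogue of the tensor product (Baer sum) of torsors: the sum of the classes of $X$ and $X'$ is the class of any $Z$ admitting a morphism $X\times X'\to Z$ inducing the addition $A\times A\to A$ on directions. $j^n_A$ sends the class of an object in $M(\mathbb D/Y)$ to the class of the same object viewed in $\mathbb D/Y$ (and is the identity on global sections for $n=0$). *)

(* Defs.v *)
Set Warnings "-notation-overridden,-ambiguous-paths".
From HB Require Import structures.
From mathcomp Require Import all_boot all_algebra.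
From mathcomp Require Import boolp.
From Stdlib Require Import Relation_Operators.

Set Implicit Arguments.
Unset Strict Implicit.
Unset Printing Implicit Defensive.
Local Obligation Tactic := idtac.

Record category := Category {
  ob :> Type;
  hom : ob -> ob -> Type;
  idm : forall X, hom X X;
  cmp : forall X Y Z, hom Y Z -> hom X Y -> hom X Z;
  cmp1m : forall X Y (f : hom X Y), cmp (idm Y) f = f;
  cmpm1 : forall X Y (f : hom X Y), cmp f (idm X) = f;
  cmpA : forall X Y Z T (h : hom Z T) (g : hom Y Z) (f : hom X Y),
    cmp h (cmp g f) = cmp (cmp h g) f }.

Notation "g ∘ f" := (cmp g f) (at level 40, left associativity).

Record functor (C D : category) := Functor {
  fob :> C -> D;
  fmap : forall X Y, hom X Y -> hom (fob X) (fob Y);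
  fmap1 : forall X, fmap (idm X) = idm (fob X);
  fmapM : forall X Y Z (g : hom Y Z) (f : hom X Y),
    fmap (g ∘ f) = fmap g ∘ fmap f }.

Arguments fmap {C D} _ {X Y} _.

Definition id_functor (C : category) : functor C C :=
  @Functor C C id (fun _ _ f => f) (fun _ => erefl) (fun _ _ _ _ _ => erefl).

Program Definition cmp_functor (C D E : category)
    (G : functor D E) (F : functor C D) : functor C E :=
  @Functor C E (fun X => G (F X)) (fun _ _ f => fmap G (fmap F f)) _ _.
Next Obligation. by move=> C D E G F X /=; rewrite !fmap1. Qed.
Next Obligation. by move=> C D E G F X Y Z g f /=; rewrite !fmapM. Qed.

Definition unit_category : category :=
  @Category unit (fun _ _ => unit) (fun _ => tt) (fun _ _ _ _ _ => tt)
    (fun _ _ f => let: tt := f in erefl) (fun _ _ f => let: tt := f in erefl)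
    (fun _ _ _ _ _ _ _ => erefl).

Definition to_unit (C : category) : functor C unit_category :=
  @Functor C unit_category (fun _ => tt) (fun _ _ _ => tt)
    (fun _ => erefl) (fun _ _ _ _ _ => erefl).

Section Universal.
Context {C : category}.
Implicit Types X Y Z P : C.

Definition is_terminal (T : C) := forall X, exists! f : hom X T, True.

Definition is_product X Y P (p : hom P X) (q : hom P Y) :=
  forall T (a : hom T X) (b : hom T Y), exists! u : hom T P, p ∘ u = a /\ q ∘ u = b.

Definition is_product3 X Y Z P (p : hom P X) (q : hom P Y) (r : hom P Z) :=
  forall T (a : hom T X) (b : hom T Y) (c : hom T Z),
    exists! u : hom T P, [/\ p ∘ u = a, q ∘ u = b & r ∘ u = c].

Definition is_pullback X Y Z P (f : hom X Z) (g : hom Y Z)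
    (p : hom P X) (q : hom P Y) :=
  f ∘ p = g ∘ q /\
  forall T (a : hom T X) (b : hom T Y), f ∘ a = g ∘ b ->
    exists! u : hom T P, p ∘ u = a /\ q ∘ u = b.

Definition is_kernel_pair X Y R (f : hom X Y) (p q : hom R X) :=
  is_pullback f f p q.

Definition is_pushout X Y Z P (f : hom Z X) (g : hom Z Y)
    (i : hom X P) (j : hom Y P) :=
  i ∘ f = j ∘ g /\
  forall T (a : hom X T) (b : hom Y T), a ∘ f = b ∘ g ->
    exists! u : hom P T, u ∘ i = a /\ u ∘ j = b.

Definition is_coequalizer R X Q (a b : hom R X) (q : hom X Q) :=
  q ∘ a = q ∘ b /\
  forall T (g : hom X T), g ∘ a = g ∘ b -> exists! u : hom Q T, u ∘ q = g.

Definition regular_epi X Q (q : hom X Q) :=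
  exists R (a b : hom R X), is_coequalizer a b q.

Definition mono X Y (m : hom X Y) :=
  forall T (u v : hom T X), m ∘ u = m ∘ v -> u = v.

Definition global_support X :=
  exists T (t : hom X T), is_terminal T /\ regular_epi t.

(** If [p, q] are the projections of a product or of a pullback, [along p q m a b c]
    says that the map [m] sends the pair [(a, b)] of generalized elements to [c]. *)
Definition along P X Y Z (p : hom P X) (q : hom P Y) (m : hom P Z)
    T (a : hom T X) (b : hom T Y) (c : hom T Z) :=
  exists u : hom T P, [/\ p ∘ u = a, q ∘ u = b & m ∘ u = c].

End Universal.

Definition has_pullbacks (C : category) :=
  forall (X Y Z : C) (f : hom X Z) (g : hom Y Z),
    exists P (p : hom P X) (q : hom P Y), is_pullback f g p q.

Definition has_terminal (C : category) := exists T : C, is_terminal T.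

Record slice_ob (D : category) (Y : D) := SliceOb {
  sl_dom :> D;
  sl_map : hom sl_dom Y }.

Record slice_hom (D : category) (Y : D) (X X' : slice_ob Y) := SliceHom {
  sl_hom :> hom X X';
  sl_homP : sl_map X' ∘ sl_hom = sl_map X }.

Lemma slice_hom_eq (D : category) (Y : D) (X X' : slice_ob Y) (f g : slice_hom X X') :
  sl_hom f = sl_hom g -> f = g.
Proof.
by case: f g => [f fP] [g gP] /= e; case: _ / e gP => gP; congr SliceHom.
Qed.

Program Definition slice (D : category) (Y : D) : category :=
  @Category (slice_ob Y) (@slice_hom D Y)
    (fun X => @SliceHom D Y X X (idm X) _)
    (fun X1 X2 X3 g f => @SliceHom D Y X1 X3 (g ∘ f) _) _ _ _.
Next Obligation. by move=> D Y X; rewrite cmpm1. Qed.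
Next Obligation. by move=> D Y X1 X2 X3 g f; rewrite cmpA !sl_homP. Qed.
Next Obligation. by move=> D Y X X' f; apply: slice_hom_eq; rewrite /= cmp1m. Qed.
Next Obligation. by move=> D Y X X' f; apply: slice_hom_eq; rewrite /= cmpm1. Qed.
Next Obligation. by move=> D Y X1 X2 X3 X4 h g f; apply: slice_hom_eq; rewrite /= cmpA. Qed.

Definition full_sub (C : category) (P : C -> Prop) : category :=
  @Category {X : C | P X} (fun X X' => hom (sval X) (sval X'))
    (fun X => idm (sval X)) (fun _ _ _ g f => g ∘ f)
    (fun _ _ f => cmp1m f) (fun _ _ f => cmpm1 f) (fun _ _ _ _ h g f => cmpA h g f).

Definition incl (C : category) (P : C -> Prop) : functor (full_sub P) C :=
  @Functor (full_sub P) C sval (fun _ _ f => f) (fun _ => erefl) (fun _ _ _ _ _ => erefl).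

(** The fibre over [b] consists of the objects [x] with [U x = b] and of the maps
    that [U] sends to the identity of [b], up to transport along these equations. *)
Definition eqhom (C : category) (X X' : C) (e : X = X') : hom X X' :=
  let: erefl := e in idm X.

Record fib_ob (A B : category) (U : functor A B) (b : B) := FibOb {
  fib_tot :> A;
  fib_tot_over : U fib_tot = b }.

Definition vertical (A B : category) (U : functor A B) (b : B) (x y : A)
    (ex : U x = b) (ey : U y = b) (f : hom x y) :=
  eqhom ey ∘ fmap U f = eqhom ex.

Record fib_hom (A B : category) (U : functor A B) (b : B) (x y : fib_ob U b) := FibHom {
  fib_map :> hom x y;
  fib_mapP : vertical (fib_tot_over x) (fib_tot_over y) fib_map }.

Section Fibre.
Variables (A B : category) (U : functor A B) (b : B).

Lemma fib_hom_eq (x y : fib_ob U b) (f g : fib_hom x y) :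
  fib_map f = fib_map g -> f = g.
Proof.
by case: f g => [f fP] [g gP] /= e; case: _ / e gP => gP; congr FibHom.
Qed.

Lemma vertical1 (x : A) (ex : U x = b) : vertical ex ex (idm x).
Proof. by rewrite /vertical fmap1 cmpm1. Qed.

Lemma verticalM (x y z : A) (ex : U x = b) (ey : U y = b) (ez : U z = b)
  (g : hom y z) (f : hom x y) :
  vertical ey ez g -> vertical ex ey f -> vertical ex ez (g ∘ f).
Proof. by rewrite /vertical fmapM cmpA => -> ->. Qed.

Program Definition fibre : category :=
  @Category (fib_ob U b) (@fib_hom A B U b)
    (fun x => @FibHom A B U b x x (idm (fib_tot x)) _)
    (fun x y z g f => @FibHom A B U b x z (fib_map g ∘ fib_map f) _) _ _ _.
Next Obligation. by move=> x; apply: vertical1. Qed.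
Next Obligation. by move=> x y z g f; apply: verticalM (fib_mapP g) (fib_mapP f). Qed.
Next Obligation. by move=> x y f; apply: fib_hom_eq; rewrite /= cmp1m. Qed.
Next Obligation. by move=> x y f; apply: fib_hom_eq; rewrite /= cmpm1. Qed.
Next Obligation. by move=> x y z t h g f; apply: fib_hom_eq; rewrite /= cmpA. Qed.

End Fibre.

(** An internal groupoid with object of objects [x0].  The object [g2] of
    composable pairs is [p0, p1], with [p0] followed by [p1]; [mul] is
    composition in diagrammatic order. *)
Record groupoid (V : category) (x0 : V) := Groupoid {
  g1 : V;
  g2 : V;
  d0 : hom g1 x0;
  d1 : hom g1 x0;
  s0 : hom x0 g1;
  p0 : hom g2 g1;
  p1 : hom g2 g1;
  mul : hom g2 g1;
  inv : hom g1 g1;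
  g_pb : is_pullback d1 d0 p0 p1;
  d0s : d0 ∘ s0 = idm x0;
  d1s : d1 ∘ s0 = idm x0;
  d0mul : d0 ∘ mul = d0 ∘ p0;
  d1mul : d1 ∘ mul = d1 ∘ p1;
  mul1l : along p0 p1 mul (s0 ∘ d0) (idm g1) (idm g1);
  mul1r : along p0 p1 mul (idm g1) (s0 ∘ d1) (idm g1);
  mulAg : forall T (a b c ab bc abc : hom T g1),
    along p0 p1 mul a b ab -> along p0 p1 mul b c bc ->
    along p0 p1 mul ab c abc -> along p0 p1 mul a bc abc;
  mulVl : along p0 p1 mul inv (idm g1) (s0 ∘ d1);
  mulVr : along p0 p1 mul (idm g1) inv (s0 ∘ d0) }.

(** [tot -> base] stands for [()_(n-1) : n-Grd E -> (n-1)-Grd E]. *)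
Record tower := Tower {
  tot : category;
  base : category;
  proj : functor tot base }.

Section NextLevel.
Variable S : tower.
Local Notation U := (proj S).

Definition pt (x : tot S) : fibre U (U x) := @FibOb _ _ U (U x) x erefl.

(** An internal groupoid in a fibre of [U]: it lies in the fibre over [U x],
    where [x] is its object of objects. *)
Record grd_ob := GrdOb {
  g_obj : tot S;
  g_grd : groupoid (pt g_obj) }.

Definition arr (G : grd_ob) : tot S := fib_tot (g1 (g_grd G)).
Definition dom (G : grd_ob) : hom (arr G) (g_obj G) := fib_map (d0 (g_grd G)).
Definition cod (G : grd_ob) : hom (arr G) (g_obj G) := fib_map (d1 (g_grd G)).
Definition idt (G : grd_ob) : hom (g_obj G) (arr G) := fib_map (s0 (g_grd G)).
Definition cmpb (G : grd_ob) : tot S := fib_tot (g2 (g_grd G)).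
Definition fst_ (G : grd_ob) : hom (cmpb G) (arr G) := fib_map (p0 (g_grd G)).
Definition snd_ (G : grd_ob) : hom (cmpb G) (arr G) := fib_map (p1 (g_grd G)).
Definition mul_ (G : grd_ob) : hom (cmpb G) (arr G) := fib_map (mul (g_grd G)).

(** Internal functors, which need not lie in a fibre of [U]; [h_mul] says that the induced
    map on composable pairs commutes with composition. *)
Record grd_hom (G H : grd_ob) := GrdHom {
  h_obj : hom (g_obj G) (g_obj H);
  h_arr : hom (arr G) (arr H);
  h_dom : dom H ∘ h_arr = h_obj ∘ dom G;
  h_cod : cod H ∘ h_arr = h_obj ∘ cod G;
  h_idt : h_arr ∘ idt G = idt H ∘ h_obj;
  h_mul : along (fst_ H) (snd_ H) (mul_ H)
    (h_arr ∘ fst_ G) (h_arr ∘ snd_ G) (h_arr ∘ mul_ G) }.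

Lemma grd_hom_eq (G H : grd_ob) (f g : grd_hom G H) :
  h_obj f = h_obj g -> h_arr f = h_arr g -> f = g.
Proof.
case: f g => [f0 f1 a1 a2 a3 a4] [g0' g1' b1 b2 b3 b4] /= e0 e1.
by case: _ / e0 b1 b2 b3 => b1 b2 b3; case: _ / e1 b1 b2 b3 b4 => *; congr GrdHom.
Qed.

Program Definition grd_id (G : grd_ob) : grd_hom G G :=
  @GrdHom G G (idm _) (idm _) _ _ _ _.
Next Obligation. by move=> G; rewrite cmp1m cmpm1. Qed.
Next Obligation. by move=> G; rewrite cmp1m cmpm1. Qed.
Next Obligation. by move=> G; rewrite cmp1m cmpm1. Qed.
Next Obligation. by move=> G; exists (idm _); rewrite !cmp1m !cmpm1. Qed.

Program Definition grd_cmp (G H K : grd_ob) (g : grd_hom H K) (f : grd_hom G H) :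
    grd_hom G K :=
  @GrdHom G K (h_obj g ∘ h_obj f) (h_arr g ∘ h_arr f) _ _ _ _.
Next Obligation. by move=> G H K g f; rewrite cmpA h_dom -!cmpA h_dom. Qed.
Next Obligation. by move=> G H K g f; rewrite cmpA h_cod -!cmpA h_cod. Qed.
Next Obligation. by move=> G H K g f; rewrite -cmpA h_idt !cmpA h_idt. Qed.
Next Obligation.
move=> G H K g f; have [u [u1 u2 u3]] := h_mul f; have [v [v1 v2 v3]] := h_mul g.
by exists (v ∘ u); split; rewrite cmpA ?v1 ?v2 ?v3 -!cmpA ?u1 ?u2 ?u3.
Qed.

Program Definition grd : category :=
  @Category grd_ob grd_hom grd_id grd_cmp _ _ _.
Next Obligation. by move=> G H f; apply: grd_hom_eq; rewrite /= cmp1m. Qed.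
Next Obligation. by move=> G H f; apply: grd_hom_eq; rewrite /= cmpm1. Qed.
Next Obligation. by move=> G H K L h g f; apply: grd_hom_eq; rewrite /= cmpA. Qed.

Definition obj_functor : functor grd (tot S) :=
  @Functor grd (tot S) g_obj h_obj (fun _ => erefl) (fun _ _ _ _ _ => erefl).

Definition arr_functor : functor grd (tot S) :=
  @Functor grd (tot S) arr h_arr (fun _ => erefl) (fun _ _ _ _ _ => erefl).

Definition next_level : tower := @Tower grd (tot S) obj_functor.

End NextLevel.

(** For [n = 0] the base is the terminal category, the single fibre of
    [E -> 1] being [E]: 1-groupoids are the internal groupoids in [E]. *)
Fixpoint grd_tower (E : category) (n : nat) : tower :=
  if n is n'.+1 then next_level (grd_tower E n') else Tower (to_unit E).

Definition nGrd (E : category) (n : nat) : category := tot (grd_tower E n).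

Fixpoint cells (E : category) (n : nat) : functor (nGrd E n) E :=
  match n return functor (nGrd E n) E with
  | 0 => id_functor E
  | n'.+1 => cmp_functor (cells E n') (arr_functor (grd_tower E n'))
  end.

Section Cells.
Variables (E : category) (n : nat).

Definition under (X : nGrd E n.+1) : nGrd E n := @g_obj (grd_tower E n) X.
Definition src (X : nGrd E n.+1) : hom (cells E n.+1 X) (cells E n (under X)) :=
  fmap (cells E n) (@dom (grd_tower E n) X).
Definition tgt (X : nGrd E n.+1) : hom (cells E n.+1 X) (cells E n (under X)) :=
  fmap (cells E n) (@cod (grd_tower E n) X).
End Cells.

(** [is_par X p0 p1]: the object [P] with projections [p0, p1] is the object of
    parallel n-cells of the n-groupoid [X]. *)
Fixpoint is_par (E : category) (n : nat) :
    forall (X : nGrd E n) (P : E) (p0 p1 : hom P (cells E n X)), Prop :=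
  match n with
  | 0 => fun X P p0 p1 => is_product p0 p1
  | n'.+1 => fun X P p0 p1 =>
      exists Q (q0 q1 : hom Q (cells E n' (under X))) (c : hom (cells E n'.+1 X) Q),
        [/\ is_par q0 q1, q0 ∘ c = src X, q1 ∘ c = tgt X & is_kernel_pair c p0 p1]
  end.

Definition is_core (E : category) (n : nat) (X : nGrd E n.+1) (Q : E)
    (c : hom (cells E n.+1 X) Q) :=
  exists q0 q1 : hom Q (cells E n (under X)),
    [/\ is_par q0 q1, q0 ∘ c = src X & q1 ∘ c = tgt X].

Fixpoint aspherical (E : category) (n : nat) : nGrd E n -> Prop :=
  match n with
  | 0 => fun X => global_support (C := E) X
  | n'.+1 => fun X => aspherical (under X) /\
      exists Q (c : hom (cells E n'.+1 X) Q), is_core c /\ regular_epi c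
  end.

(** [ag_sum x y z] reads [x + y = z] on generalized
    elements. *)
Record abgroup (E : category) := Abgroup {
  ag_ob :> E;
  ag_one : E;
  ag_sq : E;
  ag_fst : hom ag_sq ag_ob;
  ag_snd : hom ag_sq ag_ob;
  ag_add : hom ag_sq ag_ob;
  ag_zero : hom ag_one ag_ob;
  ag_opp : hom ag_ob ag_ob;
  ag_oneP : is_terminal ag_one;
  ag_sqP : is_product ag_fst ag_snd;
  ag_sum := fun T (x y z : hom T ag_ob) => along ag_fst ag_snd ag_add x y z;
  ag_addA : forall T (x y z xy yz t : hom T ag_ob),
    ag_sum xy z t -> ag_sum x y xy -> ag_sum y z yz -> ag_sum x yz t;
  ag_addC : forall T (x y z : hom T ag_ob), ag_sum x y z -> ag_sum y x z;
  ag_add0 : forall T (x : hom T ag_ob) (t : hom T ag_one), ag_sum (ag_zero ∘ t) x x;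
  ag_addN : forall T (x : hom T ag_ob) (t : hom T ag_one),
    ag_sum (ag_opp ∘ x) x (ag_zero ∘ t) }.

Section Commutative.
Context {E : category}.

Definition maltsev_op (X X3 : E) (x y z : hom X3 X) (p : hom X3 X) :=
  (forall T (u : hom T X3), y ∘ u = z ∘ u -> p ∘ u = x ∘ u) /\
  (forall T (u : hom T X3), x ∘ u = y ∘ u -> p ∘ u = z ∘ u).

Definition commutative_ob (X : E) :=
  exists (X3 : E) (x y z p : hom X3 X), is_product3 x y z /\ maltsev_op x y z p.

End Commutative.

Definition comm_cat (C : category) : category := full_sub (@commutative_ob C).

Section Cohomology.
Context {E : category} (A : abgroup E).

(** A commutative object with global support and direction [A].  The map [t_q]
    is the quotient of [X * X] by the
    equivalence relation with object [X * X * X] whose projections [l, r] are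
    [(x, y, z) |-> (x, y)] and [(x, y, z) |-> (z, p (z, x, y))].  It sends the diagonal
    to [0]; a zero-preserving map between abelian groups in a Mal'cev category being a
    homomorphism, this identifies the direction with the group [A]. *)
Record torsor := Torsor {
  t_ob : E;
  t_sq : E;
  t_fst : hom t_sq t_ob;
  t_snd : hom t_sq t_ob;
  t_cube : E;
  t_x : hom t_cube t_ob;
  t_y : hom t_cube t_ob;
  t_z : hom t_cube t_ob;
  t_p : hom t_cube t_ob;
  t_q : hom t_sq A;
  t_sqP : is_product t_fst t_snd;
  t_cubeP : is_product3 t_x t_y t_z;
  t_pP : maltsev_op t_x t_y t_z t_p;
  t_gs : global_support t_ob;
  t_qP : exists (l r : hom t_cube t_sq) (rot : hom t_cube t_cube),
    [/\ t_fst ∘ l = t_x /\ t_snd ∘ l = t_y,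
        [/\ t_x ∘ rot = t_z, t_y ∘ rot = t_x & t_z ∘ rot = t_y],
        t_fst ∘ r = t_z /\ t_snd ∘ r = t_p ∘ rot
      & is_coequalizer l r t_q];
  t_q0 : exists (s : hom t_ob t_sq) (t : hom t_ob (ag_one A)),
    [/\ t_fst ∘ s = idm t_ob, t_snd ∘ s = idm t_ob & t_q ∘ s = ag_zero A ∘ t] }.

Definition torsor_mor (X Z : torsor) :=
  exists (f : hom (t_ob X) (t_ob Z)) (g : hom (t_sq X) (t_sq Z)),
    [/\ t_fst Z ∘ g = f ∘ t_fst X, t_snd Z ∘ g = f ∘ t_snd X & t_q Z ∘ g = t_q X].

(** There is a morphism from the product [P] of [X] and [X'] to [Z], inducing the addition
    on directions; [R] is [P * P]. *)
Definition torsor_sum (X X' Z : torsor) :=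
  exists (P R : E) (a : hom P (t_ob X)) (a' : hom P (t_ob X')) (f : hom P (t_ob Z))
    (r0 r1 : hom R P) (b : hom R (t_sq X)) (b' : hom R (t_sq X')) (g : hom R (t_sq Z)),
    [/\ is_product a a' /\ is_product r0 r1,
        t_fst X ∘ b = a ∘ r0 /\ t_snd X ∘ b = a ∘ r1,
        t_fst X' ∘ b' = a' ∘ r0 /\ t_snd X' ∘ b' = a' ∘ r1,
        t_fst Z ∘ g = f ∘ r0 /\ t_snd Z ∘ g = f ∘ r1
      & ag_sum (t_q X ∘ b) (t_q X' ∘ b') (t_q Z ∘ g)].

(** An aspherical n-groupoid with direction [A], for [n >= 1].  That
    [(p_i, nu) : X_n^= -> X_n * A] is an isomorphism is stated by saying that
    [p_i] and [nu] are the projections of a product. *)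
Record dgrd (n : nat) := Dgrd {
  d_grd : nGrd E n;
  d_par : E;
  d_fst : hom d_par (cells E n d_grd);
  d_snd : hom d_par (cells E n d_grd);
  d_nu : hom d_par A;
  d_asph : aspherical d_grd;
  d_parP : is_par d_fst d_snd;
  d_nu_epi : regular_epi d_nu;
  d_nu_fst : is_product d_fst d_nu;
  d_nu_snd : is_product d_snd d_nu;
  d_nu_po : exists (s : hom (cells E n d_grd) d_par) (t : hom (cells E n d_grd) (ag_one A)),
    [/\ d_fst ∘ s = idm _, d_snd ∘ s = idm _ & is_pushout s t d_nu (ag_zero A)] }.

Definition dgrd_mor n (X Z : dgrd n) :=
  exists (f : hom (d_grd X) (d_grd Z)) (g : hom (d_par X) (d_par Z)),
    [/\ d_fst Z ∘ g = fmap (cells E n) f ∘ d_fst X,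
        d_snd Z ∘ g = fmap (cells E n) f ∘ d_snd X & d_nu Z ∘ g = d_nu X].

Definition dgrd_sum n (X X' Z : dgrd n) :=
  exists (P : nGrd E n) (a : hom P (d_grd X)) (a' : hom P (d_grd X')) (f : hom P (d_grd Z))
    (R : E) (r0 r1 : hom R (cells E n P))
    (b : hom R (d_par X)) (b' : hom R (d_par X')) (g : hom R (d_par Z)),
    [/\ is_product a a' /\ is_par r0 r1,
        d_fst X ∘ b = fmap (cells E n) a ∘ r0 /\ d_snd X ∘ b = fmap (cells E n) a ∘ r1,
        d_fst X' ∘ b' = fmap (cells E n) a' ∘ r0 /\ d_snd X' ∘ b' = fmap (cells E n) a' ∘ r1,
        d_fst Z ∘ g = fmap (cells E n) f ∘ r0 /\ d_snd Z ∘ g = fmap (cells E n) f ∘ r1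
      & ag_sum (d_nu X ∘ b) (d_nu X' ∘ b') (d_nu Z ∘ g)].

Definition cocycle (n : nat) : Type := if n is 0 then torsor else dgrd n.

Definition cocycle_mor (n : nat) : cocycle n -> cocycle n -> Prop :=
  match n with 0 => torsor_mor | n'.+1 => @dgrd_mor n'.+1 end.

Definition cocycle_sum (n : nat) : cocycle n -> cocycle n -> cocycle n -> Prop :=
  match n with 0 => torsor_sum | n'.+1 => @dgrd_sum n'.+1 end.

Definition connected (n : nat) : cocycle n -> cocycle n -> Prop :=
  clos_refl_sym_trans _ (@cocycle_mor n).

Definition component (n : nat) : Type :=
  {K : cocycle n -> Prop | exists X, K = connected X}.

Definition coh (n : nat) : Type :=
  match n with
  | 0 => hom (ag_one A) (ag_ob A)
  | n'.+1 => component n'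
  end.

Definition coh_sum (n : nat) : coh n -> coh n -> coh n -> Prop :=
  match n return coh n -> coh n -> coh n -> Prop with
  | 0 => fun a b c => ag_sum a b c
  | n'.+1 => fun a b c =>
      exists X Y Z, [/\ sval a X, sval b Y, sval c Z & cocycle_sum X Y Z]
  end.

(** The abelian group structure on [H^n(A)]; [cg_addP] determines it. *)
Record coh_group (n : nat) := CohGroup {
  cg_add : coh n -> coh n -> coh n;
  cg_zero : coh n;
  cg_opp : coh n -> coh n;
  cg_addA : associative cg_add;
  cg_addC : commutative cg_add;
  cg_add0 : left_id cg_zero cg_add;
  cg_addN : left_inverse cg_zero cg_opp cg_add;
  cg_addP : forall a b c, cg_add a b = c <-> coh_sum a b c }.

End Cohomology.

Section UniversalTheory.
Context {C : category}.

Lemma pb_eq (X Y Z P : C) (f : hom X Z) (g : hom Y Z) (p : hom P X) (q : hom P Y) :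
  is_pullback f g p q -> forall T (u v : hom T P), p ∘ u = p ∘ v -> q ∘ u = q ∘ v -> u = v.
Proof.
move=> [e pb] T u v ep eq.
have [|w [_ wu]] := pb T (p ∘ u) (q ∘ u); first by rewrite !cmpA e.
by rewrite -(wu u) // -(wu v).
Qed.

Lemma pb_lift (X Y Z P : C) (f : hom X Z) (g : hom Y Z) (p : hom P X) (q : hom P Y) :
  is_pullback f g p q -> forall T (a : hom T X) (b : hom T Y), f ∘ a = g ∘ b ->
  exists u : hom T P, p ∘ u = a /\ q ∘ u = b.
Proof. by move=> [_ pb] T a b /pb [u [uP _]]; exists u. Qed.

Lemma pbI (X Y Z P : C) (f : hom X Z) (g : hom Y Z) (p : hom P X) (q : hom P Y) :
  f ∘ p = g ∘ q ->
  (forall T (a : hom T X) (b : hom T Y), f ∘ a = g ∘ b ->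
     exists u : hom T P, p ∘ u = a /\ q ∘ u = b) ->
  (forall T (u v : hom T P), p ∘ u = p ∘ v -> q ∘ u = q ∘ v -> u = v) ->
  is_pullback f g p q.
Proof.
move=> e ex un; split=> // T a b /ex [u [ua ub]]; exists u; split=> // v [va vb].
by apply: un; rewrite ?ua ?ub.
Qed.

Lemma pb_iso (X Y Z P Q : C) (f : hom X Z) (g : hom Y Z) (p : hom P X) (q : hom P Y)
    (i : hom Q P) (j : hom P Q) :
  is_pullback f g p q -> i ∘ j = idm P -> j ∘ i = idm Q ->
  is_pullback f g (p ∘ i) (q ∘ i).
Proof.
move=> pb ij ji; apply: pbI => [|T a b ab|T u v].
- by rewrite !cmpA pb.1.
- have [u [ua ub]] := pb_lift pb ab; exists (j ∘ u).
  by rewrite -!cmpA (cmpA i) ij cmp1m.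
- rewrite -!cmpA => eu ev; have := pb_eq pb eu ev => e.
  by rewrite -[u]cmp1m -[v]cmp1m -ji -!cmpA e.
Qed.

Lemma pb_uniq (X Y Z P Q : C) (f : hom X Z) (g : hom Y Z) (p : hom P X) (q : hom P Y)
    (p' : hom Q X) (q' : hom Q Y) :
  is_pullback f g p q -> is_pullback f g p' q' ->
  exists (i : hom Q P) (j : hom P Q),
    [/\ i ∘ j = idm P, j ∘ i = idm Q, p ∘ i = p' & q ∘ i = q'].
Proof.
move=> pb pb'; have [i [ip iq]] := pb_lift pb pb'.1; have [j [jp jq]] := pb_lift pb' pb.1.
exists i, j; split=> //.
- by apply: (pb_eq pb); rewrite cmpA ?ip ?iq ?jp ?jq cmpm1.
- by apply: (pb_eq pb'); rewrite cmpA ?jp ?jq ?ip ?iq cmpm1.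
Qed.

Lemma prod_eq (X Y P : C) (p : hom P X) (q : hom P Y) : is_product p q ->
  forall T (u v : hom T P), p ∘ u = p ∘ v -> q ∘ u = q ∘ v -> u = v.
Proof. by move=> H T u v e1 e2; have [w [_ wu]] := H T (p ∘ u) (q ∘ u); rewrite -(wu u) // -(wu v). Qed.

Lemma prod_lift (X Y P : C) (p : hom P X) (q : hom P Y) : is_product p q ->
  forall T (a : hom T X) (b : hom T Y), exists u : hom T P, p ∘ u = a /\ q ∘ u = b.
Proof. by move=> H T a b; have [u [uP _]] := H T a b; exists u. Qed.

Lemma prodI (X Y P : C) (p : hom P X) (q : hom P Y) :
  (forall T (a : hom T X) (b : hom T Y), exists u : hom T P, p ∘ u = a /\ q ∘ u = b) ->
  (forall T (u v : hom T P), p ∘ u = p ∘ v -> q ∘ u = q ∘ v -> u = v) ->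
  is_product p q.
Proof.
move=> ex un T a b; have [u [ua ub]] := ex T a b; exists u; split=> // v [va vb].
by apply: un; rewrite ?ua ?ub.
Qed.

Lemma term_eq (T X : C) (f g : hom X T) : is_terminal T -> f = g.
Proof. by move=> /(_ X) [h [_ hu]]; rewrite -(hu f) // -(hu g). Qed.

Lemma term_hom (T X : C) : is_terminal T -> exists f : hom X T, True.
Proof. by move=> /(_ X) [h _]; exists h. Qed.

Lemma pb_prod (X Y T P : C) (f : hom X T) (g : hom Y T) (p : hom P X) (q : hom P Y) :
  is_terminal T -> is_pullback f g p q <-> is_product p q.
Proof.
move=> tT; split=> [pb|pr].
- by apply: prodI => [S a b|S u v]; [apply: (pb_lift pb); apply: term_eq | apply: (pb_eq pb)].
- apply: pbI => [|S a b _|S u v]; [exact: term_eq | exact: prod_lift | exact: prod_eq].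
Qed.

Lemma along_pre (P X Y Z : C) (p : hom P X) (q : hom P Y) (m : hom P Z)
    T (a : hom T X) (b : hom T Y) (c : hom T Z) S (s : hom S T) :
  along p q m a b c -> along p q m (a ∘ s) (b ∘ s) (c ∘ s).
Proof. by move=> [u [<- <- <-]]; exists (u ∘ s); rewrite !cmpA. Qed.

End UniversalTheory.

Section FixedObjects.
Variables (V : category) (x0 : V).
Implicit Types G H K : groupoid x0.

Definition gmor G H (f : hom (g1 G) (g1 H)) :=
  [/\ d0 H ∘ f = d0 G, d1 H ∘ f = d1 G, f ∘ s0 G = s0 H
    & along (p0 H) (p1 H) (mul H) (f ∘ p0 G) (f ∘ p1 G) (f ∘ mul G)].

Definition gcomp G T (a b c : hom T (g1 G)) := along (p0 G) (p1 G) (mul G) a b c.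

Lemma gcomp_uniq G T (a b c c' : hom T (g1 G)) : gcomp a b c -> gcomp a b c' -> c = c'.
Proof.
move=> [u [u0 u1 <-]] [v [v0 v1 <-]]; congr cmp.
by apply: (pb_eq (g_pb G)); rewrite ?u0 ?u1.
Qed.

Lemma gcompE G T (a b : hom T (g1 G)) : d1 G ∘ a = d0 G ∘ b -> exists c, gcomp a b c.
Proof. by move=> /(pb_lift (g_pb G)) [u [ua ub]]; exists (mul G ∘ u), u. Qed.

Lemma gcomp_dom G T (a b c : hom T (g1 G)) : gcomp a b c ->
  [/\ d1 G ∘ a = d0 G ∘ b, d0 G ∘ c = d0 G ∘ a & d1 G ∘ c = d1 G ∘ b].
Proof.
by move=> [u [<- <- <-]]; rewrite !cmpA (g_pb G).1 d0mul d1mul.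
Qed.

Lemma gcomp1l G T (a : hom T (g1 G)) : gcomp (s0 G ∘ (d0 G ∘ a)) a a.
Proof. by have := along_pre a (mul1l G); rewrite cmp1m -cmpA. Qed.

Lemma gcomp1r G T (a : hom T (g1 G)) : gcomp a (s0 G ∘ (d1 G ∘ a)) a.
Proof. by have := along_pre a (mul1r G); rewrite cmp1m -cmpA. Qed.

Lemma gcompVl G T (a : hom T (g1 G)) : gcomp (inv G ∘ a) a (s0 G ∘ (d1 G ∘ a)).
Proof. by have := along_pre a (mulVl G); rewrite cmp1m -cmpA. Qed.

Lemma gcompVr G T (a : hom T (g1 G)) : gcomp a (inv G ∘ a) (s0 G ∘ (d0 G ∘ a)).
Proof. by have := along_pre a (mulVr G); rewrite cmp1m -cmpA. Qed.

Lemma ginv_uniq G T (a b : hom T (g1 G)) :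
  gcomp b a (s0 G ∘ (d1 G ∘ a)) -> b = inv G ∘ a.
Proof.
move=> ba; have [eba _ _] := gcomp_dom ba.
have e2 : gcomp (s0 G ∘ (d1 G ∘ a)) (inv G ∘ a) (inv G ∘ a).
  by have := gcomp1l (inv G ∘ a); have [<- _ _] := gcomp_dom (gcompVr a).
have := mulAg ba (gcompVr a) e2; rewrite -eba => e3.
exact: gcomp_uniq (gcomp1r b) e3.
Qed.

Lemma gmor_comp G H (f : hom (g1 G) (g1 H)) : gmor f ->
  forall T (a b c : hom T (g1 G)), gcomp a b c -> gcomp (f ∘ a) (f ∘ b) (f ∘ c).
Proof.
by move=> [_ _ _ fm] T a b c [u [<- <- <-]]; have := along_pre u fm; rewrite !cmpA.
Qed.

Lemma gmorI G H (f : hom (g1 G) (g1 H)) :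
  d0 H ∘ f = d0 G -> d1 H ∘ f = d1 G -> f ∘ s0 G = s0 H ->
  (forall T (a b c : hom T (g1 G)), gcomp a b c -> gcomp (f ∘ a) (f ∘ b) (f ∘ c)) ->
  gmor f.
Proof.
move=> f0 f1 fs fm; split=> //; apply: fm.
by exists (idm _); rewrite !cmpm1.
Qed.

Lemma gmorV G H (f : hom (g1 G) (g1 H)) : gmor f -> f ∘ inv G = inv H ∘ f.
Proof.
move=> fg; apply: ginv_uniq; case: (fg) => _ f1 fs _; rewrite f1.
have := gmor_comp fg (mulVl G); rewrite cmpm1 cmpA fs; exact.
Qed.

Lemma gmorM G H K (f : hom (g1 G) (g1 H)) (g : hom (g1 H) (g1 K)) :
  gmor f -> gmor g -> gmor (g ∘ f).
Proof.
move=> fg gg; case: (fg) (gg) => f0 f1 fs _ [k0 k1 ks _].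
apply: gmorI; rewrite ?cmpA ?k0 ?k1 -?cmpA ?fs //.
by move=> T a b c /(gmor_comp fg) /(gmor_comp gg); rewrite !cmpA.
Qed.

Lemma gmor_pb_reflect G H K (P T : groupoid x0) (f : hom (g1 G) (g1 H)) (k : hom (g1 K) (g1 H))
    (p : hom (g1 P) (g1 G)) (q : hom (g1 P) (g1 K)) (u : hom (g1 T) (g1 P)) :
  gmor p -> gmor q -> is_pullback f k p q ->
  gmor (p ∘ u) -> gmor (q ∘ u) -> gmor u.
Proof.
move=> pg qg pb pug qug; case: (pg) (qg) (pug) (qug) => p0_ p1_ ps _ [q0_ q1_ qs _].
move=> [pu0 pu1 pus _] [qu0 qu1 qus _].
have u0 : d0 P ∘ u = d0 T by rewrite -p0_ -cmpA.
have u1 : d1 P ∘ u = d1 T by rewrite -p1_ -cmpA.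
apply: gmorI => // [|S a b c abc].
  by apply: (pb_eq pb); rewrite cmpA ?pus ?qus ?ps ?qs.
have [eab _ _] := gcomp_dom abc.
have [|c' H'] := @gcompE P S (u ∘ a) (u ∘ b); first by rewrite !cmpA u0 u1.
suff <- : c' = u ∘ c by [].
apply: (pb_eq pb).
- apply: (gcomp_uniq (gmor_comp pg H')).
  by have := gmor_comp pug abc; rewrite !cmpA.
- apply: (gcomp_uniq (gmor_comp qg H')).
  by have := gmor_comp qug abc; rewrite !cmpA.
Qed.

Hypothesis pbV : has_pullbacks V.

Lemma gmor_pb_ex G H K (f : hom (g1 G) (g1 H)) (k : hom (g1 K) (g1 H)) :
  gmor f -> gmor k ->
  exists (P : groupoid x0) (p : hom (g1 P) (g1 G)) (q : hom (g1 P) (g1 K)),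
    [/\ gmor p, gmor q & is_pullback f k p q].
Proof.
move=> fg kg; case: (fg) (kg) => f0 f1 fs _ [k0 k1 ks _].
have [P1 [p [q pb]]] := pbV f k.
have e0 : d0 K ∘ q = d0 G ∘ p by rewrite -k0 -f0 -!cmpA pb.1.
have e1 : d1 K ∘ q = d1 G ∘ p by rewrite -k1 -f1 -!cmpA pb.1.
pose dd0 := d0 G ∘ p; pose dd1 := d1 G ∘ p.
have [ss [sp sq]] := pb_lift pb (etrans fs (esym ks)).
have [P2 [r0 [r1 pb2]]] := pbV dd1 dd0.
have ev : f ∘ (inv G ∘ p) = k ∘ (inv K ∘ q).
  by rewrite !cmpA !gmorV // -!cmpA pb.1.
have [vv [vp vq]] := pb_lift pb ev.
have [mG mGP] : exists c, gcomp (p ∘ r0) (p ∘ r1) c.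
  by apply: gcompE; rewrite !cmpA; exact: pb2.1.
have [mK mKP] : exists c, gcomp (q ∘ r0) (q ∘ r1) c.
  by apply: gcompE; rewrite !cmpA e0 e1; exact: pb2.1.
have em : f ∘ mG = k ∘ mK.
  apply: (gcomp_uniq (gmor_comp fg mGP)).
  by have := gmor_comp kg mKP; rewrite !cmpA pb.1.
have [mm [mp mq]] := pb_lift pb em.
have alongE T (a b c : hom T P1) : along r0 r1 mm a b c <->
    gcomp (p ∘ a) (p ∘ b) (p ∘ c) /\ gcomp (q ∘ a) (q ∘ b) (q ∘ c).
  split=> [[u [<- <- <-]]|[pc qc]].
    split; first by have := along_pre u mGP; rewrite -mp !cmpA.
    by have := along_pre u mKP; rewrite -mq !cmpA.
  have [|u [ua ub]] := @pb_lift _ _ _ _ _ _ _ _ _ pb2 T a b.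
    by have [] := gcomp_dom pc; rewrite !cmpA.
  exists u; split=> //; apply: (pb_eq pb).
    apply: (gcomp_uniq _ pc); rewrite cmpA mp -ua -ub.
    by have := along_pre u mGP; rewrite !cmpA.
  apply: (gcomp_uniq _ qc); rewrite cmpA mq -ua -ub.
  by have := along_pre u mKP; rewrite !cmpA.
have [dG0 dG1 dG2] := gcomp_dom mGP.
unshelve eexists (@Groupoid V x0 P1 P2 dd0 dd1 ss r0 r1 mm vv pb2 _ _ _ _ _ _ _ _ _), p, q.
- by rewrite /dd0 -cmpA sp d0s.
- by rewrite /dd1 -cmpA sp d1s.
- by rewrite /dd0 -!cmpA mp.
- by rewrite /dd1 -!cmpA mp.
- apply/alongE; rewrite !cmpm1 !cmpA sp sq -[s0 G ∘ _ ∘ _]cmpA -[s0 K ∘ _ ∘ _]cmpA.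
  by split; [exact: gcomp1l | rewrite /dd0 -e0; exact: gcomp1l].
- apply/alongE; rewrite !cmpm1 !cmpA sp sq -[s0 G ∘ _ ∘ _]cmpA -[s0 K ∘ _ ∘ _]cmpA.
  by split; [exact: gcomp1r | rewrite /dd1 -e1; exact: gcomp1r].
- move=> T a b c ab bc abc /alongE [h1 h1'] /alongE [h2 h2'] /alongE [h3 h3'].
  by apply/alongE; split; [exact: mulAg h1 h2 h3 | exact: mulAg h1' h2' h3'].
- apply/alongE; rewrite !cmpm1 !cmpA sp sq vp vq -[s0 G ∘ _ ∘ _]cmpA -[s0 K ∘ _ ∘ _]cmpA.
  by split; [exact: gcompVl | rewrite /dd1 -e1; exact: gcompVl].
- apply/alongE; rewrite !cmpm1 !cmpA sp sq vp vq -[s0 G ∘ _ ∘ _]cmpA -[s0 K ∘ _ ∘ _]cmpA.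
  by split; [exact: gcompVr | rewrite /dd0 -e0; exact: gcompVr].
split=> //; apply: gmorI => //= T a b c abc.
- by have /alongE [] : along r0 r1 mm a b c := abc.
- by have /alongE [] : along r0 r1 mm a b c := abc.
Qed.

End FixedObjects.

Lemma vertical_cancel (A B : category) (U : functor A B) (b : B) (x y z : A)
    (ex : U x = b) (ey : U y = b) (ez : U z = b) (g : hom y z) (f : hom x y) :
  vertical ey ez g -> vertical ex ez (g ∘ f) -> vertical ex ey f.
Proof. by rewrite /vertical fmapM => <-; rewrite cmpA. Qed.

Section ObjFibre.
Variable S : tower.
Local Notation U := (proj S).
Variable z : tot S.
Local Notation W := (fibre (obj_functor S) z).

Definition wob (G : groupoid (pt z)) : W :=
  @FibOb _ _ (obj_functor S) z (GrdOb G) erefl.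

Definition warr (G H : groupoid (pt z)) (h : hom (wob G) (wob H)) := h_arr (fib_map h).

Lemma fib_along (T X P : fibre U (U z)) (p q m : hom P X) (a b c : hom T X) :
  along (fib_map p) (fib_map q) (fib_map m) (fib_map a) (fib_map b) (fib_map c) ->
  along p q m a b c.
Proof.
move=> [u [u0 u1 u2]].
have uv : vertical (fib_tot_over T) (fib_tot_over P) u.
  by apply: vertical_cancel (fib_mapP p) _; rewrite u0; exact: fib_mapP.
by exists (FibHom uv); split; apply: fib_hom_eq.
Qed.

Lemma along_fib (T X P : fibre U (U z)) (p q m : hom P X) (a b c : hom T X) :
  along p q m a b c ->
  along (fib_map p) (fib_map q) (fib_map m) (fib_map a) (fib_map b) (fib_map c).
Proof. by move=> [u [<- <- <-]]; exists (fib_map u). Qed.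

Lemma wmor_proof (G H : groupoid (pt z)) (f : hom (g1 G) (g1 H)) : gmor f ->
  exists h : hom (wob G) (wob H), h_arr (fib_map h) = fib_map f.
Proof.
move=> [f0 f1 fs fm].
have k0 : @dom S (GrdOb H) ∘ fib_map f = idm z ∘ @dom S (GrdOb G).
  by rewrite cmp1m -[RHS](congr1 (@fib_map _ _ _ _ _ _) f0).
have k1 : @cod S (GrdOb H) ∘ fib_map f = idm z ∘ @cod S (GrdOb G).
  by rewrite cmp1m -[RHS](congr1 (@fib_map _ _ _ _ _ _) f1).
have ks : fib_map f ∘ @idt S (GrdOb G) = @idt S (GrdOb H) ∘ idm z.
  by rewrite cmpm1 -[RHS](congr1 (@fib_map _ _ _ _ _ _) fs).
pose g := @GrdHom S (GrdOb G) (GrdOb H) (idm z) (fib_map f) k0 k1 ks (along_fib fm).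
have gv : vertical (fib_tot_over (wob G)) (fib_tot_over (wob H)) (g : hom (GrdOb G : grd S) (GrdOb H)).
  by rewrite /vertical /= cmpm1.
by exists (FibHom gv).
Qed.

Lemma wmor_obj (G H : groupoid (pt z)) (h : hom (wob G) (wob H)) :
  h_obj (fib_map h) = idm z.
Proof. by have := fib_mapP h; rewrite /vertical /= cmp1m. Qed.

Lemma wmor_eq (G H : groupoid (pt z)) (h k : hom (wob G) (wob H)) :
  h_arr (fib_map h) = h_arr (fib_map k) -> h = k.
Proof. by move=> e; apply: fib_hom_eq; apply: grd_hom_eq; rewrite ?wmor_obj. Qed.

Lemma wmor_inv (G H : groupoid (pt z)) (h : hom (wob G) (wob H)) :
  exists2 f : hom (g1 G) (g1 H), fib_map f = h_arr (fib_map h) & gmor f.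
Proof.
have eo := wmor_obj h; set g := fib_map h in eo *.
have e0 := h_dom g; rewrite eo cmp1m in e0.
have e1 := h_cod g; rewrite eo cmp1m in e1.
have es := h_idt g; rewrite eo cmpm1 in es.
have fv : vertical (fib_tot_over (g1 G)) (fib_tot_over (g1 H)) (h_arr g).
  by apply: vertical_cancel (fib_mapP (d0 H)) _; rewrite -/(@dom S (GrdOb H)) e0; exact: fib_mapP.
exists (FibHom fv) => //; split.
- exact: fib_hom_eq.
- exact: fib_hom_eq.
- exact: fib_hom_eq.
- by apply: fib_along; exact: (h_mul g).
Qed.

Lemma wob_ex (X : W) : exists G, X = wob G.
Proof. by case: X => [[x G] /= e]; subst x; exists G. Qed.

(** A square in the fibre of [()_n] is a pullback iff it is one on arrows. *)
Section Square.
Variables (G H K P : groupoid (pt z)).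
Variables (f : hom (wob G) (wob H)) (k : hom (wob K) (wob H)).
Variables (p : hom (wob P) (wob G)) (q : hom (wob P) (wob K)).
Variables (f1 : hom (g1 G) (g1 H)) (k1 : hom (g1 K) (g1 H)).
Variables (p1 : hom (g1 P) (g1 G)) (q1 : hom (g1 P) (g1 K)).
Hypotheses (f1E : fib_map f1 = h_arr (fib_map f)) (k1E : fib_map k1 = h_arr (fib_map k)).
Hypotheses (p1E : fib_map p1 = h_arr (fib_map p)) (q1E : fib_map q1 = h_arr (fib_map q)).

Lemma wmor_gmor (G' H' : groupoid (pt z)) (h : hom (wob G') (wob H')) (h1 : hom (g1 G') (g1 H')) :
  fib_map h1 = h_arr (fib_map h) -> gmor h1.
Proof. by have [h2 e2 h2g] := wmor_inv h => e; have -> : h1 = h2 by apply: fib_hom_eq; rewrite e. Qed.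

Lemma wpb_reflect : is_pullback f1 k1 p1 q1 -> is_pullback f k p q.
Proof.
move=> pb; apply: pbI => [|T a b ab|T u v].
- by apply: wmor_eq; rewrite /= -f1E -k1E -p1E -q1E; have := congr1 (@fib_map _ _ _ _ _ _) pb.1.
- have [T' eT] := wob_ex T; subst T.
  have [a1 a1E a1g] := wmor_inv a; have [b1 b1E b1g] := wmor_inv b.
  have e1 : f1 ∘ a1 = k1 ∘ b1.
    apply: fib_hom_eq; rewrite /= f1E k1E a1E b1E.
    by have := congr1 (@warr _ _) ab.
  have [u [ua ub]] := pb_lift pb e1.
  have ug : gmor u.
    apply: (gmor_pb_reflect (wmor_gmor p1E) (wmor_gmor q1E) pb); first by rewrite ua.
    by rewrite ub.
  have [h hE] := wmor_proof ug; exists h; split; apply: wmor_eq; rewrite /= hE.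
  + by rewrite -p1E -a1E -ua.
  + by rewrite -q1E -b1E -ub.
- have [T' eT] := wob_ex T; subst T => eu ev.
  have [u1 u1E _] := wmor_inv u; have [v1 v1E _] := wmor_inv v.
  apply: wmor_eq; rewrite -u1E -v1E; congr fib_map; apply: (pb_eq pb); apply: fib_hom_eq.
  + by rewrite /= p1E u1E v1E; have := congr1 (@warr _ _) eu.
  + by rewrite /= q1E u1E v1E; have := congr1 (@warr _ _) ev.
Qed.

End Square.

Hypothesis pbV : has_pullbacks (fibre U (U z)).

Lemma obj_fibre_pb : has_pullbacks W.
Proof.
move=> X Y Z f k; have [G eG] := wob_ex X; have [K eK] := wob_ex Y; have [H eH] := wob_ex Z.
subst X Y Z; have [f1 f1E f1g] := wmor_inv f; have [k1 k1E k1g] := wmor_inv k.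
have [P [p [q [pg qg pb]]]] := gmor_pb_ex pbV f1g k1g.
have [p' pE] := wmor_proof pg; have [q' qE] := wmor_proof qg.
by exists (wob P), p', q'; apply: wpb_reflect f1E k1E _ _ pb.
Qed.

Lemma wpb_arr (G H K P : groupoid (pt z))
    (f : hom (wob G) (wob H)) (k : hom (wob K) (wob H))
    (p : hom (wob P) (wob G)) (q : hom (wob P) (wob K))
    (f1 : hom (g1 G) (g1 H)) (k1 : hom (g1 K) (g1 H))
    (p1 : hom (g1 P) (g1 G)) (q1 : hom (g1 P) (g1 K)) :
  fib_map f1 = h_arr (fib_map f) -> fib_map k1 = h_arr (fib_map k) ->
  fib_map p1 = h_arr (fib_map p) -> fib_map q1 = h_arr (fib_map q) ->
  is_pullback f k p q -> is_pullback f1 k1 p1 q1.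
Proof.
move=> f1E k1E p1E q1E pb.
have [Q [r [s [rg sg pb1]]]] := gmor_pb_ex pbV (wmor_gmor f1E) (wmor_gmor k1E).
have [r' rE] := wmor_proof rg; have [s' sE] := wmor_proof sg.
have pb' := wpb_reflect f1E k1E (esym rE) (esym sE) pb1.
have [i [j [ij ji pi qi]]] := pb_uniq pb' pb.
have [i1 i1E _] := wmor_inv i; have [j1 j1E _] := wmor_inv j.
have -> : p1 = r ∘ i1 by apply: fib_hom_eq; rewrite /= p1E -pi /= rE i1E.
have -> : q1 = s ∘ i1 by apply: fib_hom_eq; rewrite /= q1E -qi /= sE i1E.
apply: (pb_iso pb1 (j := j1)); apply: fib_hom_eq; rewrite /= i1E j1E.
- by have := congr1 (@warr _ _) ij.
- by have := congr1 (@warr _ _) ji.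
Qed.

End ObjFibre.

Record tower_map (S S' : tower) := TowerMap {
  tm : functor (tot S) (tot S');
  bm : functor (base S) (base S');
  tm_sq : forall x, proj S' (tm x) = bm (proj S x);
  tm_sqh : forall x y (f : hom x y),
    eqhom (tm_sq y) ∘ fmap (proj S') (fmap tm f) = fmap bm (fmap (proj S) f) ∘ eqhom (tm_sq x) }.

Lemma eqhomM (C : category) (X Y Z : C) (e : X = Y) (e' : Y = Z) :
  eqhom e' ∘ eqhom e = eqhom (etrans e e').
Proof. by case: _ / e' => /=; rewrite cmp1m; congr eqhom; exact: Prop_irrelevance. Qed.

Lemma fmap_eqhom (C D : category) (F : functor C D) (X Y : C) (e : X = Y) :
  fmap F (eqhom e) = eqhom (congr1 F e).
Proof. by case: _ / e => /=; rewrite fmap1. Qed.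

Lemma eqhom_inj (C : category) (X Y Z : C) (e : Y = Z) (f g : hom X Y) :
  eqhom e ∘ f = eqhom e ∘ g -> f = g.
Proof. by case: _ / e => /=; rewrite !cmp1m. Qed.

Section TowerMap.
Variables (S S' : tower) (m : tower_map S S').
Local Notation U := (proj S).
Local Notation U' := (proj S').

Lemma vertical_tm (b : base S) (x y : tot S) (ex : U x = b) (ey : U y = b) (f : hom x y) :
  vertical ex ey f ->
  forall b' (ex' : U' (tm m x) = b') (ey' : U' (tm m y) = b'), vertical ex' ey' (fmap (tm m) f).
Proof.
rewrite /vertical => fv b' ex' ey'.
have Uf : fmap U f = eqhom (etrans ex (esym ey)).
  apply: (eqhom_inj (e := ey)); rewrite fv eqhomM; congr eqhom; exact: Prop_irrelevance.
have := tm_sqh m f; rewrite Uf fmap_eqhom eqhomM => e.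
have -> : fmap U' (fmap (tm m) f) = eqhom (etrans ex' (esym ey')).
  apply: (eqhom_inj (e := tm_sq m y)); rewrite e eqhomM; congr eqhom; exact: Prop_irrelevance.
by rewrite eqhomM; congr eqhom; exact: Prop_irrelevance.
Qed.

Definition tmf (b : base S) (x y : fibre U b) (f : hom x y) (b' : base S')
    (ex' : U' (tm m (fib_tot x)) = b') (ey' : U' (tm m (fib_tot y)) = b') :
    hom (@FibOb _ _ U' b' _ ex' : fibre U' b') (@FibOb _ _ U' b' _ ey') :=
  @FibHom _ _ U' b' (FibOb ex') (FibOb ey') (fmap (tm m) (fib_map f))
    (vertical_tm (fib_mapP f) ex' ey').

Definition preserves :=
  forall b (x y z w : fibre U b) (f : hom x z) (g : hom y z) (p : hom w x) (q : hom w y),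
    is_pullback f g p q ->
    forall b' (ex : U' (tm m (fib_tot x)) = b') (ey : U' (tm m (fib_tot y)) = b')
      (ez : U' (tm m (fib_tot z)) = b') (ew : U' (tm m (fib_tot w)) = b'),
      is_pullback (tmf f ex ez) (tmf g ey ez) (tmf p ew ex) (tmf q ew ey).

Lemma tm_over (x : tot S) (y : fibre U (U x)) : U' (tm m (fib_tot y)) = U' (tm m x).
Proof. by rewrite !tm_sq fib_tot_over. Qed.

Hypotheses (pbS : forall b, has_pullbacks (fibre U b)) (presm : preserves).

Section OnGroupoid.
Variables (x : tot S) (G : groupoid (pt x)).
Local Notation e1 := (@tm_over x (g1 G)).
Local Notation e2 := (@tm_over x (g2 G)).
Local Notation e0 := (erefl (U' (tm m x))).

Let D0 : hom (@FibOb _ _ U' _ _ e1 : fibre U' _) (pt (tm m x)) := tmf (d0 G) e1 e0.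
Let D1 : hom (@FibOb _ _ U' _ _ e1 : fibre U' _) (pt (tm m x)) := tmf (d1 G) e1 e0.
Let S0 : hom (pt (tm m x)) (@FibOb _ _ U' _ _ e1 : fibre U' _) := tmf (s0 G) e0 e1.
Let R0 := tmf (p0 G) e2 e1.
Let R1 := tmf (p1 G) e2 e1.
Let M := tmf (mul G) e2 e1.

Lemma tm_along (T : fibre U (U x)) (a b c : hom T (g1 G))
    (eT : U' (tm m (fib_tot T)) = U' (tm m x)) :
  along (p0 G) (p1 G) (mul G) a b c -> along R0 R1 M (tmf a eT e1) (tmf b eT e1) (tmf c eT e1).
Proof.
by move=> [u [<- <- <-]]; exists (tmf u eT e2); split; apply: fib_hom_eq; rewrite /= -fmapM.
Qed.

Lemma tm_assoc T (a b c ab bc abc : hom T (@FibOb _ _ U' _ _ e1 : fibre U' _)) :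
  along R0 R1 M a b ab -> along R0 R1 M b c bc ->
  along R0 R1 M ab c abc -> along R0 R1 M a bc abc.
Proof.
move=> [w2 [w2a w2b w2c]] [w3 [w3a w3b w3c]] [w1 [w1a w1b w1c]].
have [Q [q0 [q1 pbQ]]] := pbS (p1 G) (p0 G).
have pbQ' := presm pbQ e2 e2 e1 (@tm_over x Q).
have [t [t0 t1]] := pb_lift pbQ' (etrans w2b (esym w3a) : R1 ∘ w2 = R0 ∘ w3).
have A1 : along (p0 G) (p1 G) (mul G) (p0 G ∘ q0) (p1 G ∘ q0) (mul G ∘ q0) by exists q0.
have A2 : along (p0 G) (p1 G) (mul G) (p1 G ∘ q0) (p1 G ∘ q1) (mul G ∘ q1).
  by exists q1; split=> //; rewrite pbQ.1.
have [v [v0 v1]] : exists v, p0 G ∘ v = mul G ∘ q0 /\ p1 G ∘ v = p1 G ∘ q1.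
  apply: (pb_lift (g_pb G)).
  by rewrite !cmpA d1mul -!cmpA pbQ.1 !cmpA (g_pb G).1.
have A3 : along (p0 G) (p1 G) (mul G) (mul G ∘ q0) (p1 G ∘ q1) (mul G ∘ v) by exists v.
have A := along_pre t (tm_along (@tm_over x Q) (mulAg A1 A2 A3)).
have push (Y Z : fibre U (U x)) (g : hom Y Z) (f : hom Q Y) eY eZ :
    tmf (g ∘ f) (@tm_over x Q) eZ = tmf g eY eZ ∘ tmf f (@tm_over x Q) eY.
  by apply: fib_hom_eq; rewrite /= fmapM.
rewrite (push _ _ (p0 G) q0 e2) (push _ _ (mul G) q1 e2) (push _ _ (mul G) v e2) in A.
have c0 : R0 ∘ tmf v (@tm_over x Q) e2 = M ∘ tmf q0 (@tm_over x Q) e2.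
  by rewrite /R0 /M -!push v0.
have c1 : R1 ∘ tmf v (@tm_over x Q) e2 = R1 ∘ tmf q1 (@tm_over x Q) e2.
  by rewrite /R1 -!push v1.
have pbG' := presm (g_pb G) e1 e1 e0 e2.
have ew : w1 = tmf v (@tm_over x Q) e2 ∘ t.
  apply: (pb_eq pbG'); rewrite cmpA -/R0 -/R1 ?c0 ?c1 -cmpA ?t0 ?t1.
  - by rewrite w1a w2c.
  - by rewrite w1b w3b.
move: A; rewrite -!cmpA t0 t1 -ew.
by rewrite -/R0 -/M w2a w3c w1c.
Qed.

Lemma tmf_congr (X Y : fibre U (U x)) (f g : hom X Y) :
  f = g -> fmap (tm m) (fib_map f) = fmap (tm m) (fib_map g).
Proof. by move=> ->. Qed.

Lemma tmf1 (X : fibre U (U x)) (eX : U' (tm m (fib_tot X)) = U' (tm m x)) :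
  tmf (idm X) eX eX = idm _.
Proof. by apply: fib_hom_eq; rewrite /= fmap1. Qed.

Lemma tmf_s0d0 : tmf (s0 G ∘ d0 G) e1 e1 = S0 ∘ D0.
Proof. by apply: fib_hom_eq; rewrite /= fmapM. Qed.

Lemma tmf_s0d1 : tmf (s0 G ∘ d1 G) e1 e1 = S0 ∘ D1.
Proof. by apply: fib_hom_eq; rewrite /= fmapM. Qed.

Definition tm_grd : groupoid (pt (tm m x)).
Proof.
refine (@Groupoid (fibre U' (U' (tm m x))) (pt (tm m x)) (@FibOb _ _ U' _ _ e1)
  (@FibOb _ _ U' _ _ e2) D0 D1 S0 R0 R1 M (tmf (inv G) e1 e1) _ _ _ _ _ _ _ _ _ _).
- exact: presm (g_pb G) _ _ _ _ _.
- by apply: fib_hom_eq; have := tmf_congr (d0s G); rewrite /= fmapM fmap1.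
- by apply: fib_hom_eq; have := tmf_congr (d1s G); rewrite /= fmapM fmap1.
- by apply: fib_hom_eq; have := tmf_congr (d0mul G); rewrite /= !fmapM.
- by apply: fib_hom_eq; have := tmf_congr (d1mul G); rewrite /= !fmapM.
- by have := tm_along e1 (mul1l G); rewrite tmf1 tmf_s0d0.
- by have := tm_along e1 (mul1r G); rewrite tmf1 tmf_s0d1.
- exact: tm_assoc.
- by have := tm_along e1 (mulVl G); rewrite tmf1 tmf_s0d1.
- by have := tm_along e1 (mulVr G); rewrite tmf1 tmf_s0d0.
Defined.

End OnGroupoid.

Program Definition tm_next_functor : functor (grd S) (grd S') :=
  @Functor (grd S) (grd S') (fun G => GrdOb (tm_grd (g_grd G)))
    (fun G H f => @GrdHom S' (GrdOb (tm_grd (g_grd G))) (GrdOb (tm_grd (g_grd H)))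
       (fmap (tm m) (h_obj f)) (fmap (tm m) (h_arr f)) _ _ _ _) _ _.
Next Obligation. by move=> G H f; rewrite /dom /= -!fmapM -/(dom H) h_dom. Qed.
Next Obligation. by move=> G H f; rewrite /cod /= -!fmapM -/(cod H) h_cod. Qed.
Next Obligation. by move=> G H f; rewrite /idt /= -!fmapM -/(idt H) -h_idt. Qed.
Next Obligation.
move=> G H f; have [u [u0 u1 u2]] := h_mul f.
exists (fmap (tm m) u).
by rewrite /fst_ /snd_ /mul_ /= -!fmapM -/(fst_ H) -/(snd_ H) -/(mul_ H) u0 u1 u2.
Qed.
Next Obligation. by move=> G; apply: grd_hom_eq; rewrite /= fmap1. Qed.
Next Obligation. by move=> G H K g f; apply: grd_hom_eq; rewrite /= fmapM. Qed.

Program Definition tm_next : tower_map (next_level S) (next_level S') :=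
  @TowerMap (next_level S) (next_level S') tm_next_functor (tm m) (fun _ => erefl) _.
Next Obligation. by move=> G H f; rewrite /= cmp1m cmpm1. Qed.

End TowerMap.

Lemma tm_next_pres (S S' : tower) (m : tower_map S S')
    (pbS : forall b, has_pullbacks (fibre (proj S) b)) (presm : preserves m) :
  preserves (tm_next pbS presm).
Proof.
move=> z X Y Z W f k p q pb b' eX eY eZ eW.
have [G eG] := wob_ex X; have [K eK] := wob_ex Y; have [H eH] := wob_ex Z.
have [P eP] := wob_ex W; subst X Y Z W.
have [f1 f1E f1g] := wmor_inv f; have [k1 k1E k1g] := wmor_inv k.
have [p1 p1E p1g] := wmor_inv p; have [q1 q1E q1g] := wmor_inv q.
have pb1 := wpb_arr (pbS _) f1E k1E p1E q1E pb.
simpl in eX, eY, eZ, eW; case: b' / eZ eX eY eW => eX eY eW.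
have -> : eX = erefl by exact: Prop_irrelevance.
have -> : eY = erefl by exact: Prop_irrelevance.
have -> : eW = erefl by exact: Prop_irrelevance.
have pb' := presm _ _ _ _ _ _ _ _ _ pb1 _ (tm_over m (g1 G)) (tm_over m (g1 K))
  (tm_over m (g1 H)) (tm_over m (g1 P)).
apply: (@wpb_reflect S' (tm m z) (tm_grd pbS presm G) (tm_grd pbS presm H)
  (tm_grd pbS presm K) (tm_grd pbS presm P) _ _ _ _ _ _ _ _ _ _ _ _ pb').
- by rewrite /= f1E.
- by rewrite /= k1E.
- by rewrite /= p1E.
- by rewrite /= q1E.
Qed.

Lemma unit_vertical (E : category) (b : unit_category) (x y : E) (ex : to_unit E x = b)
    (ey : to_unit E y = b) (f : hom x y) : vertical ex ey f.
Proof. by rewrite /vertical; case: (eqhom ex); case: (_ ∘ _). Qed.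

Lemma unit_over (E : category) (b : unit_category) (x : E) : to_unit E x = b.
Proof. by case: b. Qed.

Definition unit_fib (E : category) (b : unit_category) (x : E) : fibre (to_unit E) b :=
  @FibOb _ _ (to_unit E) b x (unit_over b x).

Definition unit_fibh (E : category) (b : unit_category) (x y : fibre (to_unit E) b)
    (f : hom (fib_tot x) (fib_tot y)) : hom x y :=
  @FibHom _ _ (to_unit E) b x y f (unit_vertical _ _ f).

Lemma unit_fib_pb (E : category) (b : unit_category) (x y z w : fibre (to_unit E) b)
    (f : hom x z) (g : hom y z) (p : hom w x) (q : hom w y) :
  is_pullback f g p q <->
  is_pullback (C := E) (fib_map f) (fib_map g) (fib_map p) (fib_map q).
Proof.
split=> pb; apply: pbI => [|T a c ac|T u v eu ev].
- by have := congr1 (@fib_map _ _ _ _ _ _) pb.1.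
- have [|u [ua uc]] := @pb_lift _ _ _ _ _ _ _ _ _ pb (unit_fib b T) (@unit_fibh E b (unit_fib b T) x a) (@unit_fibh E b (unit_fib b T) y c).
    exact: fib_hom_eq.
  exists (fib_map u); split; first by rewrite -[RHS](congr1 (@fib_map _ _ _ _ _ _) ua).
  by rewrite -[RHS](congr1 (@fib_map _ _ _ _ _ _) uc).
- have := @pb_eq _ _ _ _ _ _ _ _ _ pb (unit_fib b T) (@unit_fibh E b (unit_fib b T) w u) (@unit_fibh E b (unit_fib b T) w v).
  move=> H; apply: (congr1 (@fib_map _ _ _ _ _ _) (H _ _)); exact: fib_hom_eq.
- by apply: fib_hom_eq; exact: pb.1.
- have ac' := congr1 (@fib_map _ _ _ _ _ _) ac.
  have [u [ua uc]] := @pb_lift _ _ _ _ _ _ _ _ _ pb (fib_tot T) (fib_map a) (fib_map c) ac'.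
  by exists (@unit_fibh E b T w u); split; apply: fib_hom_eq.
- apply: fib_hom_eq; apply: (pb_eq pb).
  + exact: (congr1 (@fib_map _ _ _ _ _ _) eu).
  + exact: (congr1 (@fib_map _ _ _ _ _ _) ev).
Qed.

Section Induced.
Variables (C D : category) (F : functor C D).
Hypothesis pbC : has_pullbacks C.
Hypothesis presF : forall X Y Z P (f : hom X Z) (g : hom Y Z) (p : hom P X) (q : hom P Y),
  is_pullback f g p q -> is_pullback (fmap F f) (fmap F g) (fmap F p) (fmap F q).

Record pb_map (S S' : tower) := PbMap {
  pm :> tower_map S S';
  pm_pb : forall b, has_pullbacks (fibre (proj S) b);
  pm_pres : preserves pm }.

Definition tm_base : tower_map (Tower (to_unit C)) (Tower (to_unit D)) :=
  @TowerMap (Tower (to_unit C)) (Tower (to_unit D)) F (id_functor unit_category)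
    (fun _ => erefl) (fun _ _ _ => erefl).

Lemma tm_base_pb b : has_pullbacks (fibre (to_unit C) b).
Proof.
move=> x y z f g; have [P [p [q pb]]] := pbC (fib_map f) (fib_map g).
exists (unit_fib b P), (@unit_fibh C b (unit_fib b P) x p), (@unit_fibh C b (unit_fib b P) y q).
exact/unit_fib_pb.
Qed.

Lemma tm_base_pres : preserves tm_base.
Proof.
move=> b x y z w f g p q /unit_fib_pb pb b' ex ey ez ew; apply/unit_fib_pb => /=.
exact: presF.
Qed.

Fixpoint tm_ind (n : nat) : pb_map (grd_tower C n) (grd_tower D n) :=
  match n return pb_map (grd_tower C n) (grd_tower D n) with
  | 0 => @PbMap (Tower (to_unit C)) (Tower (to_unit D)) tm_base tm_base_pb tm_base_pres
  | n'.+1 => let m := tm_ind n' in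
      @PbMap (next_level (grd_tower C n')) (next_level (grd_tower D n'))
        (@tm_next _ _ m (@pm_pb _ _ m) (@pm_pres _ _ m))
        (fun z => @obj_fibre_pb (grd_tower C n') z (@pm_pb _ _ m (proj (grd_tower C n') z)))
        (@tm_next_pres _ _ m (@pm_pb _ _ m) (@pm_pres _ _ m))
  end.

Definition nGrd_map (n : nat) : functor (nGrd C n) (nGrd D n) := tm (tm_ind n).

(** n-cells of the image, up to isomorphism. *)
Fixpoint cells_to (n : nat) :
    forall X : nGrd C n, hom (cells D n (nGrd_map n X)) (F (cells C n X)) :=
  match n return forall X : nGrd C n, hom (cells D n (nGrd_map n X)) (F (cells C n X)) with
  | 0 => fun X => idm _
  | n'.+1 => fun X => @cells_to n' (arr X)
  end.

Fixpoint cells_from (n : nat) :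
    forall X : nGrd C n, hom (F (cells C n X)) (cells D n (nGrd_map n X)) :=
  match n return forall X : nGrd C n, hom (F (cells C n X)) (cells D n (nGrd_map n X)) with
  | 0 => fun X => idm _
  | n'.+1 => fun X => @cells_from n' (arr X)
  end.

Arguments cells_to {n} X.
Arguments cells_from {n} X.

Lemma cells_tf n (X : nGrd C n) : cells_to X ∘ cells_from X = idm _.
Proof. by elim: n X => [|n IH] X; [exact: cmp1m | exact: IH]. Qed.

Lemma cells_ft n (X : nGrd C n) : cells_from X ∘ cells_to X = idm _.
Proof. by elim: n X => [|n IH] X; [exact: cmp1m | exact: IH]. Qed.

Lemma cells_to_nat n (X Y : nGrd C n) (f : hom X Y) :
  fmap F (fmap (cells C n) f) ∘ cells_to X
  = cells_to Y ∘ fmap (cells D n) (fmap (nGrd_map n) f).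
Proof.
elim: n X Y f => [|n IH] X Y f; first by rewrite /= cmpm1 cmp1m.
exact: (IH _ _ (h_arr f)).
Qed.

Lemma cells_from_nat n (X Y : nGrd C n) (f : hom X Y) :
  fmap (cells D n) (fmap (nGrd_map n) f) ∘ cells_from X
  = cells_from Y ∘ fmap F (fmap (cells C n) f).
Proof.
rewrite -[LHS]cmp1m -(cells_ft Y) -!cmpA; congr cmp; rewrite !cmpA -cells_to_nat.
by rewrite -cmpA cells_tf cmpm1.
Qed.

Lemma src_map n (X : nGrd C n.+1) :
  src (nGrd_map n.+1 X) ∘ cells_from X = cells_from (under X) ∘ fmap F (src X).
Proof. exact: (cells_from_nat (@dom (grd_tower C n) X)). Qed.

Lemma tgt_map n (X : nGrd C n.+1) :
  tgt (nGrd_map n.+1 X) ∘ cells_from X = cells_from (under X) ∘ fmap F (tgt X).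
Proof. exact: (cells_from_nat (@cod (grd_tower C n) X)). Qed.

Hypothesis prodF : forall X Y P (p : hom P X) (q : hom P Y),
  is_product p q -> is_product (fmap F p) (fmap F q).
Hypothesis repiF : forall X Y (f : hom X Y), regular_epi f -> regular_epi (fmap F f).
Hypothesis termF : forall T, is_terminal T -> is_terminal (F T).

Lemma is_par_map n (X : nGrd C n) P (q0 q1 : hom P (cells C n X)) : is_par q0 q1 ->
  is_par (X := nGrd_map n X) (cells_from X ∘ fmap F q0) (cells_from X ∘ fmap F q1).
Proof.
elim: n X P q0 q1 => [|n IH] X P q0 q1.
  by move=> /prodF; rewrite /= !cmp1m.
move=> [Q [r0 [r1 [c [/IH par c0 c1 kp]]]]].
exists (F Q), (cells_from (under X) ∘ fmap F r0), (cells_from (under X) ∘ fmap F r1),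
  (fmap F c ∘ cells_to X); split=> //.
- rewrite -!cmpA (cmpA (fmap F r0)) -fmapM c0 cmpA -src_map -cmpA cells_ft; exact: cmpm1.
- rewrite -!cmpA (cmpA (fmap F r1)) -fmapM c1 cmpA -tgt_map -cmpA cells_ft; exact: cmpm1.
have kpF := presF kp.
have red T (u : hom T (F (cells C n.+1 X))) :
    fmap F c ∘ cells_to X ∘ (cells_from X ∘ u) = fmap F c ∘ u.
  by rewrite -cmpA (cmpA (cells_to X)) cells_tf cmp1m.
have inj T (u v : hom T (F (cells C n.+1 X))) :
    cells_from X ∘ u = cells_from X ∘ v -> u = v.
  by move=> e; rewrite -[u]cmp1m -[v]cmp1m -cells_tf -!cmpA e.
apply: pbI => [|T a b|T u v].
- by rewrite !red kpF.1.
- rewrite -!cmpA => ab; have [u [ua ub]] := pb_lift kpF ab; exists u.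
  by rewrite -!cmpA ua ub !cmpA cells_ft !cmp1m.
- by rewrite -!cmpA => /inj e0 /inj e1; exact: (pb_eq kpF).
Qed.

Lemma epi_pre_iso (X Y Z : D) (f : hom Y Z) (i : hom X Y) (j : hom Y X) :
  i ∘ j = idm Y -> j ∘ i = idm X -> regular_epi f -> regular_epi (f ∘ i).
Proof.
move=> ij ji [R [a [b [e co]]]]; exists R, (j ∘ a), (j ∘ b); split.
  by rewrite -!cmpA !(cmpA i) ij !cmp1m.
move=> T g; rewrite !cmpA => /co [u [ug un]]; exists u; split.
  by rewrite cmpA ug -cmpA ji cmpm1.
by move=> v vg; apply: un; rewrite -vg -!cmpA ij cmpm1.
Qed.

Lemma aspherical_map n (X : nGrd C n) : aspherical X -> aspherical (nGrd_map n X).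
Proof.
elim: n X => [|n IH] X.
  by move=> [T [t [tT te]]]; exists (F T), (fmap F t); split; [exact: termF | exact: repiF].
move=> [/IH aX [Q [c [[q0 [q1 [par c0 c1]]] ce]]]]; split=> //.
exists (F Q), (fmap F c ∘ cells_to X); split.
  exists (cells_from (under X) ∘ fmap F q0), (cells_from (under X) ∘ fmap F q1); split.
  - exact: is_par_map.
  - rewrite -!cmpA (cmpA (fmap F q0)) -fmapM c0 cmpA -src_map -cmpA cells_ft; exact: cmpm1.
  - rewrite -!cmpA (cmpA (fmap F q1)) -fmapM c1 cmpA -tgt_map -cmpA cells_ft; exact: cmpm1.
by apply: epi_pre_iso (cells_tf X) (cells_ft X) _; exact: repiF.
Qed.

End Induced.

(** Used of [C = D/Y]: commutative objects are closed in [C] under pullbacks and regular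
    quotients, hence [M C -> C] preserves finite limits, regular epimorphisms,
    coequalizers, and the pushouts defining directions. *)
Record comm_closed (C : category) : Prop := CommClosed {
  cc_pb : has_pullbacks C;
  cc_term : has_terminal C;
  cc_comm_pb : forall (X Y Z P : C) (f : hom X Z) (g : hom Y Z) (p : hom P X) (q : hom P Y),
    is_pullback f g p q -> commutative_ob X -> commutative_ob Y -> commutative_ob P;
  cc_image : forall (X T : C) (g : hom X T), commutative_ob X ->
    exists (I : C) (e : hom X I) (m : hom I T),
      [/\ commutative_ob I, regular_epi e, mono m & m ∘ e = g] }.

Section CommClosed.
Variables (C : category) (ccC : comm_closed C).
Local Notation M := (comm_cat C).
Local Notation J := (incl (@commutative_ob C)).

Lemma comm_term (T : C) : is_terminal T -> commutative_ob T.
Proof.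
move=> tT; exists T, (idm T), (idm T), (idm T), (idm T); split.
  move=> S a b c; exists a; split; first by split; rewrite cmp1m //; exact: term_eq.
  by move=> u _; exact: term_eq.
by split=> S u _.
Qed.

Lemma incl_term (T : M) : is_terminal T -> is_terminal (J T).
Proof.
move=> tT; have [T0 tT0] := cc_term ccC.
pose T0' : M := exist _ T0 (comm_term tT0).
have [h _] := @term_hom M T T0' tT.
have [k _] := @term_hom C T0 (J T) tT0.
have hk : (h : hom T0 (J T)) ∘ k = idm (J T).
  exact: (@term_eq M T T ((h : hom T0' T) ∘ (k : hom T T0')) (idm T) tT).
move=> X; have [u _] := @term_hom C T0 X tT0.
exists ((h : hom T0 (J T)) ∘ u); split=> // v _.
by rewrite -[v]cmp1m -hk -cmpA; congr cmp; exact: term_eq.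
Qed.

Lemma full_pb (X Y Z P : M) (f : hom X Z) (g : hom Y Z) (p : hom P X) (q : hom P Y) :
  is_pullback (C := C) f g p q -> is_pullback f g p q.
Proof. by move=> [e pb]; split=> // T; exact: pb. Qed.

Lemma comm_pb : has_pullbacks M.
Proof.
move=> X Y Z f g; have [P [p [q pb]]] := @cc_pb C ccC (J X) (J Y) (J Z) f g.
have cP := cc_comm_pb ccC pb (svalP X) (svalP Y).
by exists (exist _ P cP : M), p, q; exact: full_pb.
Qed.

Lemma incl_pb (X Y Z P : M) (f : hom X Z) (g : hom Y Z) (p : hom P X) (q : hom P Y) :
  is_pullback f g p q -> is_pullback (fmap J f) (fmap J g) (fmap J p) (fmap J q).
Proof.
move=> pb; have [Q [r [s pbQ]]] := @cc_pb C ccC (J X) (J Y) (J Z) f g.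
have cQ := cc_comm_pb ccC pbQ (svalP X) (svalP Y).
pose Q' : M := exist _ Q cQ.
have pbQ' : @is_pullback M X Y Z Q' f g r s by exact: full_pb.
have [i [j [ij ji ip iq]]] := pb_uniq pbQ' pb.
have := @pb_iso C _ _ _ _ (J P) _ _ _ _ i j pbQ ij ji.
by move: ip iq; rewrite /= => -> ->.
Qed.

Lemma incl_prod (X Y P : M) (p : hom P X) (q : hom P Y) :
  is_product p q -> is_product (fmap J p) (fmap J q).
Proof.
have [T tT] := cc_term ccC; pose T' : M := exist _ T (comm_term tT).
have tT' : is_terminal T' by move=> Z; exact: tT.
have [f _] := @term_hom M T' X tT'; have [g _] := @term_hom M T' Y tT'.
by move=> /(pb_prod f g p q tT') /incl_pb /(pb_prod _ _ _ _ tT).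
Qed.

Lemma prod_ex (X Y : C) : exists P (p : hom P X) (q : hom P Y), is_product p q.
Proof.
have [T tT] := cc_term ccC.
have [f _] := term_hom X tT; have [g _] := term_hom Y tT.
have [P [p [q pb]]] := cc_pb ccC f g.
by exists P, p, q; apply/(pb_prod f g p q tT).
Qed.

Lemma comm_prod (X Y P : C) (p : hom P X) (q : hom P Y) :
  is_product p q -> commutative_ob X -> commutative_ob Y -> commutative_ob P.
Proof.
have [T tT] := cc_term ccC.
have [f _] := term_hom X tT; have [g _] := term_hom Y tT.
by move=> /(pb_prod f g p q tT); exact: cc_comm_pb.
Qed.

Lemma prod3_ex (X : C) : exists P (x y z : hom P X),
  is_product3 x y z /\ (commutative_ob X -> commutative_ob P).
Proof.
have [Q [q0 [q1 qP]]] := prod_ex X X; have [P [p0 [p1 pP]]] := prod_ex X Q.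
exists P, p0, (q0 ∘ p1), (q1 ∘ p1); split; last first.
  by move=> cX; apply: (comm_prod pP) => //; exact: (comm_prod qP).
move=> T a b c; have [u [u0 u1]] := prod_lift qP b c; have [v [v0 v1]] := prod_lift pP a u.
exists v; split; first by rewrite -!cmpA v1 u0 u1.
move=> w [w0 w1 w2]; apply: (prod_eq pP); rewrite ?v0 ?w0 //.
by apply: (prod_eq qP); rewrite v1 ?u0 ?u1 cmpA.
Qed.

Lemma incl_prod3 (X P : M) (x y z : hom P X) :
  is_product3 x y z -> is_product3 (fmap J x) (fmap J y) (fmap J z).
Proof.
move=> pP; have [Q [a [b [c [qP cQ]]]]] := prod3_ex (J X).
pose Q' : M := exist _ Q (cQ (svalP X)).
have [u [[u0 u1 u2] _]] := pP Q' a b c.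
have [v [[v0 v1 v2] _]] := qP (J P) x y z.
have vu : (u : hom Q (J P)) ∘ v = idm (J P).
  have [w [_ wu]] := pP P x y z.
  have w1 : w = idm P by apply: wu; rewrite !cmpm1.
  rewrite -[RHS]w1; apply: esym; apply: (wu ((u : hom Q' P) ∘ (v : hom P Q'))); rewrite !cmpA.
  by split; [rewrite u0; exact: v0 | rewrite u1; exact: v1 | rewrite u2; exact: v2].
move=> T a' b' c'; have [w [[w0 w1 w2] wu]] := qP T a' b' c'.
exists ((u : hom Q (J P)) ∘ w); split.
  by rewrite !cmpA -w0 -w1 -w2; split; congr cmp.
move=> t [t0 t1 t2]; rewrite -[t]cmp1m -vu -cmpA; congr cmp; apply: wu.
by rewrite !cmpA v0 v1 v2.
Qed.

Lemma incl_maltsev (X S P : M) (f g : hom S X) (x y z p : hom P X) :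
  is_product f g -> is_product3 x y z -> maltsev_op x y z p ->
  maltsev_op (fmap J x) (fmap J y) (fmap J z) (fmap J p).
Proof.
move=> sP cP [h1 h2].
have eq3 T (u v : hom T (J P)) : fmap J x ∘ u = fmap J x ∘ v ->
    fmap J y ∘ u = fmap J y ∘ v -> fmap J z ∘ u = fmap J z ∘ v -> u = v.
  move=> e0 e1 e2; have [w [_ wu]] := incl_prod3 cP (fmap J x ∘ u) (fmap J y ∘ u) (fmap J z ∘ u).
  by rewrite -(wu u) // -(wu v).
have [d [[d0 d1 d2] _]] := cP S f g g; have [d' [[d'0 d'1 d'2] _]] := cP S f f g.
have hd := h1 S d (etrans d1 (esym d2)); have hd' := h2 S d' (etrans d'0 (esym d'1)).
split=> T u e.
- have [w [w0 w1]] := prod_lift (incl_prod sP) (fmap J x ∘ u) (fmap J y ∘ u).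
  have -> : u = fmap J d ∘ w.
    apply: eq3; rewrite cmpA -[fmap J _ ∘ fmap J d]fmapM ?d0 ?d1 ?d2 ?w0 ?w1 //.
  by rewrite !cmpA -!fmapM hd.
- have [w [w0 w1]] := prod_lift (incl_prod sP) (fmap J x ∘ u) (fmap J z ∘ u).
  have -> : u = fmap J d' ∘ w.
    apply: eq3; rewrite cmpA -[fmap J _ ∘ fmap J d']fmapM ?d'0 ?d'1 ?d'2 ?w0 ?w1 //.
  by rewrite !cmpA -!fmapM hd'.
Qed.

Definition strong_epi (X Y : C) (f : hom X Y) :=
  forall (A B : C) (m : hom A B) (a : hom X A) (b : hom Y B), mono m ->
    m ∘ a = b ∘ f -> exists d : hom Y A, m ∘ d = b /\ d ∘ f = a.

Definition epi (X Y : C) (f : hom X Y) := forall T (u v : hom Y T), u ∘ f = v ∘ f -> u = v.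

Lemma coeq_epi (R X Y : C) (a b : hom R X) (f : hom X Y) : is_coequalizer a b f -> epi f.
Proof.
move=> [e co] T u v uv; have [|w [_ wu]] := co T (u ∘ f); first by rewrite -!cmpA e.
by rewrite -(wu u) // -(wu v).
Qed.

Lemma repi_strong (X Y : C) (f : hom X Y) : regular_epi f -> strong_epi f.
Proof.
move=> [R [r [s co]]] A B m a b mm e; have fe := coeq_epi co.
have [|d [da _]] := co.2 A a; first by apply: mm; rewrite !cmpA e -!cmpA co.1.
by exists d; split=> //; apply: fe; rewrite -cmpA da.
Qed.

Lemma strongM (X Y Z : C) (f : hom X Y) (g : hom Y Z) :
  strong_epi f -> strong_epi g -> strong_epi (g ∘ f).
Proof.
move=> sf sg A B m a b mm; rewrite cmpA => e.
have [d [d0 d1]] := sf _ _ _ _ _ mm e; have [d' [d'0 d'1]] := sg _ _ _ _ _ mm d0.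
by exists d'; rewrite cmpA d'1.
Qed.

Lemma split_strong (X Y : C) (f : hom X Y) (s : hom Y X) : f ∘ s = idm Y -> strong_epi f.
Proof.
move=> fs A B m a b mm e; have e' : m ∘ (a ∘ s) = b by rewrite cmpA e -cmpA fs cmpm1.
by exists (a ∘ s); split=> //; apply: mm; rewrite e cmpA e'.
Qed.

Lemma incl_coeq_repi (R X Q : M) (a b : hom R X) (q : hom X Q) :
  is_coequalizer a b q -> regular_epi (fmap J q).
Proof.
move=> [e co]; have [I [f [m [cI fe mm mf]]]] := cc_image ccC (fmap J q) (svalP X).
pose I' : M := exist _ I cI.
have [|t [tq _]] := co I' (f : hom X I').
  by apply: mm; rewrite !cmpA mf; exact: e.
have mt : (m : hom I' Q) ∘ t = idm Q.
  have [w [_ wu]] := co Q q e.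
  have w1 : w = idm Q by apply: wu; rewrite cmp1m.
  by rewrite -w1; apply: esym; apply: wu; rewrite -cmpA tq; exact: mf.
have tm1 : (t : hom (J Q) I) ∘ m = idm I.
  by apply: mm; rewrite cmpA cmpm1; have := congr1 (fun h => (h : hom (J Q) (J Q)) ∘ m) mt; rewrite /= cmp1m.
case: fe => S [r [s [rs fco]]]; exists S, r, s; split.
  by rewrite -mf -!cmpA rs.
move=> T g /fco [u [uf un]]; exists (u ∘ t); split.
  by rewrite -cmpA; have := tq; rewrite /= => ->.
move=> v vq; have -> : u = v ∘ m by apply: un; rewrite -cmpA mf.
rewrite -cmpA; exact: etrans (congr1 (cmp v) mt) (cmpm1 v).
Qed.

Lemma incl_repi (X Q : M) (q : hom X Q) : regular_epi q -> regular_epi (fmap J q).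
Proof. by move=> [R [a [b]]]; exact: incl_coeq_repi. Qed.

Lemma incl_coeq (R X Q : M) (a b : hom R X) (q : hom X Q) :
  is_coequalizer a b q -> is_coequalizer (fmap J a) (fmap J b) (fmap J q).
Proof.
move=> co; have [S [r [s /coeq_epi qe]]] := incl_coeq_repi co.
case: co => e co; split; first exact: e.
move=> T g gab; have [I [f [m [cI _ mm mf]]]] := cc_image ccC g (svalP X).
pose I' : M := exist _ I cI.
have [|t [tq _]] := co I' (f : hom X I').
  by apply: mm; rewrite !cmpA mf; exact: gab.
have mtq : m ∘ t ∘ (q : hom (J X) (J Q)) = g by rewrite -cmpA -mf; congr cmp.
exists (m ∘ t); split=> // v vq; apply: qe.
exact: etrans mtq (esym vq).
Qed.

Lemma incl_pushout (X Y Z P : M) (f : hom Z X) (g : hom Z Y) (i : hom X P) (j : hom Y P) :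
  regular_epi i -> strong_epi (fmap J g) ->
  is_pushout f g i j -> is_pushout (fmap J f) (fmap J g) (fmap J i) (fmap J j).
Proof.
move=> ri sg [e po]; split; first exact: e.
have [S [r [s /coeq_epi ie]]] := incl_repi ri.
move=> T a b ab; have [I [h [m [cI _ mm mh]]]] := cc_image ccC a (svalP X).
pose I' : M := exist _ I cI.
have e1 : m ∘ (h ∘ (f : hom (J Z) (J X))) = b ∘ fmap J g by rewrite cmpA mh.
have [d [d0 d1]] := sg _ _ _ _ _ mm e1.
have [|u [[ui uj] _]] := po I' (h : hom X I') (d : hom Y I'); first exact: esym d1.
have e2 : m ∘ u ∘ (i : hom (J X) (J P)) = a by rewrite -cmpA -mh; congr cmp.
exists (m ∘ u); split; first split=> //.
  by rewrite -cmpA -d0; congr cmp.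
by move=> v [vi _]; apply: ie; exact: etrans e2 (esym vi).
Qed.

Lemma par_strong n (X : nGrd C n) P (q0 q1 : hom P (cells C n X)) : is_par q0 q1 ->
  strong_epi q0.
Proof.
case: n X P q0 q1 => [|n] X P q0 q1.
  move=> pr; have [s [s0 _]] := prod_lift pr (idm _) (idm _); exact: split_strong s0.
move=> [Q [r0 [r1 [c [_ _ _ kp]]]]].
have [s [s0 _]] := pb_lift kp (erefl (c ∘ idm _)); exact: split_strong s0.
Qed.

Lemma aspherical_strong n (X : nGrd C n) (T : C) (t : hom (cells C n X) T) :
  aspherical X -> is_terminal T -> strong_epi t.
Proof.
elim: n X t => [|n IH] X t.
  move=> [T' [t' [tT' /repi_strong st]]] tT.
  have [k _] := term_hom T' tT; have [l _] := term_hom T tT'.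
  have -> : t = k ∘ t' by exact: term_eq.
  by apply: strongM => //; apply: (@split_strong _ _ k l); exact: term_eq.
move=> [aX [Q [c [[q0 [q1 [par _ _]]] /repi_strong sc]]]] tT.
have [k _] := term_hom (cells C n (under X)) tT.
have -> : t = k ∘ q0 ∘ c by exact: term_eq.
by apply: strongM => //; apply: strongM; [exact: par_strong par | exact: IH].
Qed.

Lemma ag_sum_uniq (E : category) (A : abgroup E) T (x y z z' : hom T A) :
  ag_sum x y z -> ag_sum x y z' -> z = z'.
Proof.
move=> [u [u0 u1 <-]] [v [v0 v1 <-]]; congr cmp.
by apply: (prod_eq (@ag_sqP _ A)); rewrite ?u0 ?u1.
Qed.

Lemma ag_comm (A : abgroup C) : commutative_ob (ag_ob A).
Proof.
have [X3 [x [y [z [pr _]]]]] := prod3_ex A.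
have [u1 [u1a u1b]] := prod_lift (@ag_sqP _ A) (ag_opp A ∘ y) z.
have [u2 [u2a u2b]] := prod_lift (@ag_sqP _ A) x (ag_add A ∘ u1).
have sumE T (u : hom T X3) :
    ag_sum (ag_opp A ∘ (y ∘ u)) (z ∘ u) (ag_add A ∘ u1 ∘ u) /\
    ag_sum (x ∘ u) (ag_add A ∘ u1 ∘ u) (ag_add A ∘ u2 ∘ u).
  split; first by exists (u1 ∘ u); rewrite !cmpA u1a u1b.
  by exists (u2 ∘ u); rewrite !cmpA u2a u2b.
exists X3, x, y, z, (ag_add A ∘ u2); split=> //; split=> T u e.
- have [h1 h2] := sumE T u; have [t _] := term_hom T (@ag_oneP _ A).
  rewrite -e in h1; rewrite (ag_sum_uniq h1 (ag_addN (y ∘ u) t)) in h2.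
  exact: ag_sum_uniq h2 (ag_addC (ag_add0 (x ∘ u) t)).
- have [h1 h2] := sumE T u; have [t _] := term_hom T (@ag_oneP _ A).
  have h3 := ag_addA (ag_add0 (z ∘ u) t) (ag_addC (ag_addN (y ∘ u) t)) h1.
  by rewrite e in h2; exact: ag_sum_uniq h2 h3.
Qed.

Definition comm_abgroup (A : abgroup C) : abgroup M :=
  @Abgroup M (exist _ (ag_ob A) (ag_comm A))
    (exist _ (ag_one A) (comm_term (@ag_oneP C A)))
    (exist _ (ag_sq A) (comm_prod (@ag_sqP C A) (ag_comm A) (ag_comm A)))
    (ag_fst A) (ag_snd A) (ag_add A) (ag_zero A) (ag_opp A)
    (fun X => @ag_oneP C A (sval X)) (fun T => @ag_sqP C A (sval T))
    (fun T => @ag_addA C A (sval T)) (fun T => @ag_addC C A (sval T))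
    (fun T => @ag_add0 C A (sval T)) (fun T => @ag_addN C A (sval T)).

Variable A : abgroup C.
Local Notation AM := (comm_abgroup A).

Lemma incl_gs (X : M) : global_support X -> global_support (J X).
Proof.
by move=> [T [t [tT te]]]; exists (J T), t; split; [exact: incl_term | exact: incl_repi te].
Qed.

Program Definition torsor_incl (X : torsor AM) : torsor A :=
  @Torsor C A (J (t_ob X)) (J (t_sq X)) (t_fst X) (t_snd X) (J (t_cube X))
    (t_x X) (t_y X) (t_z X) (t_p X) (t_q X)
    (incl_prod (@t_sqP _ _ X)) (incl_prod3 (@t_cubeP _ _ X)) _
    (incl_gs (t_gs X)) _ (t_q0 X).
Next Obligation. by move=> X; apply: incl_maltsev (@t_sqP _ _ X) (@t_cubeP _ _ X) (t_pP X). Qed.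
Next Obligation.
move=> X; have [l [r [rot [hl hrot hr /incl_coeq co]]]] := t_qP X.
by exists l, r, rot.
Qed.

Local Notation nJ := (nGrd_map comm_pb incl_pb).
Local Notation to_ := (cells_to comm_pb incl_pb).
Local Notation from_ := (cells_from comm_pb incl_pb).

Lemma prod_iso_l (X X' Y P : C) (p : hom P X) (q : hom P Y) (i : hom X X') (k : hom X' X) :
  i ∘ k = idm X' -> k ∘ i = idm X -> is_product p q -> is_product (i ∘ p) q.
Proof.
move=> ik ki pr; apply: prodI => [T a b|T u v].
  have [u [ua ub]] := prod_lift pr (k ∘ a) b; exists u; split=> //.
  by rewrite -cmpA ua cmpA ik cmp1m.
rewrite -!cmpA => e; apply: (prod_eq pr).
by rewrite -[p ∘ u]cmp1m -[p ∘ v]cmp1m -ki -!cmpA e.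
Qed.

Lemma pushout_pre_iso (X Y Z Z' P : C) (f : hom Z X) (g : hom Z Y) (i : hom X P)
    (j : hom Y P) (h : hom Z' Z) (k : hom Z Z') : h ∘ k = idm Z ->
  is_pushout f g i j -> is_pushout (f ∘ h) (g ∘ h) i j.
Proof.
move=> hk [e po]; split; first by rewrite !cmpA e.
move=> T a b; rewrite !cmpA => ab; apply: po.
by rewrite -[a ∘ f]cmpm1 -[b ∘ g]cmpm1 -hk !cmpA ab.
Qed.

Program Definition dgrd_incl (n : nat) (X : dgrd AM n) : dgrd A n :=
  @Dgrd C A n (nJ n (d_grd X)) (J (d_par X))
    (from_ (d_grd X) ∘ fmap J (d_fst X)) (from_ (d_grd X) ∘ fmap J (d_snd X))
    (fmap J (d_nu X)) _ _ _ _ _ _.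
Next Obligation.
move=> n X; apply: aspherical_map incl_prod incl_repi incl_term _ _ _; exact: d_asph.
Qed.
Next Obligation. by move=> n X; apply: is_par_map incl_prod _ _ _ _ _ _; exact: d_parP. Qed.
Next Obligation. by move=> n X; exact: incl_repi (d_nu_epi X). Qed.
Next Obligation.
move=> n X; apply: prod_iso_l (cells_ft _ _ _) (cells_tf _ _ _) _.
exact: incl_prod (@d_nu_fst _ _ _ X).
Qed.
Next Obligation.
move=> n X; apply: prod_iso_l (cells_ft _ _ _) (cells_tf _ _ _) _.
exact: incl_prod (@d_nu_snd _ _ _ X).
Qed.
Next Obligation.
move=> n X; have [s [t [s0 s1 po]]] := d_nu_po X.
exists (fmap J s ∘ to_ (d_grd X)), (fmap J t ∘ to_ (d_grd X)); split.
- rewrite -cmpA (cmpA (fmap J (d_fst X))) -fmapM s0 fmap1 cmp1m; exact: cells_ft.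
- rewrite -cmpA (cmpA (fmap J (d_snd X))) -fmapM s1 fmap1 cmp1m; exact: cells_ft.
apply: pushout_pre_iso (cells_tf _ _ _) _; apply: (incl_pushout (d_nu_epi X) _ po).
rewrite -[fmap J t]cmpm1 -(cells_tf comm_pb incl_pb (d_grd X)) cmpA.
apply: strongM; first exact: split_strong (cells_ft _ _ _).
apply: aspherical_strong; last exact: (@ag_oneP _ A).
apply: aspherical_map incl_prod incl_repi incl_term _ _ _; exact: d_asph.
Qed.

Lemma torsor_incl_mor (X Z : torsor AM) :
  torsor_mor X Z -> torsor_mor (torsor_incl X) (torsor_incl Z).
Proof. by move=> [f [g H]]; exists f, g. Qed.

Lemma dgrd_incl_mor n (X Z : dgrd AM n) :
  dgrd_mor X Z -> dgrd_mor (dgrd_incl X) (dgrd_incl Z).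
Proof.
move=> [f [g [h0 h1 h2]]]; have H := cells_from_nat comm_pb incl_pb f.
exists (fmap (nJ n) f), (fmap J g); split.
- exact: etrans (esym (cmpA _ _ _)) (etrans (congr1 (cmp (from_ (d_grd Z))) h0)
    (etrans (cmpA _ _ _) (etrans (congr1 (fun k => k ∘ fmap J (d_fst X)) (esym H)) (esym (cmpA _ _ _))))).
- exact: etrans (esym (cmpA _ _ _)) (etrans (congr1 (cmp (from_ (d_grd Z))) h1)
    (etrans (cmpA _ _ _) (etrans (congr1 (fun k => k ∘ fmap J (d_snd X)) (esym H)) (esym (cmpA _ _ _))))).
- exact: h2.
Qed.

Definition cocycle_incl (n : nat) : cocycle AM n -> cocycle A n :=
  match n with 0 => torsor_incl | n'.+1 => @dgrd_incl n'.+1 end.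

Lemma connected_incl n (X Z : cocycle AM n) :
  connected X Z -> connected (cocycle_incl X) (cocycle_incl Z).
Proof.
elim=> [X' Z' h|X'|X' Z' _ h|X' Y' Z' _ h _ h'].
- apply: rst_step; case: n X Z X' Z' h => [|n] _ _ X' Z'; [exact: torsor_incl_mor|exact: dgrd_incl_mor].
- exact: rst_refl.
- exact: rst_sym.
- exact: rst_trans h h'.
Qed.

Lemma component_incl_proof n (K : component AM n) :
  exists X, (fun Z => exists2 X, sval K X & connected (cocycle_incl X) Z) = connected X.
Proof.
case: K => K [X eK]; subst K; exists (cocycle_incl X); apply: funext => Z; apply: propext; split=> /=.
- by move=> [X' /connected_incl h h']; exact: rst_trans h h'.
- by exists X; first exact: rst_refl.
Qed.

Definition component_incl (n : nat) (K : component AM n) : component A n :=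
  exist _ _ (component_incl_proof K).

Definition coh_incl (n : nat) : coh AM n -> coh A n :=
  match n with
  | 0 => fun f => f
  | n'.+1 => @component_incl n'
  end.

End CommClosed.

(** Properties shared by groups ([trm x y z = x * y^-1 * z]) and Lie algebras
    ([trm x y z = x - y + z]) that give [comm_closed] for all slices. *)
Record algebraic (D : category) := Algebraic {
  car : D -> Type;
  app : forall X Y : D, hom X Y -> car X -> car Y;
  trm : forall X : D, car X -> car X -> car X -> car X;
  jinj := fun (X Y P : D) (p : hom P X) (q : hom P Y) =>
    forall z z', app p z = app p z' -> app q z = app q z' -> z = z';
  app1 : forall (X : D) x, app (idm X) x = x;
  appM : forall (X Y Z : D) (g : hom Y Z) (f : hom X Y) x, app (g ∘ f) x = app g (app f x);
  app_inj : forall (X Y : D) (f g : hom X Y), (forall x, app f x = app g x) -> f = g;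
  app_lift : forall (T P X Y : D) (p : hom P X) (q : hom P Y) (k : car T -> car P)
    (a : hom T X) (b : hom T Y), jinj p q ->
    (forall t, app p (k t) = app a t) -> (forall t, app q (k t) = app b t) ->
    exists h : hom T P, forall t, app h t = k t;
  app_desc : forall (X I T : D) (e : hom X I) (k : car I -> car T) (h : hom X T),
    (forall i, exists x, app e x = i) -> (forall x, k (app e x) = app h x) ->
    exists u : hom I T, forall i, app u i = k i;
  alg_pb : forall (X Y Z : D) (f : hom X Z) (g : hom Y Z),
    exists P (p : hom P X) (q : hom P Y),
      [/\ f ∘ p = g ∘ q, jinj p q
        & forall x y, app f x = app g y -> exists z, app p z = x /\ app q z = y];
  alg_im : forall (X T : D) (g : hom X T),
    exists I (e : hom X I) (m : hom I T),
      [/\ forall i, exists x, app e x = i, injective (app m) & m ∘ e = g];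
  trm_nat : forall (X Y : D) (f : hom X Y) x y z,
    app f (trm x y z) = trm (app f x) (app f y) (app f z);
  trm_r : forall (X : D) (x y : car X), trm x y y = x;
  trm_l : forall (X : D) (x y : car X), trm x x y = y;
  trm_uniq : forall (X Y W : D) (f : hom X Y) (x y z p : hom W X),
    (forall w w', app x w = app x w' -> app y w = app y w' -> app z w = app z w' -> w = w') ->
    (forall a b c, app f a = app f b -> app f b = app f c ->
       exists w, [/\ app x w = a, app y w = b & app z w = c]) ->
    f ∘ x = f ∘ y -> f ∘ y = f ∘ z ->
    (forall w, app y w = app z w -> app p w = app x w) ->
    (forall w, app x w = app y w -> app p w = app z w) ->
    forall w, app p w = trm (app x w) (app y w) (app z w) }.

Section Algebraic.
Variables (D : category) (aD : algebraic D).
Local Notation app := (@app D aD _ _).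
Local Notation trm := (@trm D aD _).

Lemma lift_choice (X Y P T : D) (p : hom P X) (q : hom P Y) (a : hom T X) (b : hom T Y) :
  jinj aD p q -> (forall t, exists z, app p z = app a t /\ app q z = app b t) ->
  exists h : hom T P, p ∘ h = a /\ q ∘ h = b.
Proof.
move=> inj ex; pose k t := sval (cid (ex t)).
have kP t : app p (k t) = app a t /\ app q (k t) = app b t := svalP (cid (ex t)).
have [h hk] := app_lift inj (fun t => (kP t).1) (fun t => (kP t).2).
by exists h; split; apply: (@app_inj D aD) => t; rewrite appM hk; case: (kP t).
Qed.

Section Slice.
Variable Y : D.
Local Notation C := (slice Y).
Local Notation "h @ x" := (app (sl_hom h) x) (at level 20).

Lemma sl_eq (X X' : C) (f g : hom X X') : (forall x, f @ x = g @ x) -> f = g.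
Proof. by move=> e; apply: slice_hom_eq; exact: (@app_inj D aD). Qed.

Lemma sl_over (X X' : C) (f : hom X X') x : app (sl_map X') (f @ x) = app (sl_map X) x.
Proof. by rewrite -appM sl_homP. Qed.

Lemma sl_congr (X X' : C) (f g : hom X X') x : f = g -> f @ x = g @ x.
Proof. by move=> ->. Qed.

Lemma sl_pb (X X' Z : C) (f : hom X Z) (g : hom X' Z) :
  exists (P : C) (p : hom P X) (q : hom P X'),
    [/\ is_pullback f g p q, jinj aD (sl_hom p) (sl_hom q)
      & forall x y, f @ x = g @ y -> exists z, p @ z = x /\ q @ z = y].
Proof.
have [P [p [q [e inj sur]]]] := alg_pb aD (sl_hom f) (sl_hom g).
pose P' : C := SliceOb (sl_map X ∘ p).
have qP : sl_map X' ∘ q = sl_map X ∘ p.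
  by rewrite -(sl_homP g) -cmpA -e cmpA sl_homP.
pose p' : hom P' X := @SliceHom D Y P' X p erefl.
pose q' : hom P' X' := @SliceHom D Y P' X' q qP.
exists P', p', q'; split=> //; apply: pbI => [|T a b ab|T u v eu ev].
- exact: slice_hom_eq.
- have [|h [hp hq]] := lift_choice (a := sl_hom a) (b := sl_hom b) inj.
    by move=> t; apply: sur; rewrite -!appM; have := congr1 (@sl_hom _ _ _ _) ab; rewrite /= => ->.
  have hP : sl_map P' ∘ h = sl_map T by rewrite /= -cmpA hp sl_homP.
  by exists (@SliceHom D Y T P' h hP); split; apply: slice_hom_eq.
- apply: sl_eq => t; apply: inj.
  + by have := sl_congr t eu; rewrite /= !appM.
  + by have := sl_congr t ev; rewrite /= !appM.
Qed.

Lemma sl_has_pb : has_pullbacks C.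
Proof. by move=> X X' Z f g; have [P [p [q [pb _ _]]]] := sl_pb f g; exists P, p, q. Qed.

Definition sl_one : C := SliceOb (idm Y).

Lemma sl_term : is_terminal sl_one.
Proof.
move=> X; have e : sl_map sl_one ∘ sl_map X = sl_map X by rewrite /= cmp1m.
exists (@SliceHom D Y X sl_one (sl_map X) e); split=> // v _; apply: slice_hom_eq.
by rewrite /= -(sl_homP v) /= cmp1m.
Qed.

Lemma pb_elts (X X' Z P : C) (f : hom X Z) (g : hom X' Z) (p : hom P X) (q : hom P X') :
  is_pullback f g p q ->
  jinj aD (sl_hom p) (sl_hom q) /\
  forall x y, f @ x = g @ y -> exists z, p @ z = x /\ q @ z = y.
Proof.
move=> pb; have [Q [r [s [pbQ inj sur]]]] := sl_pb f g.
have [i [j [ij ji rp sq]]] := pb_uniq pbQ pb; split.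
  move=> z z'; rewrite -rp -sq /= !appM => e0 e1.
  have e := inj _ _ e0 e1.
  have k t : j @ (i @ t) = t by have := sl_congr t ji; rewrite /= appM app1.
  by rewrite -(k z) -(k z') e.
move=> x y /sur [z [<- <-]]; exists (j @ z).
have k : i @ (j @ z) = z by have := sl_congr z ij; rewrite /= appM app1.
by rewrite -rp -sq /= !appM k.
Qed.

Lemma prod_elts (X X' P : C) (p : hom P X) (q : hom P X') : is_product p q ->
  jinj aD (sl_hom p) (sl_hom q) /\
  forall x y, app (sl_map X) x = app (sl_map X') y -> exists z, p @ z = x /\ q @ z = y.
Proof.
have [f _] := term_hom X sl_term; have [g _] := term_hom X' sl_term.
move=> /(pb_prod f g p q sl_term) /pb_elts [inj sur]; split=> // x y e; apply: sur.
by have := sl_over f x; have := sl_over g y; rewrite /= !app1 => -> ->.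
Qed.

Definition trm_closed (X : C) := forall (W : C) (x y z : hom W X),
  exists p : hom W X, forall w, p @ w = trm (x @ w) (y @ w) (z @ w).

Lemma sl_prod (X X' : C) : exists P (p : hom P X) (q : hom P X'), is_product p q.
Proof.
have [f _] := term_hom X sl_term; have [g _] := term_hom X' sl_term.
have [P [p [q pb]]] := sl_has_pb f g.
by exists P, p, q; apply/(pb_prod f g p q sl_term).
Qed.

Lemma prod3_eq (X P : C) (x y z : hom P X) : is_product3 x y z ->
  forall T (u v : hom T P), x ∘ u = x ∘ v -> y ∘ u = y ∘ v -> z ∘ u = z ∘ v -> u = v.
Proof.
move=> H T u v e0 e1 e2; have [w [_ wu]] := H T (x ∘ u) (y ∘ u) (z ∘ u).
by rewrite -(wu u) // -(wu v).
Qed.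

Lemma prod3_elts (X P : C) (x y z : hom P X) : is_product3 x y z ->
  (forall w w', x @ w = x @ w' -> y @ w = y @ w' -> z @ w = z @ w' -> w = w') /\
  (forall a b c, app (sl_map X) a = app (sl_map X) b -> app (sl_map X) b = app (sl_map X) c ->
     exists w, [/\ x @ w = a, y @ w = b & z @ w = c]).
Proof.
move=> pr; have [Q [q0 [q1 qP]]] := sl_prod X X; have [R [r0 [r1 rP]]] := sl_prod X Q.
have [qi qs] := prod_elts qP; have [ri rs] := prod_elts rP.
have [u [[u0 u1 u2] _]] := pr R r0 (q0 ∘ r1) (q1 ∘ r1).
have [v [v0 v1]] := prod_lift qP y z; have [w [w0 w1]] := prod_lift rP x v.
have uw : u ∘ w = idm P.
  apply: (prod3_eq pr); rewrite cmpA cmpm1 ?u0 ?u1 ?u2 // -cmpA w1 //.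
split=> [t t' e0 e1 e2|a b c ab bc].
  have k s : u @ (w @ s) = s by have := sl_congr s uw; rewrite /= appM app1.
  have kx s : r0 @ (w @ s) = x @ s by have := sl_congr s w0; rewrite /= appM.
  have ky s : q0 @ (r1 @ (w @ s)) = y @ s.
    by have := sl_congr s w1; have := sl_congr s v0; rewrite /= !appM => <- ->.
  have kz s : q1 @ (r1 @ (w @ s)) = z @ s.
    by have := sl_congr s w1; have := sl_congr s v1; rewrite /= !appM => <- ->.
  suff e : w @ t = w @ t' by rewrite -(k t) -(k t') e.
  by apply: ri; rewrite ?kx //; apply: qi; rewrite ?ky ?kz.
have [s [s0 s1]] := qs b c bc.
have [|t [t0 t1]] := rs a s; first by rewrite ab -s0 sl_over.
exists (u @ t); split.
- by have := sl_congr t u0; rewrite /= appM t0.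
- by have := sl_congr t u1; rewrite /= !appM t1 s0.
- by have := sl_congr t u2; rewrite /= !appM t1 s1.
Qed.

Lemma trm_closedP (X : C) : commutative_ob X <-> trm_closed X.
Proof.
split=> [[P [x [y [z [p [pr [h1 h2]]]]]]]|cX].
  have [inj sur] := prod3_elts pr.
  have [S [a [b sP]]] := sl_prod X X; have [_ ss] := prod_elts sP.
  have [d [[d0 d1 d2] _]] := pr S a b b; have [d' [[d'0 d'1 d'2] _]] := pr S a a b.
  have hd := h1 S d (etrans d1 (esym d2)); have hd' := h2 S d' (etrans d'0 (esym d'1)).
  have over (f : hom P X) w : app (sl_map X) (f @ w) = app (sl_map P) w by exact: sl_over.
  have pE w : p @ w = trm (x @ w) (y @ w) (z @ w).
    apply: (trm_uniq (f := sl_map X)) => //.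
    - by rewrite !sl_homP.
    - by rewrite !sl_homP.
    - move=> t e; have [s [s0 s1]] := ss (x @ t) (y @ t) (etrans (over x t) (esym (over y t))).
      have -> : t = d @ s.
        apply: inj; rewrite -appM.
        + by have := sl_congr s d0; rewrite /= => ->.
        + by have := sl_congr s d1; rewrite /= => ->.
        + by have := sl_congr s d2; rewrite /= => ->; rewrite s1.
      by have := sl_congr s hd; rewrite /= !appM.
    - move=> t e; have [s [s0 s1]] := ss (x @ t) (z @ t) (etrans (over x t) (esym (over z t))).
      have -> : t = d' @ s.
        apply: inj; rewrite -appM.
        + by have := sl_congr s d'0; rewrite /= => ->.
        + by have := sl_congr s d'1; rewrite /= => ->; rewrite s0.
        + by have := sl_congr s d'2; rewrite /= => ->.
      by have := sl_congr s hd'; rewrite /= !appM.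
  move=> W a' b' c'; have [u [[u0 u1 u2] _]] := pr W a' b' c'; exists (p ∘ u) => w.
  by rewrite /= appM pE -u0 -u1 -u2 /= !appM.
have [Q [q0 [q1 qP]]] := sl_prod X X; have [R [r0 [r1 rP]]] := sl_prod X Q.
have [p pE] := cX R r0 (q0 ∘ r1) (q1 ∘ r1).
exists R, r0, (q0 ∘ r1), (q1 ∘ r1), p; split.
  move=> T a b c; have [u [u0 u1]] := prod_lift qP b c; have [v [v0 v1]] := prod_lift rP a u.
  exists v; split; first by rewrite -!cmpA v1 u0 u1.
  move=> w [w0 w1 w2]; apply: (prod_eq rP); rewrite ?v0 ?w0 //.
  by apply: (prod_eq qP); rewrite v1 ?u0 ?u1 cmpA.
split=> T u e; apply: sl_eq => t; have := sl_congr t e; rewrite /= !appM pE /= !appM.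
- by move=> ->; exact: trm_r.
- by move=> ->; exact: trm_l.
Qed.

Lemma surj_repi (X I : C) (e : hom X I) : (forall i, exists x, e @ x = i) -> regular_epi e.
Proof.
move=> sur; have [R [a [b [[ab _] _ ex]]]] := sl_pb e e; exists R, a, b; split=> // T g gab.
pose k i := g @ sval (cid (sur i)).
have kP x : k (e @ x) = g @ x.
  rewrite /k; case: (cid _) => x' /= /ex [z [z0 z1]].
  by have := sl_congr z gab; rewrite /= !appM z0 z1.
have [u uk] := app_desc sur kP.
have uP : sl_map T ∘ u = sl_map I.
  apply: (@app_inj D aD) => i; have [x <-] := sur i.
  by rewrite appM uk kP !sl_over.
exists (@SliceHom D Y I T u uP); split.
  by apply: sl_eq => x; rewrite /= appM uk kP.
move=> v vg; apply: sl_eq => i; have [x <-] := sur i.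
by rewrite /= uk kP; have := sl_congr x vg; rewrite /= appM.
Qed.

Lemma slice_comm_closed : comm_closed C.
Proof.
split.
- exact: sl_has_pb.
- by exists sl_one; exact: sl_term.
- move=> X X' Z P f g p q pb /trm_closedP cX /trm_closedP cX'; apply/trm_closedP => W x y z.
  have [a aE] := cX W (p ∘ x) (p ∘ y) (p ∘ z).
  have [b bE] := cX' W (q ∘ x) (q ∘ y) (q ∘ z).
  have ab : f ∘ a = g ∘ b.
    apply: sl_eq => w; rewrite /= !appM aE bE !trm_nat /= !appM.
    have k t : f @ (p @ t) = g @ (q @ t) by have := sl_congr t pb.1; rewrite /= !appM.
    by rewrite !k.
  have [r [ra rb]] := pb_lift pb ab; exists r => w; apply: (pb_elts pb).1.
  + by rewrite trm_nat; have := sl_congr w ra; rewrite /= appM aE /= !appM.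
  + by rewrite trm_nat; have := sl_congr w rb; rewrite /= appM bE /= !appM.
- move=> X T g /trm_closedP cX; have [I [e [m [sur inj me]]]] := alg_im aD (sl_hom g).
  pose I' : C := SliceOb (sl_map T ∘ m).
  have eP : sl_map I' ∘ e = sl_map X by rewrite /= -cmpA me sl_homP.
  pose e' : hom X I' := @SliceHom D Y X I' e eP.
  pose m' : hom I' T := @SliceHom D Y I' T m erefl.
  exists I', e', m'; split.
  + apply/trm_closedP => W x y z.
    have [W1 [a1 [b1 [[c1 _] _ s1]]]] := sl_pb x e'.
    have [W2 [a2 [b2 [[c2 _] _ s2]]]] := sl_pb (y ∘ a1) e'.
    have [W3 [a3 [b3 [[c3 _] _ s3]]]] := sl_pb (z ∘ a1 ∘ a2) e'.
    have [p pE] := cX W3 (b1 ∘ a2 ∘ a3) (b2 ∘ a3) b3.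
    pose c := a1 ∘ a2 ∘ a3.
    have csur w : exists t, c @ t = w.
      have [i1 hi1] := sur (x @ w); have [t1 [t1a _]] := s1 w i1 (esym hi1).
      have [i2 hi2] := sur ((y ∘ a1) @ t1); have [t2 [t2a _]] := s2 t1 i2 (esym hi2).
      have [i3 hi3] := sur ((z ∘ a1 ∘ a2) @ t2); have [t3 [t3a _]] := s3 t2 i3 (esym hi3).
      by exists t3; rewrite /= !appM t3a t2a t1a.
    pose k w := trm (x @ w) (y @ w) (z @ w).
    have kP t : k (c @ t) = (e' ∘ p) @ t.
      rewrite /k /= !appM pE trm_nat /= !appM.
      have := sl_congr (a2 @ (a3 @ t)) c1; rewrite /= !appM => <-.
      have := sl_congr (a3 @ t) c2; rewrite /= !appM => <-.
      by have := sl_congr t c3; rewrite /= !appM => <-.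
    have [u uk] := app_desc csur kP.
    have uP : sl_map I' ∘ u = sl_map W.
      apply: (@app_inj D aD) => w; have [t <-] := csur w.
      by rewrite appM uk kP !sl_over.
    by exists (@SliceHom D Y W I' u uP).
  + exact: surj_repi.
  + move=> S u v uv; apply: sl_eq => t; apply: inj.
    by have := sl_congr t uv; rewrite /= !appM.
  + exact: slice_hom_eq.
Qed.

End Slice.
End Algebraic.

Section Groups.
Local Open Scope group_scope.

Lemma multiplicative_eq (G H : groupType) (f g : {multiplicative G -> H}) : f =1 g -> f = g.
Proof.
case: f g => [f [[fM]]] [g [[gM]]] /= /funext e; case: _ / e gM => gM.
by rewrite (Prop_irrelevance fM gM).
Qed.

Program Definition Gp : category :=
  @Category groupType (fun G H => {multiplicative G -> H}) (fun G => idfun)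
    (fun G H K g f => g \o f) _ _ _.
Next Obligation. by move=> G H f; exact: multiplicative_eq. Qed.
Next Obligation. by move=> G H f; exact: multiplicative_eq. Qed.
Next Obligation. by move=> G H K L h g f; exact: multiplicative_eq. Qed.

Definition mk_mult (G H : groupType) (k : G -> H) (kM : {morph k : x y / x * y}) :
    {multiplicative G -> H} := HB.pack k (isMultiplicative.Build G H k kM).

Lemma mult1 (G H : groupType) (f : {multiplicative G -> H}) : f 1 = 1.
Proof. by apply: (mulgI (f 1)); rewrite -gmulfM !mulg1. Qed.

Lemma multV (G H : groupType) (f : {multiplicative G -> H}) x : f x^-1 = (f x)^-1.
Proof. by apply: (mulgI (f x)); rewrite -gmulfM !mulgV mult1. Qed.

Lemma subgroup_ex (G : groupType) (P : G -> Prop) :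
  P 1 -> (forall x y, P x -> P y -> P (x * y)) -> (forall x, P x -> P x^-1) ->
  exists (H : groupType) (i : {multiplicative H -> G}),
    injective i /\ forall x, P x <-> exists y, i y = x.
Proof.
move=> P1 PM PV; pose T := {x : G | `[<P x>]}.
pose mk x (Px : P x) : T := exist _ x (asboolT Px).
have TP (x : T) : P (sval x) by exact/asboolP/(svalP x).
pose m (x y : T) := mk _ (PM _ _ (TP x) (TP y)).
have mA : associative m by move=> x y z; apply: val_inj; exact: mulgA.
have m1 : left_id (mk _ P1) m by move=> x; apply: val_inj; exact: mul1g.
have m2 : right_id (mk _ P1) m by move=> x; apply: val_inj; exact: mulg1.
have m3 : left_inverse (mk _ P1) (fun x => mk _ (PV _ (TP x))) m.
  by move=> x; apply: val_inj; exact: mulVg.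
have m4 : right_inverse (mk _ P1) (fun x => mk _ (PV _ (TP x))) m.
  by move=> x; apply: val_inj; exact: mulgV.
pose H : groupType := HB.pack T (isGroup.Build T mA m1 m2 m3 m4).
have iM : {morph (val : H -> G) : x y / x * y} by [].
exists H, (mk_mult iM); split; first exact: val_inj.
by move=> x; split=> [Px|[y <-]]; [exists (mk x Px) | exact: TP].
Qed.

Lemma Gp_algebraic : exists a : algebraic Gp, True.
Proof.
have lift (T P X Y : groupType) (p : {multiplicative P -> X}) (q : {multiplicative P -> Y})
    (k : T -> P) (a : {multiplicative T -> X}) (b : {multiplicative T -> Y}) :
    (forall z z', p z = p z' -> q z = q z' -> z = z') ->
    (forall t, p (k t) = a t) -> (forall t, q (k t) = b t) ->
    exists h : {multiplicative T -> P}, forall t, h t = k t.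
  move=> inj pk qk; unshelve eexists (mk_mult (k := k) _) => //.
  by move=> x y; apply: inj; rewrite gmulfM ?pk ?qk gmulfM.
unshelve eexists (@Algebraic Gp (fun G => G) (fun G H f => f)
  (fun G x y z => x * y^-1 * z) _ _ _ _ _ _ _ _ _ _ _) => //=.
- by move=> G H f g; exact: multiplicative_eq.
- move=> X I T e k h sur kP; unshelve eexists (mk_mult (k := k) _) => //.
  by move=> i j; have [x <-] := sur i; have [y <-] := sur j; rewrite -gmulfM !kP gmulfM.
- move=> X Y Z f g.
  have [||| H [i [inj iP]]] := @subgroup_ex (X * Y)%type (fun u => f u.1 = g u.2).
  + by rewrite /= !mult1.
  + by move=> u v /= fu fv; rewrite !gmulfM fu fv.
  + by move=> u /= fu; rewrite !multV fu.
  have pM : {morph (fun u => (i u).1) : x y / x * y} by move=> x y; rewrite gmulfM.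
  have qM : {morph (fun u => (i u).2) : x y / x * y} by move=> x y; rewrite gmulfM.
  exists H, (mk_mult pM), (mk_mult qM); split.
  + by apply: multiplicative_eq => u /=; apply/(iP (i u)); exists u.
  + by move=> z z' /= e1 e2; apply: inj; rewrite [LHS]surjective_pairing e1 e2 -surjective_pairing.
  + by move=> x y e; have [z zE] := (iP (x, y)).1 e; exists z; rewrite /= zE.
- move=> X T g.
  have [||| I [i [inj iP]]] := @subgroup_ex T (fun u => exists x, g x = u).
  + by exists 1; rewrite mult1.
  + by move=> _ _ [x <-] [y <-]; exists (x * y); rewrite gmulfM.
  + by move=> _ [x <-]; exists x^-1; rewrite multV.
  have ex x : exists y, i y = g x by apply/iP; exists x.
  pose k x := sval (cid (ex x)); have kP x : i (k x) = g x := svalP (cid (ex x)).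
  have [e eP] := lift _ _ _ _ i i k g g (fun z z' h _ => inj z z' h) kP kP.
  exists I, e, i; split=> //.
  + move=> y; have [x xE] := (iP (i y)).2 (ex_intro _ y erefl); exists x.
    by rewrite eP; apply: inj; rewrite kP.
  + by apply: multiplicative_eq => x /=; rewrite eP kP.
- by move=> X Y f x y z; rewrite !gmulfM multV.
- by move=> X x y; rewrite mulgVK.
- by move=> X x y; rewrite mulgV mul1g.
move=> X Y W f x y z p inj sur xy yz p1 p2 w.
have k (g h : {multiplicative W -> X}) t : (f \o g : {multiplicative W -> Y}) = f \o h ->
  f (g t) = f (h t) by move=> /(congr1 (fun s : {multiplicative W -> Y} => s t)).
have fxy := k _ _ w xy; have fyz := k _ _ w yz.
have [w1 [x1 y1 z1]] := sur _ _ _ erefl fyz.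
have [||w2 [x2 y2 z2]] := sur (x w * (y w)^-1) 1 1 => //.
  by rewrite gmulfM multV fxy mulgV mult1.
have -> : w = w2 * w1 by apply: inj; rewrite gmulfM ?x1 ?x2 ?y1 ?y2 ?z1 ?z2 ?mulgVK ?mul1g.
rewrite !gmulfM p1 ?p2 ?x1 ?x2 ?y1 ?y2 ?z1 ?z2 // ?mulgVK ?mul1g ?mulgA ?mulgV ?mulgVK ?mul1g //.
Qed.

End Groups.

Section Lie.
Import GRing.Theory.
Local Open Scope ring_scope.

Record lie_algebra (K : fieldType) := LieAlgebra {
  lie_mod :> lmodType K;
  bracket : lie_mod -> lie_mod -> lie_mod;
  bracket_linl : forall y, linear (bracket^~ y);
  bracket_linr : forall x, linear (bracket x);
  bracketxx : forall x, bracket x x = 0;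
  bracket_jacobi : forall x y z,
    bracket x (bracket y z) + bracket y (bracket z x) + bracket z (bracket x y) = 0 }.

Record lie_hom (K : fieldType) (L L' : lie_algebra K) := LieHom {
  lie_lin :> {linear L -> L'};
  lie_homM : forall x y, lie_lin (bracket x y) = bracket (lie_lin x) (lie_lin y) }.

Variable K : fieldType.
Implicit Types L : lie_algebra K.

Definition mk_lin (U V : lmodType K) (f : U -> V) (fL : linear f) : {linear U -> V} :=
  HB.pack f (GRing.isLinear.Build K U V *:%R f fL).

Lemma linear_eq (U V : lmodType K) (f g : {linear U -> V}) : f =1 g -> f = g.
Proof.
case: f g => [f [[fA] [fS]]] [g [[gA] [gS]]] /= /funext e; case: _ / e gA gS => gA gS.
by rewrite (Prop_irrelevance fA gA) (Prop_irrelevance fS gS).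
Qed.

Lemma lie_hom_eq L L' (f g : lie_hom L L') : f =1 g -> f = g.
Proof.
case: f g => [f fM] [g gM] /= /linear_eq e.
by case: _ / e gM => gM; congr LieHom; exact: Prop_irrelevance.
Qed.

Program Definition lie_id L : lie_hom L L := @LieHom K L L idfun _.
Next Obligation. by []. Qed.

Program Definition lie_cmp L L' L'' (g : lie_hom L' L'') (f : lie_hom L L') : lie_hom L L'' :=
  @LieHom K L L'' (g \o f) _.
Next Obligation. by move=> L L' L'' g f x y; rewrite /= !lie_homM. Qed.

Program Definition Lie : category :=
  @Category (lie_algebra K) (@lie_hom K) lie_id lie_cmp _ _ _.
Next Obligation. by move=> L L' f; exact: lie_hom_eq. Qed.
Next Obligation. by move=> L L' f; exact: lie_hom_eq. Qed.
Next Obligation. by move=> L1 L2 L3 L4 h g f; exact: lie_hom_eq. Qed.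

Lemma bracketDl L (x y z : L) : bracket (x + y) z = bracket x z + bracket y z.
Proof. by have := bracket_linl z 1 x y; rewrite !scale1r. Qed.

Lemma bracketDr L (x y z : L) : bracket z (x + y) = bracket z x + bracket z y.
Proof. by have := bracket_linr z 1 x y; rewrite !scale1r. Qed.

Lemma bracket0l L (x : L) : bracket 0 x = 0.
Proof. by apply: (addrI (bracket 0 x)); rewrite -bracketDl !addr0. Qed.

Lemma bracket0r L (x : L) : bracket x 0 = 0.
Proof. by apply: (addrI (bracket x 0)); rewrite -bracketDr !addr0. Qed.

Program Definition lie_prod L L' : lie_algebra K :=
  @LieAlgebra K (L * L')%type (fun u v => (bracket u.1 v.1, bracket u.2 v.2)) _ _ _ _.
Next Obligation. by move=> L L' [y y'] a [x x'] [z z']; congr pair; exact: bracket_linl. Qed.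
Next Obligation. by move=> L L' [y y'] a [x x'] [z z']; congr pair; exact: bracket_linr. Qed.
Next Obligation. by move=> L L' [x x']; rewrite /= !bracketxx. Qed.
Next Obligation. by move=> L L' [x x'] [y y'] [z z']; congr pair; exact: bracket_jacobi. Qed.

Lemma sublie_ex L (P : L -> Prop) :
  P 0 -> (forall a x y, P x -> P y -> P (a *: x + y)) ->
  (forall x y, P x -> P y -> P (bracket x y)) ->
  exists (H : lie_algebra K) (i : lie_hom H L),
    injective i /\ forall x, P x <-> exists y, i y = x.
Proof.
move=> P0 PL PB; pose T := {x : L | `[<P x>]}.
pose mk x (Px : P x) : T := exist _ x (asboolT Px).
have TP (x : T) : P (sval x) by exact/asboolP/(svalP x).
have PD x y : P x -> P y -> P (x + y) by move=> Px Py; rewrite -[x]scale1r; exact: PL.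
have PZ a x : P x -> P (a *: x) by move=> Px; rewrite -[_ *: _]addr0; exact: PL.
have PN x : P x -> P (- x) by rewrite -scaleN1r; exact: PZ.
pose ad (x y : T) := mk _ (PD _ _ (TP x) (TP y)).
pose op (x : T) := mk _ (PN _ (TP x)).
pose sc a (x : T) := mk _ (PZ a _ (TP x)).
have a1 : associative ad by move=> x y z; apply: val_inj; exact: addrA.
have a2 : commutative ad by move=> x y; apply: val_inj; exact: addrC.
have a3 : left_id (mk _ P0) ad by move=> x; apply: val_inj; exact: add0r.
have a4 : left_inverse (mk _ P0) op ad by move=> x; apply: val_inj; exact: addNr.
pose Z : zmodType := HB.pack T (GRing.isZmodule.Build T a1 a2 a3 a4).
have s1 a b (x : Z) : sc a (sc b x) = sc (a * b) x by apply: val_inj; exact: scalerA.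
have s2 : left_id 1 (sc : K -> Z -> Z) by move=> x; apply: val_inj; exact: scale1r.
have s3 : right_distributive (sc : K -> Z -> Z) +%R.
  by move=> a x y; apply: val_inj; exact: scalerDr.
have s4 (x : Z) : {morph (sc : K -> Z -> Z)^~ x : a b / a + b}.
  by move=> a b; apply: val_inj; exact: scalerDl.
pose V : lmodType K := HB.pack Z (GRing.Zmodule_isLmodule.Build K Z s1 s2 s3 s4).
pose br (x y : V) : V := mk _ (PB _ _ (TP x) (TP y)).
have b1 y : linear (br^~ y) by move=> a x z; apply: val_inj; exact: bracket_linl.
have b2 x : linear (br x) by move=> a y z; apply: val_inj; exact: bracket_linr.
have b3 x : br x x = 0 by apply: val_inj; exact: bracketxx.
have b4 x y z : br x (br y z) + br y (br z x) + br z (br x y) = 0.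
  by apply: val_inj; exact: bracket_jacobi.
pose H := LieAlgebra b1 b2 b3 b4.
have iL : linear (val : H -> L) by [].
have iM (x y : H) : mk_lin iL (bracket x y) = bracket (mk_lin iL x) (mk_lin iL y) by [].
exists H, (LieHom iM).
split; first exact: val_inj.
by move=> x; split=> [Px|[y <-]]; [exists (mk x Px) | exact: TP].
Qed.

Definition mk_lie L L' (k : L -> L') (kL : linear k)
    (kM : forall x y, k (bracket x y) = bracket (k x) (k y)) : lie_hom L L' :=
  @LieHom K L L' (mk_lin kL) kM.

Lemma Lie_algebraic : exists a : algebraic Lie, True.
Proof.
have lift L P X Y (p : lie_hom P X) (q : lie_hom P Y) (k : L -> P) (a : lie_hom L X)
    (b : lie_hom L Y) : (forall z z', p z = p z' -> q z = q z' -> z = z') ->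
    (forall t, p (k t) = a t) -> (forall t, q (k t) = b t) ->
    exists h : lie_hom L P, forall t, h t = k t.
  move=> inj pk qk; unshelve eexists (@mk_lie L P k _ _) => //.
  - by move=> c x y; apply: inj; rewrite linearP ?pk ?qk linearP.
  - by move=> x y; apply: inj; rewrite lie_homM ?pk ?qk lie_homM.
unshelve eexists (@Algebraic Lie (fun L => L) (fun L L' f => f)
  (fun L x y z => x - y + z) _ _ _ _ _ _ _ _ _ _ _) => //=.
- by move=> L L' f g; exact: lie_hom_eq.
- move=> X I T e k h sur kP; unshelve eexists (@mk_lie I T k _ _) => //.
  + by move=> c i j; have [x <-] := sur i; have [y <-] := sur j; rewrite -linearP !kP linearP.
  + by move=> i j; have [x <-] := sur i; have [y <-] := sur j; rewrite -lie_homM !kP lie_homM.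
- move=> X Y Z f g.
  have [||| H [i [inj iP]]] := @sublie_ex (lie_prod X Y) (fun u => f u.1 = g u.2).
  + by rewrite /= !linear0.
  + by move=> c u v /= fu fv; rewrite !linearP fu fv.
  + by move=> u v /= fu fv; rewrite !lie_homM fu fv.
  have pL : linear (fun u => (i u).1) by move=> a x y; rewrite linearP.
  have qL : linear (fun u => (i u).2) by move=> a x y; rewrite linearP.
  have pM x y : (i (bracket x y)).1 = bracket (i x).1 (i y).1 by rewrite lie_homM.
  have qM x y : (i (bracket x y)).2 = bracket (i x).2 (i y).2 by rewrite lie_homM.
  exists H, (@mk_lie H X _ pL pM), (@mk_lie H Y _ qL qM); split.
  + by apply: lie_hom_eq => u /=; apply/(iP (i u)); exists u.
  + by move=> z z' /= e1 e2; apply: inj; rewrite [LHS]surjective_pairing e1 e2 -surjective_pairing.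
  + by move=> x y e; have [z zE] := (iP (x, y)).1 e; exists z; rewrite /= zE.
- move=> X T g.
  have [||| I [i [inj iP]]] := @sublie_ex T (fun u => exists x, g x = u).
  + by exists 0; rewrite linear0.
  + by move=> c _ _ [x <-] [y <-]; exists (c *: x + y); rewrite linearP.
  + by move=> _ _ [x <-] [y <-]; exists (bracket x y); rewrite lie_homM.
  have ex x : exists y, i y = g x by apply/iP; exists x.
  pose k x := sval (cid (ex x)); have kP x : i (k x) = g x := svalP (cid (ex x)).
  have [e eP] := lift _ _ _ _ i i k g g (fun z z' h _ => inj z z' h) kP kP.
  exists I, e, i; split=> //.
  + move=> y; have [x xE] := (iP (i y)).2 (ex_intro _ y erefl); exists x.
    by rewrite eP; apply: inj; rewrite kP.
  + by apply: lie_hom_eq => x /=; rewrite eP kP.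
- by move=> X Y f x y z; rewrite linearD linearB.
- by move=> X x y; rewrite subrK.
- by move=> X x y; rewrite subrr add0r.
move=> X Y W f x y z p inj sur xy yz p1 p2 w.
have k (g h : lie_hom W X) t : lie_cmp f g = lie_cmp f h -> f (g t) = f (h t).
  by move=> /(congr1 (fun s : lie_hom W Y => s t)).
have fxy := k _ _ w xy; have fyz := k _ _ w yz.
have [w1 [x1 y1 z1]] := sur _ _ _ erefl fyz.
have [||w2 [x2 y2 z2]] := sur (x w - y w) 0 0 => //.
  by rewrite linearB fxy subrr linear0.
have e : w = w2 + w1.
  by apply: inj; rewrite linearD ?x1 ?x2 ?y1 ?y2 ?z1 ?z2 ?subrK ?add0r.
by rewrite {1}e linearD p1 ?p2 ?x1 ?x2 ?y1 ?y2 ?z1 ?z2.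
Qed.

End Lie.

Inductive base_theory := Groups | LieAlgebras (K : fieldType).

Definition base_cat (b : base_theory) : category :=
  match b with Groups => Gp | LieAlgebras K => Lie K end.

Lemma base_comm_closed (b : base_theory) (Y : base_cat b) : comm_closed (slice Y).
Proof.
case: b Y => [|K] Y.
- by have [a _] := Gp_algebraic; exact: slice_comm_closed a Y.
- by have [a _] := Lie_algebraic K; exact: slice_comm_closed a Y.
Qed.

Section Main.
Variables (D : base_theory) (Y : base_cat D) (A : abgroup (slice Y)).

Definition abM : abgroup (comm_cat (slice Y)) := comm_abgroup (base_comm_closed Y) A.

(** [j^n_A : H^n_{M(D/Y)}(A) -> H^n_{D/Y}(A)] *)
Definition jmap (n : nat) : coh abM n -> coh A n := @coh_incl _ (base_comm_closed Y) A n.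

End Main.

(* Main.v *)
Set Warnings "-notation-overridden,-ambiguous-paths".
From HB Require Import structures.
From mathcomp Require Import all_boot all_algebra.
From mathcomp Require Import boolp functions.
From Stdlib Require Import Relation_Operators.
Require Import Defs.
From mathcomp Require Import ssreflect ssrfun.
Set Implicit Arguments.
Unset Strict Implicit.
Unset Printing Implicit Defensive.

(** The inclusion of commutative objects induces isomorphisms because, after a change of
    objects, every cocycle becomes one whose levelwise abelianization is again a cocycle.

    Groups and Lie algebras, and their slices, have elements and a term [tm x y z], namely
    [x * y^-1 * z] or [x - y + z], which all maps preserve ([conc]).  An object is
    commutative when [tm] turns maps into maps ([comm_tmc]), and the composite of two arrows
    of an internal groupoid can only be [tm a (i (t a)) b] ([grd_mulE]).  Hence an n-groupoid
    is a globular diagram subject to conditions on elements ([compat_under], [ext_grd]), and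
    a functor is a family of maps of cells ([hom_full]).  A cocycle is an aspherical
    n-groupoid with a label in [A] for each pair of parallel n-cells, such that the label and
    one of the cells determine the other ([toL], [ofL]).  Labels without this last property
    ([lab]) have the same connected components, since each of them maps to a universal
    directed one ([phi_lab]); they are stable under products and change of objects, which
    gives the group structure ([component_group]) and allows the following argument.

    The quotients of the objects of cells of an n-groupoid [W] that are universal among maps
    to commutative objects form an n-groupoid, and a label of [W] descends to it as soon as
    parallel cells are separated by maps to commutative objects ([lab_refl]).  In dimensions
    at least two they always are, by an Eckmann-Hilton argument ([top_sep]); in dimension
    zero it follows from being directed ([dir_tmc]).  In dimension one, [W] is first
    replaced by its inverse image along a suitable cover of its objects ([covers]).
    Abelianizing such covers gives an inverse of the comparison map ([approx_connected],
    [component_incl_surj]), whence [comm_cohomology].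

    It remains to find the covers.  Let [X1] be the arrows and [X0] the objects of an
    internal groupoid over [Y].  One needs a surjection [F -> X0] such that, for all maps [u]
    from [P] to [X1] and [a], [b] from [P] to [F] over the ends of [u], every [z] in the
    derived algebra of [ker (P -> Y)] with [a z] and [b z] trivial has [u z] trivial.  For
    groups, a wreath product provides a cover for which [ker (F -> Y)] lifts to arrows from
    the unit ([wreath_cover]); corrected by these lifts, [u] becomes a homomorphism to an
    abelian group, which kills [z].  For Lie algebras, [F] is free on the underlying set of
    [X0].  The arrows from [0], pulled back to [ker (F -> Y)], form a central extension whose
    kernel meets the derived algebra trivially ([free_central]).  This is the vanishing of
    the Schur multiplier of an ideal of a free Lie algebra.  It is obtained by filtering
    [ker (F -> Y)] by degree, which reduces it to the kernel of a map to an abelian algebra,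
    and there by splitting off one dimension at a time with a Lie algebra of sequences
    ([splits_codim1]). *)

(** * Categories of algebras, elementwise *)

(** Maps are determined by elements, [mal] is a heap operation natural in all maps, and
    pullbacks, images, quotients by internal equivalence relations and factorizations
    through surjections are those of the underlying sets. *)
Record conc (E : category) := Conc {
  el : E -> Type;
  ap : forall X Y : E, hom X Y -> el X -> el Y;
  mal : forall X : E, el X -> el X -> el X -> el X;
  ap1 : forall (X : E) x, ap (idm X) x = x;
  apM : forall (X Y Z : E) (g : hom Y Z) (f : hom X Y) x, ap (g ∘ f) x = ap g (ap f x);
  ap_inj : forall (X Y : E) (f g : hom X Y), (forall x, ap f x = ap g x) -> f = g;
  tm_nat : forall (X Y : E) (f : hom X Y) x y z,
    ap f (mal x y z) = mal (ap f x) (ap f y) (ap f z);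
  tmr : forall (X : E) (x y : el X), mal x y y = x;
  tml : forall (X : E) (x y : el X), mal x x y = y;
  tmA : forall (X : E) (x y z u v : el X), mal (mal x y z) u v = mal x y (mal z u v);
  pb_el : forall (X Y Z : E) (f : hom X Z) (g : hom Y Z),
    exists P (p : hom P X) (q : hom P Y),
      [/\ is_pullback f g p q,
          forall z z', ap p z = ap p z' -> ap q z = ap q z' -> z = z'
        & forall x y, ap f x = ap g y -> exists z, ap p z = x /\ ap q z = y];
  im_el : forall (X T : E) (g : hom X T), exists I (e : hom X I) (m : hom I T),
    [/\ forall i, exists x, ap e x = i, injective (ap m) & m ∘ e = g];
  desc_el : forall (X I T : E) (e : hom X I) (h : hom X T),
    (forall i, exists x, ap e x = i) ->
    (forall x x', ap e x = ap e x' -> ap h x = ap h x') -> exists u : hom I T, u ∘ e = h;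
  quo_el : forall (X R : E) (a b : hom R X) (rel := fun x y => exists r, ap a r = x /\ ap b r = y),
    (forall x, rel x x) -> (forall x y, rel x y -> rel y x) ->
    (forall x y z, rel x y -> rel y z -> rel x z) ->
    exists Q (q : hom X Q),
      (forall i, exists x, ap q x = i) /\ forall x x', ap q x = ap q x' <-> rel x x' }.

Section Conc.
Variables (E : category) (cE : conc E).
Local Notation el := (@el E cE).
Local Notation "f @ x" := (@ap E cE _ _ f x) (at level 20).
Local Notation tm := (@mal E cE _).

Lemma hap (X Y : E) (f g : hom X Y) x : f = g -> f @ x = g @ x.
Proof. by move=> ->. Qed.

Definition surj (X Y : E) (e : hom X Y) := forall i : el Y, exists x, e @ x = i.

Definition is_hom (X Y : E) (k : el X -> el Y) := exists h : hom X Y, forall x, h @ x = k x.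

Definition jinj (X Y P : E) (p : hom P X) (q : hom P Y) :=
  forall z z', p @ z = p @ z' -> q @ z = q @ z' -> z = z'.

Lemma ap_is_hom (X Y : E) (f : hom X Y) : is_hom (fun x => f @ x).
Proof. by exists f. Qed.

Lemma id_is_hom (X : E) : is_hom (fun x : el X => x).
Proof. by exists (idm X) => x; rewrite ap1. Qed.

Lemma hom_comp (W X Y : E) (f : hom X Y) (k : el W -> el X) :
  is_hom k -> is_hom (fun w => f @ k w).
Proof. by move=> [h hk]; exists (f ∘ h) => w; rewrite apM hk. Qed.

Lemma is_hom_ext (X Y : E) (k k' : el X -> el Y) : k =1 k' -> is_hom k -> is_hom k'.
Proof. by move=> e [h hk]; exists h => x; rewrite hk. Qed.

Lemma hom_pre (W X Y : E) (f : hom W X) (k : el X -> el Y) :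
  is_hom k -> is_hom (fun w => k (f @ w)).
Proof. by move=> [h hk]; exists (h ∘ f) => w; rewrite apM hk. Qed.

(** Being a map is local on the domain: it can be tested after a surjection. *)
Lemma desc_hom (W' W Y : E) (c : hom W' W) (k : el W -> el Y) :
  surj c -> is_hom (fun w => k (c @ w)) -> is_hom k.
Proof.
move=> sc [h hk]; have [|u ue] := desc_el (c := cE) (h := h) sc.
  by move=> x x' e; rewrite !hk e.
by exists u => w; have [x <-] := sc w; rewrite -apM ue hk.
Qed.

Lemma bij_inv (X Y : E) (f : hom X Y) : injective (@ap E cE _ _ f) -> surj f ->
  exists g : hom Y X, f ∘ g = idm Y /\ g ∘ f = idm X.
Proof.
move=> inj sur; have [|g gf] := desc_el (c := cE) (h := idm X) sur.
  by move=> x x' /inj ->.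
exists g; split=> //; apply: (@ap_inj E cE) => y; have [x <-] := sur y.
by rewrite apM -[g @ _]apM gf !ap1.
Qed.

Lemma surj_comp (X Y Z : E) (f : hom X Y) (g : hom Y Z) : surj f -> surj g -> surj (g ∘ f).
Proof. by move=> sf sg z; have [y <-] := sg z; have [x <-] := sf y; exists x; rewrite apM. Qed.

Lemma inj_mono (X Y : E) (m : hom X Y) : injective (@ap E cE _ _ m) -> mono m.
Proof. by move=> inj T u v e; apply: (@ap_inj E cE) => t; apply: inj; rewrite -!apM e. Qed.

Lemma pb_el2 (X Y Z P : E) (f : hom X Z) (g : hom Y Z) (p : hom P X) (q : hom P Y) :
  is_pullback f g p q ->
  jinj p q /\ forall x y, f @ x = g @ y -> exists z, p @ z = x /\ q @ z = y.
Proof.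
move=> pb; have [Q [r [s [pbQ inj sur]]]] := pb_el cE f g.
have [i [j [ij ji rp sq]]] := pb_uniq pbQ pb; split.
  move=> z z'; rewrite -rp -sq !apM => e0 e1.
  by rewrite -(ap1 z) -(ap1 z') -ji !apM (inj _ _ e0 e1).
move=> x y /sur [z [<- <-]]; exists (j @ z).
by rewrite -rp -sq !apM -(apM i) ij ap1.
Qed.

Lemma pb_hom (X Y Z P W : E) (f : hom X Z) (g : hom Y Z) (p : hom P X) (q : hom P Y)
    (a : el W -> el X) (b : el W -> el Y) :
  is_pullback f g p q -> is_hom a -> is_hom b -> (forall w, f @ a w = g @ b w) ->
  exists u : hom W P, forall w, p @ (u @ w) = a w /\ q @ (u @ w) = b w.
Proof.
move=> pb [h ha] [k kb] e; have [|u [ua ub]] := pb_lift pb (a := h) (b := k).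
  by apply: (@ap_inj E cE) => w; rewrite !apM ha kb.
by exists u => w; rewrite -!apM ua ub ha kb.
Qed.

(** A pullback object of surjections covers: used to replace elements by lifts. *)
Lemma pb_surj (X Y Z P : E) (f : hom X Z) (g : hom Y Z) (p : hom P X) (q : hom P Y) :
  is_pullback f g p q -> surj g -> surj p.
Proof.
by move=> /pb_el2 [_ sur] sg x; have [y /esym /sur [z [zx _]]] := sg (f @ x); exists z.
Qed.

Lemma cover_lift (W X Y : E) (e : hom X Y) (k : el W -> el Y) : surj e -> is_hom k ->
  exists W' (c : hom W' W) (u : hom W' X), surj c /\ forall w, e @ (u @ w) = k (c @ w).
Proof.
move=> se [h hk]; have [P [p [q pb]]] := pb_el cE h e; case: pb => pb _ _.
exists P, p, q; split; first exact: pb_surj pb se.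
by move=> w; rewrite -apM -pb.1 apM hk.
Qed.

(** The pullback of [m] along the composite map projects bijectively to [W], and bijective
    maps are invertible. *)
Lemma lift_inj (W X Y : E) (m : hom X Y) (k : el W -> el X) : injective (@ap E cE _ _ m) ->
  is_hom (fun w => m @ k w) -> is_hom k.
Proof.
move=> inj [h hk]; have [P [p [q [pb pinj psur]]]] := pb_el cE h m.
have [|w|g [pg gp]] := bij_inv (f := p).
- move=> z z' e; apply: pinj => //; apply: inj.
  by rewrite -!apM -pb.1 !apM e.
- by have [z [zw _]] := psur w (k w) (hk w); exists z.
- exists (q ∘ g) => w; apply: inj; rewrite -hk -apM cmpA -pb.1 -cmpA pg cmpm1 //.
Qed.

Lemma surj_regular (X I : E) (e : hom X I) : surj e -> regular_epi e.
Proof.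
move=> sur; have [R [a [b [pb _ ex]]]] := pb_el cE e e; exists R, a, b; split; first exact: pb.1.
move=> T g gab; have [|u ue] := desc_el (c := cE) (h := g) sur.
  by move=> x x' /ex [z [<- <-]]; rewrite -!apM gab.
exists u; split=> // v ve; apply: (@ap_inj E cE) => i; have [x <-] := sur i.
by rewrite -!apM ue ve.
Qed.

Lemma regular_surj (X I : E) (q : hom X I) : regular_epi q -> surj q.
Proof.
move=> [R [a [b [ab co]]]]; have [J [e [m [se mi me]]]] := im_el cE q.
have [|u [uq _]] := co J e.
  by apply: (inj_mono mi); rewrite !cmpA me.
have mu : m ∘ u = idm I.
  have [w [_ wu]] := co I q ab.
  have <- := wu _ (cmp1m q); apply: esym; apply: wu.
  by rewrite -cmpA uq.
by move=> i; have [x xe] := se (u @ i); exists x; rewrite -me apM xe -apM mu ap1.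
Qed.

(** Reflexive internal relations are equivalence relations, thanks to the term. *)
Lemma quo_refl (X R : E) (a b : hom R X) :
  (forall x, exists r, a @ r = x /\ b @ r = x) ->
  exists Q (q : hom X Q), surj q /\
    forall x x', q @ x = q @ x' <-> exists r, a @ r = x /\ b @ r = x'.
Proof.
move=> rr; apply: quo_el => // [x y [r [<- <-]]|x y z [r [<- rb]] [s [sa <-]]].
- have [u [ua ub]] := rr (a @ r); have [v [va vb]] := rr (b @ r).
  by exists (tm u r v); rewrite !tm_nat ua ub va vb tml tmr.
- have [u [ua ub]] := rr y; exists (tm r u s).
  by rewrite !tm_nat ua ub sa rb tml tmr.
Qed.

Lemma coeq_el (X R Q : E) (a b : hom R X) (q : hom X Q) : surj q ->
  (forall x x', q @ x = q @ x' <-> exists r, a @ r = x /\ b @ r = x') ->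
  is_coequalizer a b q.
Proof.
move=> sq H; split.
  by apply: (@ap_inj E cE) => r; rewrite !apM; apply/H; exists r.
move=> T g gab; have [|u ue] := desc_el (c := cE) (h := g) sq.
  by move=> x x' /H [r [<- <-]]; rewrite -!apM gab.
exists u; split=> // v ve; apply: (@ap_inj E cE) => i; have [x <-] := sq i.
by rewrite -!apM ue ve.
Qed.

(** The kernel relation of a coequalizer of a reflexive pair. *)
Lemma coeq_kernel (X R Q : E) (a b : hom R X) (q : hom X Q) :
  is_coequalizer a b q -> (forall x, exists r, a @ r = x /\ b @ r = x) ->
  forall x x', q @ x = q @ x' -> exists r, a @ r = x /\ b @ r = x'.
Proof.
move=> [e co] /quo_refl [P [p [sp pP]]] x x' xx'; apply/pP.
have [|u [uq _]] := co P p.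
  by apply: (@ap_inj E cE) => r; rewrite !apM; apply/pP; exists r.
by rewrite -uq !apM xx'.
Qed.

Definition invh (X Q : E) (s t : hom Q X) (i : hom X Q) (a : el Q) :=
  tm (i @ (t @ a)) a (i @ (s @ a)).

(** In a Mal'cev category the composition of an internal groupoid with object
    of objects [X] is [(a, b) |-> tm a (i (t a)) b]. *)
Definition comph (X Q : E) (s t : hom Q X) (i : hom X Q) :=
  forall W (a b : el W -> el Q), is_hom a -> is_hom b -> (forall w, t @ a w = s @ b w) ->
    is_hom (fun w => tm (a w) (i @ (t @ a w)) (b w)).

(** The inverse of [a] from [x] to [y] is [tm (i y) a (i x)]: it is read off the fibre
    product of composable arrows, on which the composition is a map. *)
Lemma comph_inv (X Q : E) (s t : hom Q X) (i : hom X Q) :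
  (forall x, s @ (i @ x) = x) -> (forall x, t @ (i @ x) = x) ->
  comph s t i -> is_hom (invh s t i).
Proof.
move=> si ti cm; have [P [p [q [pb pinj psur]]]] := pb_el cE t s.
have pq z : t @ (p @ z) = s @ (q @ z) by rewrite -!apM pb.1.
have [m mE] := cm P _ _ (ap_is_hom p) (ap_is_hom q) pq.
have [R [a [b [pb' rinj rsur]]]] := pb_el cE s s.
have sm z : s @ (p @ z) = s @ (m @ z) by rewrite mE !tm_nat si -pq tmr.
have [u uE] := pb_hom pb' (ap_is_hom p) (ap_is_hom m) sm.
have [|z|v [uv vu]] := bij_inv (f := u).
- move=> z z' e; have ep : p @ z = p @ z' by rewrite -(uE z).1 -(uE z').1 e.
  apply: pinj => //; have := (uE z).2; rewrite e (uE z').2 !mE ep.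
  move=> /(congr1 (fun x => tm (i @ (t @ (p @ z'))) (p @ z') x)).
  by rewrite -!tmA !tmr !tml.
- have ab : s @ (a @ z) = s @ (b @ z) by rewrite -!apM pb'.1.
  pose y := tm (i @ (t @ (a @ z))) (a @ z) (b @ z).
  have [|w [wp wq]] := psur (a @ z) y; first by rewrite !tm_nat si ab tmr.
  exists w; apply: rinj; first by rewrite (uE w).1.
  by rewrite (uE w).2 mE wp wq /y -tmA tmr tml.
have [|k kE] := pb_hom pb' (id_is_hom Q) (ap_is_hom (i ∘ s)).
  by move=> w; rewrite apM si.
exists (q ∘ v ∘ k) => x; rewrite !apM.
set w := v @ (k @ x); have uw : u @ w = k @ x by rewrite -apM uv ap1.
have wp : p @ w = x by rewrite -(uE w).1 uw (kE x).1.
have := (uE w).2; rewrite uw (kE x).2 mE wp apM /invh => ->.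
by rewrite -tmA tmr tml.
Qed.

End Conc.
Arguments surj {E} cE {X Y} e.
Arguments is_hom {E} cE {X Y} k.
Arguments jinj {E} cE {X Y P} p q.
Arguments comph {E} cE {X Q} s t i.
Arguments invh {E} cE {X Q} s t i a.

Section Terminal.
Variables (E : category) (cE : conc E) (one : E) (oneP : is_terminal one).
Local Notation el := (@el E cE).
Local Notation "f @ x" := (@ap E cE _ _ f x) (at level 20).
Local Notation tm := (@mal E cE _).

Definition to_one (X : E) : hom X one := sval (cid (oneP X)).

Lemma bangE (X : E) (f : hom X one) : f = to_one X.
Proof. exact: term_eq oneP. Qed.

Lemma bang_ap (X Y : E) (f : hom X Y) x : to_one Y @ (f @ x) = to_one X @ x.
Proof. by rewrite -apM -(bangE (to_one Y ∘ f)). Qed.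

Lemma one_ap (f : hom one one) x : f @ x = x.
Proof. by rewrite -{2}(ap1 x) (term_eq f (idm one) oneP). Qed.

Lemma hom_bang (W X Y : E) (a : el W -> el X) (b : el W -> el Y) w :
  is_hom cE a -> is_hom cE b -> to_one X @ a w = to_one Y @ b w.
Proof. by move=> [h <-] [k <-]; rewrite !bang_ap. Qed.

Lemma hom_bang1 (W X : E) (a : el W -> el X) w : is_hom cE a -> to_one X @ a w = to_one W @ w.
Proof. by move=> [h <-]; rewrite bang_ap. Qed.

Lemma prod_ex_el (X Y : E) : exists P (p : hom P X) (q : hom P Y), is_product p q.
Proof.
have [P [p [q [pb _ _]]]] := pb_el cE (to_one X) (to_one Y).
by exists P, p, q; apply/(pb_prod (to_one X) (to_one Y) p q oneP).
Qed.

Lemma prod_el (X Y P : E) (p : hom P X) (q : hom P Y) : is_product p q ->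
  jinj cE p q /\ forall x y, to_one X @ x = to_one Y @ y -> exists z, p @ z = x /\ q @ z = y.
Proof. by move=> /(pb_prod (to_one X) (to_one Y) p q oneP) /(pb_el2 cE). Qed.

Lemma prod_hom (X Y P W : E) (p : hom P X) (q : hom P Y) (a : el W -> el X) (b : el W -> el Y) :
  is_product p q -> is_hom cE a -> is_hom cE b ->
  exists u : hom W P, forall w, p @ (u @ w) = a w /\ q @ (u @ w) = b w.
Proof.
move=> /(pb_prod (to_one X) (to_one Y) p q oneP) pb ha hb; apply: (pb_hom pb ha hb) => w.
exact: hom_bang.
Qed.

Lemma prod_elI (X Y P : E) (p : hom P X) (q : hom P Y) : jinj cE p q ->
  (forall x y, to_one X @ x = to_one Y @ y -> exists z, p @ z = x /\ q @ z = y) -> is_product p q.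
Proof.
move=> inj sur; have [Q [r [s rs]]] := prod_ex_el X Y; have [rinj rsur] := prod_el rs.
have [u uE] := prod_hom rs (ap_is_hom cE p) (ap_is_hom cE q).
have [|z|v [uv vu]] := bij_inv (cE := cE) (f := u).
- by move=> z z' e; apply: inj; rewrite -?(uE _).1 -?(uE _).2 e.
- have [|x [xp xq]] := sur (r @ z) (s @ z); first by rewrite !bang_ap.
  by exists x; apply: rinj; rewrite ?(uE _).1 ?(uE _).2.
have e0 : p = r ∘ u by apply: (@ap_inj E cE) => x; rewrite apM (uE x).1.
have e1 : q = s ∘ u by apply: (@ap_inj E cE) => x; rewrite apM (uE x).2.
move: rs => /(pb_prod (to_one X) (to_one Y) r s oneP) pb.
by rewrite e0 e1; apply/(pb_prod (to_one X) (to_one Y) _ _ oneP); apply: pb_iso pb uv vu.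
Qed.

Lemma equalizer_ex (X Z : E) (f g : hom X Z) :
  exists R (m : hom R X), injective (@ap E cE _ _ m) /\
    forall x, (exists r, m @ r = x) <-> f @ x = g @ x.
Proof.
have [P [p [q pq]]] := prod_ex_el Z Z; have [inj sur] := prod_el pq.
have [u uE] := prod_hom pq (ap_is_hom cE f) (ap_is_hom cE g).
have [d dE] := prod_hom pq (id_is_hom cE Z) (id_is_hom cE Z).
have [R [m [k [pb rinj rsur]]]] := pb_el cE u d; exists R, m.
have kE r : k @ r = f @ (m @ r) /\ k @ r = g @ (m @ r).
  have e : u @ (m @ r) = d @ (k @ r) by rewrite -!apM pb.1.
  by rewrite -(uE _).1 -(uE _).2 e (dE _).1 (dE _).2.
split; first by move=> r r' e; apply: rinj => //; rewrite !(kE _).1 e.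
move=> x; split=> [[r <-]|e]; first by rewrite -(kE r).1 (kE r).2.
have [|r [rx _]] := rsur x (f @ x); last by exists r.
by apply: inj; rewrite ?(uE x).1 ?(uE x).2 ?(dE _).1 ?(dE _).2.
Qed.

Definition tmc (X : E) := forall W (x y z : el W -> el X),
  is_hom cE x -> is_hom cE y -> is_hom cE z -> is_hom cE (fun w => tm (x w) (y w) (z w)).

Lemma prod3_el (X P : E) (x y z : hom P X) : is_product3 x y z ->
  (forall w w', x @ w = x @ w' -> y @ w = y @ w' -> z @ w = z @ w' -> w = w') /\
  (forall a b c, to_one X @ a = to_one X @ b -> to_one X @ b = to_one X @ c ->
     exists w, [/\ x @ w = a, y @ w = b & z @ w = c]).
Proof.
move=> pr; have [Q [q0 [q1 qP]]] := prod_ex_el X X; have [R [r0 [r1 rP]]] := prod_ex_el X Q.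
have [qi qs] := prod_el qP; have [ri rs] := prod_el rP.
have [u [[u0 u1 u2] _]] := pr R r0 (q0 ∘ r1) (q1 ∘ r1).
have [v [v0 v1]] := prod_lift qP y z; have [w [w0 w1]] := prod_lift rP x v.
have wu : u ∘ w = idm P.
  have [t [_ tu]] := pr P x y z; rewrite -(tu (idm P)) ?cmpm1 //.
  apply: esym; apply: tu; rewrite !cmpA u0 u1 u2 -!cmpA w0 w1; split=> //.
split=> [t t' e0 e1 e2|a b c ab bc].
  rewrite -(ap1 t) -(ap1 t') -wu !apM; congr (_ @ _).
  apply: ri; rewrite -!apM ?w0 // w1; apply: qi; rewrite -!apM ?v0 ?v1 //.
have [s [s0 s1]] := qs b c bc.
have [|t [t0 t1]] := rs a s; first by rewrite ab -s0 bang_ap.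
by exists (u @ t); rewrite -!apM u0 u1 u2 !apM t0 t1 s0 s1.
Qed.

Lemma prod3_ex_el (X : E) : exists P (x y z : hom P X), is_product3 x y z.
Proof.
have [Q [q0 [q1 qP]]] := prod_ex_el X X; have [R [r0 [r1 rP]]] := prod_ex_el X Q.
exists R, r0, (q0 ∘ r1), (q1 ∘ r1) => T a b c.
have [u [u0 u1]] := prod_lift qP b c; have [v [v0 v1]] := prod_lift rP a u.
exists v; split; first by rewrite -!cmpA v1 u0 u1.
move=> w [w0 w1 w2]; apply: (prod_eq rP); rewrite ?v0 ?w0 //.
by apply: (prod_eq qP); rewrite v1 ?u0 ?u1 cmpA.
Qed.

(** A Mal'cev operation is a homomorphism, so it commutes with the term; this forces
    it to be the term. *)
Lemma maltsev_tm (X P : E) (x y z p : hom P X) w : is_product3 x y z -> maltsev_op x y z p ->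
  p @ w = tm (x @ w) (y @ w) (z @ w).
Proof.
move=> pr [h1 h2].
have [u1 [[a1 b1 c1] _]] := pr P x y y; have [u2 [[a2 b2 c2] _]] := pr P y y y.
have [u3 [[a3 b3 c3] _]] := pr P y y z.
have e : w = tm (u1 @ w) (u2 @ w) (u3 @ w).
  by apply: (prod3_el pr).1; rewrite !tm_nat -!apM ?a1 ?a2 ?a3 ?b1 ?b2 ?b3 ?c1 ?c2 ?c3 ?tmr ?tml.
rewrite {1}e tm_nat -!apM (h1 _ u1) ?b1 ?c1 // (h1 _ u2) ?b2 ?c2 // (h2 _ u3) ?a3 ?b3 //.
by rewrite a1 a2 c3.
Qed.

(** By uniqueness the internal Mal'cev operation is [tm]. *)
Lemma comm_tmc (X : E) : commutative_ob X <-> tmc X.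
Proof.
split=> [[P [x [y [z [p [pr mp]]]]]] W a b c [a' aE] [b' bE] [c' cE']|cX].
  have [u [[u0 u1 u2] _]] := pr W a' b' c'; exists (p ∘ u) => w.
  by rewrite apM (maltsev_tm _ pr mp) -!apM u0 u1 u2 aE bE cE'.
have [P [x [y [z pr]]]] := prod3_ex_el X.
have [p pE] := cX P _ _ _ (ap_is_hom cE x) (ap_is_hom cE y) (ap_is_hom cE z).
exists P, x, y, z, p; split=> //; split=> T u /(hap (cE := cE)) e;
  apply: (@ap_inj E cE) => t; have := e t; rewrite !apM pE => ->.
- by rewrite tmr.
- by rewrite tml.
Qed.

Lemma tmc_inj (X T : E) (m : hom X T) : injective (@ap E cE _ _ m) -> tmc T -> tmc X.
Proof.
move=> inj cT W x y z hx hy hz; apply: (lift_inj inj).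
apply: is_hom_ext (cT _ _ _ _ (hom_comp m hx) (hom_comp m hy) (hom_comp m hz)) => w.
by rewrite tm_nat.
Qed.

Lemma cover3 (W X Y : E) (e : hom X Y) (x y z : el W -> el Y) : surj cE e ->
  is_hom cE x -> is_hom cE y -> is_hom cE z ->
  exists W' (c : hom W' W) (u v t : hom W' X), surj cE c /\
    forall w, [/\ e @ (u @ w) = x (c @ w), e @ (v @ w) = y (c @ w) & e @ (t @ w) = z (c @ w)].
Proof.
move=> se hx hy hz; have [W1 [c1 [u [s1 uE]]]] := cover_lift se hx.
have [W2 [c2 [v [s2 vE]]]] := cover_lift se (hom_pre c1 hy).
have [W3 [c3 [t [s3 tE]]]] := cover_lift se (hom_pre c2 (hom_pre c1 hz)).
exists W3, (c1 ∘ c2 ∘ c3), (u ∘ c2 ∘ c3), (v ∘ c3), t; split.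
  by apply: surj_comp s3 _; apply: surj_comp s2 s1.
by move=> w; rewrite !apM uE vE tE.
Qed.

Lemma tmc_surj (X Q : E) (q : hom X Q) : surj cE q -> tmc X -> tmc Q.
Proof.
move=> sq cX W x y z hx hy hz.
have [W' [c [u [v [t [sc uvt]]]]]] := cover3 sq hx hy hz.
apply: (desc_hom sc).
have := hom_comp q (cX _ _ _ _ (ap_is_hom cE u) (ap_is_hom cE v) (ap_is_hom cE t)).
by apply: is_hom_ext => w; rewrite tm_nat; have [-> -> ->] := uvt w.
Qed.

Lemma tmc_pb (X Y P : E) (p : hom P X) (q : hom P Y) Z (f : hom X Z) (g : hom Y Z) :
  is_pullback f g p q -> tmc X -> tmc Y -> tmc P.
Proof.
move=> pb cX cY W x y z hx hy hz.
have [|u uE] := pb_hom pb (cX _ _ _ _ (hom_comp p hx) (hom_comp p hy) (hom_comp p hz))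
  (cY _ _ _ _ (hom_comp q hx) (hom_comp q hy) (hom_comp q hz)).
  by move=> w; rewrite !tm_nat -!apM pb.1.
exists u => w; apply: (pb_el2 cE pb).1; rewrite ?(uE w).1 ?(uE w).2 tm_nat //.
Qed.

Lemma tmc_comph (X Q : E) (s t : hom Q X) (i : hom X Q) : tmc Q -> comph cE s t i.
Proof. by move=> cQ W a b ha hb _; apply: cQ => //; do 2 apply: hom_comp. Qed.

End Terminal.
Arguments tmc {E} cE X.

Section CommCat.
Variables (E : category) (cE : conc E) (one : E) (oneP : is_terminal one).
Local Notation M := (comm_cat E).

Local Lemma M_tmc (X : M) : tmc cE (sval X).
Proof. by apply/(comm_tmc cE oneP); exact: (svalP X). Qed.

(** Commutative objects are closed under pullbacks, subobjects and quotients, by [tmc_pb],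
    [tmc_inj] and [tmc_surj]. *)
Definition conc_comm : conc M.
Proof.
unshelve refine (@Conc M (fun X => el cE (sval X)) (fun X Y f => @ap E cE (sval X) (sval Y) f)
  (fun X => @mal E cE (sval X))
  _ _ _ _ _ _ _ _ _ _ _).
- by move=> X x; exact: ap1.
- by move=> X Y Z g f x; exact: apM.
- by move=> X Y f g; exact: ap_inj.
- by move=> X Y f; exact: tm_nat.
- by move=> X; exact: tmr.
- by move=> X; exact: tml.
- by move=> X; exact: tmA.
- move=> X Y Z f g; have [P [p [q [pb inj sur]]]] := @pb_el E cE (sval X) (sval Y) (sval Z) f g.
  have cP := (comm_tmc cE oneP P).2 (tmc_pb pb (@M_tmc X) (@M_tmc Y)).
  by exists (exist _ P cP : M), p, q; split=> //; exact: full_pb.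
- move=> X T g; have [I [e [m [se im me]]]] := @im_el E cE (sval X) (sval T) g.
  have cI := (comm_tmc cE oneP I).2 (tmc_inj im (@M_tmc T)).
  by exists (exist _ I cI : M), e, m.
- by move=> X I T e h; exact: (@desc_el E cE (sval X) (sval I) (sval T)).
- move=> X R a b /= r1 r2 r3; have [Q [q [sq qP]]] := @quo_el E cE (sval X) (sval R) a b r1 r2 r3.
  have cQ := (comm_tmc cE oneP Q).2 (tmc_surj sq (@M_tmc X)).
  by exists (exist _ Q cQ : M), q.
Defined.

Lemma tmc_comm (X : M) : tmc conc_comm X.
Proof. by move=> W x y z; exact: (@M_tmc X (sval W)). Qed.

End CommCat.

Section Slice.
Variables (D : category) (cD : conc D) (Y : D).
Local Notation C := (slice Y).

Lemma slice_one : is_terminal (SliceOb (idm Y) : C).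
Proof.
move=> X; have e : sl_map (SliceOb (idm Y)) ∘ sl_map X = sl_map X by rewrite /= cmp1m.
exists (@SliceHom D Y X (SliceOb (idm Y)) (sl_map X) e); split=> // v _; apply: slice_hom_eq.
by rewrite /= -(sl_homP v) /= cmp1m.
Qed.

Definition conc_slice : conc C.
Proof.
unshelve refine (@Conc C (fun X => el cD (sl_dom X)) (fun X Z f => @ap D cD _ _ (sl_hom f))
  (fun X => @mal D cD (sl_dom X)) _ _ _ _ _ _ _ _ _ _ _).
- by move=> X x; exact: ap1.
- by move=> X X' Z g f x; exact: apM.
- by move=> X X' f g e; apply: slice_hom_eq; exact: (@ap_inj D cD).
- by move=> X X' f; exact: tm_nat.
- by move=> X; exact: tmr.
- by move=> X; exact: tml.
- by move=> X; exact: tmA.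
- move=> X X' Z f g; have [P [p [q [pb inj sur]]]] := pb_el cD (sl_hom f) (sl_hom g).
  pose P' : C := SliceOb (sl_map X ∘ p).
  have qP : sl_map X' ∘ q = sl_map X ∘ p by rewrite -(sl_homP g) -cmpA -pb.1 cmpA sl_homP.
  pose p' : hom P' X := @SliceHom D Y P' X p erefl.
  pose q' : hom P' X' := @SliceHom D Y P' X' q qP.
  exists P', p', q'; split=> //; apply: pbI => [|T a b ab|T u v eu ev].
  + by apply: slice_hom_eq; exact: pb.1.
  + have [|h [hp hq]] := pb_lift pb (a := sl_hom a) (b := sl_hom b).
      by have := congr1 (@sl_hom _ _ _ _) ab.
    have hP : sl_map P' ∘ h = sl_map T by rewrite /= -cmpA hp sl_homP.
    by exists (@SliceHom D Y T P' h hP); split; apply: slice_hom_eq.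
  + apply: slice_hom_eq; apply: (pb_eq pb).
    * by have := congr1 (@sl_hom _ _ _ _) eu.
    * by have := congr1 (@sl_hom _ _ _ _) ev.
- move=> X T g; have [I [e [m [se im me]]]] := im_el cD (sl_hom g).
  pose I' : C := SliceOb (sl_map T ∘ m).
  have eP : sl_map I' ∘ e = sl_map X by rewrite /= -cmpA me sl_homP.
  exists I', (@SliceHom D Y X I' e eP), (@SliceHom D Y I' T m erefl); split=> //.
  exact: slice_hom_eq.
- move=> X I T e h se eh; have [u ue] := desc_el se eh.
  have uP : sl_map T ∘ u = sl_map I.
    apply: (@ap_inj D cD) => i; have [x <-] := se i.
    by rewrite -!apM -cmpA ue !sl_homP.
  by exists (@SliceHom D Y I T u uP); apply: slice_hom_eq.
- move=> X R a b rel r1 r2 r3; have [Q [q [sq qP]]] := quo_el r1 r2 r3.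
  have [|m mq] := desc_el (h := sl_map X) sq.
    by move=> x x' /qP [r [<- <-]]; rewrite -!apM !sl_homP.
  by exists (SliceOb m), (@SliceHom D Y X (SliceOb m) q mq).
Defined.

End Slice.

(** * Internal groupoids in a category of structured algebras *)

Section Over.
Variables (E : category) (cE : conc E) (V : category) (F : functor V E).
Local Notation "f @ x" := (@ap E cE _ _ f x) (at level 20).
Local Notation tm := (@mal E cE _).
Local Notation "'F1' f" := (fmap F f) (at level 10, f at level 8).
Hypothesis Ff : forall (x y : V) (f g : hom x y), F1 f = F1 g -> f = g.
Hypothesis Fpb : forall (x y z w : V) (f : hom x z) (g : hom y z) (p : hom w x) (q : hom w y),
  is_pullback f g p q -> is_pullback (F1 f) (F1 g) (F1 p) (F1 q).

Lemma over_eq (x y : V) (f g : hom x y) : (forall w, F1 f @ w = F1 g @ w) -> f = g.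
Proof. by move=> e; apply: Ff; exact: ap_inj e. Qed.

Lemma over_hap (x y z : V) (f : hom y z) (g : hom x y) (h : hom x z) w :
  f ∘ g = h -> F1 f @ (F1 g @ w) = F1 h @ w.
Proof. by move=> <-; rewrite fmapM apM. Qed.

Section Groupoid.
Variables (x0 : V) (G : groupoid x0).

Lemma grd_d0s w : F1 (d0 G) @ (F1 (s0 G) @ w) = w.
Proof. by rewrite (over_hap w (d0s G)) fmap1 ap1. Qed.

Lemma grd_d1s w : F1 (d1 G) @ (F1 (s0 G) @ w) = w.
Proof. by rewrite (over_hap w (d1s G)) fmap1 ap1. Qed.

(** A composable pair [(a, b)] is [tm (a, 1) (1, 1) (1, b)], and composition is a map. *)
Lemma grd_mulE w : F1 (mul G) @ w =
  tm (F1 (p0 G) @ w) (F1 (s0 G) @ (F1 (d1 G) @ (F1 (p0 G) @ w))) (F1 (p1 G) @ w).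
Proof.
have pb := Fpb (g_pb G); have [inj _] := pb_el2 cE pb.
have [u [u0 u1 u2]] := mul1r G; have [v [v0 v1 v2]] := mul1l G.
have := over_hap _ u0; have := over_hap _ u1; have := over_hap _ u2.
have := over_hap _ v0; have := over_hap _ v1; have := over_hap _ v2.
move=> {}v2 {}v1 {}v0 {}u2 {}u1 {}u0.
set a := F1 (p0 G) @ w; set b := F1 (p1 G) @ w.
have ab : F1 (d1 G) @ a = F1 (d0 G) @ b by rewrite -!apM pb.1.
pose c := F1 (s0 G) @ (F1 (d1 G) @ a).
have -> : w = tm (F1 u @ a) (F1 u @ c) (F1 v @ b).
  by apply: inj; rewrite !tm_nat ?u0 ?u1 ?v0 ?v1 ?fmapM ?apM ?fmap1 ?ap1 ?grd_d1s -?ab ?tmr ?tml.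
by rewrite !tm_nat !u2 !v2 fmap1 !ap1.
Qed.

Lemma grd_comph : comph cE (F1 (d0 G)) (F1 (d1 G)) (F1 (s0 G)).
Proof.
move=> W a b ha hb ab; have [u uE] := pb_hom (Fpb (g_pb G)) ha hb ab.
by exists (F1 (mul G) ∘ u) => w; rewrite apM grd_mulE (uE w).1 (uE w).2.
Qed.

End Groupoid.

(** The composition being given by [tm], maps that commute with domains, codomains and
    identities are functorial. *)
Lemma grd_gmor (x0 : V) (G H : groupoid x0) (f : hom (g1 G) (g1 H)) :
  d0 H ∘ f = d0 G -> d1 H ∘ f = d1 G -> f ∘ s0 G = s0 H -> gmor f.
Proof.
move=> f0 f1 fs; split=> //.
have [|u [ua ub]] := pb_lift (g_pb H) (a := f ∘ p0 G) (b := f ∘ p1 G).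
  by rewrite !cmpA f0 f1 (g_pb G).1.
exists u; split=> //; apply: over_eq => w.
rewrite !fmapM !apM !grd_mulE !tm_nat (over_hap w ua) (over_hap w ub) !fmapM !apM.
by rewrite (over_hap _ fs) (over_hap _ f1).
Qed.

Hypothesis Fpbs : has_pullbacks V.

(** A reflexive graph is an internal groupoid as soon as its composition is a morphism. *)
Lemma mk_grd (x0 g1' : V) (s t : hom g1' x0) (i : hom x0 g1') :
  (forall x y (a b c : hom x y) k, (forall w, k @ w = tm (F1 a @ w) (F1 b @ w) (F1 c @ w)) ->
     exists f : hom x y, F1 f = k) ->
  s ∘ i = idm x0 -> t ∘ i = idm x0 -> comph cE (F1 s) (F1 t) (F1 i) ->
  exists (G : groupoid x0) (j : hom (g1 G) g1') (k : hom g1' (g1 G)),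
    [/\ j ∘ k = idm _, k ∘ j = idm _, s ∘ j = d0 G, t ∘ j = d1 G & j ∘ s0 G = i].
Proof.
move=> Ffull si ti cm; have [P [p [q pb]]] := Fpbs t s.
have fsi w : F1 s @ (F1 i @ w) = w by rewrite (over_hap w si) fmap1 ap1.
have fti w : F1 t @ (F1 i @ w) = w by rewrite (over_hap w ti) fmap1 ap1.
have pbF := Fpb pb; have pq w : F1 t @ (F1 p @ w) = F1 s @ (F1 q @ w) by rewrite -!apM pbF.1.
have [m0 m0E] := cm _ _ _ (ap_is_hom cE (F1 p)) (ap_is_hom cE (F1 q)) pq.
have [|m mE] := Ffull _ _ p (i ∘ t ∘ p) q m0.
  by move=> w; rewrite m0E !fmapM !apM.
have [v0 v0E] := comph_inv fsi fti cm.
have [|v vE] := Ffull _ _ (i ∘ t) (idm _) (i ∘ s) v0.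
  by move=> w; rewrite v0E !fmapM !apM fmap1 ap1.
have mP T (a b c : hom T g1') : along p q m a b c <-> t ∘ a = s ∘ b /\
    forall w, F1 c @ w = tm (F1 a @ w) (F1 i @ (F1 t @ (F1 a @ w))) (F1 b @ w).
  split=> [[u [<- <- <-]]|[ab cE']].
    split=> [|w]; first by rewrite !cmpA pb.1.
    by rewrite !fmapM !apM mE m0E.
  have [u [ua ub]] := pb_lift pb ab; exists u; split=> //; apply: over_eq => w.
  by rewrite fmapM apM mE m0E cE' (over_hap w ua) (over_hap w ub).
unshelve eexists (@Groupoid V x0 g1' P s t i p q m v pb si ti _ _ _ _ _ _ _),
  (idm _), (idm _); last by split; rewrite ?cmpm1 ?cmp1m.
- apply: over_eq => w; rewrite !fmapM !apM mE m0E !tm_nat fsi pq tmr //.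
- apply: over_eq => w; rewrite !fmapM !apM mE m0E !tm_nat fti tml //.
- apply/mP; split=> [|w]; first by rewrite cmpA ti cmp1m cmpm1.
  by rewrite fmap1 ap1 !fmapM !apM fti tml.
- apply/mP; split=> [|w]; first by rewrite cmpA si cmp1m cmpm1.
  by rewrite fmap1 ap1 !fmapM !apM tmr.
- move=> T a b c ab bc abc /mP [tab abE] /mP [tbc bcE] /mP [_ abcE].
  have tab' w := over_hap w tab; have tbc' w := over_hap w tbc.
  rewrite fmapM in tab'; rewrite fmapM in tbc'.
  apply/mP; split=> [|w].
    apply: over_eq => w; rewrite !fmapM !apM tab' bcE !tm_nat fsi.
    by rewrite tbc' !apM tmr.
  rewrite abcE abE bcE -tmA; congr (tm _ _ _); congr (_ @ _).
  by rewrite !tm_nat fti tml.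
- apply/mP; split=> [|w].
    by apply: over_eq => w; rewrite cmpm1 !fmapM !apM vE v0E !tm_nat !fti tml.
  rewrite fmap1 ap1 vE v0E !fmapM !apM /invh !tm_nat !fti tml.
  by rewrite tmA tml tmr.
- apply/mP; split=> [|w].
    by apply: over_eq => w; rewrite cmpm1 !fmapM !apM vE v0E !tm_nat !fsi tmr.
  by rewrite fmap1 ap1 vE v0E !fmapM !apM /invh -!tmA tmr tml.
Qed.

End Over.

(** * Higher groupoids as globular diagrams *)

Definition ftot (A B : category) (U : functor A B) (b : B) : functor (fibre U b) A :=
  @Functor (fibre U b) A (@fib_tot A B U b) (fun x y f => fib_map f)
    (fun _ => erefl) (fun _ _ _ _ _ => erefl).

Section Levels.
Variables (E : category) (cE : conc E).
Local Notation el := (@el E cE).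
Local Notation "f @ x" := (@ap E cE _ _ f x) (at level 20).
Local Notation tm := (@mal E cE _).
Local Notation S := (grd_tower E).
Local Notation cmap n f := (fmap (cells E n) f).

Definition fcF n (b : base (S n)) : functor (fibre (proj (S n)) b) E :=
  cmp_functor (cells E n) (ftot (proj (S n)) b).
Arguments fcF : clear implicits.
Local Notation fm n f := (fmap (fcF n _) f).

Lemma conc_pb : has_pullbacks E.
Proof. by move=> X Y Z f g; have [P [p [q [pb _ _]]]] := pb_el cE f g; exists P, p, q. Qed.

Lemma fibre_pb n b : has_pullbacks (fibre (proj (S n)) b).
Proof.
elim: n b => [|n IH] b; first by apply: tm_base_pb conc_pb b.
by apply: obj_fibre_pb; exact: IH.
Qed.

(** Pullbacks in a fibre are computed on top cells. *)
Lemma fcF_pb n b (x y z w : fibre (proj (S n)) b) (f : hom x z) (g : hom y z)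
    (p : hom w x) (q : hom w y) :
  is_pullback f g p q -> is_pullback (fm n f) (fm n g) (fm n p) (fm n q).
Proof.
elim: n b x y z w f g p q => [|n IH] b x y z w f g p q; first by move/unit_fib_pb.
have [G eG] := wob_ex x; have [K eK] := wob_ex y; have [H eH] := wob_ex z.
have [P eP] := wob_ex w; subst x y z w.
have [f1 f1E _] := wmor_inv f; have [k1 k1E _] := wmor_inv g.
have [p1 p1E _] := wmor_inv p; have [q1 q1E _] := wmor_inv q.
move=> /(wpb_arr (@fibre_pb n _) f1E k1E p1E q1E) /IH.
by rewrite /= f1E k1E p1E q1E.
Qed.

Lemma fcF_faithful n b (x y : fibre (proj (S n)) b) (f g : hom x y) : fm n f = fm n g -> f = g.
Proof.
elim: n b x y f g => [|n IH] b x y f g; first exact: fib_hom_eq.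
have [G eG] := wob_ex x; have [H eH] := wob_ex y; subst x y.
have [f1 f1E _] := wmor_inv f; have [g1 g1E _] := wmor_inv g => e.
apply: wmor_eq; rewrite -f1E -g1E; congr fib_map; apply: IH.
by rewrite /= f1E g1E.
Qed.

Definition idn n (X : nGrd E n.+1) : hom (cells E n (under X)) (cells E n.+1 X) :=
  cmap n (@idt (S n) X).

(** Source, target and identities of the objects of a fibre, over the fixed base. *)
Definition fsrc n (b : tot (S n)) (x : fibre (obj_functor (S n)) b) :
    hom (fcF n.+1 b x) (cells E n b) := cmap n (eqhom (fib_tot_over x)) ∘ @src E n (fib_tot x).
Definition ftgt n (b : tot (S n)) (x : fibre (obj_functor (S n)) b) :
    hom (fcF n.+1 b x) (cells E n b) := cmap n (eqhom (fib_tot_over x)) ∘ @tgt E n (fib_tot x).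
Definition fidn n (b : tot (S n)) (x : fibre (obj_functor (S n)) b) :
    hom (cells E n b) (fcF n.+1 b x) := @idn n (fib_tot x) ∘ cmap n (eqhom (esym (fib_tot_over x))).

Lemma fsrc_fm n (b : tot (S n)) (x y : fibre (obj_functor (S n)) b) (f : hom x y) :
  [/\ fsrc y ∘ fm n.+1 f = fsrc x, ftgt y ∘ fm n.+1 f = ftgt x & fm n.+1 f ∘ fidn x = fidn y].
Proof.
have [G eG] := wob_ex x; have [H eH] := wob_ex y; subst x y.
have eo := wmor_obj f; rewrite /fsrc /ftgt /fidn /= !fmap1 !cmp1m !cmpm1 /src /tgt /idn.
split; rewrite -fmapM.
- by rewrite (h_dom (fib_map f)) eo cmp1m.
- by rewrite (h_cod (fib_map f)) eo cmp1m.
- by rewrite (h_idt (fib_map f)) eo cmpm1.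
Qed.

Lemma fsrc_pt n (X : nGrd E n.+1) : fsrc (pt (S := S n.+1) X) = src X.
Proof. by rewrite /fsrc /= fmap1 cmp1m. Qed.
Lemma ftgt_pt n (X : nGrd E n.+1) : ftgt (pt (S := S n.+1) X) = tgt X.
Proof. by rewrite /ftgt /= fmap1 cmp1m. Qed.
Lemma fidn_pt n (X : nGrd E n.+1) : fidn (pt (S := S n.+1) X) = idn X.
Proof. by rewrite /fidn /= fmap1 cmpm1. Qed.

(** The maps of top cells that come from a morphism of the fibre. *)
Definition vert n : forall (b : base (S n)) (x y : fibre (proj (S n)) b),
    hom (fcF n b x) (fcF n b y) -> Prop :=
  match n with
  | 0 => fun _ _ _ _ => True
  | n'.+1 => fun b x y k => [/\ fsrc y ∘ k = fsrc x, ftgt y ∘ k = ftgt x & k ∘ fidn x = fidn y]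
  end.

Lemma vert_tm n b (x y : fibre (proj (S n)) b) (f g h : hom x y) (k : hom (fcF n b x) (fcF n b y)) :
  (forall w, k @ w = tm (fm n f @ w) (fm n g @ w) (fm n h @ w)) -> vert k.
Proof.
case: n b x y f g h k => [//|n] b x y f g h k kE.
have [f0 f1 f2] := fsrc_fm f; have [g0 g1 g2] := fsrc_fm g; have [h0 h1 h2] := fsrc_fm h.
split; apply: (@ap_inj E cE) => w; rewrite apM kE ?tm_nat -!apM.
- by rewrite f0 g0 h0 tmr.
- by rewrite f1 g1 h1 tmr.
- by rewrite f2 g2 h2 tmr.
Qed.

(** Cell maps that commute with the structure lift to morphisms of the fibre. *)
Lemma fcF_full n b (x y : fibre (proj (S n)) b) (k : hom (fcF n b x) (fcF n b y)) :
  vert k -> exists f : hom x y, fm n f = k.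
Proof.
elim: n b x y k => [|n IH] b x y k; first by move=> _; exists (@unit_fibh E b x y k).
have [G eG] := wob_ex x; have [H eH] := wob_ex y; subst x y.
rewrite /vert /fsrc /ftgt /fidn /= !fmap1 !cmp1m !cmpm1 => -[k0 k1 k2].
have gv : vert (n := n) (x := g1 G) (y := g1 H) k.
  case: n IH b G H k k0 k1 k2 => [//|n] IH b G H k k0 k1 k2.
  have [a0 a1 a2] := fsrc_fm (d0 G); have [b0 b1 b2] := fsrc_fm (d0 H).
  have [_ _ c2] := fsrc_fm (s0 G); have [_ _ e2] := fsrc_fm (s0 H).
  split.
  - by rewrite -a0 -b0 -cmpA; congr cmp; exact: k0.
  - by rewrite -a1 -b1 -cmpA; congr cmp; exact: k0.
  - by rewrite -c2 -e2 cmpA; congr cmp; exact: k2.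
have [f fE] := IH _ _ _ _ gv.
have fg : gmor f.
  by apply: (@grd_gmor E cE _ (fcF n _)) => *; try apply: fcF_pb => //;
    apply: fcF_faithful => //; rewrite fmapM fE.
by have [h hE] := wmor_proof fg; exists h; rewrite /= hE.
Qed.

(** The structure on a reflexive graph [Q] over the n-cells of [X] that makes it an
    (n+1)-groupoid over [X]: globularity, and composition at every level. *)
Fixpoint compat n : forall (X : nGrd E n) (Q : E) (s t : hom Q (cells E n X))
    (i : hom (cells E n X) Q), Prop :=
  match n with
  | 0 => fun X Q s t i => [/\ s ∘ i = idm _, t ∘ i = idm _ & comph cE s t i]
  | n'.+1 => fun X Q s t i => [/\ s ∘ i = idm _, t ∘ i = idm _ & comph cE s t i] /\
      [/\ src X ∘ s = src X ∘ t, tgt X ∘ s = tgt X ∘ t &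
          compat (X := under X) (src X ∘ s) (tgt X ∘ s) (i ∘ idn X)]
  end.

Lemma compat_refl n (X : nGrd E n) Q s t i : @compat n X Q s t i ->
  [/\ s ∘ i = idm _, t ∘ i = idm _ & comph cE s t i].
Proof. by case: n X Q s t i => [//|n] X Q s t i []. Qed.

(** Compositions along lower cells are obtained by composing functors with the structure
    maps of the internal groupoid. *)
Lemma compat_grd n (X : tot (S n)) (G : groupoid (pt X)) :
  compat (X := X) (fm n (d0 G)) (fm n (d1 G)) (fm n (s0 G)).
Proof.
have refl : [/\ fm n (d0 G) ∘ fm n (s0 G) = idm _, fm n (d1 G) ∘ fm n (s0 G) = idm _
    & comph cE (fm n (d0 G)) (fm n (d1 G)) (fm n (s0 G))].
  rewrite -!fmapM d0s d1s !fmap1; split=> //.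
  by apply: grd_comph => *; exact: fcF_pb.
elim: n X G refl => [//|n IH] X G refl; split=> //.
have [a0 a1 _] := fsrc_fm (d0 G); have [b0 b1 _] := fsrc_fm (d1 G); have [_ _ c2] := fsrc_fm (s0 G).
move: a0 a1 b0 b1 c2; rewrite !fsrc_pt !ftgt_pt fidn_pt => a0 a1 b0 b1 c2.
split; [exact: etrans a0 (esym b0) | exact: etrans a1 (esym b1) |].
have [H eH] := wob_ex (g1 G).
case: G refl a0 a1 b0 b1 c2 eH => /= g1 g2 d0 d1 s0 p0 p1 mul inv + + + + + + + + + +.
move=> + + + + + + + + + + + + + + + + eH; subst g1 => _ _ _ _ _ _ _ _ _ _ _ a0 a1 _ _ c2.
rewrite a0 a1 c2 /fsrc /ftgt /fidn /= !fmap1 !cmp1m cmpm1; apply: IH.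
rewrite -!fmapM Defs.d0s Defs.d1s !fmap1; split=> //.
by apply: grd_comph => *; exact: fcF_pb.
Qed.

Lemma compat_under n (X : nGrd E n.+1) : compat (src X) (tgt X) (idn X).
Proof. exact: (compat_grd (g_grd X)). Qed.

(** Conversely compatible data are underlying an (n+1)-groupoid. *)
Lemma ext_grd n (X : tot (S n)) Q (s t : hom Q (cells E n X)) i : compat s t i ->
  exists (G : groupoid (pt X)) (j : hom (fcF n _ (g1 G)) Q) (k : hom Q (fcF n _ (g1 G))),
    [/\ j ∘ k = idm _, k ∘ j = idm _, s ∘ j = fm n (d0 G), t ∘ j = fm n (d1 G)
      & j ∘ fm n (s0 G) = i].
Proof.
elim: n X Q s t i => [|n IH] X Q s t i.
  move=> [si ti cm].
  pose x := pt (S := S 0) X; pose q := @unit_fib E (to_unit E X) Q.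
  have [|||||||G [j [k [jk kj j0 j1 js]]]] := @mk_grd E cE _ (fcF 0 (to_unit E X)) _ _ _ x q
    (@unit_fibh E _ q x s) (@unit_fibh E _ q x t) (@unit_fibh E _ x q i).
  - exact: fcF_faithful.
  - exact: fcF_pb.
  - exact: fibre_pb.
  - by move=> y z a b c u uE; apply: fcF_full.
  - exact: fib_hom_eq.
  - exact: fib_hom_eq.
  - exact: cm.
  have fM (y z w : fibre (to_unit E) (to_unit E X)) (g : hom z w) (f : hom y z) h :
    g ∘ f = h -> fm 0 g ∘ fm 0 f = fm 0 h by move=> <-; rewrite fmapM.
  exists G, (fm 0 j), (fm 0 k); split.
  - exact: etrans (fM _ _ _ _ _ _ jk) (fmap1 _ _).
  - exact: etrans (fM _ _ _ _ _ _ kj) (fmap1 _ _).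
  - exact: (fM _ _ _ _ _ _ j0).
  - exact: (fM _ _ _ _ _ _ j1).
  - exact: (fM _ _ _ _ _ _ js).
move=> [[si ti cm] [ss tt /IH [H [j [k [jk kj j0 j1 js]]]]]].
pose x := pt (S := S n.+1) X; pose q := wob H.
have fq : [/\ fsrc q = src X ∘ s ∘ j, ftgt q = tgt X ∘ s ∘ j & fidn q = k ∘ i ∘ idn X].
  rewrite j0 j1 /fsrc /ftgt /fidn /= !fmap1 !cmp1m cmpm1; split=> //.
  by rewrite -cmpA -js cmpA kj cmp1m.
have [q0 q1 q2] := fq.
have [d dE] : exists d : hom q x, fm n.+1 d = s ∘ j.
  apply: (@fcF_full n.+1 _ q x (s ∘ j)); split; rewrite ?fsrc_pt ?ftgt_pt ?fidn_pt ?q0 ?q1 ?q2 ?cmpA //.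
  by rewrite -(cmpA s) jk cmpm1 si cmp1m.
have [e eE] : exists d : hom q x, fm n.+1 d = t ∘ j.
  apply: (@fcF_full n.+1 _ q x (t ∘ j)); split; rewrite ?fsrc_pt ?ftgt_pt ?fidn_pt ?q0 ?q1 ?q2 ?cmpA ?ss ?tt //.
  by rewrite -(cmpA t) jk cmpm1 ti cmp1m.
have [f fE] : exists d : hom x q, fm n.+1 d = k ∘ i.
  apply: (@fcF_full n.+1 _ x q (k ∘ i)); split; rewrite ?fsrc_pt ?ftgt_pt ?fidn_pt ?q0 ?q1 ?q2 ?cmpA //.
  - by rewrite -(cmpA _ j) jk cmpm1 -cmpA si cmpm1.
  - by rewrite -(cmpA _ j) jk cmpm1 -cmpA si cmpm1.
have [|||||||G [j' [k' [jk' kj' j0' j1' js']]]] :=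
  @mk_grd E cE _ (fcF n.+1 (proj (S n.+1) X)) _ _ _ x q d e f.
- exact: fcF_faithful.
- exact: fcF_pb.
- exact: fibre_pb.
- by move=> y z a b c u uE; apply: (@fcF_full n.+1); exact: (@vert_tm n.+1 _ _ _ _ _ _ _ uE).
- by apply: fcF_faithful; rewrite fmapM dE fE cmpA -(cmpA s) jk cmpm1 si fmap1.
- by apply: fcF_faithful; rewrite fmapM eE fE cmpA -(cmpA t) jk cmpm1 ti fmap1.
- rewrite dE eE fE => W a b ha hb ab.
  have [|m mE] := cm W _ _ (hom_comp j ha) (hom_comp j hb).
    by move=> w; rewrite -!apM; exact: ab.
  exists (k ∘ m) => w; rewrite apM mE !tm_nat -!apM !cmpA kj !ap1 //.
exists G, (j ∘ fm n.+1 j'), (fm n.+1 k' ∘ k); split.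
- by rewrite -cmpA (cmpA (fm _ j')) -fmapM jk' fmap1 cmp1m.
- by rewrite -cmpA (cmpA k) kj cmp1m -fmapM kj' fmap1.
- by rewrite cmpA -dE -j0'; exact: esym (fmapM (fcF n.+1 _) d j').
- by rewrite cmpA -eE -j1'; exact: esym (fmapM (fcF n.+1 _) e j').
- rewrite -cmpA -[X in j ∘ X](fmapM (fcF n.+1 _) j' (Defs.s0 G)) js' fE cmpA jk; exact: cmp1m.
Qed.

End Levels.
Arguments fcF {E} n b.

(** * Functors between higher groupoids as maps of cells *)

Section Functors.
Variables (E : category) (cE : conc E).
Local Notation el := (@el E cE).
Local Notation "f @ x" := (@ap E cE _ _ f x) (at level 20).
Local Notation tm := (@mal E cE _).
Local Notation S := (grd_tower E).
Local Notation cmap n f := (fmap (cells E n) f).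
Local Notation fm n f := (fmap (fcF n _) f).

(** Maps between objects of two fibres, lying over a map of the bases. *)
Definition ov n (b b' : base (S n)) (f : hom b b') (x : fibre (proj (S n)) b)
    (y : fibre (proj (S n)) b') (a : hom (fib_tot x) (fib_tot y)) :=
  eqhom (fib_tot_over y) ∘ fmap (proj (S n)) a = f ∘ eqhom (fib_tot_over x).

Definition vertf n : forall (b b' : base (S n)) (f : hom b b') (x : fibre (proj (S n)) b)
    (y : fibre (proj (S n)) b') (k : hom (fcF n b x) (fcF n b' y)), Prop :=
  match n with
  | 0 => fun _ _ _ _ _ _ => True
  | n'.+1 => fun b b' f x y k =>
      [/\ fsrc y ∘ k = cmap n' f ∘ fsrc x, ftgt y ∘ k = cmap n' f ∘ ftgt x
        & k ∘ fidn x = fidn y ∘ cmap n' f]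
  end.

Lemma ov_comp n (b b' b'' : base (S n)) (f : hom b b') (g : hom b' b'')
    (x : fibre (proj (S n)) b) (y : fibre (proj (S n)) b') (z : fibre (proj (S n)) b'')
    (a : hom (fib_tot x) (fib_tot y)) (c : hom (fib_tot y) (fib_tot z)) :
  ov f a -> ov g c -> ov (g ∘ f) (c ∘ a).
Proof. by rewrite /ov fmapM cmpA => e ->; rewrite -cmpA e cmpA. Qed.

Lemma ov_vert n (b : base (S n)) (x y : fibre (proj (S n)) b) (h : hom x y) :
  ov (idm b) (fib_map h).
Proof. by have := fib_mapP h; rewrite /vertical /ov cmp1m. Qed.

Lemma ov_pt n (x y : tot (S n)) (f : hom x y) :
  ov (x := pt x) (y := pt y) (fmap (proj (S n)) f) f.
Proof. by rewrite /ov /= cmp1m cmpm1. Qed.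

Lemma hom_src n (X Z : nGrd E n.+1) (h : hom X Z) :
  src Z ∘ cmap n.+1 h = cmap n (h_obj h) ∘ src X.
Proof. by have := congr1 (fun g => cmap n g) (h_dom h); rewrite !fmapM. Qed.

Lemma hom_tgt n (X Z : nGrd E n.+1) (h : hom X Z) :
  tgt Z ∘ cmap n.+1 h = cmap n (h_obj h) ∘ tgt X.
Proof. by have := congr1 (fun g => cmap n g) (h_cod h); rewrite !fmapM. Qed.

Lemma hom_idn n (X Z : nGrd E n.+1) (h : hom X Z) :
  cmap n.+1 h ∘ idn X = idn Z ∘ cmap n (h_obj h).
Proof. by have := congr1 (fun g => cmap n g) (h_idt h); rewrite !fmapM. Qed.

Lemma ov_faithful n (b b' : base (S n)) (f : hom b b') (x : fibre (proj (S n)) b)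
    (y : fibre (proj (S n)) b') (a a' : hom (fib_tot x) (fib_tot y)) :
  ov f a -> ov f a' -> cmap n a = cmap n a' -> a = a'.
Proof.
elim: n b b' f x y a a' => [//|n IH] b b' f x y a a'.
have [G eG] := wob_ex x; have [H eH] := wob_ex y; subst x y.
rewrite /ov /= !cmp1m !cmpm1 => ao ao' e; apply: grd_hom_eq; first by rewrite ao ao'.
have arrP (c : hom (GrdOb G : nGrd E n.+1) (GrdOb H)) : h_obj c = f ->
    ov (x := g1 G) (y := g1 H) (fmap (proj (S n)) f) (h_arr c).
  move=> co; have := congr1 (fmap (proj (S n))) (h_dom c); rewrite co !fmapM.
  have := fib_mapP (d0 H); have := fib_mapP (d0 G); rewrite /vertical /= !cmp1m /dom /=.
  by rewrite /ov => -> ->.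
exact: IH (arrP _ ao) (arrP _ ao') e.
Qed.

Lemma ov_full n (b b' : base (S n)) (f : hom b b') (x : fibre (proj (S n)) b)
    (y : fibre (proj (S n)) b') (k : hom (fcF n b x) (fcF n b' y)) :
  vertf f k -> exists a : hom (fib_tot x) (fib_tot y), ov f a /\ cmap n a = k.
Proof.
elim: n b b' f x y k => [|n IH] b b' f x y k.
  by move=> _; exists k; split=> //; rewrite /ov; case: (_ ∘ _); case: (_ ∘ _).
have [G eG] := wob_ex x; have [H eH] := wob_ex y; subst x y.
rewrite /vertf /fsrc /ftgt /fidn /= !fmap1 !cmp1m !cmpm1 => -[k0 k1 k2].
have lift (u : fibre (proj (S n)) (proj (S n) b)) (v : fibre (proj (S n)) (proj (S n) b'))
    (l : hom (fcF n _ u) (fcF n _ v)) (c : hom u (pt b)) (d : hom v (pt b')) (e : hom (pt b) u)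
    (e' : hom (pt b') v) :
    fm n d ∘ l = cmap n f ∘ fm n c -> l ∘ fm n e = fm n e' ∘ cmap n f ->
    vertf (fmap (proj (S n)) f) l.
  case: n IH b b' f G H k k0 k1 k2 u v l c d e e' => [//|n] IH b b' f G H k k0 k1 k2 u v l c d e e'.
  move=> h0 h1; have [c0 c1 _] := fsrc_fm c; have [d0 d1 _] := fsrc_fm d.
  have [_ _ e2] := fsrc_fm e; have [_ _ e2'] := fsrc_fm e'.
  move: c0 c1 d0 d1 e2 e2'; rewrite !fsrc_pt !ftgt_pt !fidn_pt => c0 c1 d0 d1 e2 e2'.
  split; rewrite -?c0 -?c1 -?d0 -?d1 -?e2 -?e2'.
  - by rewrite -cmpA h0 !cmpA; congr cmp; exact: hom_src.
  - by rewrite -cmpA h0 !cmpA; congr cmp; exact: hom_tgt.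
  - by rewrite cmpA h1 -!cmpA; congr cmp; exact: hom_idn.
have [a [ao ac]] := IH _ _ _ _ _ _ (lift (g1 G) (g1 H) k _ _ _ _ k0 k2).
have pbH := fcF_pb cE (g_pb H).
have [|l [l0 l1]] := pb_lift pbH (a := k ∘ fm n (p0 G)) (b := k ∘ fm n (p1 G)).
  rewrite !cmpA -[fm n (d1 H) ∘ k]/(tgt (GrdOb H : nGrd E n.+1) ∘ k).
  rewrite -[fm n (d0 H) ∘ k]/(src (GrdOb H : nGrd E n.+1) ∘ k) k0 k1 -!cmpA; congr cmp.
  by have := congr1 (fun h => fm n h) (g_pb G).1; rewrite !fmapM.
have q0 z : fm n (p0 H) @ (l @ z) = k @ (fm n (p0 G) @ z) by rewrite -!apM l0.
have q1 z : fm n (p1 H) @ (l @ z) = k @ (fm n (p1 G) @ z) by rewrite -!apM l1.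
have q2 z : fm n (s0 H) @ (cmap n f @ z) = k @ (fm n (s0 G) @ z).
  by have := hap (cE := cE) z k2; rewrite !apM.
have q3 z : fm n (d1 H) @ (k @ z) = cmap n f @ (fm n (d1 G) @ z).
  by have := hap (cE := cE) z k1; rewrite !apM.
have q4 z : fm n (d0 H) @ (k @ z) = cmap n f @ (fm n (d0 G) @ z).
  by have := hap (cE := cE) z k0; rewrite !apM.
have lv : vertf (fmap (proj (S n)) f) l.
  have [sG [/(over_hap (cE := cE) (F := fcF n _)) sG0 /(over_hap (cE := cE) (F := fcF n _)) sG1 _]] := mul1l G.
  have [sH [/(over_hap (cE := cE) (F := fcF n _)) sH0 /(over_hap (cE := cE) (F := fcF n _)) sH1 _]] := mul1l H.
  apply: (lift _ _ _ (d0 G ∘ p0 G) (d0 H ∘ p0 H) (sG ∘ s0 G) (sH ∘ s0 H));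
    apply: (@ap_inj E cE) => z; first by rewrite !fmapM !apM q0 q4.
  apply: (pb_el2 cE pbH).1; rewrite !apM ?q0 ?q1 !fmapM !apM ?sG0 ?sG1 ?sH0 ?sH1 !q2.
    by rewrite !fmapM !apM q4 !(@grd_d0s E cE _ (fcF n _)) q2.
  by rewrite !fmap1 !ap1.
have [u [uo uc]] := IH _ _ _ _ _ _ lv.
have ovx (v : fibre (proj (S n)) (proj (S n) b)) (w : fibre (proj (S n)) (proj (S n) b'))
    (c c' : hom (fib_tot v) (fib_tot w)) : ov (fmap (proj (S n)) f ∘ idm _) c ->
    ov (idm _ ∘ fmap (proj (S n)) f) c' -> cmap n c = cmap n c' -> c = c'.
  by rewrite cmp1m cmpm1; exact: ov_faithful.
have m3 : fm n (mul H) ∘ l = k ∘ fm n (mul G).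
  apply: (@ap_inj E cE) => w.
  by rewrite !apM !(@grd_mulE E cE _ (fcF n _) (@fcF_pb E cE n _)) tm_nat q0 q1 q3 q2.
have cdom (x y : fibre (proj (S n)) (proj (S n) b)) (x' y' : fibre (proj (S n)) (proj (S n) b'))
    (h : hom x y) (h' : hom x' y') (c : hom (fib_tot x) (fib_tot x')) (d : hom (fib_tot y) (fib_tot y')) :
    ov (fmap (proj (S n)) f) c -> ov (fmap (proj (S n)) f) d ->
    cmap n d ∘ fm n h = fm n h' ∘ cmap n c -> d ∘ fib_map h = fib_map h' ∘ c.
  move=> oc od e; apply: (ovx _ _ _ _ (ov_comp (ov_vert h) od) (ov_comp oc (ov_vert h'))).
  by rewrite !fmapM.
have a0 : dom (GrdOb H) ∘ a = f ∘ dom (GrdOb G).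
  by apply: esym; apply: (cdom _ _ _ _ (d0 G) (d0 H) _ _ ao (ov_pt f)); rewrite ac; exact: esym k0.
have a1 : cod (GrdOb H) ∘ a = f ∘ cod (GrdOb G).
  by apply: esym; apply: (cdom _ _ _ _ (d1 G) (d1 H) _ _ ao (ov_pt f)); rewrite ac; exact: esym k1.
have a2 : a ∘ idt (GrdOb G) = idt (GrdOb H) ∘ f.
  by apply: (cdom _ _ _ _ (s0 G) (s0 H) _ _ (ov_pt f) ao); rewrite ac; exact: k2.
have a3 : along (fst_ (GrdOb H)) (snd_ (GrdOb H)) (mul_ (GrdOb H))
    (a ∘ fst_ (GrdOb G)) (a ∘ snd_ (GrdOb G)) (a ∘ mul_ (GrdOb G)).
  exists u; split; apply: esym.
  - by apply: (cdom _ _ _ _ (p0 G) (p0 H) _ _ uo ao); rewrite ac uc l0.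
  - by apply: (cdom _ _ _ _ (p1 G) (p1 H) _ _ uo ao); rewrite ac uc l1.
  - by apply: (cdom _ _ _ _ (mul G) (mul H) _ _ uo ao); rewrite ac uc m3.
exists (@GrdHom (S n) (GrdOb G) (GrdOb H) f a a0 a1 a2 a3); split; last exact: ac.
by rewrite /ov /= cmp1m cmpm1.
Qed.

Lemma hom_faithful n (X Z : nGrd E n.+1) (h h' : hom X Z) :
  h_obj h = h_obj h' -> cmap n.+1 h = cmap n.+1 h' -> h = h'.
Proof.
move=> e e1; apply: (@ov_faithful n.+1 _ _ (h_obj h) (pt X) (pt Z)) e1.
- exact: ov_pt.
- by rewrite e; exact: ov_pt.
Qed.

(** A map of top cells that commutes with sources, targets and identities automatically
    preserves all compositions, as these are given by [tm]. *)
Lemma hom_full n (X Z : nGrd E n.+1) (f : hom (under X) (under Z))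
    (k : hom (cells E n.+1 X) (cells E n.+1 Z)) :
  src Z ∘ k = cmap n f ∘ src X -> tgt Z ∘ k = cmap n f ∘ tgt X ->
  k ∘ idn X = idn Z ∘ cmap n f -> exists h : hom X Z, h_obj h = f /\ cmap n.+1 h = k.
Proof.
move=> k0 k1 k2; have [|h [ho hk]] := @ov_full n.+1 _ _ f (pt X) (pt Z) k.
  by rewrite /vertf !fsrc_pt !ftgt_pt !fidn_pt.
by exists h; split=> //; move: ho; rewrite /ov /= cmp1m cmpm1.
Qed.

End Functors.

(** * Parallel cells and asphericity, elementwise *)

Section Cells.
Variables (E : category) (cE : conc E) (one : E) (oneP : is_terminal one).
Local Notation el := (@el E cE).
Local Notation "f @ x" := (@ap E cE _ _ f x) (at level 20).
Local Notation tm := (@mal E cE _).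
Local Notation S := (grd_tower E).
Local Notation cmap n f := (fmap (cells E n) f).
Local Notation bang := (to_one oneP).

Lemma src_idn n (X : nGrd E n.+1) x : src X @ (idn X @ x) = x.
Proof. by have [e _ _] := compat_refl (compat_under cE X); rewrite -apM e ap1. Qed.

Lemma tgt_idn n (X : nGrd E n.+1) x : tgt X @ (idn X @ x) = x.
Proof. by have [_ e _] := compat_refl (compat_under cE X); rewrite -apM e ap1. Qed.

Lemma glob_src n (X : nGrd E n.+2) f :
  src (under X) @ (src X @ f) = src (under X) @ (tgt X @ f).
Proof. by have [_ [e _ _]] := compat_under cE X; rewrite -!apM e. Qed.

Lemma glob_tgt n (X : nGrd E n.+2) f :
  tgt (under X) @ (src X @ f) = tgt (under X) @ (tgt X @ f).
Proof. by have [_ [_ e _]] := compat_under cE X; rewrite -!apM e. Qed.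

Lemma src_el n (X Z : nGrd E n.+1) (h : hom X Z) f :
  src Z @ (cmap n.+1 h @ f) = cmap n (h_obj h) @ (src X @ f).
Proof. by rewrite -!apM hom_src. Qed.

Lemma tgt_el n (X Z : nGrd E n.+1) (h : hom X Z) f :
  tgt Z @ (cmap n.+1 h @ f) = cmap n (h_obj h) @ (tgt X @ f).
Proof. by rewrite -!apM hom_tgt. Qed.

Lemma idn_el n (X Z : nGrd E n.+1) (h : hom X Z) x :
  cmap n.+1 h @ (idn X @ x) = idn Z @ (cmap n (h_obj h) @ x).
Proof. by rewrite -!apM hom_idn. Qed.

Definition parel n : forall X : nGrd E n, el (cells E n X) -> el (cells E n X) -> Prop :=
  match n with
  | 0 => fun X f g => bang X @ f = bang X @ g
  | n'.+1 => fun X f g => src X @ f = src X @ g /\ tgt X @ f = tgt X @ g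
  end.
Arguments parel : clear implicits.

Lemma parel_refl n X f : parel n X f f.
Proof. by case: n X f. Qed.

Lemma parel_sym n X f g : parel n X f g -> parel n X g f.
Proof. by case: n X f g => [|n] X f g /=; [move=> -> | case=> -> ->]. Qed.

Lemma parel_trans n X f g h : parel n X f g -> parel n X g h -> parel n X f h.
Proof. by case: n X f g h => [|n] X f g h /=; [move=> -> | case=> -> ->]. Qed.

Lemma parel_bang n X f g : parel n X f g -> bang _ @ f = bang _ @ g.
Proof.
by case: n X f g => [//|n] X f g [e _]; rewrite -(bang_ap oneP (src X)) e bang_ap.
Qed.

Lemma parel_tm n X f g f' g' f'' g'' : parel n X f g -> parel n X f' g' -> parel n X f'' g'' ->
  parel n X (tm f f' f'') (tm g g' g'').
Proof.
case: n X f g f' g' f'' g'' => [|n] X f g f' g' f'' g''; rewrite /= !tm_nat; first by move=> -> -> ->.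
by move=> [-> ->] [-> ->] [-> ->].
Qed.

Lemma parel_src n (X : nGrd E n.+1) f : parel n (under X) (src X @ f) (tgt X @ f).
Proof.
case: n X f => [|n] X f; first by rewrite /= !bang_ap.
by split; [exact: glob_src | exact: glob_tgt].
Qed.

Lemma parel_hom n (X Z : nGrd E n) (h : hom X Z) f g : parel n X f g ->
  parel n Z (cmap n h @ f) (cmap n h @ g).
Proof.
case: n X Z h f g => [|n] X Z h f g; first by rewrite /= !bang_ap.
by rewrite /parel !src_el !tgt_el => -[-> ->].
Qed.

Lemma par_el n X P (p q : hom P (cells E n X)) : is_par p q ->
  [/\ jinj cE p q, forall z, parel n X (p @ z) (q @ z)
    & forall f g, parel n X f g -> exists z, p @ z = f /\ q @ z = g].
Proof.
elim: n X P p q => [|n IH] X P p q.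
  move=> /(prod_el cE oneP) [inj sur]; split=> // z; by rewrite /= !bang_ap.
move=> [Q [r [s [c [/IH [inj _ _] c0 c1 kp]]]]]; have [pinj psur] := pb_el2 cE kp.
split=> // [z|f g [e0 e1]].
  by rewrite /= -c0 -c1 -!apM -!cmpA kp.1.
by apply: psur; apply: inj; rewrite -!apM ?c0 ?c1.
Qed.

Lemma par_lift n X P (p q : hom P (cells E n X)) W (a b : el W -> el (cells E n X)) :
  is_par p q -> is_hom cE a -> is_hom cE b -> (forall w, parel n X (a w) (b w)) ->
  exists u : hom W P, forall w, p @ (u @ w) = a w /\ q @ (u @ w) = b w.
Proof.
case: n X P p q a b => [|n] X P p q a b; first by move=> pr ha hb _; exact: (@prod_hom E cE one oneP _ _ _ _ p q a b pr ha hb).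
move=> [Q [r [s [c [/par_el [inj _ _] c0 c1 kp]]]]] ha hb ab; apply: (pb_hom kp ha hb) => w.
by apply: inj; rewrite -!apM ?c0 ?c1; case: (ab w).
Qed.

Lemma par_lift_hom n X P (p q : hom P (cells E n X)) W (a b : hom W (cells E n X)) :
  is_par p q -> (forall w, parel n X (a @ w) (b @ w)) ->
  exists u : hom W P, p ∘ u = a /\ q ∘ u = b.
Proof.
move=> pq ab; have [u uE] := par_lift pq (ap_is_hom cE a) (ap_is_hom cE b) ab.
by exists u; split; apply: (@ap_inj E cE) => w; rewrite apM; case: (uE w).
Qed.

(** Parallel (n+1)-cells are the kernel pair of the map to parallel n-cells. *)
Lemma par_ex n (X : nGrd E n) : exists P (p q : hom P (cells E n X)), is_par p q.
Proof.
elim: n X => [|n IH] X; first by have [P [p [q pq]]] := prod_ex_el cE oneP X X; exists P, p, q.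
have [Q [r [s rs]]] := IH (under X).
have [u uE] := par_lift rs (ap_is_hom cE (src X)) (ap_is_hom cE (tgt X)) (@parel_src n X).
have [P [p [q [pb _ _]]]] := pb_el cE u u; exists P, p, q, Q, r, s, u; split=> //;
  by apply: (@ap_inj E cE) => w; rewrite apM ?(uE w).1 ?(uE w).2.
Qed.

(** Asphericity on elements: any two parallel cells, and in dimension [0] the points over
    every element of [one], are joined. *)
Fixpoint asph n : nGrd E n -> Prop :=
  match n with
  | 0 => fun X => forall y : el one, exists x, bang X @ x = y
  | n'.+1 => fun X => asph (under X) /\
      forall x y, parel n' (under X) x y -> exists f, src X @ f = x /\ tgt X @ f = y
  end.

Lemma asphP n (X : nGrd E n) : aspherical X <-> asph X.
Proof.
elim: n X => [|n IH] X.
  split=> [[T [t [tT /regular_surj st]]] y|H].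
    have [h _] := term_hom one tT; have [x xE] := st cE (h @ y); exists x.
    by rewrite -(bang_ap oneP t) xE -apM one_ap.
  by exists one, (bang X); split=> //; apply: (surj_regular (cE := cE)).
split=> [[/IH aX [Q [c [[r [s [rs c0 c1]]] /regular_surj sc]]]]|[/IH aX sX]]; split=> //.
  have [_ _ H] := par_el rs.
  move=> x y /H [z [<- <-]]; have [f <-] := sc cE z; exists f.
  by rewrite -!apM c0 c1.
have [Q [r [s rs]]] := par_ex (under X); have [inj _ _] := par_el rs.
have [u uE] := par_lift rs (ap_is_hom cE (src X)) (ap_is_hom cE (tgt X)) (@parel_src n X).
exists Q, u; split.
  by exists r, s; split=> //; apply: (@ap_inj E cE) => w; rewrite apM ?(uE w).1 ?(uE w).2.
apply: (surj_regular (cE := cE)) => z; have [_ H _] := par_el rs.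
have [f [fs ft]] := sX _ _ (H z).
by exists f; apply: inj; rewrite ?(uE f).1 ?(uE f).2.
Qed.

Lemma asph_bang n (X : nGrd E n) : asph X -> forall y, exists f, bang (cells E n X) @ f = y.
Proof.
elim: n X => [//|n IH] X [/IH H _] y; have [x <-] := H y.
by exists (idn X @ x); rewrite bang_ap.
Qed.

(** * Building higher groupoids *)

(** Compatibility is tested on maps to compatible graphs. *)
Definition test n (X : nGrd E n) Q (s t : hom Q (cells E n X)) (i : hom (cells E n X) Q)
    Q1 (p : hom Q Q1) :=
  exists (X1 : nGrd E n) (s1 t1 : hom Q1 (cells E n X1)) (i1 : hom (cells E n X1) Q1) (h : hom X X1),
    [/\ compat cE s1 t1 i1, s1 ∘ p = cmap n h ∘ s, t1 ∘ p = cmap n h ∘ t & p ∘ i = i1 ∘ cmap n h].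

Lemma test_under n (X : nGrd E n.+1) Q (s t : hom Q (cells E n.+1 X)) (i : hom (cells E n.+1 X) Q)
    Q1 (p : hom Q Q1) :
  test s t i p -> test (X := under X) (src X ∘ s) (tgt X ∘ s) (i ∘ idn X) p.
Proof.
move=> [X1 [s1 [t1 [i1 [h [[_ [_ _ c1]] e0 e1 e2]]]]]].
exists (under X1), (src X1 ∘ s1), (tgt X1 ∘ s1), (i1 ∘ idn X1), (h_obj h); split=> //.
- by rewrite -cmpA e0 !cmpA; congr cmp; exact: hom_src.
- by rewrite -cmpA e0 !cmpA; congr cmp; exact: hom_tgt.
- by rewrite cmpA e2 -!cmpA; congr cmp; exact: hom_idn.
Qed.

Definition jointly_hom n (X : nGrd E n) Q (s t : hom Q (cells E n X)) (i : hom (cells E n X) Q) :=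
  forall W (k : el W -> el Q),
    (forall Q1 (p : hom Q Q1), test s t i p -> is_hom cE (fun w => p @ k w)) -> is_hom cE k.

Lemma compat_joint n (X : nGrd E n) Q (s t : hom Q (cells E n X)) (i : hom (cells E n X) Q) :
  s ∘ i = idm _ -> t ∘ i = idm _ -> (forall q, parel n X (s @ q) (t @ q)) ->
  jointly_hom s t i -> compat cE s t i.
Proof.
elim: n X Q s t i => [|n IH] X Q s t i si ti par J.
  split=> // W a b ha hb ab; apply: J => Q1 p [X1 [s1 [t1 [i1 [h [c1 e0 e1 e2]]]]]].
  have [_ _ cm] := compat_refl c1.
  apply: is_hom_ext (cm W _ _ (hom_comp p ha) (hom_comp p hb) _) => w.
    by rewrite tm_nat -(apM t1) e1 apM -(apM i1) -e2 apM.
  by rewrite -!apM e0 e1 !apM ab.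
split.
  split=> // W a b ha hb ab; apply: J => Q1 p [X1 [s1 [t1 [i1 [h [c1 e0 e1 e2]]]]]].
  have [_ _ cm] := compat_refl c1.
  apply: is_hom_ext (cm W _ _ (hom_comp p ha) (hom_comp p hb) _) => w.
    by rewrite tm_nat -(apM t1) e1 apM -(apM i1) -e2 apM.
  by rewrite -!apM e0 e1 !apM ab.
split.
- by apply: (@ap_inj E cE) => q; rewrite !apM; case: (par q).
- by apply: (@ap_inj E cE) => q; rewrite !apM; case: (par q).
apply: IH.
- rewrite -cmpA (cmpA s) si cmp1m; apply: (@ap_inj E cE) => x; rewrite apM src_idn ap1 //.
- rewrite -cmpA (cmpA s) si cmp1m; apply: (@ap_inj E cE) => x; rewrite apM tgt_idn ap1 //.
- by move=> q; rewrite !apM; exact: parel_src.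
- by move=> W k H; apply: J => Q1 p /test_under; exact: H.
Qed.

(** When [tm] turns maps into maps every composition is a map. *)
Lemma compat_tmc n (X : nGrd E n) Q (s t : hom Q (cells E n X)) (i : hom (cells E n X) Q) :
  tmc cE Q -> s ∘ i = idm _ -> t ∘ i = idm _ -> (forall q, parel n X (s @ q) (t @ q)) ->
  compat cE s t i.
Proof.
elim: n X Q s t i => [|n IH] X Q s t i cQ si ti par.
  by split=> //; exact: tmc_comph.
split; first by split=> //; exact: tmc_comph.
split.
- by apply: (@ap_inj E cE) => q; rewrite !apM; case: (par q).
- by apply: (@ap_inj E cE) => q; rewrite !apM; case: (par q).
apply: IH => //.
- rewrite -cmpA (cmpA s) si cmp1m; apply: (@ap_inj E cE) => x; rewrite apM src_idn ap1 //.
- rewrite -cmpA (cmpA s) si cmp1m; apply: (@ap_inj E cE) => x; rewrite apM tgt_idn ap1 //.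
- by move=> q; rewrite !apM; exact: parel_src.
Qed.

(** A composable pair of the quotient is covered by pairs of [Q0], which are again
    composable because the source and target factor through [q]. *)
Lemma comph_desc X Q0 Q (q : hom Q0 Q) (s t : hom Q X) (i : hom X Q0) : surj cE q ->
  comph cE (s ∘ q) (t ∘ q) i -> comph cE s t (q ∘ i).
Proof.
move=> sq cm W a b ha hb ab.
have [W1 [c1 [u [s1 uE]]]] := cover_lift sq ha.
have [W2 [c2 [v [s2 vE]]]] := cover_lift sq (hom_pre c1 hb).
apply: (desc_hom (surj_comp s2 s1)).
have := hom_comp q (cm _ _ _ (ap_is_hom cE (u ∘ c2)) (ap_is_hom cE v) _).
move=> H; apply: is_hom_ext (H _) => w.
  by rewrite !tm_nat !apM uE vE.
by rewrite !apM uE vE ab.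
Qed.

Lemma compat_desc n (X : nGrd E n) Q0 Q (q : hom Q0 Q) (s t : hom Q (cells E n X))
    (i : hom (cells E n X) Q0) :
  surj cE q -> compat cE (s ∘ q) (t ∘ q) i -> compat cE s t (q ∘ i).
Proof.
have epi T (f g : hom Q T) : surj cE q -> f ∘ q = g ∘ q -> f = g.
  move=> sq e; apply: (@ap_inj E cE) => x; have [y <-] := sq x; by rewrite -!apM e.
elim: n X s t i => [|n IH] X s t i sq.
  by move=> [si ti cm]; rewrite /= !cmpA; split=> //; exact: comph_desc.
move=> [[si ti cm] [ss tt cu]]; split; first by rewrite !cmpA; split=> //; exact: comph_desc.
split; [by apply: epi => //; rewrite -!cmpA | by apply: epi => //; rewrite -!cmpA |].
by rewrite -cmpA; apply: IH => //; rewrite -!cmpA.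
Qed.

End Cells.
Arguments parel {E} cE {one} oneP n X f g.
Arguments asph {E} cE {one} oneP {n} X.

Section Constructions.
Variables (E : category) (cE : conc E) (one : E) (oneP : is_terminal one).
Local Notation el := (@el E cE).
Local Notation "f @ x" := (@ap E cE _ _ f x) (at level 20).
Local Notation tm := (@mal E cE _).
Local Notation S := (grd_tower E).
Local Notation cmap n f := (fmap (cells E n) f).
Local Notation bang := (to_one oneP).
Local Notation parel := (parel cE oneP).
Local Notation asph := (asph cE oneP).

Lemma ext_nGrd n (X : nGrd E n) Q (s t : hom Q (cells E n X)) i : compat cE s t i ->
  exists (G : groupoid (pt (S := S n) X)) (j : hom (cells E n.+1 (GrdOb G)) Q)
    (k : hom Q (cells E n.+1 (GrdOb G))),
    [/\ j ∘ k = idm _, k ∘ j = idm _, s ∘ j = @src E n (GrdOb G), t ∘ j = @tgt E n (GrdOb G)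
      & j ∘ @idn E n (GrdOb G) = i].
Proof. exact: ext_grd. Qed.

Lemma iso_el X Y (j : hom X Y) (k : hom Y X) : k ∘ j = idm X -> forall x, k @ (j @ x) = x.
Proof. by move=> e x; rewrite -apM e ap1. Qed.

(** ** Products *)

(** A product taken separately at each level; it is a product of n-groupoids by
    [lprod_univ]. *)
Fixpoint lprod n : forall (P X Y : nGrd E n) (a : hom P X) (b : hom P Y), Prop :=
  match n with
  | 0 => fun P X Y a b => is_product a b
  | n'.+1 => fun P X Y a b =>
      @lprod n' (under P) (under X) (under Y) (h_obj a) (h_obj b) /\
      is_product (cmap n'.+1 a) (cmap n'.+1 b)
  end.

Lemma lprod_cells n (P X Y : nGrd E n) (a : hom P X) (b : hom P Y) :
  lprod a b -> is_product (cmap n a) (cmap n b).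
Proof. by case: n P X Y a b => [|n] P X Y a b //= []. Qed.

Lemma lprod_parel n (P X Y : nGrd E n) (a : hom P X) (b : hom P Y) x y : lprod a b ->
  parel n X (cmap n a @ x) (cmap n a @ y) -> parel n Y (cmap n b @ x) (cmap n b @ y) ->
  parel n P x y.
Proof.
case: n P X Y a b x y => [|n] P X Y a b x y; first by rewrite /= !bang_ap.
move=> [/lprod_cells /(prod_el cE oneP) [inj _] _]; rewrite /parel !src_el !tgt_el.
by move=> [e0 e1] [e2 e3]; split; apply: inj.
Qed.

Lemma lprod_univ n (P X Y : nGrd E n) (a : hom P X) (b : hom P Y) :
  lprod a b -> is_product a b.
Proof.
elim: n P X Y a b => [//|n IH] P X Y a b [lp pr].
have [inj _] := prod_el cE oneP (lprod_cells lp).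
apply: prodI => [T f g|T u v ea eb].
  have [u0 [ua ub]] := prod_lift (IH _ _ _ _ _ lp) (h_obj f) (h_obj g).
  have [k [ka kb]] := prod_lift pr (cmap n.+1 f) (cmap n.+1 g).
  have ka' x : cmap n.+1 a @ (k @ x) = cmap n.+1 f @ x by rewrite -apM ka.
  have kb' x : cmap n.+1 b @ (k @ x) = cmap n.+1 g @ x by rewrite -apM kb.
  have ua' x : cmap n (h_obj a) @ (cmap n u0 @ x) = cmap n (h_obj f) @ x by rewrite -apM -fmapM ua.
  have ub' x : cmap n (h_obj b) @ (cmap n u0 @ x) = cmap n (h_obj g) @ x by rewrite -apM -fmapM ub.
  have [|||u [uo uc]] := @hom_full E cE n T P u0 k.
  - by apply: (@ap_inj E cE) => x; rewrite !apM; apply: inj;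
      rewrite -src_el ?ka' ?kb' src_el ?ua' ?ub'.
  - by apply: (@ap_inj E cE) => x; rewrite !apM; apply: inj;
      rewrite -tgt_el ?ka' ?kb' tgt_el ?ua' ?ub'.
  - apply: (@ap_inj E cE) => x; rewrite !apM; apply: (prod_el cE oneP pr).1.
      by rewrite ka' !idn_el ua'.
    by rewrite kb' !idn_el ub'.
  exists u; split; apply: hom_faithful; rewrite ?fmapM ?uc //=.
  + by rewrite uo ua.
  + by rewrite uo ub.
apply: hom_faithful.
  apply: (prod_eq (IH _ _ _ _ _ lp)).
  - by have := congr1 (fun w : hom T X => h_obj w) ea.
  - by have := congr1 (fun w : hom T Y => h_obj w) eb.
by apply: (prod_eq pr); rewrite -!fmapM ?ea ?eb.
Qed.

Lemma prod_nGrd n (X Y : nGrd E n) : exists (P : nGrd E n) (a : hom P X) (b : hom P Y), lprod a b.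
Proof.
elim: n X Y => [|n IH] X Y; first exact: (prod_ex_el cE oneP X Y).
have [P [a [b lp]]] := IH (under X) (under Y); have pr := lprod_cells lp.
have [inj _] := prod_el cE oneP pr.
have [Q [p [q pq]]] := prod_ex_el cE oneP (cells E n.+1 X) (cells E n.+1 Y).
have [pinj psur] := prod_el cE oneP pq.
have [s sE] := prod_hom oneP pr (ap_is_hom cE (src X ∘ p)) (ap_is_hom cE (src Y ∘ q)).
have [t tE] := prod_hom oneP pr (ap_is_hom cE (tgt X ∘ p)) (ap_is_hom cE (tgt Y ∘ q)).
have [i iE] := prod_hom oneP pq (ap_is_hom cE (idn X ∘ cmap n a)) (ap_is_hom cE (idn Y ∘ cmap n b)).
have cm : compat cE s t i.
  apply: (compat_joint (oneP := oneP)).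
  - apply: (@ap_inj E cE) => x; rewrite apM ap1; apply: inj.
      by rewrite (sE _).1 apM (iE _).1 apM src_idn.
    by rewrite (sE _).2 apM (iE _).2 apM src_idn.
  - apply: (@ap_inj E cE) => x; rewrite apM ap1; apply: inj.
      by rewrite (tE _).1 apM (iE _).1 apM tgt_idn.
    by rewrite (tE _).2 apM (iE _).2 apM tgt_idn.
  - move=> w; apply: (lprod_parel lp).
      by rewrite (sE w).1 (tE w).1 !apM; exact: parel_src.
    by rewrite (sE w).2 (tE w).2 !apM; exact: parel_src.
  - move=> W k H; have [||u uE] := @prod_hom E cE one oneP _ _ _ _ p q (fun w => p @ k w) (fun w => q @ k w) pq.
    + apply: H; exists (under X), (src X), (tgt X), (idn X), a; split; first exact: compat_under.
      * by apply: (@ap_inj E cE) => x; rewrite !apM (sE x).1 apM.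
      * by apply: (@ap_inj E cE) => x; rewrite !apM (tE x).1 apM.
      * by apply: (@ap_inj E cE) => x; rewrite !apM (iE x).1 apM.
    + apply: H; exists (under Y), (src Y), (tgt Y), (idn Y), b; split; first exact: compat_under.
      * by apply: (@ap_inj E cE) => x; rewrite !apM (sE x).2 apM.
      * by apply: (@ap_inj E cE) => x; rewrite !apM (tE x).2 apM.
      * by apply: (@ap_inj E cE) => x; rewrite !apM (iE x).2 apM.
    + by exists u => w; apply: pinj; rewrite ?(uE w).1 ?(uE w).2.
have [G [j [k [jk kj sj tj ji]]]] := ext_nGrd cm.
have [|||a' [ao ac]] := @hom_full E cE n (GrdOb G) X a (p ∘ j).
- by rewrite -sj; apply: (@ap_inj E cE) => x; rewrite !apM (sE _).1 apM.
- by rewrite -tj; apply: (@ap_inj E cE) => x; rewrite !apM (tE _).1 apM.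
- by rewrite -cmpA ji; apply: (@ap_inj E cE) => x; rewrite !apM (iE _).1 apM.
have [|||b' [bo bc]] := @hom_full E cE n (GrdOb G) Y b (q ∘ j).
- by rewrite -sj; apply: (@ap_inj E cE) => x; rewrite !apM (sE _).2 apM.
- by rewrite -tj; apply: (@ap_inj E cE) => x; rewrite !apM (tE _).2 apM.
- by rewrite -cmpA ji; apply: (@ap_inj E cE) => x; rewrite !apM (iE _).2 apM.
exists (GrdOb G), a', b'; split; first by rewrite ao bo.
rewrite ac bc; apply: (prod_elI (cE := cE) (oneP := oneP)) => [z z'|x y].
  by rewrite !apM => e0 e1; rewrite -(iso_el kj z) -(iso_el kj z') (pinj _ _ e0 e1).
by move=> /psur [z [<- <-]]; exists (k @ z); rewrite !apM (iso_el jk).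
Qed.

Lemma asph_prod n (P X Y : nGrd E n) (a : hom P X) (b : hom P Y) :
  lprod a b -> asph X -> asph Y -> asph P.
Proof.
elim: n P X Y a b => [|n IH] P X Y a b.
  move=> /(prod_el cE oneP) [_ sur] sX sY y; have [x xy] := sX y; have [x' x'y] := sY y.
  have [|z [za zb]] := sur x x'; first by rewrite xy x'y.
  by exists z; rewrite -xy -za bang_ap.
move=> [lp /(prod_el cE oneP) [_ sur]] [aX sX] [aY sY]; split; first exact: IH lp aX aY.
have [inj _] := prod_el cE oneP (lprod_cells lp).
move=> x y xy; have [f [fs ft]] := sX _ _ (parel_hom (h_obj a) xy).
have [g [gs gt]] := sY _ _ (parel_hom (h_obj b) xy).
have [|z [za zb]] := sur f g.
  by rewrite -(bang_ap oneP (src X)) -(bang_ap oneP (src Y)) fs gs !bang_ap.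
by exists z; split; apply: inj; rewrite -?src_el -?tgt_el ?za ?zb.
Qed.

Lemma lprod_iso n (P P' X Y : nGrd E n) (a : hom P X) (b : hom P Y) (i : hom P' P) (j : hom P P') :
  i ∘ j = idm P -> j ∘ i = idm P' -> lprod a b -> lprod (a ∘ i) (b ∘ i).
Proof.
have prI (X' Y' Q Q' : E) (p : hom Q X') (q : hom Q Y') (u : hom Q' Q) (v : hom Q Q') :
    u ∘ v = idm Q -> v ∘ u = idm Q' -> is_product p q -> is_product (p ∘ u) (q ∘ u).
  move=> uv vu /(pb_prod (bang X') (bang Y') p q oneP) pb.
  by apply/(pb_prod (bang X') (bang Y') _ _ oneP); exact: pb_iso pb uv vu.
elim: n P P' X Y a b i j => [|n IH] P P' X Y a b i j ij ji; first exact: prI ij ji.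
move=> [lp pr]; split.
  apply: (IH _ _ _ _ _ _ (h_obj i) (h_obj j)) lp; first by have := congr1 (fun w : hom P P => h_obj w) ij.
  by have := congr1 (fun w : hom P' P' => h_obj w) ji.
by rewrite !fmapM; apply: (prI _ _ _ _ _ _ _ (cmap n.+1 j)) pr; rewrite -fmapM ?ij ?ji fmap1.
Qed.

Lemma product_lprod n (P X Y : nGrd E n) (a : hom P X) (b : hom P Y) :
  is_product a b -> lprod a b.
Proof.
move=> pr; have [Q [r [s rs]]] := prod_nGrd X Y; have pr' := lprod_univ rs.
have [i [ia ib]] := prod_lift pr' a b; have [j [ja jb]] := prod_lift pr r s.
rewrite -ia -ib; apply: (lprod_iso (j := j)) rs.
- by apply: (prod_eq pr'); rewrite cmpA ?ia ?ib ?ja ?jb cmpm1.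
- by apply: (prod_eq pr); rewrite cmpA ?ja ?jb ?ia ?ib cmpm1.
Qed.

(** ** The n-groupoid with a single nontrivial level *)

Fixpoint lterm n : nGrd E n -> Prop :=
  match n with
  | 0 => fun X => is_terminal (C := E) X
  | n'.+1 => fun X => @lterm n' (under X) /\ is_terminal (cells E n'.+1 X)
  end.

Lemma lterm_cells n (X : nGrd E n) : lterm X -> is_terminal (cells E n X).
Proof. by case: n X => [|n] X //= []. Qed.

Lemma term_el (T : E) (x y : el T) : is_terminal T -> bang T @ x = bang T @ y -> x = y.
Proof.
move=> tT e; have [h _] := term_hom one tT.
by rewrite -(ap1 x) -(ap1 y) (term_eq (idm T) (h ∘ bang T) tT) !apM e.
Qed.

Lemma tmc_term T : is_terminal T -> tmc cE T.
Proof.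
move=> tT W x y z [h hx] [k ky] [l lz]; exists h => w.
by rewrite -hx -ky -lz -(term_eq h k tT) -(term_eq h l tT) tmr.
Qed.

Lemma lterm_ex n : exists X : nGrd E n, lterm X.
Proof.
elim: n => [|n [X tX]]; first by exists one.
have tc := lterm_cells tX.
have [|G [j [k [jk kj _ _ _]]]] := @ext_nGrd n X _ (idm _) (idm _) (idm _).
  by apply: (compat_tmc (oneP := oneP) (tmc_term tc)); rewrite ?cmp1m // => q; exact: parel_refl.
exists (GrdOb G); split=> // Y; have [h _] := term_hom Y tc.
by exists (k ∘ h); split=> // v _; rewrite -[v]cmp1m -kj -cmpA; congr cmp; exact: term_eq.
Qed.

Lemma lterm_hom n (X T : nGrd E n) : lterm T -> exists h : hom X T, True.
Proof.
elim: n X T => [|n IH] X T; first exact: term_hom.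
move=> [tT tc]; have [h _] := IH (under X) _ tT; have [k _] := term_hom (cells E n.+1 X) tc.
by have [|||u _] := @hom_full E cE n X T h k; [exact: term_eq (lterm_cells tT)
  | exact: term_eq (lterm_cells tT) | exact: term_eq tc | exists u].
Qed.

Lemma lterm_asph n (T : nGrd E n) : lterm T -> asph T.
Proof.
elim: n T => [|n IH] T tT.
  move=> y; have [h _] := term_hom one tT; exists (h @ y).
  by rewrite bang_ap -(term_eq (idm one) (bang one) oneP) ap1.
case: tT => tT tc; split; [exact: IH | move=> x y /(parel_bang (cE := cE)) e].
have -> : y = x by apply: term_el (lterm_cells tT) (esym e).
by exists (idn T @ x); rewrite src_idn tgt_idn.
Qed.

Definition null_idn n : forall (K : nGrd E n) (A : E) (z : hom one A) (j : hom (cells E n K) A), Prop :=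
  match n with
  | 0 => fun _ _ _ _ => True
  | n'.+1 => fun K A z j => forall y, j @ (idn K @ y) = z @ (bang _ @ y)
  end.

(** [K] is the Eilenberg-Mac Lane n-groupoid [K(A, n)]: its n-cells form [A], and all
    lower levels are terminal. *)
Lemma null_ex n (A : E) (z : hom one A) : tmc cE A ->
  exists (K : nGrd E n) (j : hom (cells E n K) A) (k : hom A (cells E n K)),
    [/\ j ∘ k = idm _, k ∘ j = idm _,
        [/\ asph K, null_idn z j & forall x y, bang _ @ x = bang _ @ y -> parel n K x y]
      & forall X : nGrd E n, exists h : hom X K, forall x, j @ (cmap n h @ x) = z @ (bang _ @ x)].
Proof.
move=> cA; case: n => [|n].
  exists A, (idm A), (idm A); rewrite cmp1m; split=> //; first split=> //.
    by move=> y; exists (z @ y); rewrite bang_ap -(term_eq (idm one) (bang one) oneP) ap1.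
  by move=> X; exists (z ∘ bang X) => x; rewrite ap1 apM.
have [T tT] := lterm_ex n; have tc := lterm_cells tT.
have [s _] := term_hom A tc.
have [|G [j [k [jk kj sj tj ji]]]] := @ext_nGrd n T A s s (z ∘ bang _).
  by apply: (compat_tmc (oneP := oneP) cA) => [||q]; [exact: term_eq tc | exact: term_eq tc | exact: parel_refl].
exists (GrdOb G), j, k; split=> //.
  split; [|by move=> y; rewrite -apM ji apM |];
    last by move=> x y e; split; apply: term_el tc _; rewrite !bang_ap.
  split; first exact: lterm_asph.
  move=> x y /(parel_bang (cE := cE)) e; have -> : y = x by apply: term_el tc (esym e).
  by exists (@idn E n (GrdOb G) @ x); rewrite src_idn tgt_idn.
move=> X; have [h _] := lterm_hom (under X) tT.
have [|||u [_ uc]] := @hom_full E cE n X (GrdOb G) h (k ∘ z ∘ bang _).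
- exact: term_eq tc.
- exact: term_eq tc.
- have -> : @idn E n (GrdOb G) = k ∘ (z ∘ bang _) by rewrite -ji cmpA kj cmp1m.
  by apply: (@ap_inj E cE) => x; rewrite !apM !bang_ap.
by exists u => x; rewrite uc !apM (iso_el jk).
Qed.

(** ** Quotients of the top cells *)

(** Quotients that identify parallel n-cells only leave the lower levels unchanged. *)
Lemma quot_nGrd n (X : nGrd E n) Q (q : hom (cells E n X) Q) : surj cE q ->
  (forall x y, q @ x = q @ y -> parel n X x y) ->
  exists (Z : nGrd E n) (h : hom X Z),
    [/\ surj cE (cmap n h), forall x y, cmap n h @ x = cmap n h @ y <-> q @ x = q @ y,
        forall x y, parel n Z (cmap n h @ x) (cmap n h @ y) -> parel n X x y,
        asph X -> asph Z
      & forall (T : nGrd E n) (g : hom X T),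
          (forall x y, q @ x = q @ y -> cmap n g @ x = cmap n g @ y) ->
          exists u : hom Z T, forall x, cmap n u @ (cmap n h @ x) = cmap n g @ x].
Proof.
case: n X q => [|n] X q sq qp.
  exists Q, q; split=> //.
  - by move=> x y; rewrite /= !bang_ap.
  - by move=> aX y; have [x xy] := aX y; exists (q @ x); rewrite bang_ap.
  - by move=> T g H; have [u uq] := desc_el sq H; exists u => x; rewrite /= -apM uq.
have [|s sq'] := desc_el (h := src X) sq; first by move=> x y /qp [].
have [|t tq'] := desc_el (h := tgt X) sq; first by move=> x y /qp [].
have cm : compat cE s t (q ∘ idn X).
  by apply: compat_desc => //; rewrite sq' tq'; exact: compat_under.
have [G [j [k [jk kj sj tj ji]]]] := ext_nGrd cm.
have [|||h [ho hc]] := @hom_full E cE n X (GrdOb G) (idm _) (k ∘ q).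
- by rewrite -sj cmpA -(cmpA s) jk cmpm1 sq' fmap1 cmp1m.
- by rewrite -tj cmpA -(cmpA t) jk cmpm1 tq' fmap1 cmp1m.
- by rewrite fmap1 cmpm1 -cmpA -ji cmpA kj cmp1m.
have hE x : cmap n.+1 h @ x = k @ (q @ x) by rewrite hc apM.
have hsur : surj cE (cmap n.+1 h).
  by move=> i; have [x xE] := sq (j @ i); exists x; rewrite hE xE (iso_el kj).
exists (GrdOb G), h; split=> //.
- move=> x y; rewrite !hE; split=> [e|-> //].
  by rewrite -(iso_el jk (q @ x)) e (iso_el jk).
- by move=> x y; rewrite /parel !src_el !tgt_el ho fmap1 !ap1.
- move=> [aX sX]; split=> // x y /sX [f [fs ft]]; exists (cmap n.+1 h @ f).
  by rewrite src_el tgt_el ho fmap1 !ap1 fs ft.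
move=> T g H; have [l lq] := desc_el sq H.
have lE x : l @ (j @ (cmap n.+1 h @ x)) = cmap n.+1 g @ x by rewrite hE (iso_el jk) -apM lq.
have [|||u [_ uc]] := @hom_full E cE n (GrdOb G) T (h_obj g) (l ∘ j).
- apply: (@ap_inj E cE) => i; have [x <-] := hsur i; rewrite !apM lE !src_el ho fmap1 ap1 //.
- apply: (@ap_inj E cE) => i; have [x <-] := hsur i; rewrite !apM lE !tgt_el ho fmap1 ap1 //.
- apply: (@ap_inj E cE) => x.
  have -> : (l ∘ j ∘ @idn E n (GrdOb G)) @ x = cmap n.+1 g @ (idn X @ x).
    by rewrite -lE idn_el ho fmap1 ap1 !apM.
  by rewrite idn_el apM.
by exists u => x; rewrite uc apM lE.
Qed.

(** ** Cartesian lifts *)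

(** The (n+1)-cells of [Z] are those of [X] with ends prescribed in the n-groupoid under
    [Z]: full faithfulness on elements and on maps. *)
Definition cartesian n (Z X : nGrd E n.+1) (g : hom Z X) :=
  [/\ forall f x y, parel n (under Z) x y -> cmap n (h_obj g) @ x = src X @ f ->
        cmap n (h_obj g) @ y = tgt X @ f ->
        exists f', [/\ cmap n.+1 g @ f' = f, src Z @ f' = x & tgt Z @ f' = y],
      forall f f', cmap n.+1 g @ f = cmap n.+1 g @ f' -> src Z @ f = src Z @ f' ->
        tgt Z @ f = tgt Z @ f' -> f = f'
    & forall W (a : el W -> _) (x y : el W -> _), is_hom cE a -> is_hom cE x -> is_hom cE y ->
        (forall w, [/\ parel n (under Z) (x w) (y w), cmap n (h_obj g) @ (x w) = src X @ (a w)
            & cmap n (h_obj g) @ (y w) = tgt X @ (a w)]) ->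
        exists u : hom W (cells E n.+1 Z), forall w,
          [/\ cmap n.+1 g @ (u @ w) = a w, src Z @ (u @ w) = x w & tgt Z @ (u @ w) = y w]].

Lemma cart_ex n (X : nGrd E n.+1) (x' : nGrd E n) (h : hom x' (under X)) :
  exists (G : groupoid (pt (S := S n) x')) (g : hom (GrdOb G : nGrd E n.+1) X),
    h_obj g = h /\ @cartesian n (GrdOb G) X g.
Proof.
have [P [p [q pq]]] := par_ex cE oneP (under X); have [inj _ _] := par_el cE oneP pq.
have [P' [p' [q' pq']]] := par_ex cE oneP x'; have [inj' par' sur'] := par_el cE oneP pq'.
have [u uE] := par_lift pq (ap_is_hom cE (src X)) (ap_is_hom cE (tgt X)) (@parel_src E cE one oneP n X).
have [|||v vE] := @par_lift E cE one oneP n (under X) P p q P' (fun w => (cmap n h ∘ p') @ w)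
  (fun w => (cmap n h ∘ q') @ w) pq; [exact: ap_is_hom | exact: ap_is_hom | |].
  by move=> w; rewrite !apM; apply: parel_hom; exact: par'.
have [Q [r [c [pb rinj rsur]]]] := pb_el cE u v.
have rc z : u @ (r @ z) = v @ (c @ z) by rewrite -!apM pb.1.
have srcE z : cmap n h @ (p' @ (c @ z)) = src X @ (r @ z).
  by rewrite -(uE _).1 rc (vE _).1 apM.
have tgtE z : cmap n h @ (q' @ (c @ z)) = tgt X @ (r @ z).
  by rewrite -(uE _).2 rc (vE _).2 apM.
have [|||d dE] := @par_lift E cE one oneP n x' P' p' q' (cells E n x') id id pq';
  [exact: id_is_hom | exact: id_is_hom | |].
  by move=> w; exact: parel_refl.
have [|||i iE] := @pb_hom E cE _ _ _ _ (cells E n x') _ _ _ _ (fun w => (idn X ∘ cmap n h) @ w)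
  (fun w => d @ w) pb; [exact: ap_is_hom | exact: ap_is_hom | |].
  move=> w; apply: inj.
  + by rewrite (uE _).1 (vE _).1 !apM src_idn (dE w).1.
  + by rewrite (uE _).2 (vE _).2 !apM tgt_idn (dE w).2.
pose s := p' ∘ c; pose t := q' ∘ c.
have qinj z z' : r @ z = r @ z' -> s @ z = s @ z' -> t @ z = t @ z' -> z = z'.
  rewrite !apM => e0 e1 e2; apply: rinj => //; exact: inj'.
have qhom W (a : el W -> _) (x y : el W -> _) : is_hom cE a -> is_hom cE x -> is_hom cE y ->
    (forall w, [/\ parel n x' (x w) (y w), cmap n h @ (x w) = src X @ (a w)
        & cmap n h @ (y w) = tgt X @ (a w)]) ->
    exists k : hom W Q, forall w, [/\ r @ (k @ w) = a w, s @ (k @ w) = x w & t @ (k @ w) = y w].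
  move=> ha hx hy H; have [|b bE] := @par_lift E cE one oneP n x' P' p' q' W x y pq' hx hy.
    by move=> w; case: (H w).
  have [|k kE] := @pb_hom E cE _ _ _ _ W _ _ _ _ a (fun w => b @ w) pb ha (ap_is_hom cE b).
    move=> w; case: (H w) => _ H0 H1; apply: inj.
    + by rewrite (uE _).1 (vE _).1 apM (bE w).1 H0.
    + by rewrite (uE _).2 (vE _).2 apM (bE w).2 H1.
  by exists k => w; rewrite !apM (kE w).1 (kE w).2 (bE w).1 (bE w).2.
have spar z : parel n x' (s @ z) (t @ z) by rewrite !apM; exact: par'.
have si : s ∘ i = idm _ by apply: (@ap_inj E cE) => x; rewrite !apM (iE x).2 (dE x).1 ap1.
have ti : t ∘ i = idm _ by apply: (@ap_inj E cE) => x; rewrite !apM (iE x).2 (dE x).2 ap1.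
have si' x : s @ (i @ x) = x by rewrite -apM si ap1.
have ti' x : t @ (i @ x) = x by rewrite -apM ti ap1.
have ri x : r @ (i @ x) = idn X @ (cmap n h @ x) by rewrite (iE x).1 apM.
have cmp' : comph cE s t i.
  move=> W a b ha hb ab; have [_ _ cmX] := compat_refl (compat_under cE X).
  have m := cmX W _ _ (hom_comp r ha) (hom_comp r hb).
  have [|w|k kE] := qhom W _ _ _ (m _) (hom_comp s ha) (hom_comp t hb).
  - by move=> w; rewrite -tgtE -srcE -!(apM _ c) -/s -/t ab.
  - have ra : src X @ (r @ b w) = tgt X @ (r @ a w).
      by rewrite -tgtE -srcE -!(apM _ c) -/s -/t ab.
    rewrite !tm_nat src_idn tgt_idn ra tmr tml -srcE -tgtE -!(apM _ c); split=> //.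
    have := parel_trans (spar (a w)); rewrite ab => H.
    exact: H (spar (b w)).
  exists k => w; have [k0 k1 k2] := kE w; apply: qinj.
  + by rewrite k0 !tm_nat ri -tgtE -(apM _ c).
  + by rewrite k1 !tm_nat si' -ab tmr.
  + by rewrite k2 !tm_nat ti' tml.
have cm : compat cE s t i.
  destruct n as [|n]; first by [].
  have ss : src x' ∘ s = src x' ∘ t by apply: (@ap_inj E cE) => z; rewrite (apM _ s) (apM _ t); case: (spar z).
  have tt : tgt x' ∘ s = tgt x' ∘ t by apply: (@ap_inj E cE) => z; rewrite (apM _ s) (apM _ t); case: (spar z).
  split=> //; split=> //; apply: (compat_joint (oneP := oneP)).
  - by rewrite -cmpA (cmpA s) si cmp1m; apply: (@ap_inj E cE) => x; rewrite apM src_idn ap1.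
  - by rewrite -cmpA (cmpA s) si cmp1m; apply: (@ap_inj E cE) => x; rewrite apM tgt_idn ap1.
  - by move=> z; rewrite (apM (src x')) (apM (tgt x')); exact: parel_src.
  move=> W k H; have [_ [_ _ cu]] := compat_under cE X; have cx := compat_under cE x'.
  have hr : is_hom cE (fun w => r @ k w).
    apply: H; exists (under (under X)), (src (under X) ∘ src X), (tgt (under X) ∘ src X),
      (idn X ∘ idn (under X)), (h_obj h); split=> //; apply: (@ap_inj E cE) => z.
    - by rewrite !apM -srcE src_el.
    - by rewrite !apM -srcE tgt_el.
    - by rewrite !apM ri idn_el.
  have hs : is_hom cE (fun w => s @ k w).
    apply: H; exists (under x'), (src x'), (tgt x'), (idn x'), (idm _).
    by rewrite fmap1 !cmp1m cmpm1 cmpA si cmp1m.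
  have ht : is_hom cE (fun w => t @ k w).
    apply: H; exists (under x'), (src x'), (tgt x'), (idn x'), (idm _).
    by rewrite fmap1 !cmp1m cmpm1 cmpA ti cmp1m ss tt.
  have [w|l lE] := qhom W _ _ _ hr hs ht.
    by rewrite -srcE -tgtE -!(apM _ c); split=> //; exact: spar.
  by exists l => w; have [l0 l1 l2] := lE w; exact: qinj.
have [G [j [k [jk kj sj tj ji]]]] := ext_nGrd cm.
have sE z : @src E n (GrdOb G) @ z = s @ (j @ z) by rewrite -sj apM.
have tE z : @tgt E n (GrdOb G) @ z = t @ (j @ z) by rewrite -tj apM.
have [|||g [go gc]] := @hom_full E cE n (GrdOb G) X h (r ∘ j).
- by apply: (@ap_inj E cE) => z; rewrite !apM sE -srcE apM.
- by apply: (@ap_inj E cE) => z; rewrite !apM tE -tgtE apM.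
- by rewrite -cmpA ji; apply: (@ap_inj E cE) => z; rewrite !apM ri.
exists G, g; split=> //; rewrite /cartesian go gc; split.
- move=> f x y /sur' [z [zx zy]] e0 e1; have [|w [wr wc]] := rsur f z.
    apply: inj; first by rewrite (uE _).1 (vE _).1 apM zx e0.
    by rewrite (uE _).2 (vE _).2 apM zy e1.
  by exists (k @ w); rewrite apM sE tE (iso_el jk) !apM wr wc zx zy.
- move=> f f'; rewrite !apM !sE !tE => e0 e1 e2.
  by rewrite -(iso_el kj f) -(iso_el kj f') (qinj _ _ e0 e1 e2).
- move=> W a x y ha hx hy H; have [l lE] := qhom W a x y ha hx hy H.
  by exists (k ∘ l) => w; have [l0 l1 l2] := lE w; rewrite !apM sE tE (iso_el jk).
Qed.

(** Objects of objects, at the lowest level. *)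
Fixpoint bot n : functor (nGrd E n) E :=
  match n with
  | 0 => id_functor E
  | n'.+1 => cmp_functor (bot n') (obj_functor (S n'))
  end.

Fixpoint lcart n : forall (Z X : nGrd E n) (g : hom Z X), Prop :=
  match n with
  | 0 => fun _ _ _ => True
  | n'.+1 => fun Z X g => @lcart n' (under Z) (under X) (h_obj g) /\ @cartesian n' Z X g
  end.

(** Change of objects along [e], by cartesian lifts at all levels in turn. *)
Lemma lcart_ex n (X : nGrd E n) F (e : hom F (bot n X)) :
  exists (Z : nGrd E n) (g : hom Z X) (j : hom (bot n Z) F) (k : hom F (bot n Z)),
    [/\ lcart g, j ∘ k = idm _, k ∘ j = idm _ & e ∘ j = fmap (bot n) g].
Proof.
elim: n X F e => [|n IH] X F e.
  by exists F, e, (idm F), (idm F); rewrite cmp1m cmpm1.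
have [Z [g [j [k [lg jk kj ej]]]]] := IH (under X) F e.
have [G [g' [go cg]]] := cart_ex (X := X) g.
exists (GrdOb G), g', j, k; split=> //; first by split=> //; rewrite go.
by rewrite ej -go.
Qed.

Lemma lcart_univ n (Z X T : nGrd E n) (g : hom Z X) (f : hom T X) (b : hom (bot n T) (bot n Z)) :
  lcart g -> fmap (bot n) g ∘ b = fmap (bot n) f ->
  exists u : hom T Z, g ∘ u = f /\ fmap (bot n) u = b.
Proof.
elim: n Z X T g f b => [|n IH] Z X T g f b; first by move=> _ e; exists b.
move=> [lg [_ c1 c2]] /(IH _ _ _ _ _ _ lg) [u0 [gu0 bu0]].
have gE x : cmap n (h_obj g) @ (cmap n u0 @ x) = cmap n (h_obj f) @ x by rewrite -apM -fmapM gu0.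
have [|k kE] := c2 _ _ _ _ (ap_is_hom cE (cmap n.+1 f)) (ap_is_hom cE (cmap n u0 ∘ src T))
  (ap_is_hom cE (cmap n u0 ∘ tgt T)).
  move=> w; rewrite !apM !gE src_el tgt_el; split=> //.
  by apply: parel_hom; exact: parel_src.
have [|||u [uo uc]] := @hom_full E cE n T Z u0 k.
- by apply: (@ap_inj E cE) => w; rewrite apM; case: (kE w).
- by apply: (@ap_inj E cE) => w; rewrite apM; case: (kE w).
- apply: (@ap_inj E cE) => x; have [k0 k1 k2] := kE (idn T @ x).
  apply: c1; rewrite !apM ?k0 ?k1 ?k2 ?apM ?src_idn ?tgt_idn //.
  by rewrite !idn_el gE.
exists u; split; last by rewrite -bu0 -uo.
apply: hom_faithful; first by rewrite /= uo gu0.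
by rewrite fmapM uc; apply: (@ap_inj E cE) => w; rewrite apM; case: (kE w).
Qed.

(** Only surjectivity on objects matters, because cells of [Z] are the cells of [X]
    between them. *)
Lemma lcart_asph n (Z X : nGrd E n) (g : hom Z X) :
  lcart g -> surj cE (fmap (bot n) g) -> asph X -> asph Z.
Proof.
elim: n Z X g => [|n IH] Z X g.
  by move=> _ sg aX y; have [x <-] := aX y; have [z <-] := sg x; exists z; rewrite bang_ap.
move=> [lg [c0 _ _]] sg [aX sX]; split; first exact: IH lg sg aX.
move=> x y xy; have [f [fs ft]] := sX _ _ (parel_hom (h_obj g) xy).
by have [f' [_ ? ?]] := c0 f x y xy (esym fs) (esym ft); exists f'.
Qed.

End Constructions.
Arguments cartesian {E} cE {one} oneP {n Z X} g.
Arguments lcart {E} cE {one} oneP {n Z X} g.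
Arguments bot {E} n.
Arguments null_idn {E} cE {one} oneP {n K A} z j.

(** * Labelled higher groupoids *)

Section Labels.
Variables (E : category) (cE : conc E) (A : abgroup E).
Local Notation el := (@el E cE).
Local Notation "f @ x" := (@ap E cE _ _ f x) (at level 20).
Local Notation tm := (@mal E cE _).
Local Notation S := (grd_tower E).
Local Notation cmap n f := (fmap (cells E n) f).
Local Notation oneP := (@ag_oneP E A).
Local Notation bang := (to_one oneP).
Local Notation parel := (parel cE oneP).
Local Notation asph := (asph cE oneP).

Definition nul (y : el (ag_one A)) : el A := ag_zero A @ y.

Lemma bang_nul y : bang A @ nul y = y.
Proof. by rewrite bang_ap -(term_eq (idm _) (bang _) oneP) ap1. Qed.

Lemma ag_addE s :
  ag_add A @ s = tm (ag_fst A @ s) (nul (bang _ @ s)) (ag_snd A @ s).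
Proof.
have [u [u0 u1 u2]] := ag_add0 (idm A) (bang A).
have [v [v0 v1 v2]] := ag_addC (ag_add0 (idm A) (bang A)).
have [inj _] := prod_el cE oneP (@ag_sqP _ A).
have U0 x : ag_fst A @ (u @ x) = nul (bang _ @ x) by rewrite -apM u0 apM.
have U1 x : ag_snd A @ (u @ x) = x by rewrite -apM u1 ap1.
have U2 x : ag_add A @ (u @ x) = x by rewrite -apM u2 ap1.
have V0 x : ag_fst A @ (v @ x) = x by rewrite -apM v0 ap1.
have V1 x : ag_snd A @ (v @ x) = nul (bang _ @ x) by rewrite -apM v1 apM.
have V2 x : ag_add A @ (v @ x) = x by rewrite -apM v2 ap1.
have e : s = tm (v @ (ag_fst A @ s)) (u @ nul (bang _ @ s)) (u @ (ag_snd A @ s)).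
  apply: inj; rewrite !tm_nat ?U0 ?U1 ?V0 ?V1 ?bang_nul ?bang_ap ?tmr ?tml //.
by rewrite {1}e !tm_nat V2 !U2.
Qed.

Lemma ag_sumE T (x y z : hom T A) :
  ag_sum x y z <-> forall w, z @ w = tm (x @ w) (nul (bang T @ w)) (y @ w).
Proof.
split=> [[u [<- <- <-]] w|H]; first by rewrite !apM ag_addE bang_ap.
have [u [ux uy]] := prod_lift (@ag_sqP _ A) x y; exists u; split=> //.
by apply: (@ap_inj E cE) => w; rewrite apM ag_addE bang_ap H -!apM ux uy.
Qed.

Lemma ag_add_hom W (a b : el W -> el A) : is_hom cE a -> is_hom cE b ->
  is_hom cE (fun w => tm (a w) (nul (bang W @ w)) (b w)).
Proof.
move=> ha hb; have [u uE] := prod_hom oneP (@ag_sqP _ A) ha hb.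
by exists (ag_add A ∘ u) => w; rewrite apM ag_addE (uE w).1 (uE w).2 bang_ap.
Qed.

Lemma nul_hom W : is_hom cE (fun w : el W => nul (bang W @ w)).
Proof. by exists (ag_zero A ∘ bang W) => w; rewrite apM. Qed.

Lemma ag_oppE x : ag_opp A @ x = tm (nul (bang A @ x)) x (nul (bang A @ x)).
Proof.
have /ag_sumE /(_ x) := ag_addN (idm A) (bang A).
rewrite cmpm1 apM ap1 -/(nul _) => e.
by rewrite {1}e tmA tml tmr.
Qed.

Lemma ag_tmc : tmc cE A.
Proof.
move=> W x y z hx hy hz; have ho := hom_comp (ag_opp A) hy.
apply: is_hom_ext (ag_add_hom (ag_add_hom hx ho) hz) => w.
by rewrite ag_oppE (hom_bang1 _ _ hy) !tmA tml -tmA tmr.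
Qed.

Lemma ag_addCE a b y : bang A @ a = y -> bang A @ b = y -> tm a (nul y) b = tm b (nul y) a.
Proof.
move=> ay bY; have [_ sur] := prod_el cE oneP (@ag_sqP _ A).
have [|s [sa sb]] := sur a b; first by rewrite ay bY.
have h : ag_sum (ag_fst A) (ag_snd A) (ag_add A) by exists (idm _); rewrite !cmpm1.
have /ag_sumE /(_ s) := ag_addC h; rewrite ag_addE sa sb.
by have -> : bang _ @ s = y by rewrite -ay -sa bang_ap.
Qed.

(** A label is a map from parallel n-cells to [A] that is zero on the diagonal; in a
    Mal'cev category it is then additive ([l_add]). A cocycle is a directed label; labels
    in general are stable under restriction along arbitrary functors. *)
Record lab n := Lab {
  l_ob : nGrd E n;
  l_asph : asph l_ob;
  l_v : el (cells E n l_ob) -> el (cells E n l_ob) -> el A;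
  l_hom : forall W (a b : el W -> el (cells E n l_ob)), is_hom cE a -> is_hom cE b ->
    (forall w, parel n l_ob (a w) (b w)) -> is_hom cE (fun w => l_v (a w) (b w));
  l_0 : forall f, l_v f f = nul (bang _ @ f) }.

Definition lmor n (X Z : lab n) := exists h : hom (l_ob X) (l_ob Z),
  forall f g, parel n (l_ob X) f g -> l_v (cmap n h @ f) (cmap n h @ g) = l_v f g.

Definition lsum n (X X' Z : lab n) :=
  exists (P : nGrd E n) (a : hom P (l_ob X)) (a' : hom P (l_ob X')) (h : hom P (l_ob Z)),
    lprod a a' /\ forall f g, parel n P f g -> l_v (cmap n h @ f) (cmap n h @ g) =
      tm (l_v (cmap n a @ f) (cmap n a @ g)) (nul (bang _ @ f)) (l_v (cmap n a' @ f) (cmap n a' @ g)).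

(** The label and the first cell of a parallel pair determine the second, as for torsors. *)
Definition directed n (X : lab n) :=
  (forall (f : el (cells E n (l_ob X))) a, bang _ @ f = bang A @ a ->
     exists g, parel n (l_ob X) f g /\ l_v f g = a) /\
  (forall f g g', parel n (l_ob X) f g -> parel n (l_ob X) f g' ->
     l_v f g = l_v f g' :> el A -> g = g').

Lemma lmor_refl n (X : lab n) : lmor X X.
Proof. by exists (idm _) => f g _; rewrite fmap1 !ap1. Qed.

Lemma lmor_trans n (X Y Z : lab n) : lmor X Y -> lmor Y Z -> lmor X Z.
Proof.
move=> [h hE] [k kE]; exists (k ∘ h) => f g fg.
by rewrite fmapM !apM kE ?hE //; exact: parel_hom.
Qed.

Section LabTheory.
Variables (n : nat) (X : lab n).
Local Notation parelX := (parel n (l_ob X)).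
Implicit Types f g h : el (cells E n (l_ob X)).
Local Notation v := (@l_v n X).

Lemma l_par : exists (P : E) (p q : hom P (cells E n (l_ob X))) (k : hom P A),
  [/\ is_par p q, jinj cE p q, forall z, parelX (p @ z) (q @ z),
      forall f g, parelX f g -> exists z, p @ z = f /\ q @ z = g
    & forall z, k @ z = v (p @ z) (q @ z)].
Proof.
have [P [p [q pq]]] := par_ex cE oneP (l_ob X); have [inj par sur] := par_el cE oneP pq.
have [k kE] := l_hom (ap_is_hom cE p) (ap_is_hom cE q) par.
by exists P, p, q, k.
Qed.

(** Labels are maps, so they commute with [tm]. *)
Lemma l_tm f g f' g' f'' g'' : parelX f g -> parelX f' g' -> parelX f'' g'' ->
  v (tm f f' f'') (tm g g' g'') = tm (v f g) (v f' g') (v f'' g'').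
Proof.
have [P [p [q [k [_ _ _ sur kE]]]]] := l_par.
move=> /sur [z [<- <-]] /sur [z' [<- <-]] /sur [z'' [<- <-]].
by rewrite -!tm_nat -!kE tm_nat.
Qed.

Lemma l_bang f g : parelX f g -> bang A @ v f g = bang _ @ f.
Proof.
have [P [p [q [k [_ _ _ sur kE]]]]] := l_par.
by move=> /sur [z [<- <-]]; rewrite -kE !bang_ap.
Qed.

Lemma l_add f g h : parelX f g -> parelX g h ->
  v f h = tm (v f g) (nul (bang _ @ f)) (v g h).
Proof.
move=> fg gh; rewrite (parel_bang fg) -(l_0 g) -l_tm ?tmr ?tml //; exact: parel_refl.
Qed.

Lemma l_opp f g : parelX f g -> v g f = tm (nul (bang _ @ f)) (v f g) (nul (bang _ @ f)).
Proof.
move=> fg; rewrite {1}(parel_bang fg) -(l_0 f) -(l_0 g) -l_tm ?tmr ?tml //; exact: parel_refl.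
Qed.

(** Translation by [tm] carries a pair at [f] to a pair at [f'] with the same label. *)
Lemma l_transl f f' g : bang _ @ f = bang _ @ f' -> parelX f g ->
  parelX f' (tm f' f g) /\ v f' (tm f' f g) = v f g.
Proof.
move=> ff' fg; have r x : parelX x x by exact: parel_refl.
split; first by have := parel_tm (r f') (r f) fg; rewrite tmr.
by have := l_tm (r f') (r f) fg; rewrite tmr !l_0 ff' tml.
Qed.

End LabTheory.

(** ** Labels given on an object of parallel cells *)

Section LabOf.
Variables (n : nat) (X : nGrd E n) (P : E) (p q : hom P (cells E n X)) (nu : hom P A).
Hypotheses (aX : asph X) (pq : is_par p q)
  (nu0 : forall z, p @ z = q @ z -> nu @ z = nul (bang P @ z)).

Definition lab_val (f g : el (cells E n X)) : el A :=
  match pselect (exists z, p @ z = f /\ q @ z = g) with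
  | left e => nu @ sval (cid e)
  | right _ => nul (bang _ @ f)
  end.

Lemma lab_valE z : lab_val (p @ z) (q @ z) = nu @ z.
Proof.
rewrite /lab_val; case: pselect => [e|[]]; last by exists z.
by case: (cid e) => z' /= [e0 e1]; have [inj _ _] := par_el cE oneP pq; rewrite (inj _ _ e0 e1).
Qed.

Lemma lab_val_hom W (a b : el W -> el (cells E n X)) : is_hom cE a -> is_hom cE b ->
  (forall w, parel n X (a w) (b w)) -> is_hom cE (fun w => lab_val (a w) (b w)).
Proof.
move=> ha hb ab; have [u uE] := par_lift pq ha hb ab.
by exists (nu ∘ u) => w; rewrite apM -lab_valE (uE w).1 (uE w).2.
Qed.

Lemma lab_val0 f : lab_val f f = nul (bang _ @ f).
Proof.
have [_ _ sur] := par_el cE oneP pq.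
have [z [zf zf']] := sur f f (parel_refl _ f).
by rewrite -{1}zf -{1}zf' lab_valE nu0 ?zf ?zf' // -zf bang_ap.
Qed.

Definition lab_of : lab n := Lab aX lab_val_hom lab_val0.

End LabOf.

Section LabMor.
Variables (n : nat) (X Z : lab n) (P R : E) (p q : hom P (cells E n (l_ob X)))
  (r s : hom R (cells E n (l_ob Z))) (nu : hom P A) (nu' : hom R A).
Hypotheses (pq : is_par p q) (rs : is_par r s).
Hypotheses (nuE : forall z, l_v (p @ z) (q @ z) = nu @ z :> el A)
  (nuE' : forall z, l_v (r @ z) (s @ z) = nu' @ z :> el A).

Lemma lab_morP : lmor X Z <-> exists (f : hom (l_ob X) (l_ob Z)) (g : hom P R),
  [/\ r ∘ g = cmap n f ∘ p, s ∘ g = cmap n f ∘ q & nu' ∘ g = nu].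
Proof.
have [inj par sur] := par_el cE oneP pq.
split=> [[h hE]|[h [g [gr gs gn]]]].
  have [|g [gp gq]] := par_lift_hom (a := cmap n h ∘ p) (b := cmap n h ∘ q) rs (oneP := oneP) (cE := cE).
    by move=> w; rewrite !apM; apply: parel_hom.
  exists h, g; split=> //; apply: (@ap_inj E cE) => z; rewrite apM.
  by rewrite -nuE' -!apM gp gq !apM hE.
exists h => x y /sur [z [<- <-]].
by rewrite nuE -!apM -gr -gs !apM nuE' -apM gn.
Qed.

End LabMor.

Section LabSum.
Variables (n : nat) (X X' Z : lab n) (P P' R : E)
  (p q : hom P (cells E n (l_ob X))) (p' q' : hom P' (cells E n (l_ob X')))
  (r s : hom R (cells E n (l_ob Z))) (nu : hom P A) (nu' : hom P' A) (mu : hom R A).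
Hypotheses (pq : is_par p q) (pq' : is_par p' q') (rs : is_par r s).
Hypotheses (nuE : forall z, l_v (p @ z) (q @ z) = nu @ z :> el A)
  (nuE' : forall z, l_v (p' @ z) (q' @ z) = nu' @ z :> el A)
  (muE : forall z, l_v (r @ z) (s @ z) = mu @ z :> el A).

Lemma lab_sumP : lsum X X' Z <->
  exists (Q : nGrd E n) (a : hom Q (l_ob X)) (a' : hom Q (l_ob X')) (f : hom Q (l_ob Z))
    (T : E) (t0 t1 : hom T (cells E n Q)) (b : hom T P) (b' : hom T P') (g : hom T R),
    [/\ is_product a a' /\ is_par t0 t1,
        p ∘ b = cmap n a ∘ t0 /\ q ∘ b = cmap n a ∘ t1,
        p' ∘ b' = cmap n a' ∘ t0 /\ q' ∘ b' = cmap n a' ∘ t1,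
        r ∘ g = cmap n f ∘ t0 /\ s ∘ g = cmap n f ∘ t1
      & ag_sum (nu ∘ b) (nu' ∘ b') (mu ∘ g)].
Proof.
split=> [[Q [a [a' [h [lp hE]]]]]|].
  have [T [t0 [t1 tt]]] := par_ex cE oneP Q; have [_ par _] := par_el cE oneP tt.
  have lift (Y : nGrd E n) (U : E) (u v : hom U (cells E n Y)) (k : hom Q Y) : is_par u v ->
      exists b : hom T U, u ∘ b = cmap n k ∘ t0 /\ v ∘ b = cmap n k ∘ t1.
    move=> uv; apply: (par_lift_hom (oneP := oneP) (cE := cE)) => // w.
    by rewrite !apM; apply: parel_hom.
  have [b bP] := lift _ _ _ _ a pq; have [b' bP'] := lift _ _ _ _ a' pq'.
  have [g gP] := lift _ _ _ _ h rs.
  exists Q, a, a', h, T, t0, t1, b, b', g; split=> //.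
    by split=> //; exact: (lprod_univ cE oneP).
  apply/ag_sumE => w; rewrite !apM -muE -nuE -nuE' -!apM.
  by move: bP bP' gP => [-> ->] [-> ->] [-> ->]; rewrite !apM hE // bang_ap.
move=> [Q [a [a' [h [T [t0 [t1 [b [b' [g [[pr tt] [b0 b1] [b0' b1'] [g0 g1] sm]]]]]]]]]]].
exists Q, a, a', h; split; first exact: (product_lprod cE oneP).
have [_ _ sur] := par_el cE oneP tt; move/ag_sumE in sm.
move=> x y /sur [w [<- <-]]; rewrite bang_ap -!apM -b0 -b1 -b0' -b1' -g0 -g1 !apM.
by rewrite nuE nuE' muE -!apM sm.
Qed.

End LabSum.
End Labels.

(** * Cocycles are the directed labelled higher groupoids *)

Section Cocycles.
Variables (E : category) (cE : conc E) (A : abgroup E).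
Local Notation el := (@el E cE).
Local Notation "f @ x" := (@ap E cE _ _ f x) (at level 20).
Local Notation tm := (@mal E cE _).
Local Notation S := (grd_tower E).
Local Notation cmap n f := (fmap (cells E n) f).
Local Notation oneP := (@ag_oneP E A).
Local Notation bang := (to_one oneP).
Local Notation parel := (parel cE oneP).
Local Notation asph := (asph cE oneP).
Local Notation lab := (lab cE A).
Local Notation nul := (nul (cE := cE) (A := A)).

Section Directed.
Variables (n : nat) (X : lab n) (P : E) (p q : hom P (cells E n (l_ob X))) (nu : hom P A).
Hypotheses (pq : is_par p q) (nuE : forall z, l_v (p @ z) (q @ z) = nu @ z :> el A).

Lemma directedI : is_product p nu -> directed X.
Proof.
have [inj par sur] := par_el cE oneP pq => /(prod_el cE oneP) [ninj nsur]; split.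
  by move=> f a /nsur [z [<- <-]]; exists (q @ z); rewrite nuE; split=> //; exact: par.
move=> f g g' /sur [z [zf <-]] /sur [z' [zf' <-]]; rewrite -{1}zf -{1}zf' !nuE => e.
by rewrite (ninj z z') // zf zf'.
Qed.

Lemma opp_oppE (a : el A) (c := nul (bang _ @ a)) : tm c (tm c a c) c = a.
Proof.
set b := tm c a c; have e : c = tm b c a by rewrite /b tmA tml tmr.
by rewrite {2}e -tmA tmr tml.
Qed.

Lemma directed_prod : directed X -> is_product p nu /\ is_product q nu.
Proof.
have [inj par sur] := par_el cE oneP pq => -[dE dU].
have bnu z : bang A @ (nu @ z) = bang _ @ (p @ z) by rewrite !bang_ap.
split; apply: (prod_elI (cE := cE) (oneP := oneP)) => [z z'|f a].
- move=> e0 e1; apply: inj => //; apply: (dU (p @ z)); rewrite ?nuE //.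
  by rewrite e0; exact: par.
  by rewrite e0 nuE.
- by move=> /dE [g [/sur [z [<- <-]] <-]]; exists z; rewrite nuE.
- move=> e0 e1; apply: inj => //; apply: (dU (q @ z)); rewrite ?nuE //.
  + exact: parel_sym.
  + by rewrite e0; apply: parel_sym.
  + by rewrite {2}e0 (l_opp (par z)) (l_opp (par z')) !nuE -!bnu e1.
- move=> e; pose b := tm (nul (bang _ @ a)) a (nul (bang _ @ a)).
  have [|g [fg gb]] := dE f b; first by rewrite /b !tm_nat bang_nul e tmr.
  have [z [zg zf]] := sur _ _ (parel_sym fg).
  by exists z; rewrite -nuE zf zg (l_opp fg) gb e opp_oppE.
Qed.

End Directed.

Lemma dir_surj n (X : lab n) P (p q : hom P (cells E n (l_ob X))) (nu : hom P A) :
  is_par p q -> (forall z, l_v (p @ z) (q @ z) = nu @ z :> el A) -> directed X -> surj cE nu.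
Proof.
move=> /(par_el cE oneP) [_ _ sur] nuE [dE _] a.
have [f fa] := asph_bang (l_asph X) (bang _ @ a).
by have [g [/sur [z [zf zg]] <-]] := dE f a fa; exists z; rewrite -nuE zf zg.
Qed.

Lemma dir_eq n (X : lab n) f g f' g' : directed X -> bang _ @ f = bang _ @ f' ->
  parel n (l_ob X) f g -> parel n (l_ob X) f' g' -> l_v f g = l_v f' g' :> el A -> g' = tm f' f g.
Proof.
move=> [_ dU] ff' fg fg' e; have [h0 h1] := l_transl ff' fg.
by apply: dU fg' h0 _; rewrite h1.
Qed.

(** By [dir_eq], [tm x y z] is the translate of [z] with the label of the pair [(y, z)],
    and labels are maps. *)
Lemma dir_tmc (X : lab 0) : directed X -> tmc cE (l_ob X : E).
Proof.
move=> dX; have [P [p [q [nu [pq inj par sur nuE]]]]] := l_par X.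
have [pr _] := directed_prod pq (fun z => esym (nuE z)) dX.
move=> W x y z hx hy hz; have [|u uE] := prod_hom oneP pr hx (l_hom (l := X) hy hz _).
  by move=> w; exact: hom_bang.
exists (q ∘ u) => w; rewrite apM; have [u0 u1] := uE w.
have yz : parel 0 (l_ob X) (y w) (z w) by exact: hom_bang.
have xu : parel 0 (l_ob X) (x w) (q @ (u @ w)) by rewrite -u0; exact: par.
apply: (@dir_eq 0 X (y w) (z w) (x w) (q @ (u @ w)) dX _ yz xu); first exact: hom_bang.
by rewrite -u1 nuE u0.
Qed.

Lemma torsor_asph (X : torsor A) : asph (t_ob X : nGrd E 0).
Proof. by apply/(asphP cE oneP (n := 0)); exact: t_gs. Qed.

Lemma torsor_nul (X : torsor A) z : t_fst X @ z = t_snd X @ z -> t_q X @ z = nul (bang _ @ z).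
Proof.
have [s [t [s0 s1 st]]] := t_q0 X => e; have [inj _] := prod_el cE oneP (@t_sqP _ _ X).
have -> : z = s @ (t_fst X @ z).
  by apply: inj; rewrite -apM ?s0 ?s1 ap1.
by rewrite -apM st apM (bangE oneP t) bang_ap !bang_ap.
Qed.

Definition torsor_lab (X : torsor A) : lab 0 :=
  @lab_of E cE A 0 (t_ob X) (t_sq X) (t_fst X) (t_snd X) (t_q X) (torsor_asph X) (@t_sqP _ _ X)
    (@torsor_nul X).

Lemma dgrd_asph n (X : dgrd A n) : asph (d_grd X).
Proof. by apply/(asphP cE oneP); exact: d_asph. Qed.

Lemma dgrd_nul n (X : dgrd A n) z : d_fst X @ z = d_snd X @ z -> d_nu X @ z = nul (bang _ @ z).
Proof.
have [s [t [s0 s1 [st _]]]] := d_nu_po X => e; have [inj _ _] := par_el cE oneP (d_parP X).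
have -> : z = s @ (d_fst X @ z).
  by apply: inj; rewrite -apM ?s0 ?s1 ap1.
by rewrite -apM st apM (bangE oneP t) bang_ap !bang_ap.
Qed.

Definition dgrd_lab n (X : dgrd A n) : lab n :=
  lab_of (dgrd_asph X) (d_parP X) (@dgrd_nul n X).

Definition toL n : cocycle A n -> lab n :=
  match n with 0 => torsor_lab | n'.+1 => @dgrd_lab n'.+1 end.

Lemma torsor_dir (X : torsor A) : directed (torsor_lab X).
Proof.
have [inj sur] := prod_el cE oneP (@t_sqP _ _ X).
have [l [r [rot [[l0 l1] [x0 x1 x2] [r0 r1] co]]]] := t_qP X.
have rotE w : t_fst X @ (r @ w) = t_z X @ w /\
    t_snd X @ (r @ w) = tm (t_z X @ w) (t_x X @ w) (t_y X @ w).
  rewrite -!apM r0 r1 !apM; split=> //; rewrite (maltsev_tm oneP _ (@t_cubeP _ _ X) (t_pP X)).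
  by rewrite -!apM x0 x1 x2.
have [cinj csur] := prod3_el cE oneP (@t_cubeP _ _ X).
have lE w : t_fst X @ (l @ w) = t_x X @ w /\ t_snd X @ (l @ w) = t_y X @ w.
  by rewrite -!apM l0 l1.
have vE z : l_v (l := torsor_lab X) (t_fst X @ z) (t_snd X @ z) = t_q X @ z.
  exact: (@lab_valE E cE A 0 (t_ob X) _ _ _ (t_q X) (@t_sqP _ _ X)).
apply: (@directedI 0 (torsor_lab X) _ _ _ _ (@t_sqP _ _ X) vE).
apply: (prod_elI (cE := cE) (oneP := oneP)) => [z z' e0 e1|f a fa].
  have [|w [lw rw]] := coeq_kernel (cE := cE) co _ e1.
    move=> y; have [||w [w0 w1 w2]] := csur (t_fst X @ y) (t_snd X @ y) (t_fst X @ y);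
      rewrite ?bang_ap //.
    exists w; have [a0 a1] := lE w; have [b0 b1] := rotE w.
    by split; apply: inj; rewrite ?a0 ?a1 ?b0 ?b1 ?w0 ?w1 ?w2 ?tml.
  have [a0 a1] := lE w; have [b0 b1] := rotE w.
  apply: inj => //; move: e0; rewrite -lw -rw a0 a1 b0 b1 => ->.
  by rewrite tml.
have [z za] := regular_surj (cE := cE) (ex_intro _ _ (ex_intro _ l (ex_intro _ r co))) a.
have [||w [w0 w1 w2]] := csur (t_fst X @ z) (t_snd X @ z) f; rewrite ?bang_ap ?fa -?za ?bang_ap //.
have [b0 b1] := rotE w; have [a0 a1] := lE w.
exists (r @ w); rewrite b0 w2; split=> //.
rewrite -(apM (t_q X)) -co.1 apM; congr (_ @ _); apply: inj; by rewrite ?a0 ?a1.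
Qed.

Lemma toL_dir n (X : cocycle A n) : directed (toL X).
Proof.
case: n X => [|n] X; first exact: torsor_dir.
apply: (@directedI n.+1 (dgrd_lab X) _ _ _ _ (d_parP X) (lab_valE (d_nu X) (d_parP X))).
exact: d_nu_fst.
Qed.

Lemma toL_mor n (X Z : cocycle A n) : cocycle_mor X Z <-> lmor (toL X) (toL Z).
Proof.
case: n X Z => [|n] X Z.
  have [h1 h2] := @lab_morP E cE A 0 (torsor_lab X) (torsor_lab Z) _ _ _ _ _ _ (t_q X) (t_q Z)
    (@t_sqP _ _ X) (@t_sqP _ _ Z) (@lab_valE E cE A 0 (t_ob X) _ _ _ (t_q X) (@t_sqP _ _ X)) (@lab_valE E cE A 0 (t_ob Z) _ _ _ (t_q Z) (@t_sqP _ _ Z)).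
  by split.
have [h1 h2] := @lab_morP E cE A n.+1 (dgrd_lab X) (dgrd_lab Z) _ _ _ _ _ _ (d_nu X) (d_nu Z)
    (d_parP X) (d_parP Z) (lab_valE (d_nu X) (d_parP X)) (lab_valE (d_nu Z) (d_parP Z)).
by split.
Qed.

Lemma toL_sum n (X X' Z : cocycle A n) : cocycle_sum X X' Z <-> lsum (toL X) (toL X') (toL Z).
Proof.
case: n X X' Z => [|n] X X' Z.
  have [h1 h2] := @lab_sumP E cE A 0 (torsor_lab X) (torsor_lab X') (torsor_lab Z)
    _ _ _ _ _ _ _ _ _ (t_q X) (t_q X') (t_q Z) (@t_sqP _ _ X) (@t_sqP _ _ X') (@t_sqP _ _ Z)
    (@lab_valE E cE A 0 (t_ob X) _ _ _ (t_q X) (@t_sqP _ _ X)) (@lab_valE E cE A 0 (t_ob X') _ _ _ (t_q X') (@t_sqP _ _ X')) (@lab_valE E cE A 0 (t_ob Z) _ _ _ (t_q Z) (@t_sqP _ _ Z)).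
  split=> [[P [R [a [a' [f [r0 [r1 [b [b' [g H]]]]]]]]]]|/h1].
    by apply: h2; exists P, a, a', f, R, r0, r1, b, b', g.
  move=> [P [a [a' [f [R [r0 [r1 [b [b' [g H]]]]]]]]]].
  by exists P, R, a, a', f, r0, r1, b, b', g.
have [h1 h2] := @lab_sumP E cE A n.+1 (dgrd_lab X) (dgrd_lab X') (dgrd_lab Z)
    _ _ _ _ _ _ _ _ _ (d_nu X) (d_nu X') (d_nu Z) (d_parP X) (d_parP X') (d_parP Z)
    (lab_valE (d_nu X) (d_parP X)) (lab_valE (d_nu X') (d_parP X')) (lab_valE (d_nu Z) (d_parP Z)).
by split.
Qed.

(** The maps required of a cocycle, such as the pushout square for the direction, are
    rebuilt from the bijection between parallel pairs and pairs of a cell and a label. *)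
Lemma ofL n (L : lab n) : directed L -> exists X : cocycle A n,
  lmor L (toL X) /\ lmor (toL X) L.
Proof.
move=> dL; have [P [p [q [nu [pq inj par sur nuE]]]]] := l_par L.
have nuE' z : l_v (p @ z) (q @ z) = nu @ z by rewrite nuE.
have [p_nu q_nu] := directed_prod pq nuE' dL; have snu := dir_surj pq nuE' dL.
have [s [s0 s1]] := par_lift_hom (cE := cE) (a := idm _) (b := idm _) pq (fun w => parel_refl oneP _).
have sp w : p @ (s @ w) = w by rewrite -apM s0 ap1.
have sq w : q @ (s @ w) = w by rewrite -apM s1 ap1.
have nus w : nu @ (s @ w) = nul (bang _ @ w) by rewrite nuE sp sq l_0.
have nu0 : nu ∘ s = ag_zero A ∘ bang _ by apply: (@ap_inj E cE) => w; rewrite !apM nus.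
have done' (aL : asph (l_ob L)) (n0 : forall z, p @ z = q @ z -> nu @ z = nul (bang P @ z))
    (L' := lab_of aL pq n0) : lmor L L' /\ lmor L' L.
  split; exists (idm _) => f g /sur [z [<- <-]]; rewrite fmap1 !ap1.
  - by rewrite nuE'; exact: (lab_valE nu pq).
  - by rewrite nuE'; exact: esym (lab_valE nu pq z).
case: n L dL P p q nu pq inj par sur nuE nuE' p_nu q_nu snu s s0 s1 sp sq nus nu0 done' =>
  [|n] L dL P p q nu pq inj par sur nuE nuE' p_nu q_nu snu s s0 s1 sp sq nus nu0 done'.
  have cL := dir_tmc dL; have [C [x [y [z pr]]]] := prod3_ex_el cE oneP (l_ob L : E).
  have [cinj csur] := prod3_el cE oneP pr.
  have [t tE] := cL _ _ _ _ (ap_is_hom cE x) (ap_is_hom cE y) (ap_is_hom cE z).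
  have mt : maltsev_op x y z t.
    by split=> T u e; apply: (@ap_inj E cE) => w; rewrite !apM tE -!apM e ?tmr ?tml //.
  have [l [l0 l1]] := prod_lift pq x y.
  have [rot [[r0 r1 r2] _]] := pr C z x y.
  have [r [ra rb]] := prod_lift pq z (t ∘ rot).
  have lp w : p @ (l @ w) = x @ w /\ q @ (l @ w) = y @ w by rewrite -!apM l0 l1.
  have rp w : p @ (r @ w) = z @ w /\ q @ (r @ w) = tm (z @ w) (x @ w) (y @ w).
    by rewrite -!apM ra rb apM tE -!apM r0 r1 r2.
  have gs : global_support (C := E) (l_ob L) by apply/(asphP cE oneP (n := 0)); exact: l_asph.
  have qP : exists (l r : hom C P) (rot : hom C C),
    [/\ p ∘ l = x /\ q ∘ l = y, [/\ x ∘ rot = z, y ∘ rot = x & z ∘ rot = y],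
        p ∘ r = z /\ q ∘ r = t ∘ rot & is_coequalizer l r nu].
    exists l, r, rot; split=> //; apply: (coeq_el snu) => a b; split=> [ab|[w [<- <-]]].
      have [||w [w0 w1 w2]] := csur (p @ a) (q @ a) (p @ b); rewrite ?bang_ap //.
        by rewrite -(bang_ap oneP nu) ab bang_ap.
      exists w; have [a0 a1] := lp w; have [b0 b1] := rp w.
      split; apply: inj; rewrite ?a0 ?a1 ?b0 ?b1 ?w0 ?w1 ?w2 //.
      apply: esym; apply: (@dir_eq 0 L _ _ _ _ dL _ (par a) (par b)).
        by rewrite !bang_ap -(bang_ap oneP nu) ab bang_ap.
      by rewrite !nuE'.
    have [a0 a1] := lp w; have [b0 b1] := rp w.
    have [||_ e] := @l_transl E cE A 0 L (x @ w) (z @ w) (y @ w) _ _.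
    - by rewrite !bang_ap.
    - by rewrite /= !bang_ap.
    by rewrite !nuE a0 a1 b0 b1 e.
  have q0 : exists (s : hom (l_ob L : E) P) (t : hom (l_ob L : E) (ag_one A)),
    [/\ p ∘ s = idm _, q ∘ s = idm _ & nu ∘ s = ag_zero A ∘ t] by exists s, (bang _).
  exists (@Torsor E A (l_ob L) P p q C x y z t nu pq pr mt gs qP q0); exact: done'.
have po : exists (s : hom (cells E n.+1 (l_ob L)) P) (t : hom (cells E n.+1 (l_ob L)) (ag_one A)),
  [/\ p ∘ s = idm _, q ∘ s = idm _ & is_pushout s t nu (ag_zero A)].
  exists s, (bang _); split=> //; split=> // T a b ab.
  have [|u ua] := desc_el (h := a) snu.
    move=> z z' e.
    have pb : bang _ @ (p @ z) = bang _ @ (p @ z') by rewrite !bang_ap -!(bang_ap oneP nu) e.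
    have qz : q @ z' = tm (p @ z') (p @ z) (q @ z).
      by apply: (dir_eq dL pb (par z) (par z')); rewrite !nuE'.
    have -> : z' = tm (s @ (p @ z')) (s @ (p @ z)) z.
      by apply: inj; rewrite !tm_nat ?sp ?sq ?tmr.
    by rewrite tm_nat -!(apM a) ab !apM pb tml.
  exists u; split=> [|v [va _]].
    split=> //; apply: (@ap_inj E cE) => y.
    have [f fy] := asph_bang (l_asph L) y.
    by rewrite -fy -apM -cmpA -nu0 cmpA ua ab apM.
  by apply: (@ap_inj E cE) => i; have [z <-] := snu i; rewrite -!apM va ua.
have aL : aspherical (l_ob L) by apply/(asphP cE oneP); exact: l_asph.
by exists (@Dgrd E A n.+1 (l_ob L) P p q nu aL pq (surj_regular snu) p_nu q_nu po); exact: done'.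
Qed.

End Cocycles.

(** * The sum of cocycles *)

Section Sum.
Variables (E : category) (cE : conc E) (A : abgroup E).
Local Notation el := (@el E cE).
Local Notation "f @ x" := (@ap E cE _ _ f x) (at level 20).
Local Notation tm := (@mal E cE _).
Local Notation cmap n f := (fmap (cells E n) f).
Local Notation oneP := (@ag_oneP E A).
Local Notation bang := (to_one oneP).
Local Notation parel := (parel cE oneP).
Local Notation asph := (asph cE oneP).
Local Notation lab := (lab cE A).
Local Notation nul := (nul (cE := cE) (A := A)).

Definition lconn n := clos_refl_sym_trans (lab n) (@lmor E cE A n).

Lemma lconn_mor n (X Z : lab n) : lmor X Z -> lconn X Z.
Proof. exact: rst_step. Qed.

Lemma lmul_ex n (X Y : lab n) : exists (W : lab n) (a : hom (l_ob W) (l_ob X)) (b : hom (l_ob W) (l_ob Y)),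
  lprod a b /\ forall f g, l_v f g = tm (l_v (cmap n a @ f) (cmap n a @ g)) (nul (bang _ @ f))
    (l_v (cmap n b @ f) (cmap n b @ g)) :> el A.
Proof.
have [P [a [b lp]]] := prod_nGrd cE oneP (l_ob X) (l_ob Y).
pose v f g := tm (l_v (cmap n a @ f) (cmap n a @ g)) (nul (bang (cells E n P) @ f))
  (l_v (cmap n b @ f) (cmap n b @ g)).
have aP : asph P by apply: asph_prod lp _ _; exact: l_asph.
have v_hom W (f g : el W -> el (cells E n P)) : is_hom cE f -> is_hom cE g ->
    (forall w, parel n P (f w) (g w)) -> is_hom cE (fun w => v (f w) (g w)).
  move=> hf hg fg.
  have ha := l_hom (l := X) (hom_comp (cmap n a) hf) (hom_comp (cmap n a) hg)
    (fun w => parel_hom a (fg w)).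
  have hb := l_hom (l := Y) (hom_comp (cmap n b) hf) (hom_comp (cmap n b) hg)
    (fun w => parel_hom b (fg w)).
  by apply: is_hom_ext (ag_add_hom ha hb) => w; rewrite /v (hom_bang1 _ _ hf).
have v0 f : v f f = nul (bang _ @ f) by rewrite /v !l_0 !bang_ap tmr.
by exists (Lab aP v_hom v0), a, b.
Qed.

Definition lmul n (X Y : lab n) : lab n := sval (cid (lmul_ex X Y)).

Lemma lmulP n (X Y : lab n) :
  exists (a : hom (l_ob (lmul X Y)) (l_ob X)) (b : hom (l_ob (lmul X Y)) (l_ob Y)),
  lprod a b /\ forall f g, l_v f g = tm (l_v (cmap n a @ f) (cmap n a @ g)) (nul (bang _ @ f))
    (l_v (cmap n b @ f) (cmap n b @ g)) :> el A.
Proof. exact: svalP (cid (lmul_ex X Y)). Qed.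

(** The universal property of the product, in terms of labels. *)
Lemma lmul_to n (T X Y : lab n) (h : hom (l_ob T) (l_ob X)) (k : hom (l_ob T) (l_ob Y)) :
  (forall f g, parel n (l_ob T) f g -> l_v f g = tm (l_v (cmap n h @ f) (cmap n h @ g))
    (nul (bang _ @ f)) (l_v (cmap n k @ f) (cmap n k @ g)) :> el A) -> lmor T (lmul X Y).
Proof.
move=> H; have [a [b [lp vE]]] := lmulP X Y.
have [u [ua ub]] := prod_lift (lprod_univ cE oneP lp) h k; exists u => f g fg.
by rewrite vE H // -ua -ub !fmapM !apM bang_ap.
Qed.

Lemma lsumP n (X Y Z : lab n) : lsum X Y Z <-> lmor (lmul X Y) Z.
Proof.
have [a [b [lp vE]]] := lmulP X Y.
split=> [[P [c [d [h [lq hE]]]]]|[h hE]]; last first.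
  by exists (l_ob (lmul X Y)), a, b, h; split=> // f g fg; rewrite hE.
have [u [uc ud]] := prod_lift (lprod_univ cE oneP lq) a b.
exists (h ∘ u) => f g fg; rewrite fmapM !apM hE; last exact: parel_hom.
by rewrite vE -uc -ud !fmapM !apM bang_ap.
Qed.

Lemma lmul_mor n (X X' Y Y' : lab n) : lmor X X' -> lmor Y Y' -> lmor (lmul X Y) (lmul X' Y').
Proof.
move=> [h hE] [k kE]; have [a [b [lp vE]]] := lmulP X Y.
apply: (lmul_to (h := h ∘ a) (k := k ∘ b)) => f g fg.
by rewrite vE !fmapM !apM hE ?kE //; exact: parel_hom.
Qed.

Lemma lmul_conn n (X X' Y Y' : lab n) : lconn X X' -> lconn Y Y' -> lconn (lmul X Y) (lmul X' Y').
Proof.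
move=> hX hY; apply: (@rst_trans _ _ _ (lmul X' Y)).
  elim: hX => [Z Z' h|Z|Z Z' _ h|Z Z' Z'' _ h _ h'].
  - by apply: rst_step; apply: lmul_mor h _; exact: lmor_refl.
  - exact: rst_refl.
  - exact: rst_sym.
  - exact: rst_trans h h'.
elim: hY => [Z Z' h|Z|Z Z' _ h|Z Z' Z'' _ h _ h'].
- by apply: rst_step; apply: lmul_mor h; exact: lmor_refl.
- exact: rst_refl.
- exact: rst_sym.
- exact: rst_trans h h'.
Qed.

Lemma lmulA n (X Y Z : lab n) : lmor (lmul (lmul X Y) Z) (lmul X (lmul Y Z)).
Proof.
have [a [b [lp vE]]] := lmulP (lmul X Y) Z; have [c [d [lq wE]]] := lmulP X Y.
have [e [f [lr tE]]] := lmulP Y Z.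
have [u [ue uf]] := prod_lift (lprod_univ cE oneP lr) (d ∘ a) b.
apply: (lmul_to (h := c ∘ a) (k := u)) => x y xy.
by rewrite vE wE tE -!apM -!fmapM ue uf !fmapM !apM !bang_ap tmA.
Qed.

Lemma lmulC n (X Y : lab n) : lmor (lmul X Y) (lmul Y X).
Proof.
have [a [b [lp vE]]] := lmulP X Y.
apply: (lmul_to (h := b) (k := a)) => f g fg; rewrite vE; apply: ag_addCE.
- by rewrite l_bang ?bang_ap //; exact: parel_hom.
- by rewrite l_bang ?bang_ap //; exact: parel_hom.
Qed.

(** [K(A, n)], labelled by differences of cells, is neutral for the sum. *)
Lemma lzero_ex n : exists (K : lab n) (j : hom (cells E n (l_ob K)) A) (k : hom A (cells E n (l_ob K))),
  [/\ j ∘ k = idm _, k ∘ j = idm _,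
      [/\ null_idn cE oneP (ag_zero A) j, forall x y, bang _ @ x = bang _ @ y -> parel n (l_ob K) x y
        & forall x y, l_v x y = tm (nul (bang _ @ x)) (j @ x) (j @ y)]
    & forall X : nGrd E n, exists h : hom X (l_ob K), forall x, j @ (cmap n h @ x) = nul (bang _ @ x)].
Proof.
have [K [j [k [jk kj [aK iK pK] hK]]]] := @null_ex E cE _ oneP n A (ag_zero A) (@ag_tmc E cE A).
pose v x y := tm (nul (bang (cells E n K) @ x)) (j @ x) (j @ y).
have v_hom W (f g : el W -> el (cells E n K)) : is_hom cE f -> is_hom cE g ->
    (forall w, parel n K (f w) (g w)) -> is_hom cE (fun w => v (f w) (g w)).
  move=> hf hg _.
  apply: is_hom_ext (ag_tmc (nul_hom cE A W) (hom_comp j hf) (hom_comp j hg)) => w.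
  by rewrite /v (hom_bang1 _ _ hf).
have v0 f : v f f = nul (bang _ @ f) by rewrite /v tmr.
by exists (Lab aK v_hom v0), j, k.
Qed.

Definition lzero n : lab n := sval (cid (lzero_ex n)).

Lemma lzeroP n : exists (j : hom (cells E n (l_ob (lzero n))) A) (k : hom A (cells E n (l_ob (lzero n)))),
  [/\ j ∘ k = idm _, k ∘ j = idm _,
      [/\ null_idn cE oneP (ag_zero A) j, forall x y, bang _ @ x = bang _ @ y -> parel n (l_ob (lzero n)) x y
        & forall x y, l_v x y = tm (nul (bang _ @ x)) (j @ x) (j @ y)]
    & forall X : nGrd E n, exists h : hom X (l_ob (lzero n)), forall x, j @ (cmap n h @ x) = nul (bang _ @ x)].
Proof. exact (svalP (cid (lzero_ex n))). Qed.

Lemma to_zero n (X : nGrd E n) : exists h : hom X (l_ob (lzero n)),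
  forall x y, bang _ @ x = bang _ @ y -> l_v (cmap n h @ x) (cmap n h @ y) = nul (bang _ @ x) :> el A.
Proof.
have [j [k [_ _ [_ _ vE] hK]]] := lzeroP n; have [h hE] := hK X; exists h => x y xy.
by rewrite vE !hE -xy tmr bang_ap.
Qed.

Lemma lmul0 n (X : lab n) : lmor X (lmul (lzero n) X).
Proof.
have [h hE] := to_zero (l_ob X).
apply: (lmul_to (h := h) (k := idm _)) => f g fg.
by rewrite hE ?(parel_bang fg) // fmap1 !ap1 tml.
Qed.

(** With the opposite label on [X], the diagonal of [X] maps both to the product and, with
    zero label, to [K(A, n)]. *)
Lemma lneg_ex n (X : lab n) : exists Y : lab n, lconn (lmul Y X) (lzero n).
Proof.
pose v f g := tm (nul (bang _ @ f)) (l_v f g) (nul (bang (cells E n (l_ob X)) @ f)).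
have v_hom W (f g : el W -> el (cells E n (l_ob X))) : is_hom cE f -> is_hom cE g ->
    (forall w, parel n (l_ob X) (f w) (g w)) -> is_hom cE (fun w => v (f w) (g w)).
  move=> hf hg fg.
  apply: is_hom_ext (ag_tmc (nul_hom cE A W) (l_hom hf hg fg) (nul_hom cE A W)) => w.
  by rewrite /v (hom_bang1 _ _ hf).
have v0 f : v f f = nul (bang _ @ f) by rewrite /v l_0 tmr.
have z_hom W (f g : el W -> el (cells E n (l_ob X))) : is_hom cE f -> is_hom cE g ->
    (forall w, parel n (l_ob X) (f w) (g w)) -> is_hom cE (fun w => nul (bang _ @ f w)).
  by move=> hf _ _; apply: is_hom_ext (nul_hom cE A W) => w; rewrite (hom_bang1 _ _ hf).
pose T := @Lab E cE A n (l_ob X) (l_asph X) (fun f _ => nul (bang _ @ f)) z_hom (fun _ => erefl).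
pose N := @Lab E cE A n (l_ob X) (l_asph X) v v_hom v0.
exists N; apply: (@rst_trans _ _ _ T).
  apply: rst_sym; apply: rst_step; apply: (@lmul_to n T N X (idm (l_ob X)) (idm (l_ob X))) => f g fg.
  by rewrite fmap1 !ap1 /= /v tmA tml tmr.
apply: rst_step; have [h hE] := to_zero (l_ob X); exists h => f g fg.
by rewrite hE //; exact: parel_bang fg.
Qed.

Lemma absorb_hom n (V K : nGrd E n) (T : lab n) (a : hom V (l_ob T)) (b : hom V K)
    (j : hom (cells E n K) A) (w : hom (cells E n V) (cells E n (l_ob T))) :
  directed T -> null_idn cE oneP (ag_zero A) j ->
  (forall f, parel n (l_ob T) (cmap n a @ f) (w @ f)) ->
  (forall f, l_v (cmap n a @ f) (w @ f) = j @ (cmap n b @ f)) ->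
  exists g : hom V (l_ob T), cmap n g = w.
Proof.
case: n V K T a b j w => [|n] V K T a b j w dT iK aw vw; first by exists w.
have [|||g [_ gc]] := @hom_full E cE n V (l_ob T) (h_obj a) w; last by exists g.
- by apply: (@ap_inj E cE) => f; rewrite !apM -src_el; case: (aw f).
- by apply: (@ap_inj E cE) => f; rewrite !apM -tgt_el; case: (aw f).
- apply: (@ap_inj E cE) => x; rewrite !apM -idn_el; apply: (dT.2 (cmap n.+1 a @ (idn V @ x))).
  + exact: aw.
  + exact: parel_refl.
  + by rewrite vw idn_el iK l_0 !bang_ap.
Qed.

(** A directed object absorbs [K(A, n)]: its direction acts on its top cells. *)
Lemma absorb n (T : lab n) : directed T -> lmor (lmul T (lzero n)) T.
Proof.
move=> dT; have [a [b [lp vE]]] := lmulP T (lzero n).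
have [j [k [jk kj [iK pK zE] _]]] := lzeroP n.
have [P [p [q [nu [pq inj par sur nuE]]]]] := l_par T.
have [p_nu _] := directed_prod pq (fun z => esym (nuE z)) dT.
set V := lmul T (lzero n) in a b lp vE *.
have [u [u0 u1]] := prod_lift p_nu (cmap n a) (j ∘ cmap n b).
have uE f : p @ (u @ f) = cmap n a @ f /\ nu @ (u @ f) = (j ∘ cmap n b) @ f by rewrite -!apM u0 u1.
have qu f : parel n (l_ob T) (cmap n a @ f) (q @ (u @ f)) by rewrite -(uE f).1; exact: par.
have vu f : l_v (cmap n a @ f) (q @ (u @ f)) = j @ (cmap n b @ f).
  by rewrite -(uE f).1 -nuE (uE f).2 apM.
have [||g gc'] := absorb_hom (a := a) (b := b) (w := q ∘ u) dT iK; [by move=> f; rewrite apM | by move=> f; rewrite apM |].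
have gc f : cmap n g @ f = q @ (u @ f) by rewrite gc' apM.
exists g => f f' ff'; rewrite !gc vE zE.
have aff := parel_hom a ff'; have q1 := qu f; have q2 := qu f'.
have q3 := parel_trans (parel_sym q1) aff.
rewrite (l_add q3 q2) (l_add (parel_sym q1) aff) (l_opp q1) !vu.
have bq : bang _ @ (q @ (u @ f)) = bang _ @ f by rewrite -(parel_bang q1) bang_ap.
have bj : bang _ @ (j @ (cmap n b @ f)) = bang _ @ f by rewrite !bang_ap.
rewrite bq !bang_ap.
set c := nul _; set x := j @ (cmap n b @ f); set l := l_v _ _.
have -> : tm (tm c x c) c l = tm l c (tm c x c).
  by apply: ag_addCE; rewrite ?tm_nat ?bang_nul ?bj ?tmr // l_bang // bang_ap.
by rewrite !tmA tml.
Qed.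

(** [Z] is the quotient of [W * K(A, n)] by the parallel pairs with label zero: adding a
    free direction and identifying cells with zero label turns any label into a directed
    one. *)
Lemma phi_lab n (W : lab n) : exists Z : lab n,
  [/\ directed Z, lmor W Z & forall T, directed T -> lmor W T -> lmor Z T].
Proof.
have [a [b [lp vE]]] := lmulP W (lzero n); set V := lmul W (lzero n) in a b lp vE *.
have [j [k [jk kj [iK pK zE] _]]] := lzeroP n.
have [P [p [q [nu [pq inj par sur nuE]]]]] := l_par V.
have [R [m [minj mP]]] := equalizer_ex cE oneP nu (ag_zero A ∘ bang P).
have rP f g : (exists r, (p ∘ m) @ r = f /\ (q ∘ m) @ r = g) <->
    parel n (l_ob V) f g /\ l_v f g = nul (bang _ @ f) :> el A.
  split=> [[r [<- <-]]|[/sur [z [<- <-]]]].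
    have /mP e : exists r', m @ r' = m @ r by exists r.
    by rewrite !apM -nuE e apM !bang_ap; split=> //; exact: par.
  rewrite bang_ap -nuE => e; have /mP [r rz] : nu @ z = (ag_zero A ∘ bang P) @ z by rewrite apM.
  by exists r; rewrite !apM rz.
have [|Q [x [sx xP]]] := quo_refl (a := p ∘ m) (b := q ∘ m) (cE := cE).
  by move=> f; apply/rP; rewrite l_0; split=> //; exact: parel_refl.
have xpar f g : x @ f = x @ g -> parel n (l_ob V) f g by move=> /xP /rP [].
have [Z [h [sh hx hpar hasph huniv]]] := quot_nGrd sx xpar.
have hP f g : cmap n h @ f = cmap n h @ g <-> parel n (l_ob V) f g /\ l_v f g = nul (bang _ @ f) :> el A.
  by split=> [/hx /xP /rP //|H]; apply/hx; apply/xP; apply/rP.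
pose rep u := sval (cid (sh u)); have repP u : cmap n h @ rep u = u := svalP (cid (sh u)).
pose v u u' : el A := l_v (rep u) (rep u').
have nulr (c : el A) y : bang A @ c = y -> tm c (nul y) (nul y) = c by rewrite tmr.
have vW f g : parel n (l_ob V) f g -> v (cmap n h @ f) (cmap n h @ g) = l_v f g.
  move=> fg; have /hP [f1 f2] := repP (cmap n h @ f); have /hP [g1 g2] := repP (cmap n h @ g).
  rewrite /v; have fg' := parel_trans f1 (parel_trans fg (parel_sym g1)).
  rewrite (l_add (parel_trans f1 fg) (parel_sym g1)) (l_add f1 fg) f2 tml.
  by rewrite (l_opp g1) g2 tmr -(parel_bang (parel_trans f1 (parel_trans fg (parel_sym g1)))) (parel_bang f1) tmr.
have v_hom S (f g : el S -> el (cells E n Z)) : is_hom cE f -> is_hom cE g ->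
    (forall w, parel n Z (f w) (g w)) -> is_hom cE (fun w => v (f w) (g w)).
  move=> hf hg fg; have [S1 [c1 [f' [s1 f'E]]]] := cover_lift sh hf.
  have [S2 [c2 [g' [s2 g'E]]]] := cover_lift sh (hom_pre c1 hg).
  apply: (desc_hom (surj_comp s2 s1)).
  have fg' w : parel n (l_ob V) ((f' ∘ c2) @ w) (g' @ w).
    by apply: hpar; rewrite apM f'E g'E; exact: fg.
  apply: is_hom_ext (l_hom (l := V) (ap_is_hom cE (f' ∘ c2)) (ap_is_hom cE g') fg') => w.
  by rewrite -vW // !apM f'E g'E.
have v0 u : v u u = nul (bang _ @ u) by rewrite /v l_0 -{2}(repP u) bang_ap.
pose ZL := Lab (hasph (l_asph V)) v_hom v0.
have VZ : lmor V ZL by exists h => f g fg; exact: vW.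
have [inja sura] := prod_el cE oneP (lprod_cells lp).
have dZ : directed ZL.
  split=> [u c uc|u u' u''].
    have [f fu] := sh u; rewrite -fu in uc *; rewrite bang_ap in uc.
    pose y := tm (j @ (cmap n b @ f)) (nul (bang _ @ f)) c.
    have yb : bang A @ y = bang _ @ f by rewrite !tm_nat bang_nul !bang_ap uc tml.
    have [|g [ga gb]] := sura (cmap n a @ f) (k @ y); first by rewrite !bang_ap.
    have fg : parel n (l_ob V) f g.
      apply: (lprod_parel lp); first by rewrite ga; exact: parel_refl.
      by apply: pK; rewrite gb !bang_ap.
    exists (cmap n h @ g); split; first exact: parel_hom.
    rewrite [LHS]vW // vE zE ga l_0 gb (iso_el jk) !bang_ap tml /y -!tmA tmr tml.
    by [].
  have [f <-] := sh u; have [g <-] := sh u'; have [g' <-] := sh u''.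
  move=> /hpar fg /hpar fg'; rewrite [l_v _ _]vW // [RHS]vW // => e.
  have gg' := parel_trans (parel_sym fg) fg'; apply/hP; split=> //.
  have := l_add fg gg'; rewrite -e => /(congr1 (fun c => tm (nul (bang _ @ f)) (l_v f g) c)).
  by rewrite tmr -tmA tmr tml (parel_bang fg).
exists ZL; split=> //.
  by apply: lmor_trans (lmor_trans (lmul0 W) (lmulC _ _)) VZ.
move=> T dT WT; have [t tE] : lmor V T.
  by apply: lmor_trans (lmul_mor WT (lmor_refl _)) _; exact: absorb.
have [|u uE] := huniv _ t.
  move=> f g /hx /hP [fg e]; apply: (dT.2 (cmap n t @ f)).
  - exact: parel_refl.
  - exact: parel_hom.
  - by rewrite l_0 tE // e bang_ap.
exists u => z z'; have [f <-] := sh z; have [g <-] := sh z' => /hpar fg.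
by rewrite !uE tE // [RHS]vW.
Qed.

(** ** Components *)

Definition class n (X : cocycle A n) : component A n := exist _ (connected X) (ex_intro _ X erefl).

Lemma class_eq n (X Y : cocycle A n) : class X = class Y <-> connected X Y.
Proof.
split=> [/(congr1 sval) /= e|h]; first by rewrite e; exact: rst_refl.
have e : connected X = connected Y.
  apply: funext => Z; apply: propext; split=> H; first exact: rst_trans (rst_sym _ _ _ _ h) H.
  exact: rst_trans h H.
rewrite /class; move: (ex_intro _ X _) (ex_intro _ Y _) => p q.
by case: _ / e q => q; congr exist; exact: Prop_irrelevance.
Qed.

Lemma class_surj n (a : component A n) : exists X, class X = a.
Proof.
case: a => K [X e]; exists X; rewrite /class; move: (ex_intro _ X erefl) => p.
by subst K; congr exist; exact: Prop_irrelevance.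
Qed.

Lemma in_class n (X Y : cocycle A n) : sval (class X) Y <-> class X = class Y.
Proof. by rewrite class_eq. Qed.

Lemma phi_ex n (W : lab n) : exists X : cocycle A n,
  lmor W (toL cE X) /\ forall X' : cocycle A n, lmor W (toL cE X') -> cocycle_mor X X'.
Proof.
have [Z [dZ WZ ZT]] := phi_lab W; have [X [ZX XZ]] := ofL dZ.
exists X; split; first exact: lmor_trans WZ ZX.
by move=> X' WX'; apply/(toL_mor cE); apply: lmor_trans XZ (ZT _ (toL_dir cE X') WX').
Qed.

Lemma phi_uniq n (W : lab n) (X X' : cocycle A n) :
  lmor W (toL cE X) -> lmor W (toL cE X') -> connected X X'.
Proof.
have [Y [_ h]] := phi_ex W => /h XY /h X'Y.
by apply: rst_trans (rst_step _ _ _ _ X'Y); apply: rst_sym; exact: rst_step.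
Qed.

(** By universality of [phi_lab], a zigzag of labels becomes a zigzag of cocycles. *)
Lemma lconn_connected n (W W' : lab n) : lconn W W' -> forall X X' : cocycle A n,
  lmor W (toL cE X) -> lmor W' (toL cE X') -> connected X X'.
Proof.
elim=> [Z Z' h|Z|Z Z' _ h|Z Z' Z'' _ h _ h'] X X' hX hX'.
- by apply: phi_uniq hX _; exact: lmor_trans h hX'.
- exact: phi_uniq hX hX'.
- by apply: rst_sym; exact: h.
- by have [Y [hY _]] := phi_ex Z'; apply: rst_trans (h _ _ hX hY) (h' _ _ hY hX').
Qed.

Definition cls n (W : lab n) : component A n := class (sval (cid (phi_ex W))).

Lemma clsP n (W : lab n) : exists2 X : cocycle A n, cls W = class X & lmor W (toL cE X).
Proof. by rewrite /cls; case: cid => X /= [h _]; exists X. Qed.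

Lemma cls_lconn n (W W' : lab n) : lconn W W' -> cls W = cls W'.
Proof.
have [X -> hX] := clsP W; have [X' -> hX'] := clsP W' => h.
by apply/class_eq; exact: lconn_connected h _ _ hX hX'.
Qed.

Lemma cls_toL n (X : cocycle A n) : cls (toL cE X) = class X.
Proof.
have [Y -> hY] := clsP (toL cE X); apply/class_eq.
by apply: rst_sym; apply: rst_step; apply/(toL_mor cE).
Qed.

Lemma connected_lconn n (X Y : cocycle A n) : connected X Y -> lconn (toL cE X) (toL cE Y).
Proof.
elim=> [Z Z' h|Z|Z Z' _ h|Z Z' Z'' _ h _ h'].
- by apply: rst_step; apply/(toL_mor cE).
- exact: rst_refl.
- exact: rst_sym.
- exact: rst_trans h h'.
Qed.

Lemma cls_inj n (W W' : lab n) : cls W = cls W' -> lconn W W'.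
Proof.
have [X -> hX] := clsP W; have [X' -> hX'] := clsP W' => /class_eq /connected_lconn h.
apply: rst_trans (lconn_mor hX) _; apply: rst_trans h _.
by apply: rst_sym; exact: lconn_mor.
Qed.

Lemma cls_surj n (a : component A n) : exists W, cls W = a.
Proof. by have [X <-] := class_surj a; exists (toL cE X); rewrite cls_toL. Qed.

(** A representative taken as a label, to which products and changes of objects apply. *)
Definition rep n (a : component A n) : lab n := sval (cid (cls_surj a)).

Lemma repK n (a : component A n) : cls (rep a) = a.
Proof. exact: svalP (cid (cls_surj a)). Qed.

Definition cadd n (a b : component A n) := cls (lmul (rep a) (rep b)).

Lemma cadd_cls n (W W' : lab n) : cadd (cls W) (cls W') = cls (lmul W W').
Proof.
by apply: cls_lconn; apply: lmul_conn; apply: cls_inj; rewrite repK.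
Qed.

Lemma cadd_sum n (a b c : component A n) : cadd a b = c <-> @coh_sum E A n.+1 a b c.
Proof.
split=> [<-|[X [Y [Z [aX bY cZ sm]]]]].
  have [X aX] := class_surj a; have [Y bY] := class_surj b; subst a b.
  rewrite -!cls_toL cadd_cls; have [Z eZ hZ] := clsP (lmul (toL cE X) (toL cE Y)).
  exists X, Y, Z; rewrite eZ !cls_toL; split; try exact: rst_refl.
  by apply/(toL_sum cE); apply/lsumP.
have [X' aX'] := class_surj a; have [Y' bY'] := class_surj b; have [Z' cZ'] := class_surj c.
subst a b c; move: aX bY cZ => /in_class -> /in_class -> /in_class ->.
rewrite -!cls_toL cadd_cls; apply: cls_lconn; apply: lconn_mor.
by apply/lsumP; apply/(toL_sum cE).
Qed.

Lemma cadd0 n (a : component A n) : cadd (cls (lzero n)) a = a.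
Proof.
have [W <-] := cls_surj a; rewrite cadd_cls; apply: esym; apply: cls_lconn.
by apply: lconn_mor; exact: lmul0.
Qed.

Lemma copp_ex n (a : component A n) : exists b, cadd b a = cls (lzero n).
Proof.
have [W <-] := cls_surj a; have [Y hY] := lneg_ex W.
by exists (cls Y); rewrite cadd_cls; exact: cls_lconn.
Qed.

Lemma component_group n : coh_group A n.+1.
Proof.
apply: (@CohGroup E A n.+1 (@cadd n) (cls (lzero n)) (fun a => sval (cid (copp_ex a)))).
- move=> a b c; have [U <-] := cls_surj a; have [V <-] := cls_surj b; have [W <-] := cls_surj c.
  rewrite !cadd_cls; apply: esym; apply: cls_lconn; apply: lconn_mor; exact: lmulA.
- move=> a b; have [U <-] := cls_surj a; have [V <-] := cls_surj b.
  by rewrite !cadd_cls; apply: cls_lconn; apply: lconn_mor; exact: lmulC.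
- exact: cadd0.
- by move=> a; exact: svalP (cid (copp_ex a)).
- exact: cadd_sum.
Qed.

Lemma global_sum_ex (x y : hom (ag_one A) A) : exists z, ag_sum x y z.
Proof.
have [z zE] := ag_add_hom (A := A) (ap_is_hom cE x) (ap_is_hom cE y).
by exists z; apply/(ag_sumE cE).
Qed.

Lemma global_group : coh_group A 0.
Proof.
pose add x y := sval (cid (global_sum_ex x y)).
have addE x y w : add x y @ w = tm (x @ w) (nul (bang _ @ w)) (y @ w).
  by move: w; apply/ag_sumE; exact: svalP (cid (global_sum_ex x y)).
apply: (@CohGroup E A 0 add (ag_zero A) (fun x => ag_opp A ∘ x)).
- by move=> x y z; apply: (@ap_inj E cE) => w; rewrite !addE tmA.
- move=> x y; apply: (@ap_inj E cE) => w; rewrite !addE; apply: ag_addCE; exact: bang_ap.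
- move=> x; apply: (@ap_inj E cE) => w; rewrite addE -(bangE oneP (idm _)) ap1 tml //.
- move=> x; apply: (@ap_inj E cE) => w.
  by rewrite addE apM ag_oppE bang_ap tmA tml tmr -(bangE oneP (idm _)) ap1.
- move=> x y z; split=> [<-|/(ag_sumE cE) e]; first exact: svalP (cid (global_sum_ex x y)).
  by apply: (@ap_inj E cE) => w; rewrite addE e.
Qed.

End Sum.

(** * Homomorphisms to commutative objects *)

Section Separation.
Variables (E : category) (cE : conc E) (one : E) (oneP : is_terminal one).
Local Notation el := (@el E cE).
Local Notation "f @ x" := (@ap E cE _ _ f x) (at level 20).
Local Notation tm := (@mal E cE _).
Local Notation cmap n f := (fmap (cells E n) f).
Local Notation bang := (to_one oneP).
Local Notation parel := (parel cE oneP).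
Local Notation asph := (asph cE oneP).

(** Ends of cells in the object of objects; with [bidn] they carry the composition of
    cells along objects ([comph_bot]). *)
Fixpoint bsrc n : forall X : nGrd E n, hom (cells E n X) (bot n X) :=
  match n with 0 => fun X => idm X | n'.+1 => fun X => bsrc (under X) ∘ src X end.
Fixpoint btgt n : forall X : nGrd E n, hom (cells E n X) (bot n X) :=
  match n with 0 => fun X => idm X | n'.+1 => fun X => btgt (under X) ∘ tgt X end.
Fixpoint bidn n : forall X : nGrd E n, hom (bot n X) (cells E n X) :=
  match n with 0 => fun X => idm X | n'.+1 => fun X => idn X ∘ bidn (under X) end.

Lemma bsrcS n (X : nGrd E n.+1) f : bsrc X @ f = bsrc (under X) @ (src X @ f).
Proof. exact: apM. Qed.

Lemma btgtS n (X : nGrd E n.+1) f : btgt X @ f = btgt (under X) @ (tgt X @ f).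
Proof. exact: apM. Qed.

Lemma bsrc_bidn n (X : nGrd E n) y : bsrc X @ (bidn X @ y) = y.
Proof. by elim: n X y => [|n IH] X y /=; rewrite ?apM ?src_idn ?IH // !ap1. Qed.

Lemma btgt_bidn n (X : nGrd E n) y : btgt X @ (bidn X @ y) = y.
Proof. by elim: n X y => [|n IH] X y /=; rewrite ?apM ?tgt_idn ?IH // !ap1. Qed.

Lemma compat_bot n (X : nGrd E n) Q (s t : hom Q (cells E n X)) i : compat cE s t i ->
  comph cE (bsrc X ∘ s) (btgt X ∘ t) (i ∘ bidn X).
Proof.
elim: n X Q s t i => [|n IH] X Q s t i.
  by move=> [_ _]; rewrite /= !cmp1m cmpm1.
by move=> [_ [_ tt /IH]]; rewrite /= -!cmpA tt.
Qed.

Lemma comph_bot n (X : nGrd E n.+1) : comph cE (bsrc X) (btgt X) (bidn X).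
Proof. exact: compat_bot (compat_under cE X). Qed.

Lemma asph_conn n (X : nGrd E n.+1) a b : asph X -> bang _ @ a = bang _ @ b ->
  exists w, bsrc X @ w = a /\ btgt X @ w = b.
Proof.
elim: n X a b => [|n IH] X a b [aX sX] ab.
  have [w [ws wt]] := sX a b ab; exists w.
  by rewrite /= !apM ws wt !ap1.
have [w [ws wt]] := IH (under X) a b aX ab; exists (idn X @ w).
by rewrite [bsrc X @ _]bsrcS [btgt X @ _]btgtS src_idn tgt_idn.
Qed.

Section Top.
Variables (n : nat) (X : nGrd E n.+2).
Hypothesis aX : asph X.
Local Notation s := (bsrc X).
Local Notation t := (btgt X).
Local Notation i := (bidn X).
Local Notation unit f := (idn X @ (src X @ f)).

Lemma bsrc_unit f : s @ unit f = s @ f.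
Proof. by rewrite [LHS]bsrcS src_idn -bsrcS. Qed.

Lemma btgt_unit f : t @ unit f = t @ f.
Proof. by rewrite [LHS]btgtS tgt_idn [RHS]btgtS !btgtS glob_tgt. Qed.

(** The cell obtained from [f] by composing, along objects, with the inverse of its
    domain; it is a loop at the initial object of [f]. *)
Definition loop f := tm f (unit f) (i @ (s @ f)).

Lemma loop_bsrc f : s @ loop f = s @ f.
Proof. by rewrite !tm_nat bsrc_unit bsrc_bidn tmr. Qed.

Lemma loop_btgt f : t @ loop f = s @ f.
Proof. by rewrite !tm_nat btgt_unit btgt_bidn tml. Qed.

Lemma inv_hom W (a : el W -> el (cells E n.+2 X)) : is_hom cE a ->
  is_hom cE (fun w => tm (i @ (t @ a w)) (a w) (i @ (s @ a w))).
Proof.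
move=> [h ha].
have [k kE] := comph_inv (bsrc_bidn (n:=n.+2) (X:=X)) (btgt_bidn (n:=n.+2) (X:=X)) (@comph_bot n.+1 X).
by exists (k ∘ h) => w; rewrite apM kE /invh ha.
Qed.

Lemma comp_hom W (a b : el W -> el (cells E n.+2 X)) : is_hom cE a -> is_hom cE b ->
  (forall w, t @ a w = s @ b w) -> is_hom cE (fun w => tm (a w) (i @ (t @ a w)) (b w)).
Proof. exact: (@comph_bot n.+1 X). Qed.

Lemma loop_hom W (f : el W -> el (cells E n.+2 X)) : is_hom cE f ->
  is_hom cE (fun w => loop (f w)).
Proof.
move=> hf; have hu := hom_comp (idn X) (hom_comp (src X) hf).
have := comp_hom hf (inv_hom hu) _ => H; apply: is_hom_ext (H _) => w.
  by rewrite btgt_unit bsrc_unit -tmA tmr.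
by rewrite !tm_nat !bsrc_bidn btgt_unit bsrc_unit tmr.
Qed.

(** Eckmann-Hilton: a loop [f] at [a] commutes with every cell [w] from [a] to [b], so it
    can be moved to [b] by composition with [w] and its inverse. *)
Lemma loop_move W (f w : el W -> el (cells E n.+2 X)) : is_hom cE f -> is_hom cE w ->
  (forall z, s @ f z = s @ w z) -> (forall z, t @ f z = s @ w z) ->
  is_hom cE (fun z => tm (f z) (i @ (s @ w z)) (i @ (t @ w z))).
Proof.
move=> hf hw fs ft.
have hfw := comp_hom hf hw ft.
have hv := inv_hom hw.
have H := comp_hom hv hfw _; apply: is_hom_ext (H _) => z; last first.
  by rewrite !tm_nat !btgt_bidn !bsrc_bidn fs ft tmr tml.
have [P [p [q [pb pinj psur]]]] := pb_el cE t s.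
have pq y : t @ (p @ y) = s @ (q @ y) by rewrite -!apM pb.1.
have [m mE] := comp_hom (ap_is_hom cE p) (ap_is_hom cE q) pq.
pose a := i @ (s @ w z); pose b := i @ (t @ w z).
have [x1 [x1p x1q]] : exists y, p @ y = a /\ q @ y = f z.
  by apply: psur; rewrite btgt_bidn fs.
have [x2 [x2p x2q]] : exists y, p @ y = a /\ q @ y = a.
  by apply: psur; rewrite btgt_bidn bsrc_bidn.
have [x3 [x3p x3q]] : exists y, p @ y = w z /\ q @ y = b.
  by apply: psur; rewrite bsrc_bidn.
have := mE (tm x1 x2 x3); rewrite !tm_nat x1p x2p x3p x1q x2q x3q !mE x1p x2p x3p x1q x2q x3q.
have ia : i @ (t @ a) = a by rewrite /a btgt_bidn.
have ib : i @ (t @ b) = b by rewrite /b btgt_bidn.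
rewrite ft -/a -/b ia ib !tml tmr => e.
by rewrite tmA tml e -tmA tmr tml.
Qed.

(** The translate is the composite of a loop with [idn X @ x], the loop of [f] being moved
    along a path between the two objects. Such a path exists only after a cover, but its
    choice does not matter by [loop_move]. *)
Lemma trans_hom W (f : el W -> el (cells E n.+2 X)) (x : el W -> el (cells E n.+1 (under X))) :
  is_hom cE f -> is_hom cE x -> is_hom cE (fun w => tm (f w) (unit (f w)) (idn X @ x w)).
Proof.
move=> hf hx; have hix := hom_comp (idn X) hx.
have [P [p [q pq]]] := prod_ex_el cE oneP (bot n.+2 X) (bot n.+2 X).
have [inj _] := prod_el cE oneP pq; have [st [sP tP]] := prod_lift pq s t.
have sst : surj cE st.
  move=> z; have [|w [ws wt]] := @asph_conn n.+1 X (p @ z) (q @ z) aX; first by rewrite !bang_ap.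
  by exists w; apply: inj; rewrite -apM ?sP ?tP.
have [k kE] := prod_hom oneP pq (hom_comp s hf) (hom_comp s hix).
have [W' [c [v [sc vE]]]] := cover_lift sst (ap_is_hom cE k).
have vs w : s @ (v @ w) = s @ f (c @ w) by have [<- _] := kE (c @ w); rewrite -vE -[RHS]apM sP.
have vt w : t @ (v @ w) = s @ (idn X @ x (c @ w)) by have [_ <-] := kE (c @ w); rewrite -vE -[RHS]apM tP.
apply: (desc_hom sc).
have hl := loop_hom (hom_pre c hf).
have H := loop_move hl (ap_is_hom cE v) _ _.
have {}H : is_hom cE (fun w => tm (f (c @ w)) (unit (f (c @ w))) (i @ (s @ (idn X @ x (c @ w))))).
  apply: is_hom_ext (H _ _) => w; last by rewrite loop_btgt vs.
    by rewrite vs vt /loop tmA tml.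
  by rewrite loop_bsrc vs.
apply: is_hom_ext (comp_hom H (hom_pre c hix) _) => w.
  by rewrite !tm_nat btgt_unit btgt_bidn tml tmA tml.
by rewrite !tm_nat btgt_unit btgt_bidn tml.
Qed.

Lemma tm_cancel Z (u e a g w : el Z) : tm (tm u e a) (tm g e a) w = tm u g w.
Proof.
have wE : w = tm (tm g e a) a (tm e g w) by rewrite tmA tml -tmA tmr tml.
by rewrite {1}wE -[LHS]tmA tmr tmA tml -tmA tmr.
Qed.

(** In dimension at least two, cells with a common domain are separated by maps to
    commutative objects: the cells [f] and [tm f (unit f) (idn X @ x)], one for each
    object [x], are identified in a quotient which is commutative because loops compose. *)
Lemma top_sep : exists B (nu : hom (cells E n.+2 X) B),
  tmc cE B /\ forall f g, nu @ f = nu @ g -> src X @ f = src X @ g -> f = g.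
Proof.
have [R [rf [rx rP]]] := prod_ex_el cE oneP (cells E n.+2 X) (cells E n.+1 (under X)).
have [_ rsur] := prod_el cE oneP rP.
have [m mE] := trans_hom (ap_is_hom cE rf) (ap_is_hom cE rx).
have [|B [nu [snu nuP]]] := @quo_refl E cE _ _ rf m.
  move=> f; have [|r [r0 r1]] := rsur f (src X @ f); first by rewrite bang_ap.
  by exists r; rewrite mE r0 r1 tmr.
exists B, nu; split; last first.
  move=> f g /nuP [r [r0]]; rewrite mE r0 => <-.
  by rewrite !tm_nat !src_idn tml => <-; rewrite tmr.
have nu_trans f x : bang _ @ f = bang _ @ x -> nu @ tm f (unit f) (idn X @ x) = nu @ f.
  by move=> /rsur [r [r0 r1]]; apply/esym/nuP; exists r; rewrite mE r0 r1.
move=> W x y z hx hy hz; have [W' [c [u [v [w [sc uvw]]]]]] := cover3 snu hx hy hz.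
apply: (desc_hom sc).
have hu := ap_is_hom cE u; have hxu := hom_comp (src X) hu.
pose g a := tm (v @ a) (unit (v @ a)) (unit (u @ a)).
pose h a := tm (w @ a) (unit (w @ a)) (unit (u @ a)).
have hg : is_hom cE g by exact: trans_hom (ap_is_hom cE v) hxu.
have hh : is_hom cE h by exact: trans_hom (ap_is_hom cE w) hxu.
have gs a : src X @ g a = src X @ (u @ a) by rewrite !tm_nat !src_idn tml.
have hs a : src X @ h a = src X @ (u @ a) by rewrite !tm_nat !src_idn tml.
have gb a : s @ g a = s @ (u @ a) by rewrite !bsrcS gs.
have hb a : s @ h a = s @ (u @ a) by rewrite !bsrcS hs.
have lu := loop_hom hu; have lg := inv_hom (loop_hom hg).
have tg a : t @ loop (u @ a) = s @ tm (i @ (t @ loop (g a))) (loop (g a)) (i @ (s @ loop (g a))).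
  by rewrite [RHS]tm_nat !bsrc_bidn !loop_btgt !loop_bsrc gb tmr.
have k1 := comp_hom lu lg tg.
have {}k1 : is_hom cE (fun a => tm (loop (u @ a)) (loop (g a)) (i @ (s @ (u @ a)))).
  by apply: is_hom_ext k1 => a; rewrite !loop_btgt !loop_bsrc gb -tmA tmr.
have k2 : is_hom cE (fun a => tm (u @ a) (g a) (h a)).
  have tk a : t @ tm (loop (u @ a)) (loop (g a)) (i @ (s @ (u @ a))) = s @ (u @ a).
    by rewrite [LHS]tm_nat !loop_btgt btgt_bidn gb tml.
  apply: is_hom_ext (comp_hom k1 hh _) => a; last by rewrite tk hb.
  by rewrite tk tmA tml /loop gs gb tm_cancel.
apply: is_hom_ext (hom_comp nu k2) => a; have [<- <- <-] := uvw a.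
rewrite tm_nat /g /h !nu_trans //; by rewrite !bang_ap.
Qed.

End Top.

(** Objects joined by an arrow which [q] does not distinguish from an identity are
    identified in a commutative quotient, [q] having a commutative codomain. *)
Lemma conn_quot (X : nGrd E 1) I (q : hom (cells E 1 X) I) : asph X -> tmc cE I ->
  exists Z (r : hom (cells E 0 (under X)) Z), tmc cE Z /\
    forall y y', r @ y = r @ y' -> exists v,
      [/\ src X @ v = y, tgt X @ v = y' & q @ v = q @ (idn X @ y)].
Proof.
move=> [_ sX] cI.
have [R [m [minj mP]]] := equalizer_ex cE oneP q (q ∘ idn X ∘ src X).
have [|Z [r [sr rP]]] := @quo_refl E cE _ _ (src X ∘ m) (tgt X ∘ m).
  move=> y; have [|v vE] := (mP (idn X @ y)).2; first by rewrite !apM src_idn.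
  by exists v; rewrite !apM vE src_idn tgt_idn.
have rv y y' : r @ y = r @ y' <->
    exists v, [/\ src X @ v = y, tgt X @ v = y' & q @ v = q @ (idn X @ y)].
  split=> [/rP [v []]|[v [vs vt vq]]].
    rewrite !apM => <- <-; exists (m @ v); split=> //.
    by have := (mP (m @ v)).1 (ex_intro _ v erefl); rewrite !apM.
  apply/rP; have [|v' vE] := (mP v).2; first by rewrite !apM vs.
  by exists v'; rewrite !apM vE.
exists Z, r; split; last by move=> y y' /rv.
move=> W x y z hx hy hz; have [W1 [c1 [u [v [t [s1 uvt]]]]]] := cover3 sr hx hy hz.
have [P [p0 [p1 pP]]] := prod_ex_el cE oneP (cells E 0 (under X)) (cells E 0 (under X)).
have [pinj psur] := prod_el cE oneP pP; have [st [sP tP]] := prod_lift pP (src X) (tgt X).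
have sst : surj cE st.
  move=> b; have [|w [ws wt]] := sX (p0 @ b) (p1 @ b); first by rewrite /= !bang_ap.
  by exists w; apply: pinj; rewrite -apM ?sP ?tP.
have [a' [a0 a1]] := prod_lift pP v u; have [b' [b0 b1]] := prod_lift pP v t.
have [W2 [c2 [a [b [b2 [s2 ab]]]]]] := cover3 sst (ap_is_hom cE a') (ap_is_hom cE b') (ap_is_hom cE b').
have aE w : src X @ (a @ w) = v @ (c2 @ w) /\ tgt X @ (a @ w) = u @ (c2 @ w).
  by rewrite -sP -tP !apM; have [-> _ _] := ab w; rewrite -!apM a0 a1.
have bE w : src X @ (b @ w) = v @ (c2 @ w) /\ tgt X @ (b @ w) = t @ (c2 @ w).
  by rewrite -sP -tP !apM; have [_ -> _] := ab w; rewrite -!apM b0 b1.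
have [Q [q0 [q1 qP]]] := prod_ex_el cE oneP (cells E 0 (under X)) I.
have [qinj _] := prod_el cE oneP qP; have [d [d0 d1]] := prod_lift qP (src X) q.
have [B [e [n [se ninj ne]]]] := im_el cE d.
have [|dB dBe] := desc_el (c := cE) (h := r ∘ tgt X) se.
  move=> f f' ff'; have dd : d @ f = d @ f' by rewrite -ne !apM ff'.
  have fs : src X @ f = src X @ f' by rewrite -d0 !apM dd.
  have fq : q @ f = q @ f' by rewrite -d1 !apM dd.
  rewrite !apM; apply/rv; exists (tm (idn X @ (tgt X @ f)) f f').
  by rewrite !tm_nat src_idn tgt_idn fs fq !tmr tml.
pose k w := tm (a @ w) (idn X @ (v @ (c2 @ w))) (b @ w).
apply: (desc_hom (surj_comp s2 s1)).
have hk : is_hom cE (fun w => e @ k w).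
  apply: (lift_inj ninj).
  have hp := cI _ _ _ _ (hom_comp q (ap_is_hom cE a)) (hom_comp q (hom_comp (idn X) (ap_is_hom cE (v ∘ c2)))) (hom_comp q (ap_is_hom cE b)).
  have [l lE] := prod_hom oneP qP (ap_is_hom cE (v ∘ c2)) hp.
  exists l => w; rewrite -apM ne; apply: qinj; rewrite -[RHS]apM ?d0 ?d1 ?(lE w).1 ?(lE w).2.
    by rewrite /k !tm_nat src_idn (aE w).1 (bE w).1 tmr apM.
  by rewrite /k !tm_nat !apM.
apply: is_hom_ext (hom_comp dB hk) => w.
rewrite -apM dBe apM /k !tm_nat tgt_idn (aE w).2 (bE w).2 apM.
by have [-> -> ->] := uvt (c2 @ w).
Qed.

End Separation.

(** * The inclusion of commutative objects *)

Section Inclusion.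
Variables (C : category) (cC : conc C) (ccC : comm_closed C) (A : abgroup C).
Local Notation M := (comm_cat C).
Local Notation J := (incl (@commutative_ob C)).
Local Notation AM := (comm_abgroup ccC A).
Local Notation oneP := (@ag_oneP C A).
Local Notation oneM := (@ag_oneP M AM).
Local Notation cM := (conc_comm cC oneP).
Local Notation nJ := (nGrd_map (comm_pb ccC) (incl_pb ccC)).
Local Notation to_ := (cells_to (comm_pb ccC) (incl_pb ccC)).
Local Notation from_ := (cells_from (comm_pb ccC) (incl_pb ccC)).
Local Notation el := (@el C cC).
Local Notation "f @ x" := (@ap C cC _ _ f x) (at level 20).
Local Notation tm := (@mal C cC _).
Local Notation cmap n f := (fmap (cells C n) f).
Local Notation mmap n f := (fmap J (fmap (cells M n) f)).
Local Notation bang := (to_one oneP).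
Local Notation parelC n := (parel cC oneP n).
Local Notation parelM n := (parel cM oneM n).

(** The image of an n-groupoid under a functor has its cells only up to isomorphism; [jt]
    and [jf] are this isomorphism on elements. *)
Definition jt n (X : nGrd M n) (f : el (cells C n (nJ n X))) : el (sval (cells M n X)) :=
  to_ X @ f.

Definition jf n (X : nGrd M n) (f : el (sval (cells M n X))) : el (cells C n (nJ n X)) :=
  from_ X @ f.

Lemma jtK n (X : nGrd M n) f : jf (@jt n X f) = f.
Proof. by rewrite /jf /jt -apM cells_ft ap1. Qed.

Lemma jfK n (X : nGrd M n) f : jt (@jf n X f) = f.
Proof. by rewrite /jf /jt -apM cells_tf ap1. Qed.

Lemma jt_inj n (X : nGrd M n) : injective (@jt n X).
Proof. exact: can_inj (@jtK n X). Qed.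

Lemma jt_src n (X : nGrd M n.+1) f : jt (X := under X) (src (nJ n.+1 X) @ f) = fmap J (src X) @ jt f.
Proof.
rewrite -{1}[f]jtK; move: (jt f) => g; rewrite -[RHS](jfK (X := under X)); congr jt.
by rewrite /jf -!apM; apply: hap; exact (src_map (comm_pb ccC) (incl_pb ccC) X).
Qed.

Lemma jt_tgt n (X : nGrd M n.+1) f : jt (X := under X) (tgt (nJ n.+1 X) @ f) = fmap J (tgt X) @ jt f.
Proof.
rewrite -{1}[f]jtK; move: (jt f) => g; rewrite -[RHS](jfK (X := under X)); congr jt.
by rewrite /jf -!apM; apply: hap; exact (tgt_map (comm_pb ccC) (incl_pb ccC) X).
Qed.

Lemma jt_idn n (X : nGrd M n.+1) f : jt (idn (nJ n.+1 X) @ f) = fmap J (idn X) @ jt (X := under X) f.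
Proof.
rewrite -{1}[f](jtK (X := under X)); move: (jt (X := under X) f) => g; rewrite -[RHS]jfK; congr jt.
rewrite /jf -!apM; apply: hap.
exact (cells_from_nat (comm_pb ccC) (incl_pb ccC) (@idt (grd_tower M n) X)).
Qed.

Lemma jt_map n (X Z : nGrd M n) (h : hom X Z) f : jt (cmap n (fmap (nJ n) h) @ f) = mmap n h @ jt f.
Proof. by rewrite /jt -!apM; congr (_ @ _); rewrite -cells_to_nat. Qed.

Lemma jt_parel n (X : nGrd M n) f g : parelC n (nJ n X) f g <-> parelM n X (jt f) (jt g).
Proof.
case: n X f g => [|n] X f g.
  rewrite /parel. 
  have e (x : el (sval (cells M 0 X))) : @ap M cM _ _ (to_one oneM X) x = bang _ @ x.
    by rewrite -[RHS](hap _ (bangE oneP (fmap J (to_one oneM X)))).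
  by rewrite !e /jt !bang_ap.
have inj := @jt_inj n (under X).
split=> -[e0 e1]; split.
- by have := congr1 (@jt n (under X)) e0; rewrite !jt_src.
- by have := congr1 (@jt n (under X)) e1; rewrite !jt_tgt.
- by apply: inj; rewrite !jt_src.
- by apply: inj; rewrite !jt_tgt.
Qed.

(** Functors to the image of [X] can be given by maps to the cells of [X]. *)
Lemma to_nJ n (W : nGrd C n.+1) (X : nGrd M n.+1) (h : hom (under W) (nJ n (under X)))
    (k : hom (cells C n.+1 W) (sval (cells M n.+1 X))) :
  (forall f, fmap J (src X) @ (k @ f) = jt (cmap n h @ (src W @ f))) ->
  (forall f, fmap J (tgt X) @ (k @ f) = jt (cmap n h @ (tgt W @ f))) ->
  (forall x, k @ (idn W @ x) = fmap J (idn X) @ jt (cmap n h @ x)) ->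
  exists u : hom W (nJ n.+1 X), h_obj u = h /\ forall f, jt (cmap n.+1 u @ f) = k @ f.
Proof.
move=> ks kt ki.
have jk f : jt ((from_ X ∘ k) @ f) = k @ f by rewrite apM [jt _]jfK.
have [|||u [u0 uE]] := @hom_full C cC n W (nJ n.+1 X) h (from_ X ∘ k).
- by apply: (@ap_inj C cC) => f; rewrite apM; apply: (@jt_inj n (under X)); rewrite jt_src jk ks apM.
- by apply: (@ap_inj C cC) => f; rewrite apM; apply: (@jt_inj n (under X)); rewrite jt_tgt jk kt apM.
- by apply: (@ap_inj C cC) => f; apply: jt_inj; rewrite apM jk ki [in RHS]apM [RHS]jt_idn.
by exists u; split=> // f; rewrite uE jk.
Qed.

End Inclusion.

(** * Reflection of higher groupoids *)

Section Reflection.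
Variables (C : category) (cC : conc C) (ccC : comm_closed C) (A : abgroup C).
Local Notation M := (comm_cat C).
Local Notation J := (incl (@commutative_ob C)).
Local Notation AM := (comm_abgroup ccC A).
Local Notation oneP := (@ag_oneP C A).
Local Notation oneM := (@ag_oneP M AM).
Local Notation cM := (conc_comm cC oneP).
Local Notation nJ := (nGrd_map (comm_pb ccC) (incl_pb ccC)).
Local Notation to_ := (cells_to (comm_pb ccC) (incl_pb ccC)).
Local Notation from_ := (cells_from (comm_pb ccC) (incl_pb ccC)).
Local Notation el := (@el C cC).
Local Notation "f @ x" := (@ap C cC _ _ f x) (at level 20).
Local Notation tm := (@mal C cC _).
Local Notation cmap n f := (fmap (cells C n) f).
Local Notation mmap n f := (fmap J (fmap (cells M n) f)).
Local Notation bang := (to_one oneP).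
Local Notation parelC n := (parel cC oneP n).
Local Notation parelM n := (parel cM oneM n).
Local Notation jt := (@jt C cC ccC _ _).
Local Notation jf := (@jf C cC ccC _ _).
Local Notation labC := (lab cC A).
Local Notation labM := (lab cM AM).

Lemma sval_tmc (X : M) : tmc cC (sval X).
Proof. exact/(comm_tmc cC oneP)/(svalP X). Qed.

Lemma bangM (X : M) (x : el (sval X)) : @ap M cM _ _ (to_one oneM X) x = bang _ @ x.
Proof. exact: (hap _ (bangE oneP (fmap J (to_one oneM X)))). Qed.

Definition nsep (X : C) (x y : el X) := forall Q (h : hom X Q), tmc cC Q -> h @ x = h @ y.

Hypothesis refl_ex : forall X : C, exists I (q : hom X I),
  [/\ surj cC q, tmc cC I & forall x y, q @ x = q @ y -> nsep x y].

Definition reflm (X Y : C) (q : hom X Y) :=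
  surj cC q /\ forall x y, q @ x = q @ y -> nsep x y.

Lemma reflm_desc (X Y T : C) (q : hom X Y) (h : hom X T) : reflm q -> tmc cC T ->
  exists u : hom Y T, forall x, u @ (q @ x) = h @ x.
Proof.
move=> [sq kq] cT; have [|u uE] := desc_el (c := cC) (h := h) sq.
  by move=> x y /kq; exact.
by exists u => x; rewrite -apM uE.
Qed.

Definition rho n (W : nGrd C n) (X : nGrd M n) (h : hom W (nJ n X)) :
  hom (cells C n W) (sval (cells M n X)) := to_ X ∘ cmap n h.

Lemma rhoE n (W : nGrd C n) (X : nGrd M n) (h : hom W (nJ n X)) f : rho h @ f = jt (cmap n h @ f).
Proof. exact: apM. Qed.

Section Steps.
Variables (n : nat) (W : nGrd C n.+1) (X : nGrd M n.+1) (h : hom W (nJ n.+1 X)).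
Local Notation rho0 := (@rho n (under W) (under X) (h_obj h)).

Lemma rho_src f : rho0 @ (src W @ f) = fmap J (src X) @ (rho h @ f).
Proof. by rewrite !rhoE -jt_src src_el. Qed.

Lemma rho_tgt f : rho0 @ (tgt W @ f) = fmap J (tgt X) @ (rho h @ f).
Proof. by rewrite !rhoE -jt_tgt tgt_el. Qed.

Lemma rho_idn x : rho h @ (idn W @ x) = fmap J (idn X) @ (rho0 @ x).
Proof. by rewrite !rhoE -jt_idn idn_el. Qed.

End Steps.

Lemma rho_parel n (W : nGrd C n) (X : nGrd M n) (h : hom W (nJ n X)) f g :
  parelC n W f g -> parelM n X (rho h @ f) (rho h @ g).
Proof. by move=> fg; rewrite !rhoE; apply/jt_parel; exact: parel_hom. Qed.

(** At each level the cells of [X] are the universal commutative quotient of those of [W]. *)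
Fixpoint isrefl n : forall (W : nGrd C n) (X : nGrd M n) (h : hom W (nJ n X)), Prop :=
  match n with
  | 0 => fun W X h => reflm (rho h)
  | n'.+1 => fun W X h => @isrefl n' (under W) (under X) (h_obj h) /\ reflm (rho h)
  end.

Lemma isrefl_top n (W : nGrd C n) (X : nGrd M n) (h : hom W (nJ n X)) : isrefl h -> reflm (rho h).
Proof. by case: n W X h => [|n] W X h //= []. Qed.

(** Sources, targets and identities descend to the universal quotients, and over
    commutative cells nothing has to be checked for the compositions. *)
Lemma isrefl_ex n (W : nGrd C n) : exists (X : nGrd M n) (h : hom W (nJ n X)), isrefl h.
Proof.
elim: n W => [|n IH] W.
  have [I [q [sq /(comm_tmc cC oneP) cI kq]]] := refl_ex W.
  exists (exist _ I cI : M), q; split=> [y|x y]; last by rewrite !rhoE /jt /= !ap1; exact: kq.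
  by have [x <-] := sq y; exists x; rewrite rhoE /jt /= ap1.
have [X [h hr]] := IH (under W); have rr := isrefl_top hr; have [sr kr] := rr.
have [Q [q [sq cQ kq]]] := refl_ex (cells C n.+1 W); have rq : reflm q by [].
have cQ' := (comm_tmc cC oneP Q).2 cQ; pose Q' : M := exist _ Q cQ'.
have [s sE] := reflm_desc (rho h ∘ src W) rq (@sval_tmc (cells M n X)).
have [t tE] := reflm_desc (rho h ∘ tgt W) rq (@sval_tmc (cells M n X)).
have [i iE] := reflm_desc (q ∘ idn W) rr cQ.
have si x : s @ (i @ x) = x by have [y <-] := sr x; rewrite iE apM sE apM src_idn.
have ti x : t @ (i @ x) = x by have [y <-] := sr x; rewrite iE apM tE apM tgt_idn.
have [|G [j [k [jk kj sj tj ij]]]] := @ext_nGrd M cM n X Q' s t i.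
  apply: (@compat_tmc M cM _ oneM); first exact: tmc_comm.
  - by apply: (@ap_inj M cM) => x; rewrite apM ap1; exact: si.
  - by apply: (@ap_inj M cM) => x; rewrite apM ap1; exact: ti.
  - move=> y; have [f <-] := sq y; have := rho_parel h (@parel_src C cC _ oneP n W f).
    by rewrite -!(apM (rho h)) -sE -tE.
have jkE x : fmap J j @ (fmap J k @ x) = x by exact: (@iso_el M cM _ _ k j jk x).
have kjE x : fmap J k @ (fmap J j @ x) = x by exact: (@iso_el M cM _ _ j k kj x).
have sjE x : fmap J (src (GrdOb G : nGrd M n.+1)) @ x = s @ (fmap J j @ x).
  by have := congr1 (fun g => @ap M cM _ _ g x) sj; rewrite apM => /esym; exact.
have tjE x : fmap J (tgt (GrdOb G : nGrd M n.+1)) @ x = t @ (fmap J j @ x).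
  by have := congr1 (fun g => @ap M cM _ _ g x) tj; rewrite apM => /esym; exact.
have ijE x : fmap J j @ (fmap J (idn (GrdOb G : nGrd M n.+1)) @ x) = i @ x.
  by have := congr1 (fun g => @ap M cM _ _ g x) ij; rewrite apM; exact.
have [|||u [u0 uE]] := @to_nJ C cC ccC n W (GrdOb G) h (fmap J k ∘ q).
- by move=> f; rewrite sjE apM jkE sE apM rhoE.
- by move=> f; rewrite tjE apM jkE tE apM rhoE.
- by move=> x; rewrite apM -rhoE -[RHS]kjE ijE iE apM.
exists (GrdOb G), u; split; first by rewrite u0.
split=> [y|f g].
  have [f fE] := sq (fmap J j @ y); exists f; by rewrite rhoE uE apM fE kjE.
by rewrite !rhoE !uE !apM => /(congr1 (fun x => fmap J j @ x)); rewrite !jkE; exact: kq.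
Qed.

Lemma isrefl_univ n (W : nGrd C n) (X X2 : nGrd M n) (h : hom W (nJ n X)) (g : hom W (nJ n X2)) :
  isrefl h -> exists u : hom X X2, forall f, mmap n u @ (rho h @ f) = rho g @ f.
Proof.
elim: n W X X2 h g => [|n IH] W X X2 h g.
  by move=> rr; have [u uE] := reflm_desc (rho g) rr (@sval_tmc X2); exists u.
move=> [hr rr]; have [sr kr] := rr; have r0 := isrefl_top hr.
have [u0 u0E] := IH _ _ (under X2) _ (h_obj g) hr.
have [k kE] := reflm_desc (rho g) rr (@sval_tmc (cells M n.+1 X2)).
have ks x : fmap J (src X2) @ (k @ x) = mmap n u0 @ (fmap J (src X) @ x).
  by have [f <-] := sr x; rewrite kE -!rho_src u0E.
have kt x : fmap J (tgt X2) @ (k @ x) = mmap n u0 @ (fmap J (tgt X) @ x).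
  by have [f <-] := sr x; rewrite kE -!rho_tgt u0E.
have [s0 _] := r0.
have ki x : k @ (fmap J (idn X) @ x) = fmap J (idn X2) @ (mmap n u0 @ x).
  by have [y <-] := s0 x; rewrite -rho_idn kE rho_idn u0E.
have [|||u [_ uE]] := @hom_full M cM n X X2 u0 k.
- by apply: (@ap_inj M cM) => x; rewrite !apM; exact: ks.
- by apply: (@ap_inj M cM) => x; rewrite !apM; exact: kt.
- by apply: (@ap_inj M cM) => x; rewrite !apM; exact: ki.
by exists u => f; rewrite -kE uE.
Qed.

(** Parallel cells with the same images under all maps to commutative objects agree:
    [topsep] in the top dimension, [Sep] in all dimensions above [0]. *)
Definition topsep n (X : nGrd C n) := forall f g, parelC n X f g -> nsep f g -> f = g.

Fixpoint Sep n : nGrd C n -> Prop :=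
  match n with
  | 0 => fun _ => True
  | n'.+1 => fun X => @Sep n' (under X) /\ @topsep n'.+1 X
  end.

Lemma topsep_high n (X : nGrd C n.+2) : asph cC oneP X -> topsep X.
Proof.
move=> aX f g [fg _] sfg; have [B [nu [cB nuP]]] := top_sep aX.
by apply: nuP => //; exact: sfg.
Qed.

(** Cells whose images are parallel become parallel after a change that does not affect
    their images: in dimension one by composing with arrows that [rho] does not
    distinguish from identities, in higher dimensions by translating the domain, the
    codomains then agreeing by [Sep]. *)
Lemma lift_par n (W : nGrd C n) (X : nGrd M n) (h : hom W (nJ n X)) :
  asph cC oneP W -> isrefl h -> Sep W ->
  forall f g, parelM n X (rho h @ f) (rho h @ g) -> exists f' g',
    [/\ parelC n W f' g', rho h @ f' = rho h @ f & rho h @ g' = rho h @ g].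
Proof.
case: n W X h => [|[|n]] W X h aW.
- move=> _ _ f g e; exists f, g; split=> //; move: e; rewrite /parel.
  by rewrite [X in X = _](@bangM (cells M 0 X)) [X in _ = X](@bangM (cells M 0 X)) !bang_ap.
- move=> [[s0 k0] _] _ f g [es et].
  have {}es : @rho _ (under W) (under X) (h_obj h) @ (src W @ f) = @rho _ (under W) (under X) (h_obj h) @ (src W @ g) by rewrite !rho_src.
  have {}et : @rho _ (under W) (under X) (h_obj h) @ (tgt W @ f) = @rho _ (under W) (under X) (h_obj h) @ (tgt W @ g) by rewrite !rho_tgt.
  have [Z [r [cZ rP]]] := conn_quot (rho h) aW (@sval_tmc (cells M 1 X)).
  have [v [vs vt vr]] := rP _ _ (k0 _ _ es _ r cZ).
  have [v' [vs' vt' vr']] := rP _ _ (k0 _ _ (esym et) _ r cZ).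
  exists f, (tm v (idn W @ (src W @ g)) (tm g (idn W @ (tgt W @ g)) v')); split=> //.
    by split; rewrite !tm_nat ?src_idn ?tgt_idn ?vs ?vt ?vs' ?vt' ?tmr ?tml.
  by rewrite !tm_nat vr vr' !rho_idn es tml tmr.
- move=> [[_ rr0] _] [[_ sp] _] f g [es et].
  have {}es : @rho _ (under W) (under X) (h_obj h) @ (src W @ f) = @rho _ (under W) (under X) (h_obj h) @ (src W @ g) by rewrite !rho_src.
  have {}et : @rho _ (under W) (under X) (h_obj h) @ (tgt W @ f) = @rho _ (under W) (under X) (h_obj h) @ (tgt W @ g) by rewrite !rho_tgt.
  pose f' := tm (idn W @ (src W @ g)) (idn W @ (src W @ f)) f.
  have f's : src W @ f' = src W @ g by rewrite !tm_nat !src_idn tmr.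
  exists f', g; split=> //; last by rewrite !tm_nat !rho_idn es tml.
  split=> //; apply: sp.
    apply: parel_trans (parel_sym (parel_src oneP f')) _.
    by rewrite f's; exact: parel_src.
  by apply: rr0.2; rewrite !tm_nat !tgt_idn es et tml.
Qed.

(** A cell between the images of parallel lifts is the image of a cell between the lifts. *)
Lemma asph_refl n (W : nGrd C n) (X : nGrd M n) (h : hom W (nJ n X)) :
  asph cC oneP W -> isrefl h -> Sep W -> asph cM oneM X.
Proof.
elim: n W X h => [|n IH] W X h.
  move=> aW _ _ y; have [w wy] := aW y; exists (rho h @ w).
  by rewrite [LHS](@bangM (cells M 0 X)) bang_ap.
move=> [aW sW] [r0 rr] [S0 _]; split; first exact: IH r0 S0.
move=> x y; have [s0 k0] := isrefl_top r0.
have [f <-] := s0 x; have [g <-] := s0 y.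
move=> /(lift_par aW r0 S0) [f' [g' [fg <- <-]]]; have [w [<- <-]] := sW _ _ fg.
by exists (rho h @ w); rewrite rho_src rho_tgt.
Qed.

Lemma asph_nJ n (X : nGrd M n) : asph cM oneM X -> asph cC oneP (nJ n X).
Proof.
elim: n X => [|n IH] X.
  by move=> aX y; have [x xy] := aX y; exists x; rewrite -bangM.
move=> [aX sX]; split; first exact: (IH (under X)).
move=> x y /(@jt_parel C cC ccC A n (under X)) /sX [w [ws wt]]; exists (jf w).
split; apply: (@jt_inj C cC ccC _ (under X)).
  by rewrite jt_src jfK.
by rewrite jt_tgt jfK.
Qed.

Section Label.
Variables (n : nat) (X : labM n).

Let v (f g : el (cells C n (nJ n (l_ob X)))) : el A := @l_v M cM AM n X (jt f) (jt g).

Lemma Jlab_hom W (a b : el W -> el (cells C n (nJ n (l_ob X)))) : is_hom cC a -> is_hom cC b ->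
  (forall w, parelC n (nJ n (l_ob X)) (a w) (b w)) -> is_hom cC (fun w => v (a w) (b w)).
Proof.
move=> ha hb ab; have [P [p [q [k [pq inj par sur kE]]]]] := l_par X.
have pq' := is_par_map (comm_pb ccC) (incl_pb ccC) (@incl_prod C ccC) pq.
have [u uE] := par_lift pq' ha hb ab.
have uP w : fmap J p @ (u @ w) = jt (a w) /\ fmap J q @ (u @ w) = jt (b w).
  by have [<- <-] := uE w; rewrite !apM -![from_ _ @ _]/(jf _) !jfK.
exists (fmap J k ∘ u) => w; rewrite apM /v; have [<- <-] := uP w; exact: kE.
Qed.

Lemma Jlab_0 f : v f f = nul (cE := cC) (A := A) (bang _ @ f).
Proof.
by rewrite /v l_0; congr (_ @ _); rewrite [LHS](@bangM (cells M n (l_ob X))) bang_ap.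
Qed.

Definition Jlab : labC n := Lab (asph_nJ (l_asph X)) Jlab_hom Jlab_0.

End Label.

Lemma JlabE n (X : labM n) f g : @l_v C cC A n (Jlab X) f g = @l_v M cM AM n X (jt f) (jt g).
Proof. by []. Qed.

Lemma Jlab_mor n (X Z : labM n) : lmor X Z -> lmor (Jlab X) (Jlab Z).
Proof.
move=> [h hE]; exists (fmap (nJ n) h) => f g /jt_parel fg.
by rewrite !JlabE !jt_map; exact: hE.
Qed.

Lemma Jlab_mul n (X Z : labM n) : lmor (Jlab (lmul X Z)) (lmul (Jlab X) (Jlab Z)).
Proof.
have [a [b [_ vE]]] := lmulP X Z.
apply: (@lmul_to C cC A n (Jlab (lmul X Z)) (Jlab X) (Jlab Z) (fmap (nJ n) a) (fmap (nJ n) b)) => f g _.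
rewrite !JlabE !jt_map [LHS]vE; congr (mal _ _ _).
congr (_ @ _); rewrite [LHS](@bangM (cells M n _)); exact: bang_ap.
Qed.

(** A label with enough maps to commutative objects has a best approximation by a label
    on commutative objects, carried by the levelwise reflection. *)
Lemma lab_refl n (W : labC n) : Sep (l_ob W) -> topsep (l_ob W) ->
  exists X : labM n, lmor W (Jlab X) /\ forall Z : labM n, lmor W (Jlab Z) -> lmor X Z.
Proof.
move=> SW tW; have [X [h hr]] := isrefl_ex (l_ob W).
have aW := l_asph W; have aX := asph_refl aW hr SW; have [sr kr] := isrefl_top hr.
pose R a b c := exists f g, [/\ parelC n (l_ob W) f g, rho h @ f = a, rho h @ g = b & @l_v C cC A n W f g = c].
have Runiq a b c c' : R a b c -> R a b c' -> c = c'.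
  move=> [f [g [fg <- <- <-]]] [f1 [g1 [fg1 ff gg <-]]].
  have [|h0 h1] := l_transl (f' := f1) _ fg.
    by rewrite -(bang_ap oneP (rho h)) -ff bang_ap.
  rewrite -h1; congr l_v; apply: tW; first exact: parel_trans (parel_sym h0) fg1.
  by apply: kr; rewrite !tm_nat ff gg tml.
pose v (a b : el (sval (cells M n X))) : el A := match pselect (exists c, R a b c) with
  | left e => sval (cid e) | right _ => nul (cE := cC) (A := A) (bang _ @ a) end.
have vE f g : parelC n (l_ob W) f g -> v (rho h @ f) (rho h @ g) = l_v f g.
  move=> fg; have r : R (rho h @ f) (rho h @ g) (l_v f g) by exists f, g.
  rewrite /v; case: pselect => [e|[]]; last by exists (l_v f g).
  exact: Runiq (svalP (cid e)) r.
have v_hom V (a b : el (sval V) -> el (sval (cells M n X))) : is_hom cM (X := V) (Y := cells M n X) a ->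
    is_hom cM (X := V) (Y := cells M n X) b -> (forall w, parelM n X (a w) (b w)) ->
    is_hom cM (X := V) (Y := AM) (fun w => v (a w) (b w)).
  move=> ha hb ab.
  have [P [p [q [k [pq inj par sur kE]]]]] := l_par W.
  have [T [t0 [t1 tP]]] := prod_ex_el cC oneP (sval (cells M n X)) (sval (cells M n X)).
  have [tinj _] := prod_el cC oneP tP.
  have [d [d0 d1]] := prod_lift tP (rho h ∘ p) (rho h ∘ q).
  have [u uE] := prod_hom (cE := cC) oneP tP ha hb.
  have [V' [c [r [cr _ crs]]]] := pb_el cC u d.
  have sc : surj cC c.
    move=> w; have [f fE] := sr (a w); have [g gE] := sr (b w).
    have := ab w; rewrite -fE -gE => /(lift_par aW hr SW) [f' [g' [fg ff gg]]].
    have [z [zf zg]] := sur _ _ fg.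
    have [|y [yw _]] := crs w z; last by exists y.
    by apply: tinj; rewrite ?(uE w).1 ?(uE w).2 -[RHS]apM ?d0 ?d1 apM ?zf ?zg ?ff ?gg.
  suff : is_hom cC (fun w => v (a w) (b w)) by [].
  apply: (desc_hom sc).
  have H := hom_pre r (l_hom (l := W) (ap_is_hom cC p) (ap_is_hom cC q) par).
  apply: is_hom_ext H => w; rewrite -vE; last exact: par.
  have e : u @ (c @ w) = d @ (r @ w) by rewrite -!apM cr.1.
  by rewrite -(uE _).1 -(uE _).2 e -![in RHS]apM d0 d1 !apM.
have v_0 (a : el (sval (cells M n X))) : v a a = @nul M cM AM (@ap M cM _ _ (to_one oneM (cells M n X)) a).
  have [f <-] := sr a; rewrite vE; last exact: parel_refl.
  by rewrite l_0; congr (_ @ _); rewrite [RHS]bangM bang_ap.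
exists (@Lab M cM AM n X aX v v_hom v_0); split.
  by exists h => f g fg; rewrite JlabE -!rhoE; exact: vE.
move=> Z [g gE]; have [u uE] := isrefl_univ g hr; exists u => a b.
have [f fE] := sr a; have [f1 f1E] := sr b; rewrite -fE -f1E.
move=> /(lift_par aW hr SW) [f' [g' [fg <- <-]]].
have := gE _ _ fg; rewrite JlabE -!rhoE -!uE /= vE //; exact.
Qed.

(** ** Covers *)

(** Every arrow of an internal groupoid is determined, after a change of objects along
    [e], by its ends and its images under maps to commutative objects; this property is
    stable under further changes of objects. *)
Definition good_cover (X1 X0 F : C) (d0 d1 : hom X1 X0) (e : hom F X0) :=
  forall P (u : hom P X1) (a b : hom P F), e ∘ a = d0 ∘ u -> e ∘ b = d1 ∘ u ->
  forall p p', a @ p = a @ p' -> b @ p = b @ p' -> nsep p p' -> u @ p = u @ p'.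

Hypothesis cover_ex : forall (X1 X0 : C) (d0 d1 : hom X1 X0) (s : hom X0 X1),
  d0 ∘ s = idm _ -> d1 ∘ s = idm _ -> comph cC d0 d1 s ->
  (forall y, exists x, bang X0 @ x = y) ->
  (forall x y, bang _ @ x = bang _ @ y -> exists f, d0 @ f = x /\ d1 @ f = y) ->
  exists F (e : hom F X0), surj cC e /\ good_cover d0 d1 e.

(** Only the level of arrows requires a cover; above it [topsep_high] applies. *)
Lemma sep_ex n (Z : nGrd C n) : asph cC oneP Z -> exists F (e : hom F (bot n Z)), surj cC e /\
  forall (W : nGrd C n) (g : hom W Z) (b : hom (bot n W) F), lcart cC oneP g -> surj cC (fmap (bot n) g) ->
    e ∘ b = fmap (bot n) g -> Sep W.
Proof.
elim: n Z => [|[|n] IH] Z.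
- by move=> _; exists Z, (idm Z); split=> // z; exists z; rewrite ap1.
- move=> [aZ sZ]; have [ds dt cs] := compat_refl (compat_under cC Z).
  have [F [e [se gF]]] :=
    @cover_ex (cells C 1 Z) (cells C 0 (under Z)) (src Z) (tgt Z) (idn Z) ds dt cs aZ sZ.
  exists F, e; split=> // W g b [_ [_ ginj _]] _ eb; split=> // f f' [fs ft] ff.
  apply: ginj => //; apply: (gF _ (cmap 1 g) (b ∘ src W) (b ∘ tgt W)) => //.
  - by rewrite cmpA eb; exact: esym (hom_src g).
  - by rewrite cmpA eb; exact: esym (hom_tgt g).
  - by rewrite !apM fs.
  - by rewrite !apM ft.
move=> aZ; have [F [e [se H]]] := IH (under Z) aZ.1; exists F, e; split=> // W g b lg sg eb.
split; first by case: lg => lg _; exact: H lg sg eb.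
exact/topsep_high/(lcart_asph lg sg aZ).
Qed.

Section Pull.
Variables (n : nat) (L : labC n) (W : nGrd C n) (g : hom W (l_ob L)).
Hypotheses (lg : lcart cC oneP g) (sg : surj cC (fmap (bot n) g)).

Let v f f' := @l_v C cC A n L (cmap n g @ f) (cmap n g @ f').

Lemma pull_hom V (a b : el V -> el (cells C n W)) : is_hom cC a -> is_hom cC b ->
  (forall w, parelC n W (a w) (b w)) -> is_hom cC (fun w => v (a w) (b w)).
Proof.
by move=> ha hb ab; apply: l_hom; [exact: hom_comp|exact: hom_comp|move=> w; exact: parel_hom].
Qed.

Lemma pull_0 f : v f f = nul (cE := cC) (A := A) (bang _ @ f).
Proof. by rewrite /v l_0 bang_ap. Qed.

Definition pull : labC n := Lab (lcart_asph lg sg (l_asph L)) pull_hom pull_0.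

End Pull.

(** [W] is a good cover of [L]: it is obtained from [L] by a change of objects, and so fine
    that every further change of objects yields a groupoid with enough maps to
    commutative objects. *)
Definition covers n (W L : labC n) (g : hom (l_ob W) (l_ob L)) :=
  [/\ lcart cC oneP g, surj cC (fmap (bot n) g),
      forall f f', parelC n (l_ob W) f f' -> l_v (cmap n g @ f) (cmap n g @ f') = l_v f f' :> el A
    & forall (V : nGrd C n) (v : hom V (l_ob L)) (b : hom (bot n V) (bot n (l_ob W))),
        lcart cC oneP v -> surj cC (fmap (bot n) v) -> fmap (bot n) g ∘ b = fmap (bot n) v -> Sep V].

Lemma covers_ex n (L : labC n) : exists (W : labC n) (g : hom (l_ob W) (l_ob L)), covers g.
Proof.
have [F [e [se H]]] := sep_ex (l_asph L).
have [W [g [j [k [lg jk kj ej]]]]] := lcart_ex cC oneP e.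
have sg : surj cC (fmap (bot n) g).
  rewrite -ej; apply: surj_comp se => y; exists (k @ y); exact: iso_el jk y.
exists (pull lg sg), g; split=> // V v b lv sv eb; apply: (H V v (j ∘ b)) => //.
by rewrite cmpA ej.
Qed.

Lemma covers_sep n (W L : labC n) (g : hom (l_ob W) (l_ob L)) : covers g -> Sep (l_ob W).
Proof. by move=> [lg sg _ H]; apply: (H _ g (idm _)) => //; rewrite cmpm1. Qed.

Lemma covers_mor n (W L : labC n) (g : hom (l_ob W) (l_ob L)) : covers g -> lmor W L.
Proof. by move=> [_ _ vE _]; exists g. Qed.

(** [Z] and [X] are related through a good cover of [Z]; in dimension [0], where
    directed labels live on commutative objects, [Z] itself is used. *)
Definition approx n : labC n -> labM n -> Prop :=
  match n with
  | 0 => fun Z X => directed Z /\ lmor Z (Jlab X)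
  | n'.+1 => fun Z X => exists (W : labC n'.+1) (g : hom (l_ob W) (l_ob Z)),
      covers g /\ lmor W (Jlab X)
  end.

Lemma approx_mor n (Z : labC n) (X : labM n) : directed Z -> lmor Z (Jlab X) -> approx Z X.
Proof.
case: n Z X => [//|n] Z X _ ZX; have [W [g cg]] := covers_ex Z.
exists W, g; split=> //; exact: lmor_trans (covers_mor cg) ZX.
Qed.

Lemma dir_topsep (Z : labC 0) : directed Z -> topsep (l_ob Z).
Proof. by move=> /dir_tmc cZ f g _ /(_ _ (idm _) cZ); rewrite !ap1. Qed.

Lemma approx_ex n (Z : labC n) : directed Z -> exists X, approx Z X.
Proof.
case: n Z => [|n] Z dZ.
  by have [X [ZX _]] := lab_refl (W := Z) I (dir_topsep dZ); exists X.
have [W [g cg]] := covers_ex Z; have SW := covers_sep cg.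
by have [X [WX _]] := lab_refl (W := W) SW SW.2; exists X, W, g.
Qed.

(** Covers of [Z] and of [Z'] have a common refinement over [Z], whose abelianization maps
    to [X] and to [X']. *)
Lemma approx_lconn n (Z Z' : labC n) (X X' : labM n) : lmor Z Z' ->
  approx Z X -> approx Z' X' -> lconn X X'.
Proof.
have fin (T : labM n) : lmor T X -> lmor T X' -> lconn X X'.
  by move=> /lconn_mor h /lconn_mor h'; exact: rst_trans (rst_sym _ _ _ _ h) h'.
case: n Z Z' X X' fin => [|n] Z Z' X X' fin.
  move=> ZZ' [dZ ZX] [dZ' Z'X'].
  have [T [_ TP]] := lab_refl (W := Z) I (dir_topsep dZ).
  apply: fin (TP _ ZX) (TP _ _); exact: lmor_trans ZZ' Z'X'.
move=> [h hE] [W1 [g1 [[lg1 sg1 v1 S1] WX1]]] [W2 [g2 [[lg2 sg2 v2 _] WX2]]].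
have [F [p [q [pb pinj psur]]]] := pb_el cC (fmap (bot n.+1) h ∘ fmap (bot n.+1) g1) (fmap (bot n.+1) g2).
have [W [g [j [k [lg jk kj ej]]]]] := lcart_ex cC oneP (fmap (bot n.+1) g1 ∘ p).
have sg : surj cC (fmap (bot n.+1) g).
  rewrite -ej; apply: surj_comp; last exact: surj_comp (pb_surj pb sg2) sg1.
  by move=> y; exists (k @ y); exact: iso_el jk y.
have [|u1 [u1E b1]] := @lcart_univ C cC _ oneP n.+1 _ _ W g1 g (p ∘ j) lg1; first by rewrite cmpA.
have [|u2 [u2E b2]] := @lcart_univ C cC _ oneP n.+1 _ _ W g2 (h ∘ g) (q ∘ j) lg2.
  by rewrite cmpA -pb.1 fmapM -ej !cmpA.
have SW : Sep W by apply: (S1 _ g (p ∘ j)) => //; rewrite cmpA.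
have W1' : lmor (pull lg sg) W1.
  by exists u1 => f f' ff; rewrite -v1; [rewrite -!apM -fmapM u1E|exact: parel_hom].
have W2' : lmor (pull lg sg) W2.
  exists u2 => f f' ff; rewrite -v2; last exact: parel_hom.
  by rewrite -!apM -fmapM u2E fmapM !apM hE //; exact: parel_hom.
have [T [_ TP]] := lab_refl (W := pull lg sg) SW SW.2.
by apply: (fin T); apply: TP; [exact: lmor_trans W1' WX1|exact: lmor_trans W2' WX2].
Qed.

Lemma approx_connected n (Z Z' : cocycle A n) : connected Z Z' -> forall X X' : labM n,
  approx (toL cC Z) X -> approx (toL cC Z') X' -> lconn X X'.
Proof.
elim=> [V V' h|V|V V' _ h|V V' V'' _ h _ h'] X X' hX hX'.
- exact: approx_lconn ((toL_mor cC V V').1 h) hX hX'.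
- exact: approx_lconn (lmor_refl _) hX hX'.
- exact: rst_sym (h _ _ hX' hX).
- by have [Y hY] := approx_ex (toL_dir cC V'); exact: rst_trans (h _ _ hX hY) (h' _ _ hY hX').
Qed.

(** ** The comparison map *)

Lemma toL_incl n (X : cocycle AM n) : lmor (toL cC (cocycle_incl X)) (Jlab (toL cM X)).
Proof.
case: n X => [|n] X; exists (idm _) => f g fg; rewrite JlabE fmap1 !ap1.
  have [z [<- <-]] : exists z, fmap J (t_fst X) @ z = f /\ fmap J (t_snd X) @ z = g.
    by have [_ sur] := prod_el cC oneP (@t_sqP _ _ (torsor_incl X)); exact: sur.
  rewrite /jt /= !ap1 [RHS](lab_valE (cE := cC) (n := 0) (X := sval (t_ob X)) (t_q X) (@t_sqP _ _ (torsor_incl X)) z).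
  exact: (lab_valE (cE := cM) (n := 0) (X := t_ob X) (t_q X) (@t_sqP _ _ X) z).
have [_ _ sur] := par_el cC oneP (d_parP (dgrd_incl X)).
have [z [<- <-]] := sur _ _ fg.
rewrite [RHS](lab_valE (cE := cC) (d_nu (dgrd_incl X)) (d_parP (dgrd_incl X)) z).
have e0 : jt (d_fst (dgrd_incl X) @ z) = fmap J (d_fst X) @ z by rewrite apM [LHS]jfK.
have e1 : jt (d_snd (dgrd_incl X) @ z) = fmap J (d_snd X) @ z by rewrite apM [LHS]jfK.
rewrite e0 e1; exact: (lab_valE (cE := cM) (d_nu X) (d_parP X) z).
Qed.

Lemma component_eq (E : category) (B : abgroup E) n (a b : component B n) : sval a = sval b -> a = b.
Proof.
case: a b => [K hK] [L hL] /= e; case: _ / e hL => hL.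
by congr exist; exact: Prop_irrelevance.
Qed.

Lemma incl_class n (X : cocycle AM n) : component_incl (class X) = class (cocycle_incl X).
Proof.
apply: component_eq; apply: funext => Z; apply: propext; split=> /=.
- by move=> [X' /connected_incl h h']; exact: rst_trans h h'.
- by exists X; first exact: rst_refl.
Qed.

Lemma incl_cls n (W : labM n) : component_incl (cls W) = cls (Jlab W).
Proof.
have [X -> WX] := clsP W; rewrite incl_class -(cls_toL cC); apply: cls_lconn.
apply: rst_trans (lconn_mor (toL_incl X)) _.
by apply: rst_sym; apply: lconn_mor; exact: Jlab_mor.
Qed.

Lemma component_incl_inj n : injective (@component_incl C ccC A n).
Proof.
move=> a b; have [X <-] := class_surj a; have [X' <-] := class_surj b.
rewrite !incl_class => /class_eq h; rewrite -!(cls_toL cM); apply: cls_lconn.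
by apply: (approx_connected h); apply: approx_mor; (try exact: toL_dir); exact: toL_incl.
Qed.

(** A cocycle is connected to the abelianization of a good cover of itself. *)
Lemma component_incl_surj n (b : component A n) : exists a, @component_incl C ccC A n a = b.
Proof.
have [Z <-] := class_surj b.
have [W [X [SW [WZ WX]]]] : exists (W : labC n) (X : labM n),
    Sep (l_ob W) /\ lmor W (toL cC Z) /\ lmor W (Jlab X).
  case: n Z b => [|n] Z b.
    have dZ := toL_dir cC Z.
    have [X [ZX _]] := lab_refl (W := toL cC Z) I (dir_topsep dZ).
    by exists (toL cC Z), X; do 2 split=> //; exact: lmor_refl.
  have [W [g cg]] := covers_ex (toL cC Z); have SW := covers_sep cg.
  have [X [WX _]] := lab_refl (W := W) SW SW.2.
  by exists W, X; do 2 split=> //; exact: covers_mor cg.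
exists (cls X); rewrite incl_cls -(cls_toL cC); apply: cls_lconn.
by apply: rst_trans (rst_sym _ _ _ _ (lconn_mor WX)) (lconn_mor WZ).
Qed.

Lemma component_incl_add n (a b : component AM n) :
  component_incl (cadd cM a b) = cadd cC (component_incl a) (component_incl b).
Proof.
have [W <-] := cls_surj cM a; have [W' <-] := cls_surj cM b.
rewrite cadd_cls !incl_cls cadd_cls; apply: cls_lconn; apply: lconn_mor; exact: Jlab_mul.
Qed.

(** The argument uses two properties of the category: universal commutative quotients and
    good covers of internal groupoids. *)
Theorem comm_cohomology n : exists (GM : coh_group AM n) (GC : coh_group A n),
  (forall a b, @coh_incl C ccC A n (cg_add GM a b) = cg_add GC (coh_incl a) (coh_incl b)) /\
  bijective (@coh_incl C ccC A n).
Proof.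
have sumP (E : category) (B : abgroup E) m (G : coh_group B m) a b : coh_sum a b (cg_add G a b).
  exact/cg_addP.
case: n => [|n].
  exists (global_group cM AM), (global_group cC A); split; last by exists id.
  by move=> a b; apply: esym; apply/cg_addP; have [u uP] := sumP _ _ _ (global_group cM AM) a b; exists u.
exists (component_group cM AM n), (component_group cC A n); split.
  move=> a b; apply: esym; apply/cg_addP/(cadd_sum cC).
  have /(cadd_sum cM) <- := sumP _ _ _ (component_group cM AM n) a b.
  by rewrite -component_incl_add.
pose inv b := sval (cid (@component_incl_surj n b)).
have invP b : component_incl (inv b) = b := svalP (cid (component_incl_surj b)).
by exists inv => [a|b]; [apply: component_incl_inj; exact: invP | exact: invP].
Qed.

End Reflection.

(** * Slices *)

Section SliceTools.
Variables (D : category) (cD : conc D) (Y : D) (one : slice Y) (oneP : is_terminal one).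
Local Notation C := (slice Y).
Local Notation cC := (conc_slice cD Y).
Local Notation "f @ x" := (@ap D cD _ _ f x) (at level 20).
Local Notation bang X x := (@ap C cC _ _ (to_one oneP X) x).

(** The terminal object of a slice is its identity, so being equal in it means lying over
    the same element. *)
Lemma bang_slice (X X' : C) x x' : bang X x = bang X' x' <-> sl_map X @ x = sl_map X' @ x'.
Proof.
have [h _] := term_hom one (@slice_one D Y).
have [k _] := term_hom (SliceOb (idm Y) : C) oneP.
have hE (Z : C) z : sl_hom h @ (bang Z z) = sl_map Z @ z.
  have := hap (cE := cD) (bang Z z) (sl_homP h); rewrite apM ap1 => ->.
  by rewrite -(hap (cE := cD) z (sl_homP (to_one oneP Z))) apM.
have kE (Z : C) (m : hom Z (SliceOb (idm Y) : C)) : k ∘ m = to_one oneP Z by exact: bangE.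
split=> [e|e]; first by rewrite -!hE e.
have mE (Z : C) : exists m : hom Z (SliceOb (idm Y) : C), sl_hom m = sl_map Z.
  have e1 : idm Y ∘ sl_map Z = sl_map Z by rewrite cmp1m.
  by exists (@SliceHom D Y Z (SliceOb (idm Y)) _ e1).
have [m mE1] := mE X; have [m' mE2] := mE X'.
rewrite -(kE X m) -(kE X' m') !apM; congr (ap _ _).
by rewrite -[LHS]/(sl_hom m @ x) -[RHS]/(sl_hom m' @ x') mE1 mE2.
Qed.

Lemma slice_support (X : C) : (forall y, exists x, bang X x = y) -> surj cD (sl_map X).
Proof.
move=> H y; have [k _] := term_hom (SliceOb (idm Y) : C) oneP.
have [x xE] := H (@ap C cC _ _ k y); exists x.
have : bang X x = bang (SliceOb (idm Y) : C) y by rewrite xE (bangE oneP k).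
by move=> /bang_slice ->; rewrite ap1.
Qed.

Lemma slice_over (X X' : C) (f : hom X X') x : sl_map X' @ (sl_hom f @ x) = sl_map X @ x.
Proof. by rewrite -apM sl_homP. Qed.

Lemma slice_is_hom (X X' : C) (k : el cD X -> el cD X') : (exists f : hom (sl_dom X) (sl_dom X'), forall x, f @ x = k x) ->
  (forall x, sl_map X' @ k x = sl_map X @ x) -> is_hom cC (X := X) (Y := X') k.
Proof.
move=> [f fE] kE; have e : sl_map X' ∘ f = sl_map X.
  by apply: (@ap_inj D cD) => x; rewrite apM fE kE.
by exists (@SliceHom D Y X X' f e).
Qed.

End SliceTools.

(** * Groups *)

Section Groups.
Local Open Scope group_scope.

Lemma group_quot (G : groupType) (R : G -> G -> Prop) :
  (forall x, R x x) -> (forall x y, R x y -> R y x) -> (forall x y z, R x y -> R y z -> R x z) ->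
  (forall x x' y y', R x x' -> R y y' -> R (x * y) (x' * y')) ->
  exists (Q : groupType) (q : {multiplicative G -> Q}),
    (forall y, exists x, q x = y) /\ forall x y, q x = q y <-> R x y.
Proof.
move=> r1 r2 r3 cM.
pose ch (P : G -> Prop) := match pselect (exists y, P y) with
  | left e => sval (cid e) | right _ => 1 end.
pose rp x := ch (R x).
have Rrp x : R x (rp x).
  by rewrite /rp /ch; case: pselect => [e|[]]; [exact: svalP (cid e) | exists x].
have rpE x y : R x y -> rp x = rp y.
  move=> xy; rewrite /rp; congr ch; apply: funext => t; apply: propext.
  by split; [apply: r3; exact: r2 | exact: r3].
have cV x y : R x y -> R x^-1 y^-1.
  move=> /r2 xy; have := cM _ _ _ _ (cM _ _ _ _ (r1 x^-1) xy) (r1 y^-1).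
  by rewrite -mulgA mulgV mulg1 mulVg mul1g.
pose T := {x : G | `[<x = rp x>]}.
have mkP x : `[<rp x = rp (rp x)>] by apply/asboolP; exact: rpE (Rrp x).
pose mk x : T := exist _ (rp x) (mkP x).
have mkE x y : R x y -> mk x = mk y by move=> xy; apply: val_inj; exact: rpE.
have Rmk x y : mk x = mk y -> R x y.
  by move=> /(congr1 val) /= e; apply: r3 (Rrp x) _; rewrite e; apply: r2.
have mkv (c : T) : mk (val c) = c by apply: val_inj; rewrite /= -(asboolP _ (svalP c)).
have Rv x : R (val (mk x)) x by apply: r2; exact: Rrp.
pose m (x y : T) := mk (val x * val y).
pose iv (x : T) := mk (val x)^-1.
have mM x y : m (mk x) (mk y) = mk (x * y) by apply: mkE; apply: cM; exact: Rv.
have ivM x : iv (mk x) = mk x^-1 by apply: mkE; apply: cV; exact: Rv.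
have mA : associative m by move=> x y z; rewrite -[x]mkv -[y]mkv -[z]mkv !mM mulgA.
have m1 : left_id (mk 1) m by move=> x; rewrite -[x]mkv mM mul1g.
have m2 : right_id (mk 1) m by move=> x; rewrite -[x]mkv mM mulg1.
have m3 : left_inverse (mk 1) iv m by move=> x; rewrite -[x]mkv ivM mM mulVg.
have m4 : right_inverse (mk 1) iv m by move=> x; rewrite -[x]mkv ivM mM mulgV.
pose H : groupType := HB.pack T (isGroup.Build T mA m1 m2 m3 m4).
have qM : {morph (mk : G -> H) : x y / x * y} by move=> x y; rewrite -[RHS]/(m (mk x) (mk y)) mM.
exists H, (mk_mult qM); split; first by move=> y; exists (val y); exact: mkv.
by move=> x y; split; [exact: Rmk | exact: mkE].
Qed.

Lemma mult_lift (T P X Y : groupType) (p : {multiplicative P -> X}) (q : {multiplicative P -> Y})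
    (k : T -> P) (a : {multiplicative T -> X}) (b : {multiplicative T -> Y}) :
  (forall z z', p z = p z' -> q z = q z' -> z = z') ->
  (forall t, p (k t) = a t) -> (forall t, q (k t) = b t) ->
  exists h : {multiplicative T -> P}, forall t, h t = k t.
Proof.
move=> inj pk qk; have kM : {morph k : x y / x * y}.
  by move=> x y; apply: inj; rewrite gmulfM ?pk ?qk gmulfM.
by exists (mk_mult kM).
Qed.

Definition conc_Gp : conc Gp.
Proof.
unshelve refine (@Conc Gp (fun G => G) (fun G H f => f) (fun G x y z => x * y^-1 * z)
  _ _ _ _ _ _ _ _ _ _ _).
- by [].
- by [].
- by move=> G H f g; exact: multiplicative_eq.
- by move=> X Y f x y z; rewrite !gmulfM multV.
- by move=> X x y; rewrite mulgVK.
- by move=> X x y; rewrite mulgV mul1g.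
- by move=> X x y z u w; rewrite !mulgA.
- move=> X Y Z f g.
  have [||| H [i [inj iP]]] := @subgroup_ex (X * Y)%type (fun u => f u.1 = g u.2).
  + by rewrite /= !mult1.
  + by move=> u w /= fu fw; rewrite !gmulfM fu fw.
  + by move=> u /= fu; rewrite !multV fu.
  have pM : {morph (fun u => (i u).1) : x y / x * y} by move=> x y; rewrite gmulfM.
  have qM : {morph (fun u => (i u).2) : x y / x * y} by move=> x y; rewrite gmulfM.
  have pqI z z' : mk_mult pM z = mk_mult pM z' -> mk_mult qM z = mk_mult qM z' -> z = z'.
    by move=> /= e1 e2; apply: inj; rewrite [LHS]surjective_pairing e1 e2 -surjective_pairing.
  exists H, (mk_mult pM), (mk_mult qM); split=> //; last first.
    by move=> x y e; have [z zE] := (iP (x, y)).1 e; exists z; rewrite /= zE.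
  apply: pbI => [|T a b ab|T u w eu ew].
  + by apply: multiplicative_eq => u /=; apply/(iP (i u)); exists u.
  + have ex t : exists z, i z = (a t, b t).
      by apply/iP; exact: (congr1 (fun k : {multiplicative T -> Z} => k t) ab).
    pose k t := sval (cid (ex t)); have kE t : i (k t) = (a t, b t) := svalP (cid (ex t)).
    have [||h hE] := @mult_lift T H X Y (mk_mult pM) (mk_mult qM) k a b pqI.
    * by move=> t; rewrite /= kE.
    * by move=> t; rewrite /= kE.
    by exists h; split; apply: multiplicative_eq => t; rewrite /= hE kE.
  + apply: multiplicative_eq => t; apply: pqI.
    * exact: (congr1 (fun k : {multiplicative T -> X} => k t) eu).
    * exact: (congr1 (fun k : {multiplicative T -> Y} => k t) ew).
- move=> X T g.
  have [||| I [i [inj iP]]] := @subgroup_ex T (fun u => exists x, g x = u).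
  + by exists 1; rewrite mult1.
  + by move=> _ _ [x <-] [y <-]; exists (x * y); rewrite gmulfM.
  + by move=> _ [x <-]; exists x^-1; rewrite multV.
  have ex x : exists y, i y = g x by apply/iP; exists x.
  pose k x := sval (cid (ex x)); have kE x : i (k x) = g x := svalP (cid (ex x)).
  have [e eE] := @mult_lift X I T T i i k g g (fun z z' h _ => inj z z' h) kE kE.
  exists I, e, i; split=> //.
  + move=> y; have [x xE] := (iP (i y)).2 (ex_intro _ y erefl); exists x.
    by rewrite eE; apply: inj; rewrite kE.
  + by apply: multiplicative_eq => x /=; rewrite eE kE.
- move=> X I T e h se eh.
  pose k y := h (sval (cid (se y))).
  have kE x : k (e x) = h x by apply: eh; exact: svalP (cid (se (e x))).
  have kM : {morph k : x y / x * y}.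
    by move=> i j; have [x <-] := se i; have [y <-] := se j; rewrite -gmulfM !kE gmulfM.
  by exists (mk_mult kM); apply: multiplicative_eq => x; exact: kE.
- move=> X R a b rel r1 r2 r3; apply: (group_quot (R := rel)) => //.
  by move=> x x' y y' [r [<- <-]] [s [<- <-]]; exists (r * s); rewrite !gmulfM.
Defined.

End Groups.

Section GroupSlice.
Local Open Scope group_scope.
Variables (Y : Gp) (A : abgroup (slice Y)).
Local Notation C := (slice Y).
Local Notation cC := (conc_slice conc_Gp Y).
Local Notation oneP := (@ag_oneP C A).
Local Notation "f @ x" := (@ap C cC _ _ f x) (at level 20).
Local Notation tmc := (@tmc C cC).
Implicit Types X Q : C.

Definition gcar X : groupType := sl_dom X.
Definition pm X : {multiplicative gcar X -> (Y : groupType)} := sl_map X.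

Lemma ap_mul X Q (f : hom X Q) (x y : gcar X) : f @ (x * y) = (f @ x : gcar Q) * (f @ y : gcar Q).
Proof. exact: gmulfM. Qed.

Lemma ap_one X Q (f : hom X Q) : f @ (1 : gcar X) = (1 : gcar Q).
Proof. exact: mult1. Qed.

Lemma ap_inv X Q (f : hom X Q) (x : gcar X) : f @ x^-1 = (f @ x : gcar Q)^-1.
Proof. exact: multV. Qed.

Lemma pm_ap X Q (f : hom X Q) (x : gcar X) : pm Q (f @ x) = pm X x.
Proof. exact: (@slice_over Gp conc_Gp Y X Q f x). Qed.

Lemma abelian_tmc X : (forall x y : gcar X, pm X x = 1 -> pm X y = 1 -> x * y = y * x) -> tmc X.
Proof.
move=> ab W x y z [f fE] [g gE] [h hE].
have xM w w' : x (w * w' : gcar W) = (x w : gcar X) * x w' by rewrite -!fE ap_mul.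
have yM w w' : y (w * w' : gcar W) = (y w : gcar X) * y w' by rewrite -!gE ap_mul.
have zM w w' : z (w * w' : gcar W) = (z w : gcar X) * z w' by rewrite -!hE ap_mul.
have px w : pm X (x w) = pm W w by rewrite -fE pm_ap.
have py w : pm X (y w) = pm W w by rewrite -gE pm_ap.
have pz w : pm X (z w) = pm W w by rewrite -hE pm_ap.
pose k w : gcar X := (x w : gcar X) * (y w : gcar X)^-1 * z w.
have kM : {morph (k : gcar W -> gcar X) : w w' / w * w'}.
  have H (a a' b b' c c' : gcar X) : (b^-1 * c) * (a' * b'^-1) = (a' * b'^-1) * (b^-1 * c) ->
      a * a' * (b * b')^-1 * (c * c') = a * b^-1 * c * (a' * b'^-1 * c').
    move=> e; transitivity (a * ((a' * b'^-1) * (b^-1 * c)) * c'); first by rewrite invgM !mulgA.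
    by rewrite -e !mulgA.
  move=> w w'; rewrite /k xM yM zM; apply: H; apply: ab.
    by rewrite gmulfM multV py pz mulVg.
  by rewrite gmulfM multV px py mulgV.
apply: slice_is_hom; first by exists (mk_mult kM).
by move=> w; rewrite -[LHS]/(pm X (k w)) /k !gmulfM multV px py pz mulgVK.
Qed.

(** The elements [(x, 1, 1)] and [(1, 1, y)] commute, and the Mal'cev operation sends them
    to [x] and [y]. *)
Lemma tmc_abelian X : tmc X -> forall x y : gcar X, pm X x = 1 -> pm X y = 1 -> x * y = y * x.
Proof.
move=> cX x y px py; have [P [a [b [c pr]]]] := prod3_ex_el cC oneP X.
have [inj sur] := prod3_el cC oneP pr.
have [m mE] := cX P _ _ _ (ap_is_hom cC a) (ap_is_hom cC b) (ap_is_hom cC c).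
have [||w [wa wb wc]] := sur x (1 : gcar X) (1 : gcar X); [|by []|].
  by apply/bang_slice; rewrite -[LHS]/(pm X x) -[RHS]/(pm X 1) px mult1.
have [||w' [wa' wb' wc']] := sur (1 : gcar X) (1 : gcar X) y; [by []| |].
  by apply/bang_slice; rewrite -[RHS]/(pm X y) -[LHS]/(pm X 1) py mult1.
have mw : m @ w = x by rewrite mE wa wb wc /= invg1 !mulg1.
have mw' : m @ w' = y by rewrite mE wa' wb' wc' /= invg1 mulg1 mul1g.
have ww : (w * w' : gcar P) = w' * w.
  by apply: inj; rewrite !ap_mul ?wa ?wb ?wc ?wa' ?wb' ?wc' ?mulg1 ?mul1g.
by have := congr1 (fun t => m @ t) ww; rewrite !ap_mul mw mw'.
Qed.

(** The commutator subgroup of the kernel of [pm], closed under inverses and conjugation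
    by [gder_inv] and [gder_conj]. *)
Inductive gder X : gcar X -> Prop :=
  | gder1 : gder 1
  | gderC x y z : pm X x = 1 -> pm X y = 1 -> gder z -> gder (x * y * x^-1 * y^-1 * z).

Lemma gder_mul X (x y : gcar X) : gder x -> gder y -> gder (x * y).
Proof.
move=> Hx Hy; elim: Hx => [|a b z pa pb _ IH]; first by rewrite mul1g.
by rewrite -mulgA; exact: gderC.
Qed.

Lemma gder_inv X (x : gcar X) : gder x -> gder x^-1.
Proof.
elim=> [|a b z pa pb _ IH]; first by rewrite invg1; exact: gder1.
rewrite invgM; apply: gder_mul => //; have := gderC pb pa (@gder1 X).
by rewrite mulg1 !invgM !invgK !mulgA.
Qed.

Lemma gder_conj X (g x : gcar X) : gder x -> gder (g^-1 * x * g).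
Proof.
elim=> [|a b z pa pb _ IH]; first by rewrite mulg1 mulVg; exact: gder1.
have := @gderC X (g^-1 * a * g) (g^-1 * b * g) _ _ _ IH.
rewrite !invgM !invgK !mulgA !(mulgK, mulgVK).
by apply; rewrite !gmulfM multV ?pa ?pb mulg1 mulVg.
Qed.

Lemma gder_pm X (x : gcar X) : gder x -> pm X x = 1.
Proof.
elim=> [|a b z pa pb _ IH]; first exact: mult1.
by rewrite !gmulfM !multV pa pb IH !invg1 !mulg1.
Qed.

Lemma gder_nsep X (x y : gcar X) : gder (x^-1 * y) -> @nsep C cC X x y.
Proof.
move=> H Q h cQ; have hd z : gder z -> h @ z = (1 : gcar Q).
  elim=> [|a b z' pa pb _ IH]; first exact: ap_one.
  have e : (h @ a : gcar Q) * (h @ b : gcar Q) = (h @ b : gcar Q) * (h @ a : gcar Q).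
    by apply: tmc_abelian cQ _ _ _ _; rewrite pm_ap.
  by rewrite !ap_mul !ap_inv IH mulg1 e mulgK mulgV.
by have := hd _ H; rewrite ap_mul ap_inv => /(congr1 (fun z => (h @ x : gcar Q) * z)); rewrite mulg1 mulgA mulgV mul1g.
Qed.

Lemma group_comm_quot X : exists I (q : hom X I),
  [/\ surj cC q, tmc I & forall x y : gcar X, q @ x = q @ y <-> gder (x^-1 * y)].
Proof.
have [||||Q [q [sq qE]]] := @group_quot (gcar X) (fun x y => gder (x^-1 * y)).
- by move=> x; rewrite mulVg; exact: gder1.
- by move=> x y /gder_inv; rewrite invgM invgK.
- by move=> x y z xy yz; have := gder_mul xy yz; rewrite mulgA mulgK.
- move=> x x' y y' xx yy; have := gder_mul (gder_conj y xx) yy.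
  by rewrite invgM !mulgA mulgK.
have [|p pE] := @desc_el Gp conc_Gp (gcar X) Q (Y : groupType) q (pm X) sq.
  move=> x x' /qE /gder_pm; rewrite gmulfM multV => /(congr1 (fun z => pm X x * z)).
  by rewrite mulg1 mulgA mulgV mul1g.
pose I := @SliceOb Gp Y Q p : C; pose q' := @SliceHom Gp Y X I q pE.
have pI x : pm I (q x) = pm X x by exact: (congr1 (fun f : {multiplicative gcar X -> _} => f x) pE).
exists I, q'; split=> //; apply: abelian_tmc => x y.
have [a <-] := sq x; have [b <-] := sq y; rewrite !pI => pa pb.
suff : q (a * b) = q (b * a) by rewrite !gmulfM.
apply/qE; have := @gderC X b^-1 a^-1 1; rewrite !multV pa pb invg1 !invgK mulg1 invgM.
by rewrite !mulgA; apply=> //; exact: gder1.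
Qed.

Section Wreath.
Variables (X1 X0 : C) (d0 d1 : hom X1 X0) (s : hom X0 X1).
Hypotheses (d0s : d0 ∘ s = idm _) (d1s : d1 ∘ s = idm _) (cm : comph cC d0 d1 s).
Hypotheses (sup : forall y, exists x, to_one oneP X0 @ x = y)
  (full : forall x y, to_one oneP X0 @ x = to_one oneP X0 @ y -> exists f, d0 @ f = x /\ d1 @ f = y).

Let sE x : d0 @ (s @ x) = x. Proof. by rewrite -apM d0s ap1. Qed.
Let tE x : d1 @ (s @ x) = x. Proof. by rewrite -apM d1s ap1. Qed.

(** The pairs [(a, 1)] and [(1, b)] of composable arrows commute, and composition is
    multiplicative. *)
Lemma group_peiffer (a b : gcar X1) : d1 @ a = (1 : gcar X0) -> d0 @ b = (1 : gcar X0) -> a * b = b * a.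
Proof.
move=> da db; have [P [p [q [pb inj sur]]]] := pb_el cC d1 d0.
have pq w : d1 @ (p @ w) = d0 @ (q @ w) by rewrite -!apM pb.1.
have [m mE] := cm (ap_is_hom cC p) (ap_is_hom cC q) pq.
have [w [wp wq]] : exists w, p @ w = a /\ q @ w = (1 : gcar X1) by apply: sur; rewrite da ap_one.
have [w' [wp' wq']] : exists w, p @ w = (1 : gcar X1) /\ q @ w = b by apply: sur; rewrite db ap_one.
have mw : m @ w = a.
  by rewrite mE wp wq da ap_one /= invg1 !mulg1.
have mw' : m @ w' = b.
  by rewrite mE wp' wq' !ap_one /= invg1 !mul1g.
have ww : (w * w' : gcar P) = w' * w.
  by apply: inj; rewrite !ap_mul ?wp ?wq ?wp' ?wq' ?mulg1 ?mul1g.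
by have := congr1 (fun t => m @ t) ww; rewrite !ap_mul mw mw'.
Qed.

Lemma group_section : exists sg : gcar (SliceOb (idm Y)) -> gcar X0, sg 1 = 1 /\ forall y, pm X0 (sg y) = y.
Proof.
have ss := slice_support sup.
exists (fun y => if pselect (y = 1) then 1 else sval (cid (ss y))); split; first by case: pselect.
by move=> y; case: pselect => [y1|_] /=; [rewrite y1; exact: mult1 | exact: svalP (cid (ss y))].
Qed.

(** The cover is the pullback of the wreath product of [Y] and the kernel of [d0] along
    the Kaloujnine-Krasner embedding of [X0] given by a set-theoretic section [sg]: its
    elements over [x] are families of arrows lifting [y |-> sg y * x * (sg (y * pm x))^-1].
    Evaluation at [1] is multiplicative over the kernel of [pm] and lifts [x] to an arrow
    from [1]. *)
Lemma wreath_cover : exists (F : C) (e : hom F X0) (tau : gcar F -> gcar X1),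
  [/\ surj cC e, forall k k', pm F k = 1 -> tau (k * k') = tau k * tau k', tau 1 = 1,
      forall k, d0 @ tau k = (1 : gcar X0) & forall k, pm F k = 1 -> d1 @ tau k = e @ k].
Proof.
have [sg [sg1 sgp]] := group_section.
pose T := (gcar X0 * (gcar (SliceOb (idm Y)) -> gcar X1))%type.
pose m (u w : T) : T := (u.1 * w.1, fun y => u.2 y * w.2 (y * pm X0 u.1)).
pose iv (u : T) : T := (u.1^-1, fun y => (u.2 (y * (pm X0 u.1)^-1))^-1).
pose e1 : T := (1, fun _ => 1).
have mA : associative m.
  move=> u w t; congr pair; first by rewrite /= mulgA.
  by apply: funext => y /=; rewrite gmulfM !mulgA.
have m1 : left_id e1 m.
  move=> [x f]; congr pair; first by rewrite /= mul1g.
  by apply: funext => y /=; rewrite mult1 mulg1 mul1g.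
have m2 : right_id e1 m.
  move=> [x f]; congr pair; first by rewrite /= mulg1.
  by apply: funext => y /=; rewrite mulg1.
have m3 : left_inverse e1 iv m.
  move=> [x f]; congr pair; first by rewrite /= mulVg.
  by apply: funext => y /=; rewrite multV mulVg.
have m4 : right_inverse e1 iv m.
  move=> [x f]; congr pair; first by rewrite /= mulgV.
  by apply: funext => y /=; rewrite mulgK mulgV.
pose H : groupType := HB.pack T (isGroup.Build T mA m1 m2 m3 m4).
pose Q (u : H) := forall y, d0 @ (u.2 y) = (1 : gcar X0) /\
  d1 @ (u.2 y) = sg y * u.1 * (sg (y * pm X0 u.1))^-1.
have [||| W [i [inj iP]]] := @subgroup_ex H Q.
- move=> y; rewrite -[(1 : H).2 y]/(1 : gcar X1) -[(1 : H).1]/(1 : gcar X0) !ap_one mult1 !mulg1 mulgV.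
  by split.
- move=> u w Qu Qw y; rewrite -[(u * w).2 y]/(u.2 y * w.2 (y * pm X0 u.1)) -[(u * w).1]/(u.1 * w.1).
  rewrite !ap_mul gmulfM mulgA.
  have [-> ->] := Qu y; have [-> ->] := Qw (y * pm X0 u.1).
  by rewrite mulg1 !mulgA; split=> //; rewrite -[_ * _^-1 * sg _]mulgA mulVg mulg1.
- move=> u Qu y; rewrite -[u^-1.2 y]/(u.2 (y * (pm X0 u.1)^-1))^-1 -[u^-1.1]/(u.1^-1) !ap_inv multV.
  have [-> ->] := Qu (y * (pm X0 u.1)^-1); rewrite invg1; split=> //.
  by rewrite !invgM invgK mulgVK mulgA.
have iQ z : Q (i z) by apply/iP; exists z.
have im z w : i (z * w) = m (i z) (i w) by rewrite gmulfM.
have eM : {morph (fun z : W => (i z).1) : x y / x * y} by move=> x y; rewrite im.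
pose em : {multiplicative W -> gcar X0} := mk_mult eM.
pose F := @SliceOb Gp Y W (sl_map X0 ∘ em) : C.
pose e := @SliceHom Gp Y F X0 em erefl : hom F X0.
exists F, e, (fun z : W => (i z).2 1); split.
- move=> x; have ex y : exists f, d0 @ f = (1 : gcar X0) /\ d1 @ f = sg y * x * (sg (y * pm X0 x))^-1.
    apply: full; apply/bang_slice; rewrite -[LHS]/(pm X0 1) -[RHS]/(pm X0 _).
    by rewrite mult1 !gmulfM multV !sgp mulgV.
  pose f y := sval (cid (ex y)); have fE y := svalP (cid (ex y)).
  by have [z zE] := (iP ((x, f) : T)).1 fE; exists z; rewrite -[LHS]/((i z).1) zE.
- by move=> k k' pk; rewrite im /= -[pm X0 (i k).1]/(pm F k) pk mulg1.
- by rewrite mult1.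
- by move=> k; have [] := iQ k 1.
- move=> k pk; have [_ ->] := iQ k 1; rewrite -[pm X0 (i k).1]/(pm F k) pk mulg1 sg1.
  by rewrite mul1g invg1 mulg1.
Qed.

(** For [k] over [1], the arrow [u k], divided by the identity at its domain and corrected
    by [tau] at both ends, is a loop at [1]. The Peiffer identity makes this
    multiplicative in [k] with commuting values, so it vanishes on commutators; on
    elements where [a] and [b] vanish it is [u]. *)
Lemma group_cover : exists F (e : hom F X0), surj cC e /\ good_cover cC d0 d1 e.
Proof.
have [F [e [tau [se tM t1 td0 td1]]]] := wreath_cover; exists F, e; split=> //.
move=> P u a b ea eb p p' ap bp ns.
have [I [q [_ cI qE]]] := group_comm_quot P.
have gz : gder ((p : gcar P)^-1 * p') by apply/qE; exact: ns.
have eaE k : e @ (a @ k) = d0 @ (u @ k) by rewrite -!apM ea.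
have ebE k : e @ (b @ k) = d1 @ (u @ k) by rewrite -!apM eb.
pose ch (k : gcar P) : gcar X1 :=
  tau (a @ k) * (s @ (d0 @ (u @ k)) : gcar X1)^-1 * (u @ k : gcar X1) * (tau (b @ k))^-1.
have chd0 k : d0 @ ch k = (1 : gcar X0).
  by rewrite !ap_mul !ap_inv !td0 sE mul1g invg1 mulg1 mulVg.
have chd1 k : pm P k = 1 -> d1 @ ch k = (1 : gcar X0).
  move=> pk; rewrite !ap_mul !ap_inv !td1 ?pm_ap // tE eaE ebE.
  by rewrite mulgV mul1g mulgV.
have chM k k' : pm P k = 1 -> pm P k' = 1 -> ch (k * k') = ch k * ch k'.
  move=> pk pk'; have c1 := chd1 k' pk'.
  have c2 : d1 @ (tau (a @ k') * (s @ (d0 @ (u @ k')) : gcar X1)^-1) = (1 : gcar X0).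
    by rewrite ap_mul ap_inv td1 ?pm_ap // tE eaE mulgV.
  have c3 : d0 @ ((s @ (d0 @ (u @ k)) : gcar X1)^-1 * (u @ k : gcar X1)) = (1 : gcar X0).
    by rewrite ap_mul ap_inv sE mulVg.
  have c4 : d0 @ (tau (b @ k))^-1 = (1 : gcar X0) by rewrite ap_inv td0 invg1.
  have H (x x' y y' S S' U U' : gcar X1) : (x' * S'^-1) * (S^-1 * U) = (S^-1 * U) * (x' * S'^-1) ->
      (x' * S'^-1 * U' * y'^-1) * y^-1 = y^-1 * (x' * S'^-1 * U' * y'^-1) ->
      x * x' * (S * S')^-1 * (U * U') * (y * y')^-1 = (x * S^-1 * U * y^-1) * (x' * S'^-1 * U' * y'^-1).
    move=> h1 h2.
    transitivity (x * ((x' * S'^-1) * (S^-1 * U)) * (U' * y'^-1 * y^-1)); first by rewrite !invgM !mulgA.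
    rewrite h1; transitivity (x * S^-1 * U * ((x' * S'^-1 * U' * y'^-1) * y^-1)); first by rewrite !mulgA.
    by rewrite h2 !mulgA.
  rewrite /ch !ap_mul !tM ?pm_ap //.
  by apply: H; [exact: group_peiffer c2 c3 | exact: group_peiffer c1 c4].
have ch_der z : gder z -> ch z = 1.
  elim=> [|x y w px py hw IH]; first by rewrite /ch !ap_one t1 !invg1 !mulg1.
  have pw := gder_pm hw.
  rewrite chM ?IH ?mulg1 //; last by rewrite !gmulfM !multV px py !invg1 !mulg1.
  apply: (mulIg (ch (y * x))); rewrite -chM ?gmulfM ?multV ?px ?py ?invg1 ?mulg1 // mul1g.
  rewrite !mulgA !mulgVK chM // chM //.
  by apply: group_peiffer; [exact: chd1 | exact: chd0].
have one_of Q (f : hom P Q) : f @ p = f @ p' -> f @ ((p : gcar P)^-1 * p') = (1 : gcar Q).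
  by move=> fp; rewrite ap_mul ap_inv fp mulVg.
have az := one_of _ a ap; have bz := one_of _ b bp.
have := ch_der _ gz; rewrite /ch az bz t1 -eaE az !ap_one invg1 !mulg1 mul1g.
rewrite ap_mul ap_inv => /(congr1 (fun z => (u @ p : gcar X1) * z)).
by rewrite mulg1 mulgA mulgV mul1g.
Qed.

End Wreath.

Lemma group_refl X : exists I (q : hom X I),
  [/\ surj cC q, tmc I & forall x y, q @ x = q @ y -> nsep x y].
Proof.
have [I [q [sq cI qE]]] := group_comm_quot X; exists I, q; split=> // x y /qE.
exact: gder_nsep.
Qed.

End GroupSlice.

(** * Lie algebras *)

Section LieTools.
Import GRing.Theory.
Local Open Scope ring_scope.
Variable K : fieldType.
Implicit Types L N P : lie_algebra K.

(** Lie algebras are constructed as quotients of a type with operations by a congruence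
    modulo which the axioms hold; classes are represented by chosen elements. *)
Lemma lie_setoid (T : Type) (z : T) (ad : T -> T -> T) (op : T -> T) (sc : K -> T -> T)
    (br : T -> T -> T) (E : T -> T -> Prop) :
  [/\ forall x, E x x, forall x y, E x y -> E y x & forall x y t, E x y -> E y t -> E x t] ->
  [/\ forall x x' y y', E x x' -> E y y' -> E (ad x y) (ad x' y'),
      forall x x', E x x' -> E (op x) (op x'),
      forall a x x', E x x' -> E (sc a x) (sc a x')
    & forall x x' y y', E x x' -> E y y' -> E (br x y) (br x' y')] ->
  [/\ forall x y t, E (ad x (ad y t)) (ad (ad x y) t), forall x y, E (ad x y) (ad y x),
      forall x, E (ad z x) x & forall x, E (ad (op x) x) z] ->
  [/\ forall a b x, E (sc a (sc b x)) (sc (a * b) x), forall x, E (sc 1 x) x,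
      forall a x y, E (sc a (ad x y)) (ad (sc a x) (sc a y))
    & forall x a b, E (sc (a + b) x) (ad (sc a x) (sc b x))] ->
  [/\ forall t a x y, E (br (ad (sc a x) y) t) (ad (sc a (br x t)) (br y t)),
      forall t a x y, E (br t (ad (sc a x) y)) (ad (sc a (br t x)) (br t y)),
      forall x, E (br x x) z
    & forall x y t, E (ad (ad (br x (br y t)) (br y (br t x))) (br t (br x y))) z] ->
  exists (L : lie_algebra K) (q : T -> L),
    [/\ forall y, exists x, q x = y, forall x y, q x = q y <-> E x y,
        forall a x y, q (ad (sc a x) y) = a *: q x + q y
      & forall x y, q (br x y) = bracket (q x) (q y)].
Proof.
move=> [r1 r2 r3] [cad cop csc cbr] [l1 l2 l3 l4] [s1 s2 s3 s4] [b1 b2 b3 b4].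
pose ch (Q : T -> Prop) := match pselect (exists y, Q y) with
  | left e => sval (cid e) | right _ => z end.
pose rp x := ch (E x).
have Erp x : E x (rp x).
  by rewrite /rp /ch; case: pselect => [e|[]]; [exact: svalP (cid e) | exists x].
have rpE x y : E x y -> rp x = rp y.
  move=> xy; rewrite /rp; congr ch; apply: funext => t; apply: propext.
  by split; [apply: r3; exact: r2 | exact: r3].
pose C := {x : {classic T} | `[<x = rp x>]}.
have mkP x : `[<(rp x : {classic T}) = rp (rp x)>] by apply/asboolP; exact: rpE (Erp x).
pose mk x : C := exist _ (rp x) (mkP x).
have mkE x y : E x y -> mk x = mk y by move=> xy; apply: val_inj; exact: rpE.
have Emk x y : mk x = mk y -> E x y.
  by move=> /(congr1 val) /= e; apply: r3 (Erp x) _; rewrite e; apply: r2.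
have mkv (c : C) : mk (val c) = c by apply: val_inj; rewrite /= -(asboolP _ (svalP c)).
have Ev x : E (val (mk x)) x by apply: r2; exact: Erp.
pose ad' (x y : C) : C := mk (ad (val x) (val y)).
pose op' (x : C) : C := mk (op (val x)).
pose sc' a (x : C) : C := mk (sc a (val x)).
have adM x y : ad' (mk x) (mk y) = mk (ad x y) by apply: mkE; apply: cad; exact: Ev.
have opM x : op' (mk x) = mk (op x) by apply: mkE; apply: cop; exact: Ev.
have scM a x : sc' a (mk x) = mk (sc a x) by apply: mkE; apply: csc; exact: Ev.
have a1 : associative ad'.
  by move=> x y t; rewrite -[x]mkv -[y]mkv -[t]mkv !adM; exact: mkE.
have a2 : commutative ad' by move=> x y; rewrite -[x]mkv -[y]mkv !adM; exact: mkE.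
have a3 : left_id (mk z) ad' by move=> x; rewrite -[x]mkv !adM; exact: mkE.
have a4 : left_inverse (mk z) op' ad' by move=> x; rewrite -[x]mkv opM adM; exact: mkE.
pose Z : zmodType := HB.pack C (GRing.isZmodule.Build C a1 a2 a3 a4).
have m1 a b (x : Z) : sc' a (sc' b x) = sc' (a * b) x.
  by rewrite -[x]mkv !scM; exact: mkE.
have m2 : left_id 1 (sc' : K -> Z -> Z) by move=> x; rewrite -[x]mkv !scM; exact: mkE.
have m3 : right_distributive (sc' : K -> Z -> Z) +%R.
  move=> a x y; rewrite -[x]mkv -[y]mkv -[_ + _]/(ad' _ _) -[RHS]/(ad' _ _) adM !scM adM; exact: mkE.
have m4 (x : Z) : {morph (sc' : K -> Z -> Z)^~ x : a b / a + b}.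
  by move=> a b; rewrite -[x]mkv !scM -[RHS]/(ad' _ _) adM; exact: mkE.
pose V : lmodType K := HB.pack Z (GRing.Zmodule_isLmodule.Build K Z m1 m2 m3 m4).
pose mkV x : V := mk x.
have linM a x y : a *: mkV x + mkV y = mkV (ad (sc a x) y).
  by rewrite -[LHS]/(ad' (sc' a (mk x)) (mk y)) scM adM.
pose br' (x y : V) : V := mkV (br (val x) (val y)).
have brM x y : br' (mkV x) (mkV y) = mkV (br x y) by apply: mkE; apply: cbr; exact: Ev.
have mkvV (c : V) : mkV (val c) = c by exact: mkv.
have n1 y : linear (br'^~ y).
  by move=> a x t; rewrite -[x]mkvV -[y]mkvV -[t]mkvV linM !brM linM; exact: mkE.
have n2 x : linear (br' x).
  by move=> a y t; rewrite -[x]mkvV -[y]mkvV -[t]mkvV linM !brM linM; exact: mkE.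
have n3 x : br' x x = 0 by rewrite -[x]mkvV brM; exact: mkE.
have n4 x y t : br' x (br' y t) + br' y (br' t x) + br' t (br' x y) = 0.
  rewrite -[x]mkvV -[y]mkvV -[t]mkvV !brM -[LHS]/(ad' (ad' (mk _) (mk _)) (mk _)) !adM.
  exact: mkE.
exists (LieAlgebra n1 n2 n3 n4), mkV; split.
- by move=> y; exists (val y); exact: mkvV.
- by move=> x y; split; [exact: Emk | exact: mkE].
- by move=> a x y; rewrite -linM.
- by move=> x y; exact: esym (brM x y).
Qed.

Lemma bracketC L (x y : L) : bracket x y = - bracket y x.
Proof.
apply/eqP; rewrite -addr_eq0; apply/eqP.
by have := bracketxx (x + y); rewrite bracketDl !bracketDr !bracketxx addr0 add0r.
Qed.

Lemma bracketZl L a (x y : L) : bracket (a *: x) y = a *: bracket x y.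
Proof. by have := bracket_linl y a x 0; rewrite bracket0l !addr0. Qed.

Lemma bracketZr L a (x y : L) : bracket x (a *: y) = a *: bracket x y.
Proof. by have := bracket_linr x a y 0; rewrite bracket0r !addr0. Qed.

Lemma bracketBl L (x y t : L) : bracket (x - y) t = bracket x t - bracket y t.
Proof. by rewrite -scaleN1r bracketDl bracketZl scaleN1r. Qed.

Lemma bracketBr L (x y t : L) : bracket t (x - y) = bracket t x - bracket t y.
Proof. by rewrite -scaleN1r bracketDr bracketZr scaleN1r. Qed.

(** The Jacobi identity as a Leibniz rule for [bracket x]. *)
Lemma jacobi_ad L (x y t : L) :
  bracket x (bracket y t) = bracket (bracket x y) t + bracket y (bracket x t).
Proof.
have := bracket_jacobi x y t; rewrite (bracketC t x) (bracketC t (bracket x y)).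
rewrite -(scaleN1r (bracket x t)) bracketZr scaleN1r => /eqP.
by rewrite -addrA -opprD addr_eq0 opprK addrC => /eqP.
Qed.

Inductive lie_term (X : Type) :=
  | LVar (x : X) | LZero | LAdd (s t : lie_term X) | LOpp (t : lie_term X)
  | LScale (a : K) (t : lie_term X) | LBr (s t : lie_term X).
Arguments LZero {X}.

Fixpoint lie_eval X L (f : X -> L) (t : lie_term X) : L :=
  match t with
  | LVar x => f x
  | LZero => 0
  | LAdd s t => lie_eval f s + lie_eval f t
  | LOpp t => - lie_eval f t
  | LScale a t => a *: lie_eval f t
  | LBr s t => bracket (lie_eval f s) (lie_eval f t)
  end.

(** The induction principle says that [F] is generated by [v]. *)
Record is_free (X : Type) (F : lie_algebra K) (v : X -> F) : Prop := IsFree {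
  free_hom : forall L (f : X -> L), exists h : lie_hom F L, forall x, h (v x) = f x;
  free_ind : forall P : F -> Prop, P 0 -> (forall a x y, P x -> P y -> P (a *: x + y)) ->
    (forall x y, P x -> P y -> P (bracket x y)) -> (forall x, P (v x)) -> forall f, P f }.

(** Terms are identified when they have the same value for every assignment to a Lie
    algebra. *)
Lemma free_ex (X : Type) : exists (F : lie_algebra K) (v : X -> F), is_free v.
Proof.
pose E (s t : lie_term X) := forall L (f : X -> L), lie_eval f s = lie_eval f t.
have [||||| F [q [sq qE qL qB]]] := @lie_setoid (lie_term X) LZero (@LAdd X) (@LOpp X) (@LScale X) (@LBr X) E.
- by split=> [x L f|x y xy L f|x y t xy yt L f] //; rewrite xy.
- split=> [x x' y y' xx yy L f|x x' xx L f|a x x' xx L f|x x' y y' xx yy L f] /=;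
    by rewrite ?xx ?yy.
- split=> [x y t L f|x y L f|x L f|x L f] /=; first exact: addrA.
  + exact: addrC.
  + exact: add0r.
  + exact: addNr.
- split=> [a b x L f|x L f|a x y L f|x a b L f] /=; first exact: scalerA.
  + exact: scale1r.
  + exact: scalerDr.
  + exact: scalerDl.
- split=> [t a x y L f|t a x y L f|x L f|x y t L f] /=; first exact: bracket_linl.
  + exact: bracket_linr.
  + exact: bracketxx.
  + exact: bracket_jacobi.
have eqq s t : E s t -> q s = q t by move=> /qE.
have q0 : q LZero = 0.
  rewrite -(addNr (q LZero)) -scaleN1r -qL; apply: eqq => L f /=.
  by rewrite scaler0 addr0.
exists F, (fun x => q (LVar x)); split.
  move=> L f; pose k y := lie_eval f (sval (cid (sq y))).
  have kq t : k (q t) = lie_eval f t by exact: (qE _ _).1 (svalP (cid (sq (q t)))) L f.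
  have kL : linear k.
    by move=> a x y; have [s <-] := sq x; have [t <-] := sq y; rewrite -qL !kq.
  have kM x y : k (bracket x y) = bracket (k x) (k y).
    by have [s <-] := sq x; have [t <-] := sq y; rewrite -qB !kq.
  by exists (mk_lie kL kM) => x; exact: (kq (LVar x)).
move=> P P0 PL PB Pv f; have [t <-] := sq f.
have PD a s t' : P (q s) -> P (q t') -> P (q (LAdd (LScale a s) t')) by rewrite qL; exact: PL.
have P0' : P (q LZero) by rewrite q0.
elim: t => [x||s IHs t IHt|t IHt|a t IHt|s IHs t IHt] //.
- by have := PD 1 _ _ IHs IHt; rewrite (eqq (LAdd (LScale 1 s) t) (LAdd s t)) // => L g /=; rewrite scale1r.
- have := PD (-1) _ _ IHt P0'.
  by rewrite (eqq (LAdd (LScale (-1) t) LZero) (LOpp t)) // => L g /=; rewrite scaleN1r addr0.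
- have := PD a _ _ IHt P0'.
  by rewrite (eqq (LAdd (LScale a t) LZero) (LScale a t)) // => L g /=; rewrite addr0.
- by rewrite qB; exact: PB.
Qed.

Lemma free_eq X (F : lie_algebra K) (v : X -> F) L (g h : lie_hom F L) : is_free v ->
  (forall x, g (v x) = h (v x)) -> forall f, g f = h f.
Proof.
move=> fF gh; apply: (free_ind fF) => [|a x y ex ey|x y ex ey|//].
- by rewrite !linear0.
- by rewrite !linearP ex ey.
- by rewrite !lie_homM ex ey.
Qed.

Lemma lie_quot L (I : L -> Prop) : I 0 -> (forall a x y, I x -> I y -> I (a *: x + y)) ->
  (forall x y, I x -> I (bracket x y)) ->
  exists (Q : lie_algebra K) (q : lie_hom L Q),
    (forall y, exists x, q x = y) /\ forall x y, q x = q y <-> I (x - y).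
Proof.
move=> I0 IL IB; pose E x y := I (x - y).
have ID x y : I x -> I y -> I (x + y) by move=> Ix Iy; rewrite -[x]scale1r; exact: IL.
have IZ a x : I x -> I (a *: x) by move=> Ix; rewrite -[_ *: _]addr0; exact: IL.
have IN x : I x -> I (- x) by rewrite -scaleN1r; exact: IZ.
have E1 x y : x = y -> E x y by rewrite /E => ->; rewrite subrr.
have [||||| Q [q [sq qE qL qB]]] :=
  @lie_setoid L 0 +%R -%R (fun a x => a *: x) (@bracket K L) E.
- split=> [x|x y xy|x y t xy yt]; first exact: E1.
    by rewrite /E -opprB; exact: IN.
  by rewrite /E -(subrKA y); exact: ID.
- split=> [x x' y y' xx yy|x x' xx|a x x' xx|x x' y y' xx yy]; rewrite /E.
  + by rewrite opprD addrACA; exact: ID.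
  + by rewrite -opprD; exact: IN.
  + by rewrite -scalerBr; exact: IZ.
  have -> : bracket x y - bracket x' y' = bracket (x - x') y - bracket (y - y') x'.
    by rewrite !bracketBl (bracketC y x') (bracketC y' x') opprB opprK [- _ + _]addrC addrA subrK.
  by apply: ID; [exact: IB | apply: IN; exact: IB].
- by split=> *; apply: E1; rewrite ?addrA ?addr0 ?add0r ?addNr // addrC.
- by split=> *; apply: E1; rewrite ?scalerA ?scale1r ?scalerDr ?scalerDl.
- split=> *; apply: E1; [exact: bracket_linl | exact: bracket_linr | exact: bracketxx | exact: bracket_jacobi].
have kL : linear q by move=> a x y; exact: qL.
by exists Q, (mk_lie kL qB).
Qed.

End LieTools.

(** ** Identities in abelian groups *)

Section ZmodReflection.
Import GRing.Theory.
Local Open Scope ring_scope.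
Variable V : zmodType.

Inductive zexpr := ZVar (n : nat) | ZZero | ZAdd (s t : zexpr) | ZOpp (t : zexpr).

Fixpoint zeval (env : seq V) (t : zexpr) : V :=
  match t with
  | ZVar n => nth 0 env n
  | ZZero => 0
  | ZAdd s t => zeval env s + zeval env t
  | ZOpp t => - zeval env t
  end.

Fixpoint zcoef (t : zexpr) (n : nat) : int :=
  match t with
  | ZVar m => (m == n)%:Z
  | ZZero => 0
  | ZAdd s t => zcoef s n + zcoef t n
  | ZOpp t => - zcoef t n
  end.

Fixpoint zbound (k : nat) (t : zexpr) : bool :=
  match t with
  | ZVar n => (n < k)%N
  | ZZero => true
  | ZAdd s t => zbound k s && zbound k t
  | ZOpp t => zbound k t
  end.

Lemma zevalE env t : zbound (size env) t ->
  zeval env t = \sum_(i < size env) nth 0 env i *~ zcoef t i.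
Proof.
elim: t => [n|_|s IHs t IHt /andP [bs bt]|t IH b] /=.
- move=> ln; rewrite (bigD1 (Ordinal ln)) //= eqxx mulr1z big1 ?addr0 // => i ni.
  by rewrite eq_sym (_ : (i == n :> nat) = false) ?mulr0z //; apply: negbTE.
- by rewrite big1 // => i _; rewrite mulr0z.
- by rewrite IHs // IHt // -big_split; apply: eq_bigr => i _; rewrite mulrzDr.
- by rewrite IH // -sumrN; apply: eq_bigr => i _; rewrite mulrNz.
Qed.

Lemma zsolve env s t : zbound (size env) s && zbound (size env) t &&
  all (fun i => zcoef s i == zcoef t i) (iota 0 (size env)) -> zeval env s = zeval env t.
Proof.
move=> /andP [/andP [bs bt] /allP h]; rewrite !zevalE //; apply: eq_bigr => i _.
by rewrite (eqP (h i _)) // mem_iota add0n ltn_ord.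
Qed.

End ZmodReflection.

(* Atoms are compared up to conversion, since scalars and sums may be built from
   different but convertible structures. *)
Ltac zmod_insert x l :=
  match l with
  | nil => constr:(cons x nil)
  | cons x _ => l
  | cons ?y _ => let _ := match goal with _ => unify x y end in l
  | cons ?y ?l' => let r := zmod_insert x l' in constr:(cons y r)
  end.

Ltac zmod_atoms e l :=
  match e with
  | @GRing.add _ ?a ?b => let l := zmod_atoms a l in zmod_atoms b l
  | @GRing.opp _ ?a => zmod_atoms a l
  | @GRing.zero _ => l
  | _ => zmod_insert e l
  end.

Ltac zmod_index x l :=
  match l with
  | cons x _ => constr:(0%N)
  | cons ?y _ => let _ := match goal with _ => unify x y end in constr:(0%N)
  | cons _ ?l' => let n := zmod_index x l' in constr:(S n)
  end.

Ltac zmod_reify e l :=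
  match e with
  | @GRing.add _ ?a ?b => let s := zmod_reify a l in let t := zmod_reify b l in constr:(ZAdd s t)
  | @GRing.opp _ ?a => let s := zmod_reify a l in constr:(ZOpp s)
  | @GRing.zero _ => constr:(ZZero)
  | _ => let n := zmod_index e l in constr:(ZVar n)
  end.

(** Decides equations that hold in all abelian groups. *)
Ltac zmod :=
  match goal with |- @eq ?T ?a ?b =>
    let l := zmod_atoms a (@nil T) in let l := zmod_atoms b l in
    let s := zmod_reify a l in let t := zmod_reify b l in
    exact (@zsolve _ l s t isT)
  end.

(** ** Lie algebras of sequences *)

Section Sequences.
Import GRing.Theory.
Local Open Scope ring_scope.
Variable K : fieldType.

Lemma ad_jacobi (V : lmodType K) (br : V -> V -> V) : (forall y, linear (br^~ y)) ->
  (forall x y, br x y = - br y x) ->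
  (forall x y t, br x (br y t) = br (br x y) t + br y (br x t)) ->
  forall x y t, br x (br y t) + br y (br t x) + br t (br x y) = 0.
Proof.
move=> brl anti ad x y t; rewrite ad (anti t (br x y)) (anti y (br t x)) (anti t x).
have N u v : br (- u) v = - br u v.
  have := brl v (-1) u 0; rewrite scaleN1r addr0 => ->; rewrite scaleN1r.
  have := brl v 1 0 0; rewrite !scale1r addr0 => /(congr1 (fun w => w - br 0 v)).
  by rewrite addrK subrr => <-; rewrite addr0.
rewrite N (anti (br x t) y); zmod.
Qed.

Lemma ad_linr (V : lmodType K) (br : V -> V -> V) : (forall y, linear (br^~ y)) ->
  (forall x y, br x y = - br y x) -> forall x, linear (br x).
Proof. by move=> brl anti x a y t; rewrite anti brl (anti x y) (anti x t) scalerN -opprD. Qed.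

Section OneAlgebra.
Variable N : lie_algebra K.
Implicit Types f g h : nat -> N.

Definition sh (V : Type) (f : nat -> V) : nat -> V := fun i => f i.+1.

(** The bracket of exponential generating series, for which the shift is a derivation. *)
Fixpoint hbr_at f g n : N :=
  match n with
  | 0 => bracket (f 0) (g 0)
  | n'.+1 => hbr_at (sh f) g n' + hbr_at f (sh g) n'
  end.
Definition hbr f g : nat -> N := fun n => hbr_at f g n.

Lemma sh_hbr f g : sh (hbr f g) = hbr (sh f) g + hbr f (sh g).
Proof. by []. Qed.

Lemma hbr_linl g : linear (hbr^~ g).
Proof.
move=> a f f'; apply: funext => n; rewrite -[RHS]/(a *: hbr_at f g n + hbr_at f' g n) /hbr.
elim: n f f' g => [|n IH] f f' g; first exact: bracket_linl.
by rewrite /= [hbr_at (sh _) _ _](IH (sh f) (sh f')) IH scalerDr addrACA.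
Qed.

Lemma hbr_anti f g : hbr f g = - hbr g f.
Proof.
apply: funext => n; rewrite -[RHS]/(- hbr_at g f n) /hbr.
elim: n f g => [|n IH] f g; first exact: bracketC.
by rewrite /= IH [X in _ + X]IH addrC opprD.
Qed.

Lemma hbr_alt f : hbr f f = 0.
Proof.
apply: funext => -[|n]; first exact: bracketxx.
by rewrite -[LHS]/(hbr (sh f) f n + hbr f (sh f) n) hbr_anti; exact: addNr.
Qed.

Let hbr_linr := ad_linr hbr_linl hbr_anti.

Lemma hbrDl f f' g : hbr (f + f') g = hbr f g + hbr f' g.
Proof. by have := hbr_linl g 1 f f'; rewrite !scale1r. Qed.

Lemma hbrDr f g g' : hbr f (g + g') = hbr f g + hbr f g'.
Proof. by have := hbr_linr f 1 g g'; rewrite !scale1r. Qed.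

Lemma hbr_ad f g h : hbr f (hbr g h) = hbr (hbr f g) h + hbr g (hbr f h).
Proof.
apply: funext => n; elim: n f g h => [|n IH] f g h; first exact: jacobi_ad.
have S (u v : nat -> N) : hbr u v n.+1 = hbr (sh u) v n + hbr u (sh v) n by [].
have D (u v : nat -> N) i : (u + v) i = u i + v i by [].
rewrite [LHS]S sh_hbr hbrDr !D !IH !S !sh_hbr !hbrDl !hbrDr !D; zmod.
Qed.

Definition hurwitz : lie_algebra K :=
  LieAlgebra (lie_mod := (nat -> N : lmodType K)) hbr_linl hbr_linr hbr_alt
    (ad_jacobi hbr_linl hbr_anti hbr_ad).

(** The bracket of ordinary generating series. *)
Definition cbr f g : nat -> N := fun n => \sum_(i < n.+1) bracket (f i) (g (n - i)%N).

Lemma cbr0 f g : cbr f g 0 = bracket (f 0) (g 0).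
Proof. by rewrite /cbr big_ord1. Qed.

Lemma cbrSl f g n : cbr f g n.+1 = bracket (f 0) (g n.+1) + cbr (sh f) g n.
Proof. by rewrite /cbr big_ord_recl. Qed.

Lemma cbrSr f g n : cbr f g n.+1 = cbr f (sh g) n + bracket (f n.+1) (g 0).
Proof.
rewrite /cbr big_ord_recr /= subnn; congr (_ + _); apply: eq_bigr => i _.
by rewrite subSn // -ltnS.
Qed.

Lemma cbr_linl g : linear (cbr^~ g).
Proof.
move=> a f f'; apply: funext => n; rewrite -[RHS]/(a *: cbr f g n + cbr f' g n) /cbr.
by rewrite scaler_sumr -big_split; apply: eq_bigr => i _; exact: bracket_linl.
Qed.

Lemma cbr_anti f g : cbr f g = - cbr g f.
Proof.
apply: funext => n; rewrite -[RHS]/(- cbr g f n).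
elim: n f g => [|n IH] f g; first by rewrite !cbr0 -bracketC.
by rewrite cbrSl cbrSr IH opprD -bracketC addrC.
Qed.

Lemma cbr_alt f : cbr f f = 0.
Proof.
apply: funext => n; rewrite -[RHS]/(0 : N).
elim/ltn_ind: n f => -[|[|n]] IH f; first by rewrite cbr0 bracketxx.
  by rewrite cbrSl cbr0 bracketC addNr.
rewrite cbrSl cbrSr IH // add0r -[sh f n.+1]/(f n.+2) bracketC; exact: addNr.
Qed.

Let cbr_linr := ad_linr cbr_linl cbr_anti.

Lemma cbrDl f f' g : cbr (f + f') g = cbr f g + cbr f' g.
Proof. by have := cbr_linl g 1 f f'; rewrite !scale1r. Qed.

Lemma cbrDr f g g' : cbr f (g + g') = cbr f g + cbr f g'.
Proof. by have := cbr_linr f 1 g g'; rewrite !scale1r. Qed.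

Let ad (x : N) f : nat -> N := fun i => bracket x (f i).

Lemma ad_cbr x f g n : bracket x (cbr f g n) = cbr (ad x f) g n + cbr f (ad x g) n.
Proof.
rewrite /cbr -big_split -[bracket x _]/(mk_lin (bracket_linr x) _) linear_sum.
by apply: eq_bigr => i _; exact: jacobi_ad.
Qed.

Lemma cbr_ad f g h : cbr f (cbr g h) = cbr (cbr f g) h + cbr g (cbr f h).
Proof.
apply: funext => n; elim: n f g h => [|n IH] f g h.
  by rewrite -[RHS]/(cbr _ _ 0 + cbr _ _ 0) !cbr0; exact: jacobi_ad.
have D (u v : nat -> N) i : (u + v) i = u i + v i by [].
have sl u v : sh (cbr u v) = ad (u 0) (sh v) + cbr (sh u) v.
  by apply: funext => i; rewrite D -cbrSl.
rewrite D cbrSl IH ad_cbr (cbrSl (cbr f g)) cbr0 sl cbrDl D.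
rewrite (cbrSr g (cbr f h)) cbr0 sl cbrDr !D.
rewrite (cbrSl (ad (f 0) g)) (cbrSr g (ad (f 0) h)).
rewrite -[sh (ad _ g)]/(ad (f 0) (sh g)) -[sh (ad _ h)]/(ad (f 0) (sh h)).
rewrite -[ad (f 0) g 0]/(bracket (f 0) (g 0)) -[ad (f 0) h 0]/(bracket (f 0) (h 0)); zmod.
Qed.

Definition cauchy : lie_algebra K :=
  LieAlgebra (lie_mod := (nat -> N : lmodType K)) cbr_linl cbr_linr cbr_alt
    (ad_jacobi cbr_linl cbr_anti cbr_ad).

End OneAlgebra.

(** ** Semidirect products *)

Section Semidirect.
Variables (L : lie_algebra K) (D : {linear L -> L}).
Hypothesis DM : forall x y, D (bracket x y) = bracket (D x) y + bracket x (D y).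
Local Notation T := (L * K^o)%type.

Let DZ a x : D (a *: x) = a *: D x. Proof. exact: linearZ. Qed.
Let DD x y : D (x + y) = D x + D y. Proof. exact: linearD. Qed.
Let DB x y : D (x - y) = D x - D y. Proof. exact: linearB. Qed.

(** The bracket of the semidirect product of [L] with a line acting by the derivation [D]. *)
Definition sbr (u v : T) : T := (bracket u.1 v.1 + u.2 *: D v.1 - v.2 *: D u.1, 0).

Lemma sbr_linl v : linear (sbr^~ v).
Proof.
have H (x y t : L) (a p q r : K) :
    bracket (a *: x + y) t + (a * p + q) *: D t - r *: D (a *: x + y) =
    a *: (bracket x t + p *: D t - r *: D x) + (bracket y t + q *: D t - r *: D y).
  rewrite bracketDl bracketZl DD DZ !scalerBr !scalerDr !scalerDl !scalerA (mulrC r a); zmod.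
by move=> a x y; congr pair; [exact: H | rewrite /= scaler0 addr0].
Qed.

Lemma sbr_anti u v : sbr u v = - sbr v u.
Proof.
congr pair; last by rewrite /= oppr0.
by rewrite /= bracketC; zmod.
Qed.

Lemma sbr_alt u : sbr u u = 0.
Proof. by congr pair; rewrite /= bracketxx; zmod. Qed.

Lemma sbr_ad u v w : sbr u (sbr v w) = sbr (sbr u v) w + sbr v (sbr u w).
Proof.
have H (x y z : L) (a b c : K) :
    bracket x (bracket y z + b *: D z - c *: D y) + a *: D (bracket y z + b *: D z - c *: D y) =
    bracket (bracket x y + a *: D y - b *: D x) z - c *: D (bracket x y + a *: D y - b *: D x) +
    (bracket y (bracket x z + a *: D z - c *: D x) + b *: D (bracket x z + a *: D z - c *: D x)).
  rewrite !bracketBr !bracketBl !bracketDr !bracketDl !DB !DD !DZ !DM.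
  rewrite !scalerBr !scalerDr !bracketZr !bracketZl !scalerA jacobi_ad.
  rewrite (mulrC c a) (mulrC c b) (mulrC b a).
  rewrite (bracketC (D x) y) scalerN; zmod.
congr pair; last by rewrite /= addr0.
by rewrite /= !scale0r !subr0 !addr0; exact: H.
Qed.

Definition semidirect : lie_algebra K :=
  LieAlgebra (lie_mod := (T : lmodType K)) sbr_linl (ad_linr sbr_linl sbr_anti) sbr_alt
    (ad_jacobi sbr_linl sbr_anti sbr_ad).

End Semidirect.
End Sequences.

(** ** Splittings over ideals of free Lie algebras *)

Section Splittings.
Import GRing.Theory.
Local Open Scope ring_scope.
Variable K : fieldType.
Implicit Types N P L : lie_algebra K.

Definition sublie P (I : P -> Prop) := [/\ I 0, forall a x y, I x -> I y -> I (a *: x + y)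
  & forall x y, I x -> I y -> I (bracket x y)].

Definition lie_section P (I : P -> Prop) N (g : lie_hom N P) (s : P -> N) :=
  [/\ forall x, I x -> g (s x) = x, forall a x y, I x -> I y -> s (a *: x + y) = a *: s x + s y
    & forall x y, I x -> I y -> s (bracket x y) = bracket (s x) (s y)].

(** Every surjection onto the subalgebra [I] has a section. *)
Definition splits P (I : P -> Prop) := forall N (g : lie_hom N P),
  (forall n, I (g n)) -> (forall x, I x -> exists n, g n = x) ->
  exists s : P -> N, lie_section I g s.

Lemma splits_ext P (I I' : P -> Prop) : (forall x, I x <-> I' x) -> splits I -> splits I'.
Proof.
move=> e sI N g gI gs; have [|x /e /gs //|s [s1 s2 s3]] := sI N g.
  by move=> n; apply/e.
exists s; split=> [x /e|a x y /e Ix /e Iy|x y /e Ix /e Iy]; [exact: s1|exact: s2|exact: s3].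
Qed.

Section Codimension1.
Variables (P : lie_algebra K) (I : P -> Prop) (chi : P -> K).
Hypotheses (IS : sublie I) (sI : splits I)
  (chiL : forall a x y, I x -> I y -> chi (a *: x + y) = a * chi x + chi y)
  (chiB : forall x y, I x -> I y -> chi (bracket x y) = 0).

Let adn (t : P) n (x : P) := iter n (bracket t) x.

Lemma adnL t n a x y : adn t n (a *: x + y) = a *: adn t n x + adn t n y.
Proof. by elim: n => [//|n IH]; rewrite /adn !iterS [iter n _ _]IH bracketDr bracketZr. Qed.

Lemma adnSr t n x : adn t n.+1 x = adn t n (bracket t x).
Proof. exact: iterSr. Qed.

Lemma hbr_adn t k l n : hbr (fun i => adn t i k) (fun i => adn t i l) n = adn t n (bracket k l).
Proof.
elim: n k l => [//|n IH] k l.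
rewrite -[LHS]/(hbr (sh (fun i => adn t i k)) (fun i => adn t i l) n +
  hbr (fun i => adn t i k) (sh (fun i => adn t i l)) n).
have shE x : sh (fun i => adn t i x) = fun i => adn t i (bracket t x).
  by apply: funext => i; exact: adnSr.
rewrite !shE !IH adnSr (jacobi_ad t).
by have := adnL t n 1 (bracket (bracket t k) l) (bracket k (bracket t l)); rewrite !scale1r.
Qed.

Lemma hbr_morph N (g : lie_hom N P) f h n : g (hbr f h n) = hbr (fun i => g (f i)) (fun i => g (h i)) n.
Proof.
elim: n f h => [|n IH] f h; first exact: lie_homM.
rewrite -[hbr f h n.+1]/(hbr (sh f) h n + hbr f (sh h) n) linearD.
by rewrite !IH.
Qed.

(** The kernel of a homomorphism [chi] to the base field is split as well: for [t] with
    [chi t = 1], the iterates of [ad t] embed [I] in the semidirect product of the Hurwitz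
    sequences of [ker chi] and the line of the shift, and sections lift along this embedding
    before being evaluated at index [0]. *)
Lemma splits_codim1 : splits (fun x => I x /\ chi x = 0).
Proof.
have [I0 IL IB] := IS.
have IZ a x : I x -> I (a *: x) by move=> Ix; rewrite -[_ *: _]addr0; exact: IL.
case: (pselect (exists t, I t /\ chi t <> 0)) => [[t [It /eqP ct]]|nt]; last first.
  apply: splits_ext sI => x; split=> [Ix|[//]]; split=> //.
  by case: (pselect (chi x = 0)) => // c; case: nt; exists x.
have c0 : chi 0 = 0.
  by have := chiL (-1) I0 I0; rewrite scaler0 addr0 mulN1r addNr.
have chiZ a x : I x -> chi (a *: x) = a * chi x.
  by move=> Ix; rewrite -[_ *: _]addr0 chiL // c0 addr0.
have [t0 [It0 ct0]] : exists t0, I t0 /\ chi t0 = 1.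
  by exists ((chi t)^-1 *: t); split; [exact: IZ | rewrite chiZ // mulVf].
pose k x := x - chi x *: t0.
have kE x : k x = (- chi x) *: t0 + x by rewrite /k scaleNr addrC.
have Ik x : I x -> I (k x) by move=> Ix; rewrite kE; exact: IL.
have ck x : I x -> chi (k x) = 0 by move=> Ix; rewrite kE chiL // ct0 mulr1 addNr.
have Ia n x : I x -> I (adn t0 n (k x)) /\ chi (adn t0 n (k x)) = 0.
  move=> Ix; elim: n => [|n [IH _]]; first by split; [exact: Ik | exact: ck].
  by rewrite /adn iterS; split; [exact: IB | exact: chiB].
move=> N g gI gs.
have shL : linear (@sh N : hurwitz N -> hurwitz N) by [].
pose S := @semidirect K (hurwitz N) (mk_lin shL) (@sh_hbr K N).
pose Q (u : lie_prod P S) := [/\ I u.1, u.2.2 = chi u.1 & forall n, g (u.2.1 n) = adn t0 n (k u.1)].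
have Q0 : Q 0.
  split=> //= n; rewrite /k c0 scale0r subr0.
  by have := adnL t0 n 1 0 0; rewrite !scale1r addr0 linear0 => /(congr1 (fun x => x - adn t0 n 0)); rewrite addrK subrr.
have kL a x y : I x -> I y -> k (a *: x + y) = a *: k x + k y.
  by move=> Ix Iy; rewrite /k chiL // scalerBr scalerDl scalerA; zmod.
have QL a u v : Q u -> Q v -> Q (a *: u + v).
  move=> [Iu cu fu] [Iv cv fv]; split; first exact: IL.
    by rewrite [RHS](chiL a Iu Iv) -cu -cv.
  move=> n; rewrite [in RHS](kL a _ _ Iu Iv) adnL -fu -fv; exact: (linearP g a (u.2.1 n) (v.2.1 n)).
have QB u v : Q u -> Q v -> Q (bracket u v).
  move=> [Iu cu fu] [Iv cv fv]; split; first exact: IB.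
    by rewrite /= chiB.
  case: u v Iu cu fu Iv cv fv => x [f a] [y [h b]] /= Ix ea fE Iy eb hE n.
  rewrite {1}/k chiB // scale0r subr0.
  have -> : bracket x y = a *: bracket t0 (k y) + ((- b) *: bracket t0 (k x) + bracket (k x) (k y)).
    have H kx ky : bracket (kx + a *: t0) (ky + b *: t0) =
        a *: bracket t0 ky + ((- b) *: bracket t0 kx + bracket kx ky).
      rewrite !bracketDl !bracketDr !bracketZl !bracketZr bracketxx !scaler0 (bracketC kx t0).
      by rewrite scalerN scaleNr; zmod.
    by rewrite -H /k -ea -eb !subrK.
  rewrite !adnL -!adnSr -hbr_adn -fE -hE.
  have -> : (fun i => adn t0 i (k x)) = (fun i => g (f i)) by apply: funext => i; rewrite fE.
  have -> : (fun i => adn t0 i (k y)) = (fun i => g (h i)) by apply: funext => i; rewrite hE.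
  rewrite -hbr_morph.
  have D (p q : N) : g (hbr f h n + a *: p - b *: q) = a *: g p + (- b *: g q + g (hbr f h n)).
    have Z c z : g (c *: z) = c *: g z by exact: linearZ.
    by rewrite linearB linearD !Z scaleNr; zmod.
  exact: D.
have [H [i [inj iP]]] := sublie_ex Q0 QL QB.
have g1L : linear (fun z : H => (i z).1) by move=> a x y; rewrite linearP.
have g1M (x y : H) : (i (bracket x y)).1 = bracket (i x).1 (i y).1 by rewrite lie_homM.
have iQ z : Q (i z) by apply/iP; exists z.
have [|x Ix|s [s1 s2 s3]] := sI (N := H) (g := mk_lie g1L g1M).
- by move=> z; have [] := iQ z.
- have ex n : exists y, g y = adn t0 n (k x) by apply: gs; exact: Ia.
  pose f n := sval (cid (ex n)).
  have [|z zE] := (iP ((x, (f : hurwitz N, chi x)) : lie_prod P S)).1.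
    by split=> // n; exact: svalP (cid (ex n)).
  by exists z; rewrite /= zE.
exists (fun x => (i (s x)).2.1 0); split.
- move=> x [Ix cx]; have [_ _ ->] := iQ (s x).
  by rewrite [(i (s x)).1](s1 x Ix) /adn /= /k cx scale0r subr0.
- by move=> a x y [Ix _] [Iy _]; rewrite s2 // linearP.
- move=> x y [Ix cx] [Iy cy]; rewrite s3 // lie_homM.
  have [_ ex _] := iQ (s x); have [_ ey _] := iQ (s y).
  have -> : (bracket (i (s x)) (i (s y))).2.1 0 = bracket ((i (s x)).2.1 0) ((i (s y)).2.1 0)
    + (i (s x)).2.2 *: (i (s y)).2.1 1%N - (i (s y)).2.2 *: (i (s x)).2.1 1%N by [].
  by rewrite ex ey [(i (s x)).1](s1 x Ix) [(i (s y)).1](s1 y Iy) cx cy !scale0r addr0 subr0.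
Qed.

End Codimension1.

Fixpoint spn (W : lmodType K) (ws : seq W) (v : W) : Prop :=
  match ws with [::] => v = 0 | w :: ws' => exists c : K, spn ws' (v - c *: w) end.

Lemma spn_lin (W : lmodType K) (ws : seq W) a v v' : spn ws v -> spn ws v' -> spn ws (a *: v + v').
Proof.
elim: ws v v' => [|w ws IH] v v'; first by move=> /= -> ->; rewrite scaler0 addr0.
move=> [c sc] [c' sc']; exists (a * c + c').
have -> : a *: v + v' - (a * c + c') *: w = a *: (v - c *: w) + (v' - c' *: w).
  by rewrite scalerDl scalerBr scalerA; zmod.
exact: IH.
Qed.

Lemma spn0 (W : lmodType K) (ws : seq W) : spn ws 0.
Proof. by elim: ws => [//|w ws IH]; exists 0; rewrite scale0r subr0. Qed.

(** Induction on a list spanning the values of [phi]: either the first vector is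
    redundant, or its coefficient is a homomorphism to the base field and [splits_codim1]
    applies to it. *)
Lemma splits_ker P (W : lmodType K) (ws : seq W) (I : P -> Prop) (phi : P -> W) :
  sublie I -> splits I ->
  (forall a x y, I x -> I y -> phi (a *: x + y) = a *: phi x + phi y) ->
  (forall x y, I x -> I y -> phi (bracket x y) = 0) ->
  (forall x, I x -> spn ws (phi x)) -> splits (fun x => I x /\ phi x = 0).
Proof.
elim: ws I => [|w ws IH] I IS sI phiL phiB sp.
  by apply: splits_ext sI => x; split=> [Ix|[]//]; split=> //; exact: sp.
have spD v v' : spn ws v -> spn ws v' -> spn ws (v + v').
  by move=> h h'; rewrite -[v]scale1r; exact: spn_lin.
have spZ a v : spn ws v -> spn ws (a *: v).
  by move=> h; rewrite -[_ *: _]addr0; apply: spn_lin => //; exact: spn0.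
case: (pselect (spn ws w)) => [sw|nw].
  apply: IH => // x /sp [c sc]; rewrite -(subrK (c *: w) (phi x)).
  by apply: spD => //; exact: spZ.
have uniq v c c' : spn ws (v - c *: w) -> spn ws (v - c' *: w) -> c = c'.
  move=> h h'; apply/eqP; rewrite -subr_eq0; apply/eqP; case: (pselect (c - c' = 0)) => // /eqP n.
  case: nw; have -> : w = (c - c')^-1 *: ((-1) *: (v - c *: w) + (v - c' *: w)); last exact/spZ/spn_lin.
  have -> : (-1) *: (v - c *: w) + (v - c' *: w) = (c - c') *: w.
    by rewrite scaleN1r scalerBl; zmod.
  by rewrite scalerA mulVf // scale1r.
pose chi x := match pselect (I x) with left Ix => sval (cid (sp x Ix)) | right _ => 0 end.
have chiP x : I x -> spn ws (phi x - chi x *: w).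
  by move=> Ix; rewrite /chi; case: pselect => // Ix'; exact: svalP (cid (sp x Ix')).
have [I0 IL IB] := IS.
have chiL a x y : I x -> I y -> chi (a *: x + y) = a * chi x + chi y.
  move=> Ix Iy; apply: (uniq (phi (a *: x + y))); first exact/chiP/IL.
  have -> : phi (a *: x + y) - (a * chi x + chi y) *: w = a *: (phi x - chi x *: w) + (phi y - chi y *: w).
    by rewrite phiL // scalerDl scalerBr scalerA; zmod.
  by apply: spn_lin; exact: chiP.
have chi0 x : I x -> phi x = 0 -> chi x = 0.
  by move=> Ix ex; apply: (uniq (phi x)); [exact: chiP | rewrite ex scale0r subr0; exact: spn0].
have chiB x y : I x -> I y -> chi (bracket x y) = 0.
  by move=> Ix Iy; apply: chi0; [exact: IB | exact: phiB].
have c0 : chi 0 = 0 by have := chiL (-1) _ _ I0 I0; rewrite scaler0 addr0 mulN1r addNr.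
have IS' : sublie (fun x => I x /\ chi x = 0).
  split=> [|a x y [Ix cx] [Iy cy]|x y [Ix cx] [Iy cy]] //.
  - by split; [exact: IL | rewrite chiL // cx cy mulr0 addr0].
  - by split; [exact: IB | exact: chiB].
have := IH _ IS' (splits_codim1 IS sI chiL chiB).
move=> /(_ (fun a x y h h' => phiL a x y h.1 h'.1) (fun x y h h' => phiB x y h.1 h'.1)) H.
apply: splits_ext (H _) => [x|x [Ix cx]].
  by split=> [[[Ix _] ex]|[Ix ex]] //; do 2 split=> //; exact: chi0.
by have := chiP x Ix; rewrite cx scale0r subr0.
Qed.

(** ** Finitely generated parts of free Lie algebras *)

Section FreeParts.
Variables (X : eqType) (F : lie_algebra K) (v : X -> F).
Hypothesis fF : is_free v.

(** Kills the generators outside [s]; the elements it fixes form the subalgebra generated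
    by [s]. *)
Definition retract (s : seq X) : lie_hom F F :=
  sval (cid (free_hom fF (fun x => if x \in s then v x else 0))).

Lemma retractE s x : retract s (v x) = if x \in s then v x else 0.
Proof. exact: (svalP (cid (free_hom fF (fun x => if x \in s then v x else 0)))). Qed.

Definition fixed s f := retract s f = f.

Lemma fixed_sublie s : sublie (fixed s).
Proof.
split=> [|a x y|x y]; rewrite /fixed; first exact: linear0.
  by rewrite linearP => -> ->.
by rewrite lie_homM => -> ->.
Qed.

Lemma fixed_sub s s' f : {subset s <= s'} -> fixed s f -> fixed s' f.
Proof.
move=> ss <-; apply: (free_eq (g := lie_cmp (retract s') (retract s)) (h := retract s) fF) => x.
by rewrite /= retractE; case: ifP => [/ss xs'|_]; rewrite ?linear0 // retractE xs'.
Qed.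

Lemma fixed_ex f : exists s, fixed s f.
Proof.
have cat s s' f1 f2 : fixed s f1 -> fixed s' f2 -> fixed (s ++ s') f1 /\ fixed (s ++ s') f2.
  move=> h h'; split; [apply: fixed_sub h | apply: fixed_sub h'] => x xs; rewrite mem_cat xs //.
  by rewrite orbT.
apply: (free_ind fF (P := fun f => exists s, fixed s f)) => [|a x y [s h] [s' h']|x y [s h] [s' h']|x].
- by exists [::]; have [] := fixed_sublie [::].
- have [h1 h2] := cat _ _ _ _ h h'; exists (s ++ s').
  by have [_ L _] := fixed_sublie (s ++ s'); exact: L.
- have [h1 h2] := cat _ _ _ _ h h'; exists (s ++ s').
  by have [_ _ B] := fixed_sublie (s ++ s'); exact: B.
- by exists [:: x]; rewrite /fixed retractE mem_head.
Qed.

Lemma fixed_ex_seq (fs : seq F) : exists s, forall f, f \in fs -> fixed s f.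
Proof.
elim: fs => [|f fs [s IH]]; first by exists [::].
have [s' h] := fixed_ex f; exists (s' ++ s) => f'; rewrite inE => /orP [/eqP ->|/IH h'].
  by apply: fixed_sub h => x xs; rewrite mem_cat xs.
by apply: fixed_sub h' => x xs; rewrite mem_cat xs orbT.
Qed.

(** The section is the free extension of a choice of lifts of the generators in [s]. *)
Lemma splits_fixed s : splits (fixed s).
Proof.
move=> N g gI gs; have ex x : exists n, g n = if x \in s then v x else 0.
  case: ifP => xs; last by exists 0; rewrite linear0.
  by apply: gs; rewrite /fixed retractE xs.
have [h hE] := free_hom fF (fun x => sval (cid (ex x))).
have gh f : g (h f) = retract s f.
  apply: (free_eq (g := lie_cmp g h) (h := retract s) fF) => x.
  by rewrite /= hE retractE; exact: svalP (cid (ex x)).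
exists h; split=> [f ff|a x y _ _|x y _ _]; first by rewrite gh.
  exact: linearP.
exact: lie_homM.
Qed.

Lemma splits_fixed_ker s (W : lmodType K) (phi : {linear F -> W}) :
  (forall x y, phi (bracket x y) = 0) -> splits (fun f => fixed s f /\ phi f = 0).
Proof.
move=> phiB.
apply: (splits_ker (ws := [seq phi (v x) | x <- s]) (fixed_sublie s) (@splits_fixed s)) => [a x y _ _|//|f <-].
  exact: linearP.
apply: (free_ind fF (P := fun f => spn _ (phi (retract s f)))) => [|a x y h h'|x y _ _|x].
- by rewrite !linear0; exact: spn0.
- by rewrite !linearP; exact: spn_lin.
- by rewrite lie_homM phiB; exact: spn0.
rewrite retractE; case: ifP => [|_]; last by rewrite linear0; exact: spn0.
elim: s => [//|y s IH]; rewrite inE => /orP [/eqP ->|/IH h] /=.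
  by exists 1; rewrite scale1r subrr; exact: spn0.
by exists 0; rewrite scale0r subr0.
Qed.

End FreeParts.
End Splittings.

(** ** Central extensions of ideals of free Lie algebras *)

Section Graded.
Import GRing.Theory.
Local Open Scope ring_scope.
Variables (K : fieldType) (X : eqType) (F : lie_algebra K) (v : X -> F).
Hypothesis fF : is_free v.
Implicit Types f h : F.

(** The grading of [F], as the homomorphism that sends a generator to itself times the
    formal variable. *)
Definition gr : lie_hom F (cauchy F) :=
  sval (cid (free_hom fF (fun x => (fun i => if i == 1%N then v x else 0) : cauchy F))).

Definition pr (n : nat) (f : F) : F := gr f n.

Lemma prE n x : pr n (v x) = if n == 1%N then v x else 0.
Proof.
have := svalP (cid (free_hom fF (fun x => (fun i => if i == 1%N then v x else 0) : cauchy F))).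
by rewrite /pr => /(_ x) ->.
Qed.

Lemma prL n a f h : pr n (a *: f + h) = a *: pr n f + pr n h.
Proof. by rewrite /pr linearP. Qed.

Lemma prB n f h : pr n (bracket f h) = \sum_(i < n.+1) bracket (pr i f) (pr (n - i)%N h).
Proof. by rewrite /pr lie_homM. Qed.

Lemma pr_0 n : pr n 0 = 0.
Proof. by rewrite /pr linear0. Qed.

Lemma prD n f h : pr n (f + h) = pr n f + pr n h.
Proof. by rewrite /pr linearD. Qed.

Lemma prN n f : pr n (- f) = - pr n f.
Proof. by rewrite /pr linearN. Qed.

Lemma prS n (I : Type) (r : seq I) (u : I -> F) : pr n (\sum_(i <- r) u i) = \sum_(i <- r) pr n (u i).
Proof. by elim: r => [|i r IH]; rewrite ?big_nil ?pr_0 // !big_cons prD IH. Qed.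

Lemma pr0 f : pr 0 f = 0.
Proof.
apply: (free_ind fF (P := fun f => pr 0 f = 0)) => [|a x y ex ey|x y ex ey|x].
- exact: pr_0.
- by rewrite prL ex ey scaler0 addr0.
- by rewrite prB big_ord1 ex bracket0l.
- by rewrite prE.
Qed.

Lemma pr1B f h : pr 1 (bracket f h) = 0.
Proof. by rewrite prB !big_ord_recr big_ord0 /= !pr0 bracket0l bracket0r !addr0. Qed.

Definition homog d f := forall j, pr j f = if j == d then f else 0.

(** Finite sums of homogeneous elements; every element is one by [hspan_all]. *)
Inductive hspan : F -> Prop :=
  | hspan0 : hspan 0
  | hspanD d h f : homog d h -> hspan f -> hspan (h + f).

Lemma hspan_add f h : hspan f -> hspan h -> hspan (f + h).
Proof.
move=> Hf Hh; elim: Hf => [|d k f' hk _ IH]; first by rewrite add0r.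
by rewrite -addrA; exact: hspanD hk IH.
Qed.

Lemma homogZ d a f : homog d f -> homog d (a *: f).
Proof.
move=> hf j; rewrite -[a *: f]addr0 prL pr_0 hf !addr0.
by case: ifP => // _; rewrite scaler0.
Qed.

Lemma hspan_scale a f : hspan f -> hspan (a *: f).
Proof.
elim=> [|d h f' hh _ IH]; first by rewrite scaler0; exact: hspan0.
by rewrite scalerDr; apply: hspanD IH; exact: homogZ hh.
Qed.

Lemma homogB d e f h : homog d f -> homog e h -> homog (d + e) (bracket f h).
Proof.
move=> hf hh j; rewrite prB; case: eqP => [->|nj].
  have ld : (d < (d + e).+1)%N by rewrite ltnS leq_addr.
  rewrite (bigD1 (Ordinal ld)) //= hf hh addKn !eqxx big1 ?addr0 // => i ni.
  by rewrite hf (_ : (i == d :> nat) = false) ?bracket0l //; apply: negbTE.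
rewrite big1 // => i _; rewrite hf hh; case: eqP => [ei|_]; last by rewrite bracket0l.
case: eqP => [ej|_]; last by rewrite bracket0r.
by case: nj; have := ltn_ord i; rewrite ltnS => /subnKC; rewrite ei in ej *; rewrite ej.
Qed.

Lemma hspan_bracket f h : hspan f -> hspan h -> hspan (bracket f h).
Proof.
move=> Hf Hh; elim: Hf => [|d k f' hk _ IH]; first by rewrite bracket0l; exact: hspan0.
rewrite bracketDl; apply: hspan_add IH; elim: Hh => [|e l h' hl _ IH].
  by rewrite bracket0r; exact: hspan0.
by rewrite bracketDr; apply: hspanD IH; exact: homogB hk hl.
Qed.

Lemma hspan_all f : hspan f.
Proof.
apply: (free_ind fF) => [|a x y hx hy|x y hx hy|x].
- exact: hspan0.
- by apply: hspan_add hy; exact: hspan_scale.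
- exact: hspan_bracket.
- rewrite -[v x]addr0; apply: (@hspanD 1) hspan0 => j; exact: prE.
Qed.

Lemma sum_homog d h m : homog d h -> (d < m)%N -> \sum_(i < m) pr i h = h.
Proof.
move=> hh dm; rewrite (bigD1 (Ordinal dm)) //= hh eqxx big1 ?addr0 // => i ni.
by rewrite hh (_ : (i == d :> nat) = false) //; apply: negbTE.
Qed.

Lemma pr_bound f : exists n, forall i, (n < i)%N -> pr i f = 0.
Proof.
elim: (hspan_all f) => [|d h f' hh _ [n IH]]; first by exists 0 => i _; exact: pr_0.
exists (maxn d n) => i; rewrite gtn_max => /andP [di ni].
by rewrite prD IH // hh gtn_eqF // addr0.
Qed.

Lemma pr_sum f : exists n, forall m, (n <= m)%N -> f = \sum_(i < m) pr i f.
Proof.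
elim: (hspan_all f) => [|d h f' hh _ [n IH]].
  by exists 0 => m _; rewrite big1 // => i _; exact: pr_0.
exists (maxn d.+1 n) => m; rewrite geq_max => /andP [dm nm].
rewrite -[in RHS](sum_homog hh dm) [in LHS](IH m nm).
rewrite [in RHS](eq_bigr (fun i : 'I_m => pr i h + pr i f')).
  by rewrite big_split /= (sum_homog hh dm).
by move=> i _; rewrite (sum_homog hh dm) prD.
Qed.

Lemma pr_inj f : (forall i, pr i f = 0) -> f = 0.
Proof. by move=> H; have [n nE] := pr_sum f; rewrite (nE n (leqnn n)) big1. Qed.

Lemma pr_pr i j f : pr j (pr i f) = if j == i then pr i f else 0.
Proof.
elim: (hspan_all f) => [|d h f' hh _ IH]; first by rewrite !pr_0; case: ifP.
rewrite !prD IH (_ : pr j (pr i h) = if j == i then pr i h else 0).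
  by case: ifP => // _; rewrite addr0.
rewrite (hh i); case: (eqVneq i d) => [->|_]; first exact: hh.
by rewrite pr_0; case: ifP.
Qed.

(** The filtration by degree. *)
Definition dle d f := forall i, (d < i)%N -> pr i f = 0.

Lemma dle_sum d (I : Type) (r : seq I) (u : I -> F) : (forall i, dle d (u i)) -> dle d (\sum_(i <- r) u i).
Proof. by move=> H i di; rewrite prS big1 // => k _; exact: H. Qed.

Lemma dle_lin d a f h : dle d f -> dle d h -> dle d (a *: f + h).
Proof. by move=> df dh i di; rewrite prL df // dh // scaler0 addr0. Qed.

Lemma dle_bracket d e f h : dle d f -> dle e h -> dle (d + e) (bracket f h).
Proof.
move=> df dh k dk; rewrite prB big1 // => i _.
case: (ltnP d i) => [/df ->|id]; first exact: bracket0l.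
rewrite dh ?bracket0r //; apply: leq_trans (leq_sub2l k id).
by rewrite ltn_subRL.
Qed.

Lemma pr_top d e f h : dle d f -> dle e h -> pr (d + e) (bracket f h) = bracket (pr d f) (pr e h).
Proof.
move=> df dh; have ld : (d < (d + e).+1)%N by rewrite ltnS leq_addr.
rewrite prB (bigD1 (Ordinal ld)) //= addKn big1 ?addr0 // => i ni.
case: (ltnP d i) => [/df ->|id]; first exact: bracket0l.
rewrite dh ?bracket0r // ltn_subRL ltn_add2r ltn_neqAle id andbT.
by apply: contra ni => /eqP e'; apply/eqP/val_inj.
Qed.

Inductive lder (L : lie_algebra K) : L -> Prop :=
  | lder0 : lder 0
  | lderD x y z : lder z -> lder (bracket x y + z).

Section Central.
Variables (Y N : lie_algebra K) (q : lie_hom F Y) (g : lie_hom N F).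
Hypotheses (qv : forall y, exists x, q (v x) = y)
  (gI : forall f, q f = 0 <-> exists n, g n = f)
  (central : forall z n, g z = 0 -> bracket z n = 0).

Let phi0 (f : F) : Y := q (pr 1 f).

Lemma phi_lin : linear phi0.
Proof. by move=> a x y; rewrite /phi0 prL linearP. Qed.

Definition phi : {linear F -> Y} := mk_lin phi_lin.

Lemma phiB x y : phi (bracket x y) = 0.
Proof. by rewrite -[LHS]/(q (pr 1 (bracket x y))) pr1B linear0. Qed.

(** The terms of highest degree of the ideal [ker q] lie in [ker phi]: in degree one the
    whole element is linear in the generators. *)
Lemma phi_top i n : dle i (g n) -> phi (pr i (g n)) = 0.
Proof.
move=> di; rewrite -[LHS]/(q (pr 1 (pr i (g n)))) pr_pr; case: eqP => [e|_]; last exact: linear0.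
have -> : pr i (g n) = g n; last by apply/gI; exists n.
apply/eqP; rewrite -subr_eq0; apply/eqP/pr_inj => j; rewrite prD prN pr_pr -e.
case: eqP => [->|]; first by rewrite subrr.
case: j => [|[|j]] // _; first by rewrite pr0 subr0.
by rewrite di ?subr0 // -e.
Qed.

(** Conversely every homogeneous element of [ker phi] is the highest term of an element of
    [ker q]; in degree at least two, subtract a generator with the same image in [Y]. *)
Lemma top_lift f i : phi f = 0 -> exists n, dle i (g n) /\ pr i (g n) = pr i f.
Proof.
move=> pf; case: i => [|[|i]].
- by exists 0; split=> [j _|]; rewrite linear0 ?pr_0 // pr0.
- have [n nE] := (gI (pr 1 f)).1 pf; exists n; rewrite nE; split=> [j lj|]; rewrite pr_pr ?eqxx //.
  by rewrite gtn_eqF.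
- have [x xE] := qv (q (pr i.+2 f)).
  have [|n nE] := (gI (pr i.+2 f - v x)).1; first by rewrite linearB xE subrr.
  exists n; rewrite nE; split=> [j lj|]; rewrite prD prN pr_pr prE ?eqxx ?subr0 //.
  by rewrite !gtn_eqF ?subr0 //; apply: leq_trans lj.
Qed.

(** Sums of brackets of total degree at most [d]. *)
Inductive sp (d : nat) : N -> Prop :=
  | sp0 : sp d 0
  | spD i j n m z : (i + j <= d)%N -> dle i (g n) -> dle j (g m) -> sp d z -> sp d (bracket n m + z).

Lemma sp_add d z z' : sp d z -> sp d z' -> sp d (z + z').
Proof.
move=> Hz Hz'; elim: Hz => [|i j n m w ij hn hm _ IH]; first by rewrite add0r.
by rewrite -addrA; exact: spD ij hn hm IH.
Qed.

Lemma sp_sum d (I : Type) (r : seq I) (P : pred I) (u : I -> N) :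
  (forall i, P i -> sp d (u i)) -> sp d (\sum_(i <- r | P i) u i).
Proof.
move=> H; elim: r => [|i r IH]; first by rewrite big_nil; exact: sp0.
rewrite big_cons; case: ifP => // Pi; apply: sp_add => //; exact: H.
Qed.

Lemma sp_sum_in d (I : eqType) (r : seq I) (u : I -> N) :
  (forall i, i \in r -> sp d (u i)) -> sp d (\sum_(i <- r) u i).
Proof. by move=> H; rewrite big_seq; exact: sp_sum. Qed.

Lemma sp_dle d z : sp d z -> dle d (g z).
Proof.
elim=> [i _|i j n m w ij hn hm _ IH]; first by rewrite linear0 pr_0.
move=> k dk; rewrite linearD prD IH // addr0 lie_homM.
by apply: (dle_bracket hn hm); exact: leq_ltn_trans ij dk.
Qed.

Lemma dle0 n : dle 0 (g n) -> g n = 0.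
Proof. by move=> H; apply: pr_inj => -[|i]; [exact: pr0 | exact: H]. Qed.

(** Lowering the degree of one argument; when the degree is zero, this argument is central
    and the bracket vanishes. *)
Lemma sp_low d k e x y : dle k (g x) -> pr k (g x) = 0 -> dle e (g y) -> (k + e <= d.+1)%N ->
  sp d (bracket x y) /\ sp d (bracket y x).
Proof.
move=> dx px dy ke; case: k dx px ke => [|k] dx px ke.
  have x0 := dle0 dx; rewrite (bracketC y x) central // oppr0; split; exact: sp0.
have dk : dle k (g x).
  by move=> i; rewrite leq_eqVlt => /orP [/eqP <- //|]; exact: dx.
rewrite -[bracket x y]addr0 -[bracket y x]addr0; split.
  by apply: spD dk dy (sp0 _).
by apply: spD dy dk (sp0 _); rewrite addnC.
Qed.

Definition lifts_tops (f : F) (p : nat -> N) := forall i, dle i (g (p i)) /\ pr i (g (p i)) = pr i f.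

(** The sequences of lifts of the homogeneous parts of the elements of the graded ideal
    [ker phi] form a Lie algebra over it. *)
Lemma lifts_section s : exists t : F -> cauchy N,
  (forall f, fixed fF s f /\ phi f = 0 -> lifts_tops f (t f)) /\
  (forall a f h, fixed fF s f /\ phi f = 0 -> fixed fF s h /\ phi h = 0 ->
     t (a *: f + h) = a *: t f + t h) /\
  (forall f h, fixed fF s f /\ phi f = 0 -> fixed fF s h /\ phi h = 0 ->
     t (bracket f h) = bracket (t f) (t h)).
Proof.
pose I f := fixed fF s f /\ phi f = 0; have [I0 IL IB] := fixed_sublie fF s.
pose Q (u : lie_prod F (cauchy N)) := I u.1 /\ lifts_tops u.1 u.2.
have gS (J : Type) (r : seq J) (u : J -> N) : g (\sum_(i <- r) u i) = \sum_(i <- r) g (u i).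
  exact: linear_sum.
have Q0 : Q 0.
  split; first by split=> //; exact: linear0.
  by move=> i; rewrite -[(0 : lie_prod F (cauchy N)).2 i]/(0 : N) linear0 pr_0; split=> // j _; exact: pr_0.
have QL a u w : Q u -> Q w -> Q (a *: u + w).
  move=> [[fu pu] ru] [[fw pw] rw]; split.
    by split; [exact: IL | rewrite linearP pu pw scaler0 addr0].
  move=> i; have [d1 e1] := ru i; have [d2 e2] := rw i.
  rewrite -[(a *: u + w).2 i]/(a *: u.2 i + w.2 i) linearP.
  by split; [exact: dle_lin | rewrite !prL e1 e2].
have QB u w : Q u -> Q w -> Q (bracket u w).
  move=> [[fu pu] ru] [[fw pw] rw]; split.
    by split; [exact: IB | exact: phiB].
  move=> i; rewrite -[(bracket u w).2 i]/(\sum_(k < i.+1) bracket (u.2 k) (w.2 (i - k)%N)) gS.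
  have ik (k : 'I_i.+1) : (k + (i - k) = i)%N by rewrite subnKC // -ltnS.
  split.
    apply: dle_sum => k; rewrite lie_homM -{1}(ik k).
    by apply: dle_bracket; [have [] := ru k | have [] := rw (i - k)%N].
  rewrite prS -[(bracket u w).1]/(bracket u.1 w.1) prB; apply: eq_bigr => k _.
  have [d1 e1] := ru k; have [d2 e2] := rw (i - k)%N.
  by rewrite -{1}(ik k) lie_homM pr_top // e1 e2.
have [H [i [inj iP]]] := sublie_ex Q0 QL QB.
have g1L : linear (fun z : H => (i z).1) by move=> a x y; rewrite linearP.
have g1M (x y : H) : (i (bracket x y)).1 = bracket (i x).1 (i y).1 by rewrite lie_homM.
have iQ z : Q (i z) by apply/iP; exists z.
have [|f [ff pf]|t [t1 t2 t3]] := splits_fixed_ker (fF := fF) (s := s) phiB (N := H) (g := mk_lie g1L g1M).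
- by move=> z; have [] := iQ z.
- pose p k := sval (cid (top_lift k pf)).
  have [|z zE] := (iP ((f, p : cauchy N) : lie_prod F (cauchy N))).1.
    by split=> // k; exact: svalP (cid (top_lift k pf)).
  by exists z; rewrite /= zE.
exists (fun f => (i (t f)).2); split; last split.
- by move=> f If; have [_] := iQ (t f); rewrite [(i (t f)).1](t1 f If).
- by move=> a f h If Ih; rewrite t2 // linearP.
- by move=> f h If Ih; rewrite t3 // lie_homM.
Qed.

Lemma sp_split d z : sp d.+1 z -> exists (l : seq (N * N * nat)) (w : N),
  [/\ z = \sum_(p <- l) bracket p.1.1 p.1.2 + w, sp d w
    & forall p, p \in l -> [/\ (p.2 <= d.+1)%N, dle p.2 (g p.1.1) & dle (d.+1 - p.2)%N (g p.1.2)]].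
Proof.
elim=> [|i j n m z' ij hn hm _ [l [w [-> sw lP]]]].
  by exists [::], 0; rewrite big_nil addr0; split=> //; exact: sp0.
case: (ltnP (i + j) d.+1) => [lt|ge].
  by exists l, (bracket n m + w); split=> //; [zmod | exact: spD hn hm sw].
have e : (i + j = d.+1)%N by apply/eqP; rewrite eqn_leq ij.
exists ((n, m, i) :: l), w; rewrite big_cons /= addrA; split=> // p; rewrite inE => /orP [/eqP -> /=|/lP //].
by rewrite -e leq_addr addKn.
Qed.

(** In top degree, [z] is a sum of brackets of lifts whose highest terms [a], [b] have
    brackets summing to zero. The section of [lifts_section] then produces lifts with the
    same highest terms whose brackets cancel exactly, and replacing lifts only changes [z]
    in lower degree. *)
Lemma sp_descend d z : sp d.+1 z -> g z = 0 -> sp d z.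
Proof.
move=> /sp_split [l [w [zE sw lP]]] gz.
pose a (p : N * N * nat) := pr p.2 (g p.1.1).
pose b (p : N * N * nat) := pr (d.+1 - p.2)%N (g p.1.2).
have ab0 : \sum_(p <- l) bracket (a p) (b p) = 0.
  have : pr d.+1 (g z) = 0 by rewrite gz pr_0.
  rewrite zE linearD prD (sp_dle sw) ?ltnS // addr0 linear_sum prS => e0.
  rewrite -[RHS]e0 big_seq [in RHS]big_seq; apply: eq_bigr => p /lP [lp d1 d2].
  by rewrite lie_homM; have := pr_top d1 d2; rewrite subnKC // => ->.
have [s sP] := fixed_ex_seq fF ([seq a p | p <- l] ++ [seq b p | p <- l]).
have aI p : p \in l -> fixed fF s (a p) /\ phi (a p) = 0.
  move=> pl; have [_ d1 _] := lP p pl; split; last exact: phi_top.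
  by apply: sP; rewrite mem_cat (map_f a pl).
have bI p : p \in l -> fixed fF s (b p) /\ phi (b p) = 0.
  move=> pl; have [_ _ d2] := lP p pl; split; last exact: phi_top.
  by apply: sP; rewrite mem_cat (map_f b pl) orbT.
have [t [t1 [t2 t3]]] := lifts_section s; have [I0 IL IB] := fixed_sublie fF s.
have t0 : t 0 = 0.
  have II : fixed fF s 0 /\ phi 0 = 0 by split=> //; exact: linear0.
  by have := t2 (-1) _ _ II II; rewrite scaler0 addr0 scaleN1r addNr.
have tS : forall r, {subset r <= l} ->
    (fixed fF s (\sum_(p <- r) bracket (a p) (b p)) /\ phi (\sum_(p <- r) bracket (a p) (b p)) = 0) /\
    \sum_(p <- r) bracket (t (a p)) (t (b p)) = t (\sum_(p <- r) bracket (a p) (b p)).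
  elim=> [|p r IH] rl; first by rewrite !big_nil t0; do 2 split=> //; exact: linear0.
  have [|Ir er] := IH; first by move=> x xr; apply: rl; rewrite inE xr orbT.
  have pl : p \in l by apply: rl; exact: mem_head.
  have Ip : fixed fF s (bracket (a p) (b p)) /\ phi (bracket (a p) (b p)) = 0.
    by split; [apply: IB; [case: (aI p pl)|case: (bI p pl)] | exact: phiB].
  rewrite !big_cons er -(t3 _ _ (aI p pl) (bI p pl)).
  have := t2 1 _ _ Ip Ir; rewrite !scale1r => ->; split=> //; split.
    by rewrite -[bracket _ _]scale1r; apply: IL; [case: Ip | case: Ir].
  by rewrite linearD Ip.2 Ir.2 addr0.
have [_ tl] := tS l (fun _ pl => pl); rewrite ab0 t0 in tl.
have tl' : \sum_(p <- l) cbr (t (a p)) (t (b p)) d.+1 = 0.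
  have e : (\sum_(p <- l) bracket (t (a p)) (t (b p)) : cauchy N) d.+1 = 0 :> N.
    exact: (congr1 (fun f : nat -> N => f d.+1) tl).
  rewrite -[RHS]e {e tl tS}.
  elim: (l) => [|p r IH]; first by rewrite !big_nil.
  by rewrite !big_cons IH.
have -> : z = \sum_(p <- l) (bracket p.1.1 p.1.2 - cbr (t (a p)) (t (b p)) d.+1) + w.
  by rewrite sumrB tl' subr0.
apply: sp_add sw; apply: sp_sum_in => -[[n m] i] pl; have [/= il hn hm] := lP _ pl.
have ra := t1 _ (aI _ pl); have rb := t1 _ (bI _ pl).
move: ra rb; set x := t _; set y := t _ => ra rb.
have li : (i < d.+2)%N by [].
rewrite /cbr (bigD1 (Ordinal li)) //= opprD addrA; apply: sp_add; last first.
  rewrite -sumrN; apply: sp_sum => k nk; rewrite -bracketC.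
  have [d1 e1] := ra k; have [d2 _] := rb (d.+1 - k)%N.
  have kd : (k + (d.+1 - k) <= d.+1)%N by rewrite subnKC // -ltnS.
  apply: (sp_low d1 _ d2 kd).2; rewrite e1 pr_pr (_ : (k == i :> nat) = false) //.
  by apply: negbTE.
have [d1 e1] := ra i; have [d2 e2] := rb (d.+1 - i)%N.
have -> : bracket n m - bracket (x i) (y (d.+1 - i)%N) =
    bracket (n - x i) m + bracket (x i) (m - y (d.+1 - i)%N).
  by rewrite bracketBl bracketBr; zmod.
have dB k u u' : dle k (g u) -> dle k (g u') -> dle k (g (u - u')).
  by move=> du du' j kj; rewrite linearB prD prN du // du' // subr0.
have ie : (i + (d.+1 - i) <= d.+1)%N by rewrite subnKC.
apply: sp_add.
  apply: (sp_low (dB _ _ _ hn d1) _ hm ie).1.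
  by rewrite linearB prD prN e1 /a pr_pr eqxx subrr.
rewrite addnC in ie; apply: (sp_low (dB _ _ _ hm d2) _ d1 ie).2.
by rewrite linearB prD prN e2 /b pr_pr eqxx subrr.
Qed.

(** The ideal [ker q] of a free Lie algebra has no Schur multiplier.  Filtered by the
    degree, it has associated graded algebra [ker phi], since every element of [Y] is the
    image of a generator; a relation between commutators in top degree lifts because the
    finitely generated parts of [ker phi] are split. *)
Theorem free_central z : lder z -> g z = 0 -> z = 0.
Proof.
move=> Hz gz; have [d sz] : exists d, sp d z.
  elim: Hz {gz} => [|x y w _ [d IH]]; first by exists 0; exact: sp0.
  have [i hi] := pr_bound (g x); have [j hj] := pr_bound (g y).
  have mono e e' u : (e <= e')%N -> sp e u -> sp e' u.
    by move=> ee; elim=> [|i' j' n m u' ij hn hm _]; [exact: sp0 | apply: spD hn hm; exact: leq_trans ij ee].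
  exists (maxn (i + j) d); apply: (spD (i := i) (j := j)) => //; first exact: leq_maxl.
  by apply: mono IH; exact: leq_maxr.
elim: d z sz gz {Hz} => [|d IH] z sz gz; last by apply: IH => //; exact: sp_descend.
elim: sz {gz} => [//|i j n m u ij hn hm _ ->]; rewrite addr0 central //.
by apply: dle0; move: ij hn; rewrite leqn0 addn_eq0 => /andP [/eqP ->].
Qed.

End Central.
End Graded.

(** * Lie algebras over a fixed one *)

Section LieCategory.
Import GRing.Theory.
Local Open Scope ring_scope.
Variable K : fieldType.
Implicit Types L : lie_algebra K.

Lemma lie_lift (T P X Y : lie_algebra K) (p : lie_hom P X) (q : lie_hom P Y) (k : T -> P)
    (a : lie_hom T X) (b : lie_hom T Y) :
  (forall z z', p z = p z' -> q z = q z' -> z = z') ->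
  (forall t, p (k t) = a t) -> (forall t, q (k t) = b t) ->
  exists h : lie_hom T P, forall t, h t = k t.
Proof.
move=> inj pk qk.
have kL : linear k by move=> c x y; apply: inj; rewrite linearP ?pk ?qk linearP.
have kM x y : k (bracket x y) = bracket (k x) (k y).
  by apply: inj; rewrite lie_homM ?pk ?qk lie_homM.
by exists (mk_lie kL kM).
Qed.

Definition conc_Lie : conc (Lie K).
Proof.
unshelve refine (@Conc (Lie K) (fun L => L : Type) (fun L L' f => f) (fun L x y z => x - y + z)
  _ _ _ _ _ _ _ _ _ _ _).
- by [].
- by [].
- by move=> L L' f g; exact: lie_hom_eq.
- by move=> L L' f x y z; rewrite linearD linearB.
- by move=> L x y; exact: subrK.
- by move=> L x y; rewrite subrr add0r.
- by move=> L x y z u w /=; zmod.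
- move=> X Y Z f g.
  have [||| H [i [inj iP]]] := @sublie_ex K (lie_prod X Y) (fun u => f u.1 = g u.2).
  + by rewrite /= !linear0.
  + by move=> c u w /= fu fw; rewrite !linearP fu fw.
  + by move=> u w /= fu fw; rewrite !lie_homM fu fw.
  have pL : linear (fun u => (i u).1) by move=> a x y; rewrite linearP.
  have qL : linear (fun u => (i u).2) by move=> a x y; rewrite linearP.
  have pM x y : (i (bracket x y)).1 = bracket (i x).1 (i y).1 by rewrite lie_homM.
  have qM x y : (i (bracket x y)).2 = bracket (i x).2 (i y).2 by rewrite lie_homM.
  have pqI z z' : mk_lie pL pM z = mk_lie pL pM z' -> mk_lie qL qM z = mk_lie qL qM z' -> z = z'.
    by move=> /= e1 e2; apply: inj; rewrite [LHS]surjective_pairing e1 e2 -surjective_pairing.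
  exists H, (mk_lie pL pM), (mk_lie qL qM); split=> //; last first.
    by move=> x y e; have [z zE] := (iP (x, y)).1 e; exists z; rewrite /= zE.
  apply: pbI => [|T a b ab|T u w eu ew].
  + by apply: lie_hom_eq => u /=; apply/(iP (i u)); exists u.
  + have ex t : exists z, i z = (a t, b t).
      by apply/iP; exact: (congr1 (fun k : lie_hom T Z => k t) ab).
    pose k t := sval (cid (ex t)); have kE t : i (k t) = (a t, b t) := svalP (cid (ex t)).
    have [||h hE] := @lie_lift T H X Y (mk_lie pL pM) (mk_lie qL qM) k a b pqI.
    * by move=> t; rewrite /= kE.
    * by move=> t; rewrite /= kE.
    by exists h; split; apply: lie_hom_eq => t; rewrite /= hE kE.
  + apply: lie_hom_eq => t; apply: pqI.
    * exact: (congr1 (fun k : lie_hom T X => k t) eu).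
    * exact: (congr1 (fun k : lie_hom T Y => k t) ew).
- move=> X T g.
  have [||| I [i [inj iP]]] := @sublie_ex K T (fun u => exists x, g x = u).
  + by exists 0; rewrite linear0.
  + by move=> c _ _ [x <-] [y <-]; exists (c *: x + y); rewrite linearP.
  + by move=> _ _ [x <-] [y <-]; exists (bracket x y); rewrite lie_homM.
  have ex x : exists y, i y = g x by apply/iP; exists x.
  pose k x := sval (cid (ex x)); have kE x : i (k x) = g x := svalP (cid (ex x)).
  have [e eE] := @lie_lift X I T T i i k g g (fun z z' h _ => inj z z' h) kE kE.
  exists I, e, i; split=> //.
  + move=> y; have [x xE] := (iP (i y)).2 (ex_intro _ y erefl); exists x.
    by rewrite eE; apply: inj; rewrite kE.
  + by apply: lie_hom_eq => x /=; rewrite eE kE.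
- move=> X I T e h se eh.
  pose k y := h (sval (cid (se y))).
  have kE x : k (e x) = h x by apply: eh; exact: svalP (cid (se (e x))).
  have kL : linear k.
    by move=> c i j; have [x <-] := se i; have [y <-] := se j; rewrite -linearP !kE linearP.
  have kM x y : k (bracket x y) = bracket (k x) (k y).
    by have [i <-] := se x; have [j <-] := se y; rewrite -lie_homM !kE lie_homM.
  by exists (mk_lie kL kM); apply: lie_hom_eq => x; exact: kE.
- move=> X R a b rel r1 r2 r3.
  have relL c x x' y y' : rel x x' -> rel y y' -> rel (c *: x + y) (c *: x' + y').
    by move=> [r [<- <-]] [s [<- <-]]; exists (c *: r + s); rewrite !linearP.
  have [|c x y|x y|Q [q [sq qE]]] := @lie_quot K X (fun x => rel x 0).
  + exact: r1.
  + by move=> hx hy; have := relL c _ _ _ _ hx hy; rewrite scaler0 addr0.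
  + move=> [r [<- r0]]; have [s [<- s0]] := r1 y; exists (bracket r s).
    by rewrite !lie_homM r0 bracket0l.
  exists Q, q; split=> // x y; split=> [/qE h|h].
    by have := relL 1 _ _ _ _ h (r1 y); rewrite !scale1r add0r subrK.
  apply/qE; have := relL 1 _ _ _ _ h (r1 (- y)); rewrite !scale1r subrr; exact.
Defined.

End LieCategory.

Section LieSlice.
Import GRing.Theory.
Local Open Scope ring_scope.
Variables (K : fieldType) (Y : Lie K) (A : abgroup (slice Y)).
Local Notation C := (slice Y).
Local Notation cC := (conc_slice (conc_Lie K) Y).
Local Notation oneP := (@ag_oneP C A).
Local Notation "f @ x" := (@ap C cC _ _ f x) (at level 20).
Local Notation tmc := (@tmc C cC).
Implicit Types X Q : C.

Definition Lo X : lie_algebra K := sl_dom X.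
Definition lpm X : lie_hom (Lo X) Y := sl_map X.
Definition lh X Q (f : hom X Q) : lie_hom (Lo X) (Lo Q) := sl_hom f.

Lemma lpm_ap X Q (f : hom X Q) (x : Lo X) : lpm Q (lh f x) = lpm X x.
Proof. exact: (@slice_over (Lie K) (conc_Lie K) Y X Q f x). Qed.

Lemma lie_abelian_tmc X :
  (forall x y : Lo X, lpm X x = 0 -> lpm X y = 0 -> bracket x y = 0) -> tmc X.
Proof.
move=> ab W x y z [f fE] [g gE] [h hE].
have {}fE w : x w = lh f w by rewrite -fE.
have {}gE w : y w = lh g w by rewrite -gE.
have {}hE w : z w = lh h w by rewrite -hE.
pose k (w : Lo W) : Lo X := lh f w - lh g w + lh h w.
have kL : linear k.
  by move=> a w w'; rewrite /k (linearP (lh f)) (linearP (lh g)) (linearP (lh h)) scalerDr scalerBr; zmod.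
have kM w w' : k (bracket w w') = bracket (k w) (k w').
  have px t : lpm X (lh f t) = lpm W t by exact: lpm_ap.
  have py t : lpm X (lh g t) = lpm W t by exact: lpm_ap.
  have pz t : lpm X (lh h t) = lpm W t by exact: lpm_ap.
  have H (a a' b b' c c' : Lo X) : bracket (a - b) (a' - b') = 0 -> bracket (c - b) (c' - b') = 0 ->
      bracket (a - b) (c' - b') = 0 -> bracket (c - b) (a' - b') = 0 ->
      bracket a a' - bracket b b' + bracket c c' = bracket (a - b + c) (a' - b' + c').
    move=> e1 e2 e3 e4; have -> : bracket a a' - bracket b b' + bracket c c' =
      bracket a a' - bracket b b' + bracket c c' + bracket (a - b) (c' - b') + bracket (c - b) (a' - b')
        + bracket (a - b) (a' - b') - bracket (a - b) (a' - b').
      by rewrite e1 e3 e4 subr0 !addr0.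
    rewrite (bracketDl (a - b)) !(bracketDr (a' - b')) !bracketBl !bracketBr; zmod.
  rewrite /k !lie_homM; apply: H; apply: ab; by rewrite linearB ?px ?py ?pz subrr.
have [||u uE] := @slice_is_hom (Lie K) (conc_Lie K) Y W X k.
- by exists (mk_lie kL kM).
- by move=> w; rewrite -[LHS]/(lpm X (k w)) /k linearD linearB !lpm_ap subrr add0r.
by exists u => w; rewrite uE /k fE gE hE.
Qed.

(** The elements [(x, 0, 0)] and [(0, 0, y)] have bracket zero, and the Mal'cev operation
    sends them to [x] and [y]. *)
Lemma lie_tmc_abelian X : tmc X -> forall x y : Lo X, lpm X x = 0 -> lpm X y = 0 -> bracket x y = 0.
Proof.
move=> cX x y px py; have [P [a [b [c pr]]]] := prod3_ex_el cC oneP X.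
have [inj sur] := prod3_el cC oneP pr.
have [m mE] := cX P _ _ _ (ap_is_hom cC a) (ap_is_hom cC b) (ap_is_hom cC c).
have [||w [wa wb wc]] := sur x (0 : Lo X) (0 : Lo X); [|by []|].
  by apply/bang_slice; rewrite -[LHS]/(lpm X x) -[RHS]/(lpm X 0) px linear0.
have [||w' [wa' wb' wc']] := sur (0 : Lo X) (0 : Lo X) y; [by []| |].
  by apply/bang_slice; rewrite -[RHS]/(lpm X y) -[LHS]/(lpm X 0) py linear0.
have mw : lh m w = x by rewrite -[LHS]/(m @ w) mE wa wb wc /= subr0 addr0.
have mw' : lh m w' = y by rewrite -[LHS]/(m @ w') mE wa' wb' wc' /= subr0 add0r.
have ww : bracket (w : Lo P) w' = 0.
  by apply: inj; [rewrite -[LHS]/(lh a _) -[RHS]/(lh a 0) linear0 lie_homM -[lh a w]/(a @ w) -[lh a w']/(a @ w') wa wa'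
    | rewrite -[LHS]/(lh b _) -[RHS]/(lh b 0) linear0 lie_homM -[lh b w]/(b @ w) -[lh b w']/(b @ w') wb wb'
    | rewrite -[LHS]/(lh c _) -[RHS]/(lh c 0) linear0 lie_homM -[lh c w]/(c @ w) -[lh c w']/(c @ w') wc wc'];
    rewrite ?bracket0l ?bracket0r.
by rewrite -mw -mw' -lie_homM ww linear0.
Qed.

Inductive kder X : Lo X -> Prop :=
  | kder0 : kder 0
  | kderD x y z : lpm X x = 0 -> lpm X y = 0 -> kder z -> kder (bracket x y + z).

Lemma kder_lin X a (x y : Lo X) : kder x -> kder y -> kder (a *: x + y).
Proof.
move=> Hx Hy; elim: Hx => [|b c z pb pc _ IH]; first by rewrite scaler0 add0r.
rewrite scalerDr -addrA -bracketZl; apply: kderD => //.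
by rewrite linearZ /= pb scaler0.
Qed.

Lemma kder_ideal X (x y : Lo X) : kder x -> kder (bracket x y).
Proof.
elim=> [|a b z pa pb _ IH]; first by rewrite bracket0l; exact: kder0.
have pk c : lpm X c = 0 -> lpm X (bracket c y) = 0 by move=> pc; rewrite lie_homM pc bracket0l.
have -> : bracket (bracket a b + z) y = bracket (bracket a y) b + (bracket a (bracket b y) + bracket z y).
  rewrite bracketDl bracketC (jacobi_ad y a b) (bracketC y a) (bracketC y b).
  by rewrite -!scaleN1r !bracketZl !bracketZr !scalerDr !scalerA mulrNN mulr1 !scale1r addrA.
by apply: kderD; [exact: pk | | apply: kderD; [| exact: pk |]].
Qed.

Lemma kder_pm X (x : Lo X) : kder x -> lpm X x = 0.
Proof.
elim=> [|a b z pa pb _ IH]; first exact: linear0.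
by rewrite linearD IH addr0 lie_homM pa bracket0l.
Qed.

Lemma kder_nsep X (x y : Lo X) : kder (x - y) -> @nsep C cC X x y.
Proof.
move=> H Q h cQ; have hd z : kder z -> lh h z = 0.
  elim=> [|a b z' pa pb _ IH]; first exact: linear0.
  by rewrite linearD IH addr0 lie_homM; apply: lie_tmc_abelian => //; rewrite lpm_ap.
by apply/eqP; rewrite -subr_eq0; apply/eqP; have := hd _ H; rewrite linearB.
Qed.

Lemma lie_comm_quot X : exists I (q : hom X I),
  [/\ surj cC q, tmc I & forall x y : Lo X, q @ x = q @ y <-> kder (x - y)].
Proof.
have [|a x y|x y|Q [q [sq qE]]] := @lie_quot K (Lo X) (@kder X).
- exact: kder0.
- exact: kder_lin.
- exact: kder_ideal.
have [|p pE] := @desc_el (Lie K) (conc_Lie K) (Lo X) Q Y q (lpm X) sq.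
  move=> x x' /qE /kder_pm; rewrite linearB => e; apply/eqP; rewrite -subr_eq0; exact/eqP.
pose I := @SliceOb (Lie K) Y Q p : C; pose q' := @SliceHom (Lie K) Y X I q pE.
have pI x : lpm I (q x) = lpm X x by exact: (congr1 (fun f : lie_hom (Lo X) Y => f x) pE).
exists I, q'; split=> //; apply: lie_abelian_tmc => x y.
have [a <-] := sq x; have [b <-] := sq y; rewrite !pI => pa pb.
suff : q (bracket a b) = q 0 by rewrite lie_homM linear0.
by apply/qE; rewrite subr0 -[bracket a b]addr0; apply: kderD => //; exact: kder0.
Qed.

Lemma lie_refl X : exists I (q : hom X I),
  [/\ surj cC q, tmc I & forall x y, q @ x = q @ y -> nsep x y].
Proof.
have [I [q [sq cI qE]]] := lie_comm_quot X; exists I, q; split=> // x y /qE.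
exact: kder_nsep.
Qed.

Section FreeCover.
Variables (X1 X0 : C) (d0 d1 : hom X1 X0) (s : hom X0 X1).
Hypotheses (d0s : d0 ∘ s = idm _) (d1s : d1 ∘ s = idm _) (cm : comph cC d0 d1 s).
Hypotheses (sup : forall y, exists x, to_one oneP X0 @ x = y)
  (full : forall x y, to_one oneP X0 @ x = to_one oneP X0 @ y -> exists f, d0 @ f = x /\ d1 @ f = y).

Let sE x : lh d0 (lh s x) = x.
Proof. by have := hap (cE := cC) x d0s; rewrite apM ap1. Qed.
Let tE x : lh d1 (lh s x) = x.
Proof. by have := hap (cE := cC) x d1s; rewrite apM ap1. Qed.

(** The pairs [(a, 0)] and [(0, b)] of composable arrows have bracket zero, and
    composition is a homomorphism. *)
Lemma lie_peiffer (a b : Lo X1) : lh d1 a = 0 -> lh d0 b = 0 -> bracket a b = 0.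
Proof.
move=> da db; have [P [p [q [pb inj sur]]]] := pb_el cC d1 d0.
have pq w : d1 @ (p @ w) = d0 @ (q @ w) by rewrite -!apM pb.1.
have [m mE] := cm (ap_is_hom cC p) (ap_is_hom cC q) pq.
have [w [wp wq]] : exists w, p @ w = a /\ q @ w = (0 : Lo X1).
  by apply: sur; rewrite -[LHS]/(lh d1 a) -[RHS]/(lh d0 0) da linear0.
have [w' [wp' wq']] : exists w, p @ w = (0 : Lo X1) /\ q @ w = b.
  by apply: sur; rewrite -[LHS]/(lh d1 0) -[RHS]/(lh d0 b) db linear0.
have mE' t : lh m t = lh p t - lh s (lh d1 (lh p t)) + lh q t by exact: mE.
have mw : lh m w = a.
  by rewrite mE' -[lh p w]/(p @ w) -[lh q w]/(q @ w) wp wq da (linear0 (lh s)) subr0 addr0.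
have mw' : lh m w' = b.
  by rewrite mE' -[lh p w']/(p @ w') -[lh q w']/(q @ w') wp' wq' (linear0 (lh d1)) (linear0 (lh s)) subr0 add0r.
have ww : bracket (w : Lo P) w' = 0.
  by apply: inj; [rewrite -[LHS]/(lh p _) -[RHS]/(lh p 0) linear0 lie_homM -[lh p w']/(p @ w') wp' bracket0r
    | rewrite -[LHS]/(lh q _) -[RHS]/(lh q 0) linear0 lie_homM -[lh q w]/(q @ w) wq bracket0l].
by rewrite -mw -mw' -lie_homM ww linear0.
Qed.

(** [N] consists of the arrows from [0] together with a lift of their codomain to [F]; it
    is a central extension of [ker (F -> Y)]. The map [ka] from [P], which subtracts from
    an arrow the identity at its domain, is linear, and by the Peiffer identity it sends
    the derived algebra of [ker (P -> Y)] to that of [N]. *)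
Lemma lie_cover : exists F (e : hom F X0), surj cC e /\ good_cover cC d0 d1 e.
Proof.
have [F0 [v fF]] := @free_ex K (Lo X0 : eqType).
have [e0 e0E] := free_hom fF (L := Lo X0) (fun x => x).
pose F := @SliceOb (Lie K) Y F0 (lie_cmp (lpm X0) e0) : C.
pose e := @SliceHom (Lie K) Y F X0 e0 erefl : hom F X0.
exists F, e; split; first by move=> x; exists (v x); exact: e0E.
move=> P u a b ea eb p p' ap bp ns.
have [I [q [_ cI qE]]] := lie_comm_quot P.
have gz : kder ((p : Lo P) - p') by apply/qE; exact: ns.
have eaE k : e0 (lh a k) = lh d0 (lh u k).
  by have := hap (cE := cC) k ea; rewrite !apM.
have ebE k : e0 (lh b k) = lh d1 (lh u k).
  by have := hap (cE := cC) k eb; rewrite !apM.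
have [||| N [i [inj iP]]] := @sublie_ex K (lie_prod (Lo X1) F0) (fun u => lh d0 u.1 = 0 /\ lh d1 u.1 = e0 u.2).
- by rewrite /= !linear0.
- by move=> c x y /= [h1 h2] [h3 h4]; rewrite !linearP h1 h2 h3 h4 scaler0 addr0.
- by move=> x y /= [h1 h2] [h3 h4]; rewrite !lie_homM h1 h2 h3 h4 bracket0l.
have gL : linear (fun z : N => (i z).2) by move=> c x y; rewrite linearP.
have gM (x y : N) : (i (bracket x y)).2 = bracket (i x).2 (i y).2 by rewrite lie_homM.
have iN z : lh d0 (i z).1 = 0 /\ lh d1 (i z).1 = e0 (i z).2 by apply/iP; exists z.
have full0 l : lpm X0 (e0 l) = 0 -> exists z : N, (i z).2 = l.
  move=> pl; have [|n [n0 n1]] := @full (0 : Lo X0) (e0 l).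
    by apply/bang_slice; rewrite -[LHS]/(lpm X0 0) -[RHS]/(lpm X0 (e0 l)) pl linear0.
  by have [z zE] := (iP ((n, l) : lie_prod _ _)).1 (conj n0 n1); exists z; rewrite zE.
have kex k : exists z : N, i z = (lh u k - lh s (lh d0 (lh u k)), lh b k - lh a k).
  by apply/iP; rewrite /= !linearB sE tE eaE ebE subrr.
pose ka k := sval (cid (kex k)); have kaE k : i (ka k) = _ := svalP (cid (kex k)).
have kder_ka z : kder z -> lder (ka z).
  elim=> [|x y w px py _ IH].
    have -> : ka 0 = 0.
      apply: inj; rewrite kaE (linear0 (lh u)) (linear0 (lh d0)) (linear0 (lh s)) (linear0 (lh a)).
      by rewrite (linear0 (lh b)) !subr0 (linear0 i).
    exact: lder0.
  have [nx nxE] : exists z : N, (i z).2 = lh a x by apply: full0; rewrite eaE !lpm_ap.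
  have [ny nyE] : exists z : N, (i z).2 = lh a y by apply: full0; rewrite eaE !lpm_ap.
  have -> : ka (bracket x y + w) = bracket (ka x) (ka y) + (bracket (ka x) ny + (bracket nx (ka y) + ka w)).
    have [x0 x1] := iN nx; have [y0 y1] := iN ny.
    pose U := lh u x; pose U' := lh u y; pose S := lh s (lh d0 U); pose S' := lh s (lh d0 U').
    have h1 : bracket (i nx).1 (U' - S') = bracket S (U' - S').
      apply/eqP; rewrite -subr_eq0 -bracketBl; apply/eqP/lie_peiffer.
        by rewrite linearB x1 nxE eaE /S tE subrr.
      by rewrite linearB /S' sE subrr.
    have h2 : bracket (U - S) (i ny).1 = bracket (U - S) S'.
      rewrite bracketC (bracketC (U - S)); congr (- _).
      apply/eqP; rewrite -subr_eq0 -bracketBl; apply/eqP/lie_peiffer.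
        by rewrite linearB y1 nyE eaE /S' tE subrr.
      by rewrite linearB /S sE subrr.
    have fD (L1 L2 : lie_algebra K) (f : lie_hom L1 L2) k l : f (k + l) = f k + f l by exact: linearD.
    apply: inj; rewrite !fD !lie_homM !kaE; congr pair.
      rewrite /= h1 h2 !fD !lie_homM -/U -/U' -/S -/S' !bracketBl !bracketBr; zmod.
    by rewrite /= nxE nyE !fD !lie_homM !bracketBl !bracketBr; zmod.
  by do 3 apply: lderD.
have q0 : forall f, lie_cmp (lpm X0) e0 f = 0 <-> exists n : N, mk_lie gL gM n = f.
  move=> f; split; first exact: full0.
  move=> [z <-]; rewrite -[LHS]/(lpm X0 (e0 (i z).2)); have [z0 <-] := iN z.
  by rewrite lpm_ap -(lpm_ap d0) z0 linear0.
have qv y : exists x, lie_cmp (lpm X0) e0 (v x) = y.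
  by have [x xE] := slice_support sup y; exists x; rewrite /= e0E.
have central z n : mk_lie gL gM z = 0 -> bracket z n = 0.
  rewrite -[mk_lie gL gM z]/((i z).2) => z2; apply: inj; rewrite lie_homM (linear0 i).
  have [z0 z1] := iN z; have [n0 n1] := iN n.
  congr pair; last by rewrite z2 bracket0l.
  by apply: lie_peiffer n0; rewrite z1 z2 linear0.
have pp Q (f : hom P Q) : f @ p = f @ p' -> lh f ((p : Lo P) - p') = 0.
  by move=> fp; rewrite linearB -[lh f p]/(f @ p) fp subrr.
have az := pp _ a ap; have bz := pp _ b bp.
have kz : ka ((p : Lo P) - p') = 0.
  apply: (@free_central K _ F0 v fF Y N _ _ qv q0 central _ (kder_ka _ gz)).
  by rewrite -[LHS]/((i (ka _)).2) kaE /= az bz subrr.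
have := congr1 (fun t => t.1) (kaE ((p : Lo P) - p')).
rewrite kz (linear0 i) /= -eaE az (linear0 e0) (linear0 (lh s)) subr0 (linearB (lh u)) => /esym /eqP.
by rewrite subr_eq0 => /eqP.
Qed.

End FreeCover.
End LieSlice.

Theorem mainTheorem2 (D : base_theory) (Y : base_cat D) (A : abgroup (slice Y)) (n : nat) :
  exists (GM : coh_group (abM A) n) (GD : coh_group A n),
    (forall a b, jmap (cg_add GM a b) = cg_add GD (jmap a) (jmap b)) /\
    bijective (@jmap D Y A n).
Proof.
case: D Y A => [|K] Y A.
  exact: (@comm_cohomology _ (conc_slice conc_Gp Y) (@base_comm_closed Groups Y) A
    (group_refl A) (@group_cover Y A) n).
exact: (@comm_cohomology _ (conc_slice (conc_Lie K) Y) (@base_comm_closed (LieAlgebras K) Y) A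
  (lie_refl A) (@lie_cover K Y A) n).
Qed.
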